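(* Let $E$ be a Banach space of class $\mathcal{HT}$, $p\in(1,\infty)$, $\mu\in(1/p,1]$ and $s\ge 0$. The family of left translations $\{\Lambda^E_t\}_{t\ge 0}$, given by $$(\Lambda^E_t u)(\tau):=u(\tau+t),\qquad \tau\ge 0,$$ forms a strongly continuous contraction semigroup on $W^s_{p,\mu}(\mathbb{R}_+;E)$ and on $H^s_{p,\mu}(\mathbb{R}_+;E)$. Its generator is the derivative $\partial_t$ with domain $W^{s+1}_{p,\mu}(\mathbb{R}_+;E)$ and $H^{s+1}_{p,\mu}(\mathbb{R}_+;E)$, respectively.
   Context: $\mathbb{R}_+=(0,\infty)$. A Banach space is of class $\mathcal{HT}$ if the Hilbert transform is bounded on $L_2(\mathbb{R};\cdot)$ (equivalently, UMD). $L_{p,\mu}(\mathbb{R}_+;E)=\{u: t^{1-\mu}u\in L_p(\mathbb{R}_+;E)\}$ with norm $|t^{1-\mu}u|_{L_p}$. For $k\in\mathbb{N}_0$, $W^k_{p,\mu}(\mathbb{R}_+;E)=H^k_{p,\mu}(\mathbb{R}_+;E)=\{u\in W^k_{1,\mathrm{loc}}(\mathbb{R}_+;E): u^{(j)}\in L_{p,\mu},\ 0\le j\le k\}$ with norm $(\sum_{j\le k}|u^{(j)}|^p_{L_{p,\mu}})^{1/p}$. For $s=[s]+s_*$, $[s]\in\mathbb{N}_0$, $s_*\in(0,1)$: $W^s_{p,\mu}=(W^{[s]}_{p,\mu},W^{[s]+1}_{p,\mu})_{s_*,p}$ (real interpolation) and $H^s_{p,\mu}=[W^{[s]}_{p,\mu},W^{[s]+1}_{p,\mu}]_{s_*}$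 (complex interpolation), with the interpolation norms. *)

(* Defs.v *)
From HB Require Import structures.
From mathcomp Require Import all_boot all_order all_algebra.
From mathcomp Require Import complex.
From mathcomp Require Import all_classical all_reals all_analysis.

Set Implicit Arguments.
Unset Strict Implicit.
Unset Printing Implicit Defensive.

Import Order.TTheory GRing.Theory Num.Theory.
Import numFieldNormedType.Exports.

Local Open Scope classical_set_scope.
Local Open Scope ring_scope.

(** Banach spaces are complex: [E : completeNormedModType R[i]].  A "space" of
    (classes of) functions is encoded by an extended seminorm [N] on
    representatives, with values in [\bar R]: the elements of the space are
    the [u] with [N u < +oo], and [u], [v] represent the same element when
    [N (u - v) = 0]. *)

Section BochnerIntegral.
Context {R : realType} {E : completeNormedModType R[i]}.
Implicit Types (D : set R) (f u v : R -> E).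

(* The norm of [E] takes its values in [R[i]]. *)
Definition rnorm (x : E) : R := complex.Re `|x|.

Definition simple_fun (s : R -> E) : Prop :=
  finite_set (range s) /\
  forall e : E, measurable (s @^-1` [set e] : set (measurableTypeR R)).

Definition strongly_measurable D f : Prop :=
  exists s : nat -> R -> E, (forall n, simple_fun (s n)) /\
    {ae (@lebesgue_measure R), forall x, D x -> s n x @[n --> \oo] --> f x}.

Definition norm_integral D f : \bar R :=
  (\int[@lebesgue_measure R]_(x in D) (rnorm (f x))%:E)%E.

Definition simple_integral D (s : R -> E) : E :=
  \sum_(e \in range s)
    (fine ((@lebesgue_measure R) (D `&` s @^-1` [set e])))%:C%C *: e.

Definition is_bochner_integral D f (I : E) : Prop :=
  exists s : nat -> R -> E,
    [/\ forall n, simple_fun (s n) /\ (norm_integral D (s n) < +oo)%E,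
        {ae (@lebesgue_measure R),
          forall x, D x -> s n x @[n --> \oo] --> f x},
        norm_integral D (f - s n) @[n --> \oo] --> 0%E &
        simple_integral D (s n) @[n --> \oo] --> I].

(* The Bochner integral, 0 by convention if [f] is not integrable on [D]. *)
Definition bochner D f : E := xget 0 [set I | is_bochner_integral D f I].

(* (\int_D (w |u|)^p)^(1/p) *)
Definition weighted_Lnorm D (w : R -> R) (p : R) u : \bar R :=
  if `[< strongly_measurable D u >] then
    ((\int[@lebesgue_measure R]_(x in D) ((w x * rnorm (u x)) `^ p)%:E)
       `^ p^-1)%E
  else +oo%E.

End BochnerIntegral.

Section ClassHT.
Context {R : realType}.

Definition has_derivative {E : completeNormedModType R[i]}
    (f : R -> E) (x : R) (l : E) : Prop :=
  ((h^-1)%:C%C *: (f (x + h) - f x)) @[h --> 0^'] --> l.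

Definition vector_test_function {E : completeNormedModType R[i]}
    (f : R -> E) : Prop :=
  (exists g : nat -> R -> E,
     g 0%N = f /\ forall n x, has_derivative (g n) x (g n.+1 x)) /\
  (exists M : R, forall x, M < `|x| -> f x = 0).

(* (Hf)(t) = lim_(eps -> 0+) 1/pi \int_(|s| > eps) f(t - s) / s ds *)
Definition hilbert_transform {E : completeNormedModType R[i]}
    (f : R -> E) (t : R) : E :=
  lim (bochner [set s : R | eps < `|s|]
         (fun s => ((pi * s)^-1)%:C%C *: f (t - s)) @[eps --> 0^'+]).

(* Boundedness in L_2(R;E) on the dense subspace C_c^\infty(R;E), on which
   the principal value exists pointwise. *)
Definition class_HT (E : completeNormedModType R[i]) : Prop :=
  exists C : R, forall f : R -> E, vector_test_function f ->
    (weighted_Lnorm setT (cst 1%R) 2 (hilbert_transform f)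
       <= C%:E * weighted_Lnorm setT (cst 1%R) 2 f)%E.

End ClassHT.

Section WeakDerivative.
Context {R : realType} {E : completeNormedModType R[i]}.
Implicit Types u v : R -> E.

Definition halfline : set R := `]0, +oo[.

(* Test functions in C_c^\infty((0,+oo);R). *)
Definition test_function (phi : R -> R) : Prop :=
  (forall n x, derivable (derive1n n phi) x 1) /\
  (exists a b : R, [/\ 0 < a, a < b & forall x, x \notin `[a, b] -> phi x = 0]).

(* L_(1,loc)((0,+oo);E) *)
Definition L1loc u : Prop :=
  forall a b : R, 0 < a -> a < b ->
    strongly_measurable `[a, b] u /\ (norm_integral `[a, b] u < +oo)%E.

Definition weak_derivative u v : Prop :=
  [/\ L1loc u, L1loc v &
      forall phi : R -> R, test_function phi ->
        bochner halfline (fun x => (derive1 phi x)%:C%C *: u x) =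
        - bochner halfline (fun x => (phi x)%:C%C *: v x)].

End WeakDerivative.

Section Interpolation.
Context {R : realType} {F : lmodType R[i]}.
Variables N0 N1 : F -> \bar R.
Implicit Types (u : F) (theta p t : R).

Definition Kfunctional t u : \bar R :=
  ereal_inf [set (N0 a.1 + t%:E * N1 a.2)%E | a in [set a : F * F | a.1 + a.2 = u]].

(* (X_0, X_1)_(theta,p), K-method *)
Definition real_interpolation theta p u : \bar R :=
  ((\int[@lebesgue_measure R]_(t in `]0%R, +oo[)
      (((t `^ (- theta))%:E * Kfunctional t u) `^ p * (t^-1)%:E)) `^ p^-1)%E.

Definition sum_norm u : \bar R := Kfunctional 1 u.

Definition closed_strip : set (R[i]^o) := [set z | 0 <= complex.Re z <= 1].
Definition open_strip : set (R[i]^o) := [set z | 0 < complex.Re z < 1].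

(* Calderon's functions: bounded and continuous on the closed strip and
   holomorphic in the open strip with values in X_0 + X_1, with continuous
   boundary values in X_0 and X_1 (their boundedness is imposed by the
   finiteness of [boundary_norm]). *)
Definition calderon_function (f : R[i]^o -> F) : Prop :=
  [/\ exists C : R, forall z, closed_strip z -> (sum_norm (f z) <= C%:E)%E,
      forall z, closed_strip z ->
        sum_norm (f w - f z) @[w --> within closed_strip (nbhs z)] --> 0%E,
      forall z, open_strip z -> exists d : F, (sum_norm d < +oo)%E /\
        sum_norm ((w - z)^-1 *: (f w - f z) - d) @[w --> z^'] --> 0%E,
      forall t : R, N0 (f (0 +i* r)%C - f (0 +i* t)%C) @[r --> t] --> 0%E &
      forall t : R, N1 (f (1 +i* r)%C - f (1 +i* t)%C) @[r --> t] --> 0%E].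

Definition boundary_norm (f : R[i]^o -> F) : \bar R :=
  maxe (ereal_sup (range (fun t : R => N0 (f (0 +i* t)%C))))
       (ereal_sup (range (fun t : R => N1 (f (1 +i* t)%C)))).

(* [X_0, X_1]_theta *)
Definition complex_interpolation theta u : \bar R :=
  ereal_inf [set boundary_norm f |
    f in [set f | calderon_function f /\ f (theta%:C)%C = u]].

End Interpolation.

Section WeightedSpaces.
Context {R : realType} {E : completeNormedModType R[i]}.
Variables p mu : R.
Implicit Types u : R -> E.

(* L_(p,mu)(R_+;E) *)
Definition Lpmu_norm u : \bar R :=
  weighted_Lnorm halfline (fun t => t `^ (1 - mu)) p u.

(* [U j] is a representative of u^(j) for j <= k. *)
Definition weak_derivatives (k : nat) u (U : nat -> R -> E) : Prop :=
  [/\ U 0%N = u, L1loc u &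
      forall j, (j < k)%N -> weak_derivative (U j) (U j.+1)].

(* W^k_(p,mu)(R_+;E).  All the choices of [U] give the same value, since weak
   derivatives are unique a.e.; the infimum is +oo when there is none. *)
Definition Sobolev_norm (k : nat) u : \bar R :=
  ereal_inf [set ((\sum_(j < k.+1) Lpmu_norm (U j) `^ p) `^ p^-1)%E |
    U in [set U | weak_derivatives k u U]].

(* W^s_(p,mu)(R_+;E), for s >= 0 *)
Definition W_norm (s : R) : (R -> E) -> \bar R :=
  let k := Num.truncn s in
  if s == k%:R then Sobolev_norm k
  else real_interpolation (Sobolev_norm k) (Sobolev_norm k.+1) (s - k%:R) p.

(* H^s_(p,mu)(R_+;E), for s >= 0 *)
Definition H_norm (s : R) : (R -> E) -> \bar R :=
  let k := Num.truncn s in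
  if s == k%:R then Sobolev_norm k
  else complex_interpolation (Sobolev_norm k) (Sobolev_norm k.+1) (s - k%:R).

End WeightedSpaces.

Section Semigroups.
Context {R : realType} {F : lmodType R[i]}.
Variables (N : F -> \bar R) (T : R -> F -> F).

Definition C0_contraction_semigroup : Prop :=
  [/\ (* linear contractions *)
      (forall t (c : R[i]) u v, 0 <= t -> (N u < +oo)%E -> (N v < +oo)%E ->
         N (T t (c *: u + v) - (c *: T t u + T t v)) = 0%E) /\
      (forall t u, 0 <= t -> (N u < +oo)%E -> (N (T t u) <= N u)%E),
      forall u, (N u < +oo)%E -> N (T 0 u - u) = 0%E,
      forall t r u, 0 <= t -> 0 <= r -> (N u < +oo)%E ->
        N (T (t + r) u - T t (T r u)) = 0%E &
      forall u, (N u < +oo)%E -> N (T t u - u) @[t --> 0^'+] --> 0%E].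

(* The graph of the generator: u is in its domain and Au = v. *)
Definition generator (u v : F) : Prop :=
  [/\ (N u < +oo)%E, (N v < +oo)%E &
      N ((h^-1)%:C%C *: (T h u - u) - v) @[h --> 0^'+] --> 0%E].

End Semigroups.

(* Only the values on (0,+oo) matter. *)
Definition left_translation {R : realType} (E : completeNormedModType R[i])
    (t : R) (u : R -> E) : R -> E := fun tau => u (tau + t).

(* Main.v *)
Require Import Defs.
From HB Require Import structures.
From mathcomp Require Import all_boot all_order all_algebra.
From mathcomp Require Import complex.
From mathcomp Require Import all_classical all_reals all_analysis.
From mathcomp Require Import measurable_realfun ring lra.

Set Implicit Arguments.
Unset Strict Implicit.
Unset Printing Implicit Defensive.

Import Order.TTheory GRing.Theory Num.Theory.
Import numFieldNormedType.Exports.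

Local Open Scope classical_set_scope.
Local Open Scope ring_scope.

(** Let [X_k] be the weighted Sobolev space of integer order [k] and write
    [s = k + theta] with [0 <= theta < 1].  The spaces of order [s] arise from the
    couple [(X_k, X_(k+1))] by an interpolation method -- the left endpoint, the real
    or the complex method -- and those of order [s + 1] arise by the same method from
    the couple [(X_(k+1), X_(k+2))].  What is used about the methods is collected in
    [interpolation_method]: operators that are bounded at the endpoints are bounded in
    between, with the same constant; uniformly bounded families that tend strongly to
    [0] at the endpoints do so in between; functionals that are bounded on the sum of
    the endpoint spaces are bounded in between.  This reduces the theorem to integer
    orders, that is, to estimates in [L_(p,mu)] of a function and its weak derivatives.

    Translations are contractions at integer orders because they commute with weak
    derivatives and the weight [t^(1-mu)] is nondecreasing ([Lpmu_left_translation]),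
    and they are strongly continuous by density ([Lpmu_shift_continuous]).
    Interpolating [T_t] and [T_t - 1] gives the contraction semigroup
    ([method_semigroup]).

    If [u] has order [s + 1], the difference quotient of [u] minus [u'] is the moving
    average of [u'] minus [u'] itself ([weak_derivative_average]), which is at most
    twice as large as the differences between [u'] and its small translates
    ([Lpmu_average]).  So these operators are bounded from [X_(k+1)] to [X_k], uniformly
    in the step, and tend strongly to [0]; interpolation shows that [u] is in the domain
    of the generator.

    Conversely, let the difference quotients of [u] converge to [v] at order [s].
    Testing with a smooth function, which defines a bounded functional, gives [u' = v]
    weakly ([method_weak_derivative]).  It remains to see that [u] has order [s + 1].
    Let [P] be a primitive and [(M u)(x)] the integral of [u] over [[x, x + 1]].
    The function [u - P v] has zero derivative, so it is invariant under translations
    and equal to its own averages, whence [u = M u + (P v - M P v)]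
    ([reconstruction]).  Both [M] and [v |-> P v - M P v] gain one derivative at integer
    orders ([increment_bounded], [correction_bounded]), hence at order [s]
    ([method_domain]).

    For the complex method the following is specific.  Multiplying an admissible
    function by [(1 + theta) / (1 + z)] makes it decay along the boundary lines without
    changing its value at [theta], after which strong convergence on the boundary is
    uniform by compactness ([complex_strong]).  A functional turns an admissible function
    into a bounded vector-valued holomorphic function on the strip, whose value at
    [theta] is bounded by its boundary values: Goursat's lemma for the regularised Cauchy
    integral over long rectangles gives this directly ([strip_bound],
    [complex_functional]).

    Functions are only determined almost everywhere, and weak derivatives are chosen, so
    operators are linear modulo null functions; [qnorm], [linear_mod] and [bounded_map]
    express what is needed of norms and operators in these terms. *)

(** * The real-valued norm *)

Section Rnorm.
Context {R : realType} {E : completeNormedModType R[i]}.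
Implicit Types (x y : E).

Lemma normE_rnorm x : `|x| = (rnorm x)%:C%C.
Proof.
have h : 0 <= `|x| by [].
rewrite /rnorm; move: h; case: (`|x|) => a b /=.
by rewrite lecE /= => /andP[/eqP -> _].
Qed.

Lemma rnorm_ge0 x : 0 <= rnorm x.
Proof. by have := normr_ge0 x; rewrite normE_rnorm lecE /= eqxx. Qed.

Lemma rnorm0 : rnorm (0 : E) = 0.
Proof. by rewrite /rnorm normr0. Qed.

Lemma rnorm0_eq0 x : rnorm x = 0 -> x = 0.
Proof. by move=> h; apply/normr0_eq0; rewrite normE_rnorm h. Qed.

Lemma rnormN x : rnorm (- x) = rnorm x.
Proof. by rewrite /rnorm normrN. Qed.

Lemma rnormB x y : rnorm (x - y) = rnorm (y - x).
Proof. by rewrite -rnormN opprB. Qed.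

Lemma ler_rnormD x y : rnorm (x + y) <= rnorm x + rnorm y.
Proof.
have := ler_normD x y; rewrite !normE_rnorm -rmorphD lecE /=.
by case/andP.
Qed.

Lemma rnormZ (c : R[i]) x : rnorm (c *: x) = complex.Re `|c| * rnorm x.
Proof.
rewrite /rnorm normrZ normE_rnorm.
have h : 0 <= `|c| by [].
move: h; case: (`|c|) => a b /=.
by rewrite lecE /= => /andP[/eqP -> _]; rewrite mulr0 subr0.
Qed.

Lemma rnormZr (r : R) x : rnorm (r%:C%C *: x) = `|r| * rnorm x.
Proof.
rewrite rnormZ; congr (_ * _).
by rewrite normc_def /= expr0n addr0 sqrtr_sqr.
Qed.

Lemma ler_rnormB x y : rnorm (x - y) <= rnorm x + rnorm y.
Proof. by rewrite -(rnormN y) ler_rnormD. Qed.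

Lemma ler_rnorm_distD z x y : rnorm (x - y) <= rnorm (x - z) + rnorm (z - y).
Proof.
rewrite -[X in rnorm X <= _](_ : (x - z) + (z - y) = _); last first.
  by rewrite addrA subrK.
exact: ler_rnormD.
Qed.

Lemma ler_rnorm_sum {I : Type} (r : seq I) (F : I -> E) :
  rnorm (\sum_(i <- r) F i) <= \sum_(i <- r) rnorm (F i).
Proof.
elim/big_ind2 : _ => [|x1 x2 y1 y2 h1 h2|//]; first by rewrite rnorm0.
by apply: le_trans (ler_rnormD _ _) _; exact: lerD.
Qed.

Lemma ler_dist_rnorm x y : `|rnorm x - rnorm y| <= rnorm (x - y).
Proof.
rewrite ler_norml; apply/andP; split.
  rewrite lerNl opprB lerBlDr -(rnormB y).
  by have := ler_rnormD (y - x) x; rewrite subrK.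
by rewrite lerBlDr; have := ler_rnormD (x - y) y; rewrite subrK.
Qed.

Lemma cvg_rnormP {T : Type} (F : set_system T) {FF : Filter F} (f : T -> E) l :
  f x @[x --> F] --> l <-> rnorm (f x - l) @[x --> F] --> (0 : R).
Proof.
split.
  move=> /cvgrPdist_lt h; apply/cvgrPdist_lt => e e0.
  have e0' : (0 : R[i]) < e%:C%C by rewrite ltcR.
  near=> x.
  have : `|l - f x| < e%:C%C by near: x; exact: h.
  by rewrite normE_rnorm ltcR sub0r normrN (ger0_norm (rnorm_ge0 _)) rnormB.
move=> /cvgrPdist_lt h; apply/cvgrPdist_lt => -[a b].
rewrite ltcE /= => /andP[/eqP -> a0].
near=> x.
have : `|0 - rnorm (f x - l)| < a by near: x; exact: h.
by rewrite normE_rnorm ltcR sub0r normrN (ger0_norm (rnorm_ge0 _)) rnormB.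
Unshelve. all: end_near. Qed.

Lemma continuous_rnorm : continuous (@rnorm R E).
Proof.
move=> x; apply/cvgrPdist_lt => e e0.
have /cvg_rnormP/cvgrPdist_lt/(_ e e0) h : (y : E) @[y --> x] --> x by exact: cvg_id.
near=> y; apply: le_lt_trans (ler_dist_rnorm _ _) _.
have : `|0 - rnorm (y - x)| < e by near: y.
by rewrite sub0r normrN ger0_norm ?rnorm_ge0// rnormB.
Unshelve. all: end_near. Qed.

End Rnorm.

(** * Integrals of nonnegative functions *)

Section NonnegIntegral.
Import HBNNSimple.
Context {d : measure_display} {T : measurableType d} {R : realType}
  (mu : {measure set T -> \bar R}).
Implicit Types (f g : T -> \bar R) (D N : set T).
Local Open Scope ereal_scope.

(** The integral of a nonnegative function is the supremum over the simple functions
    below it; multiplying these by the indicator of the complement of a null set does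
    not change their integrals. *)
Lemma ae_le_nnintegral D f g : d.-measurable D ->
  (forall x, D x -> 0 <= f x) -> (forall x, D x -> 0 <= g x) ->
  {ae mu, forall x, D x -> f x <= g x} ->
  \int[mu]_(x in D) f x <= \int[mu]_(x in D) g x.
Proof.
move=> mD f0 g0 [N [mN muN0 fgN]].
rewrite ge0_integralE// ge0_integralE//.
apply: ub_ereal_sup => _ [h hf <-].
have mNC : d.-measurable (~` N) by exact: measurableC.
pose h' := mul_nnsfun h (indic_nnsfun R mNC).
have <- : sintegral mu h' = sintegral mu h.
  rewrite -2!integralT_nnsfun; apply: ge0_ae_eq_integral => //.
  - by apply/measurable_EFinP.
  - by apply/measurable_EFinP.
  - by move=> x _; rewrite lee_fin.
  - by move=> x _; rewrite lee_fin.
  - exists N; split => // x /= hx; apply: contrapT => Nx; apply: hx => _.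
    by rewrite /h' /= mindicE mem_set// mulr1.
apply: ereal_sup_ubound; exists h' => //= x.
rewrite mindicE; have [/set_mem Nx|Nx] := boolP (x \in _); last first.
  by rewrite mulr0; apply: erestrict_ge0.
rewrite mulr1; have := hf x; rewrite !patchE; case: ifPn => // /set_mem Dx.
move=> /le_trans; apply.
by apply: contrapT => h1; apply: Nx; apply: fgN => h2; apply: h1; exact: h2.
Qed.

Lemma le_nnintegral D f g : d.-measurable D ->
  (forall x, D x -> 0 <= f x) ->
  (forall x, D x -> f x <= g x) ->
  \int[mu]_(x in D) f x <= \int[mu]_(x in D) g x.
Proof.
move=> mD f0 fg; apply: ae_le_nnintegral => //; last exact: aeW.
by move=> x Dx; apply: le_trans (fg _ Dx); exact: f0.
Qed.

Lemma ae_eq_nnintegral D f g : d.-measurable D ->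
  (forall x, D x -> 0 <= f x) -> (forall x, D x -> 0 <= g x) ->
  {ae mu, forall x, D x -> f x = g x} ->
  \int[mu]_(x in D) f x = \int[mu]_(x in D) g x.
Proof.
move=> mD f0 g0 h; apply/eqP; rewrite eq_le; apply/andP; split.
  apply: ae_le_nnintegral => //; apply: filterS h => x h Dx.
  by rewrite h.
apply: ae_le_nnintegral => //; apply: filterS h => x h Dx.
by rewrite h.
Qed.

Lemma subset_nnintegral (A B : set T) f : d.-measurable A -> d.-measurable B ->
  A `<=` B -> (forall x, B x -> 0 <= f x) ->
  \int[mu]_(x in A) f x <= \int[mu]_(x in B) f x.
Proof.
move=> mA mB AB f0; rewrite integral_mkcond [leRHS]integral_mkcond.
apply: le_nnintegral => // x _.
  by apply: erestrict_ge0 => // y /AB; exact: f0.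
rewrite !patchE; case: ifPn => [/set_mem/AB/mem_set -> //|_].
by case: ifPn => // /set_mem; exact: f0.
Qed.

(** The class in which integrals of nonnegative functions are additive. The norm of a
    strongly measurable function belongs to it, without being a Borel function in
    general. *)
Definition ae_measurable D f :=
  exists2 g : T -> \bar R, measurable_fun [set: T] g &
    {ae mu, forall x, D x -> f x = g x}.

Lemma ae_measurable_ge0 D f : (forall x, D x -> 0 <= f x) -> ae_measurable D f ->
  exists2 g : T -> \bar R, measurable_fun [set: T] g &
    (forall x, 0 <= g x) /\ {ae mu, forall x, D x -> f x = g x}.
Proof.
move=> f0 [g mg fg]; exists (fun x => maxe (g x) 0).
  exact: measurable_maxe.
split; first by move=> x; rewrite le_max lexx orbT.
apply: filterS fg => x fg Dx; rewrite -fg//.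
by rewrite max_l// f0.
Qed.

Lemma nnintegralD D f g : d.-measurable D ->
  (forall x, D x -> 0 <= f x) -> (forall x, D x -> 0 <= g x) ->
  ae_measurable D f -> ae_measurable D g ->
  \int[mu]_(x in D) (f x + g x) =
  \int[mu]_(x in D) f x + \int[mu]_(x in D) g x.
Proof.
move=> mD f0 g0 /(ae_measurable_ge0 f0)[f' mf' [f'0 ff']].
move=> /(ae_measurable_ge0 g0)[g' mg' [g'0 gg']].
rewrite (@ae_eq_nnintegral D f f')// (@ae_eq_nnintegral D g g')//.
rewrite -ge0_integralD//; [|exact: measurable_funTS..].
apply: ae_eq_nnintegral => //.
- by move=> x Dx; rewrite adde_ge0// ?f0// g0.
- by move=> x Dx; rewrite adde_ge0.
- by apply: filterS2 ff' gg' => x ff' gg' Dx; rewrite ff'// gg'.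
Qed.

Lemma nnintegralZ D f (r : R) : d.-measurable D -> (0 <= r)%R ->
  (forall x, D x -> 0 <= f x) -> ae_measurable D f ->
  \int[mu]_(x in D) (r%:E * f x) = r%:E * \int[mu]_(x in D) f x.
Proof.
move=> mD r0 f0 /(ae_measurable_ge0 f0)[f' mf' [f'0 ff']].
rewrite (@ae_eq_nnintegral D f f')//.
rewrite -ge0_integralZl_EFin//; last exact: measurable_funTS.
apply: ae_eq_nnintegral => //.
- by move=> x Dx; rewrite mule_ge0// f0.
- by move=> x Dx; rewrite mule_ge0.
- by apply: filterS ff' => x ff' Dx; rewrite ff'.
Qed.

End NonnegIntegral.

#[global] Instance leb_ae_filter (R : realType) :
  Filter (almost_everywhere (@lebesgue_measure R)).
Proof. exact: (@ae_filter_ringOfSetsType _ (measurableTypeR R) R lebesgue_measure). Qed.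

Section Translation.
Import HBNNSimple.
Context {R : realType}.
Notation leb := (@lebesgue_measure R).
Local Open Scope ereal_scope.

Lemma measurable_addr (h : R) :
  measurable_fun setT ((fun x => x + h)%R : measurableTypeR R -> measurableTypeR R).
Proof. exact: measurable_funD. Qed.

Lemma lebesgue_measure_shift (h : R) (A : set (measurableTypeR R)) :
  measurable A -> leb ((fun x => x + h)%R @^-1` A) = leb A.
Proof.
move=> mA; have -> : leb ((fun x => x + h)%R @^-1` A) =
  pushforward leb ((fun x => x + h)%R : measurableTypeR R -> measurableTypeR R) A by [].
have mh := measurable_addr h.
pose mm := isMeasurableFun.Build _ _ _ _ _ mh.
pose ph : {mfun measurableTypeR R >-> measurableTypeR R} := HB.pack (fun x : measurableTypeR R => x + h)%R mm.
apply/esym. apply: (@lebesgue_measure_unique R (pushforward leb ph)) => //= _ [[a b]] _ <-.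
rewrite /pushforward /=.
rewrite (_ : _ @^-1` _ = `](a - h)%R, (b - h)%R]%classic); last first.
  by apply/seteqP; split => x /=; rewrite !in_itv/= ltrBlDr lerBrDr.
rewrite !lebesgue_measure_itv/= !lte_fin ltrD2r; case: ifP => // _.
by rewrite -!EFinB opprB addrA subrK.
Qed.

Lemma negligible_shift (h : R) (A : set (measurableTypeR R)) :
  leb.-negligible A -> leb.-negligible ((fun x => x + h)%R @^-1` A).
Proof.
move=> [N [mN N0 AN]]; exists ((fun x => x + h)%R @^-1` N); split.
- by rewrite -[X in measurable X]setTI; exact: measurable_addr.
- by rewrite lebesgue_measure_shift.
- by move=> x /AN.
Qed.

(** Translation permutes the simple functions below [f] and preserves their integrals. *)
Lemma nnintegral_shift (h : R) (D : set R) (f : R -> \bar R) :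
  (forall x, D x -> 0 <= f x) ->
  \int[leb]_(x in (fun x => x + h)%R @^-1` D) f (x + h)%R =
  \int[leb]_(x in D) f x.
Proof.
move=> f0.
suff H (k : R) (C : set R) (g : R -> \bar R) : (forall x, C x -> 0 <= g x) ->
    \int[leb]_(x in C) g x <=
    \int[leb]_(x in (fun x => x + k)%R @^-1` C) g (x + k)%R.
  apply/eqP; rewrite eq_le H// andbT.
  apply: le_trans (H (- h)%R _ _ _) _; first by move=> x; exact: f0.
  rewrite (_ : _ @^-1` _ = D); last first.
    by apply/seteqP; split => x /=; rewrite subrK.
  by under eq_integral do rewrite subrK.
move=> g0; rewrite ge0_integralE// ge0_integralE; last by move=> x; exact: g0.
apply: ub_ereal_sup => _ [s sg <-]; apply: ereal_sup_ubound => /=.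
have mk := measurable_addr k.
pose s' : measurableTypeR R -> R := (s \o (fun x => x + k))%R.
have ms' : measurable_fun setT s' by exact: measurableT_comp.
have fs' : finite_set (range s').
  apply: sub_finite_set (fimfunP s) => _ [x _ <-] /=; by exists (x + k)%R.
pose s1 := isMeasurableFun.Build _ _ _ _ _ ms'.
pose s2 := FiniteImage.Build _ _ _ fs'.
have s'0 x : (0 <= s' x)%R by rewrite /s' /= fun_ge0.
pose s3 := isNonNegFun.Build _ _ s' s'0.
pose s4 : {nnsfun measurableTypeR R >-> R} := HB.pack s' s1 s2 s3.
exists s4.
  move=> x /=; have := sg (x + k)%R.
  rewrite !patchE /s' /=.
  by have -> : (x \in +%R^~ k @^-1` C) = ((x + k)%R \in C)
    by apply/idP/idP; rewrite !inE.
rewrite /sintegral; apply: eq_fsbigr => r _; congr (_ * _).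
exact: (lebesgue_measure_shift k (A := s @^-1` [set r])).
Qed.
End Translation.

(** * Strong measurability *)

Section SimpleMaps.
Context {R : realType}.

(** Arbitrary target types allow pairing two simple functions, from which sums and other
    binary operations follow by composition. *)
Definition simple_map {T : Type} (s : R -> T) : Prop :=
  finite_set (range s) /\
  forall t : T, measurable (s @^-1` [set t] : set (measurableTypeR R)).

Lemma simple_map_preimage {T : Type} (s : R -> T) (Y : set T) :
  simple_map s -> measurable (s @^-1` Y : set (measurableTypeR R)).
Proof.
move=> [fs ms].
rewrite (_ : s @^-1` Y = \bigcup_(t in range s `&` Y) (s @^-1` [set t])).
  by apply: fin_bigcup_measurable => [|t _]; [exact: finite_setIl|exact: ms].
by apply/seteqP; split => [x Yx|x [t [_ Yt] /= ->]//]; exists (s x) => //; split.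
Qed.

Lemma simple_map_comp {S T : Type} (f : S -> T) (s : R -> S) :
  simple_map s -> simple_map (f \o s).
Proof.
move=> ss; split.
  apply: (@sub_finite_set _ _ (f @` range s)); last exact: finite_image ss.1.
  by move=> _ [x _ <-]; exists (s x).
by move=> t; exact: (simple_map_preimage (f @^-1` [set t]) ss).
Qed.

Lemma simple_map_pair {S T : Type} (s : R -> S) (t : R -> T) :
  simple_map s -> simple_map t -> simple_map (fun x => (s x, t x)).
Proof.
move=> ss st; split.
  apply: (@sub_finite_set _ _ (range s `*` range t)).
    by move=> _ [x _ <-]; split.
  exact: finite_setX ss.1 st.1.
move=> [a b].
rewrite (_ : _ @^-1` _ = s @^-1` [set a] `&` t @^-1` [set b]).
  exact: measurableI (ss.2 _) (st.2 _).
by apply/seteqP; split => x /= => [[-> ->]//|[-> ->]].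
Qed.

Lemma simple_map_comp2 {S T U : Type} (f : S -> T -> U) (s : R -> S) (t : R -> T) :
  simple_map s -> simple_map t -> simple_map (fun x => f (s x) (t x)).
Proof.
move=> ss st.
exact: (simple_map_comp (fun z => f z.1 z.2) (simple_map_pair ss st)).
Qed.

Lemma simple_map_cst {T : Type} (t : T) : simple_map (cst t : R -> T).
Proof.
split.
  by apply: (@sub_finite_set _ _ [set t]) => // _ [x _ <-].
move=> u; have [->|tu] := pselect (u = t).
  by rewrite (_ : _ @^-1` _ = setT)//; apply/seteqP; split.
rewrite (_ : _ @^-1` _ = set0); first exact: measurable0.
by apply/seteqP; split => // x /= /esym.
Qed.

Lemma simple_map_mem (A : set R) :
  measurable (A : set (measurableTypeR R)) -> simple_map (fun x => x \in A).
Proof.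
move=> mA; split.
  by apply: (@sub_finite_set _ _ [set: bool]) => //; exact: finite_finset.
case.
  rewrite (_ : _ @^-1` _ = A)//.
  by apply/seteqP; split => x /=; [move/set_mem|move/mem_set].
rewrite (_ : _ @^-1` _ = ~` A); first exact: measurableC.
apply/seteqP; split => x /=; first by move=> /negbT; rewrite notin_setE.
by move=> Ax; apply/negbTE; rewrite notin_setE.
Qed.

Lemma simple_map_if {T : Type} (A : set R) (s t : R -> T) :
  measurable (A : set (measurableTypeR R)) -> simple_map s -> simple_map t ->
  simple_map (fun x => if x \in A then s x else t x).
Proof.
move=> mA ss st.
have h := simple_map_pair ss st.
exact: (simple_map_comp2 (fun b z => if b then z.1 else z.2) (simple_map_mem mA) h).
Qed.

Lemma simple_map_measurable {T : Type} {d} {U : measurableType d} (f : T -> U) (s : R -> T) :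
  simple_map s -> measurable_fun [set: measurableTypeR R] (f \o s).
Proof.
move=> ss _ Y mY; rewrite setTI.
exact: (simple_map_preimage (f @^-1` Y) ss).
Qed.

Lemma simple_map_precomp {T : Type} (s : R -> T) {d} {U : measurableType d}
    (h : U -> R) : measurable_fun [set: U] (h : U -> measurableTypeR R) ->
  simple_map s -> forall Y : set T, measurable ((s \o h) @^-1` Y : set U).
Proof.
move=> mh ss Y; rewrite -[X in measurable X]setTI.
exact: (mh measurableT _ (simple_map_preimage Y ss)).
Qed.

Lemma simple_map_shift {T : Type} (s : R -> T) (h : R) :
  simple_map s -> simple_map (fun x => s (x + h)).
Proof.
move=> ss; split.
  by apply: sub_finite_set ss.1 => _ [x _ <-]; exists (x + h).
by move=> t; exact: (simple_map_precomp (measurable_addr h) ss).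
Qed.

(** Truncated rounding to a multiple of [n.+1^-1]; composing with it turns
    continuous functions into simple ones. *)
Definition grid (n : nat) (x : R) : R :=
  if `|x| <= n%:R then (Num.floor (x * n.+1%:R))%:~R / n.+1%:R else 0.

Lemma simple_map_grid n : simple_map (grid n).
Proof.
pose f (x : R) : R := (Num.floor x)%:~R.
have mf : measurable_fun [set: measurableTypeR R] (f : _ -> measurableTypeR R).
  by apply: nondecreasing_measurable => // x y xy; rewrite /f ler_int le_floor.
have mN : measurable ([set x | `|x| <= n%:R] : set (measurableTypeR R)).
  rewrite (_ : [set x | _] = `[- n%:R, n%:R]%classic)//.
  by apply/seteqP; split => x /=; rewrite in_itv/= ler_norml.
split.
  pose N := (n * n.+1)%N.
  pose g (k : nat) : R := (k%:Z - N%:Z)%:~R / n.+1%:R.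
  apply: (@sub_finite_set _ _ (g @` `I_(N + N).+1 `|` [set 0])); last first.
    by rewrite finite_setU; split; [exact: finite_image|exact: finite_set1].
  move=> _ [x _ <-]; rewrite /grid; case: ifPn => xn; last by right.
  left.
  have := xn; rewrite ler_norml => /andP[xn1 xn2].
  have n0 : (0 : R) < n.+1%:R by [].
  have h1 : (- N%:Z <= Num.floor (x * n.+1%:R))%R.
    by rewrite floor_ge_int mulrNz -pmulrn natrM -mulNr ler_wpM2r.
  have h2 : (Num.floor (x * n.+1%:R) <= N%:Z)%R.
    rewrite -(ler_int R); apply: (le_trans (floor_le _)).
    by rewrite -pmulrn natrM ler_wpM2r.
  set F := Num.floor _ in h1 h2 *.
  have h3 : F = `|(F + N%:Z)%R|%N%:Z - N%:Z by rewrite gez0_abs ?addrK// -lerBlDr sub0r.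
  exists `|(F + N%:Z)%R|%N; last by rewrite /g -h3.
  by rewrite /= ltnS -lez_nat gez0_abs -?lerBlDr ?sub0r// PoszD lerD2r.
move=> t; rewrite (_ : _ @^-1` _ =
   ([set x | `|x| <= n%:R] `&` (fun x => f (x * n.+1%:R) / n.+1%:R) @^-1` [set t]) `|`
   (~` [set x | `|x| <= n%:R] `&` (cst 0 : R -> R) @^-1` [set t])); last first.
  apply/seteqP; split => x /=.
    by rewrite /grid; case: ifPn => // xn; [left|right; split => //; apply/negP].
  by rewrite /grid => -[[-> //]|[/negP/negbTE ->]].
  apply: measurableU; apply: measurableI => //; last exact: (measurableC mN).
  rewrite -[X in measurable X]setTI.
  have mg : measurable_fun [set: measurableTypeR R]
      ((fun x => f (x * n.+1%:R) / n.+1%:R) : _ -> measurableTypeR R).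
    apply: measurable_funM => //.
    apply: (measurableT_comp mf).
    exact: measurable_funM.
exact: (mg measurableT _ (measurable_set1 t)).
Qed.

Lemma cvg_grid (x : R) : grid n x @[n --> \oo] --> x.
Proof.
apply/cvgrPdist_le => e e0; near=> n.
have xn : `|x| <= n%:R by near: n; exact: nbhs_infty_ger.
rewrite /grid xn.
have n0 : (0 : R) < n.+1%:R by [].
have /andP[h1 h2] := floor_itv (x * n.+1%:R).
rewrite ger0_norm ?subr_ge0 ?ler_pdivrMr//.
apply: (@le_trans _ _ n.+1%:R^-1); last first.
  by apply: ltW; near: n; exact: (near_infty_natSinv_lt (PosNum e0)).
have : x <= ((Num.floor (x * n.+1%:R))%:~R + 1) / n.+1%:R.
  by rewrite ler_pdivlMr// ltW// -intrD1.
by rewrite mulrDl div1r lerBlDr addrC.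
Unshelve. all: end_near. Qed.

End SimpleMaps.

Section StrongMeasurability.
Context {R : realType} {E : completeNormedModType R[i]}.
Notation leb := (@lebesgue_measure R).
Implicit Types (f g u : R -> E) (D : set R).

(** Everywhere limits of simple functions.  Every strongly measurable function has such
    a representative, and the norm of the latter is a Borel function. *)
Definition borel_sm f := exists s : nat -> R -> E,
  (forall n, simple_map (s n)) /\ forall x, s n x @[n --> \oo] --> f x.

Lemma borel_sm_simple f : simple_map f -> borel_sm f.
Proof. by move=> sf; exists (fun=> f); split => // x; exact: cvg_cst. Qed.

Lemma borel_sm_cut D f : measurable (D : set (measurableTypeR R)) ->
  borel_sm f -> borel_sm (fun x => if x \in D then f x else 0).
Proof.
move=> mD [s [ss sf]].
exists (fun n x => if x \in D then s n x else 0); split.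
  by move=> n; apply: simple_map_if => //; exact: simple_map_cst.
by move=> x; case: ifPn => _; [exact: sf|exact: cvg_cst].
Qed.

Lemma borel_smD f g : borel_sm f -> borel_sm g -> borel_sm (f + g).
Proof.
move=> [s [ss sf]] [t [st tg]]; exists (fun n x => s n x + t n x); split.
  by move=> n; exact: simple_map_comp2.
by move=> x; exact: cvgD.
Qed.

Lemma borel_smZ (c : R[i]) f : borel_sm f -> borel_sm (c *: f).
Proof.
move=> [s [ss sf]]; exists (fun n x => c *: s n x); split.
  by move=> n; exact: (simple_map_comp (fun e : E => c *: e)).
by move=> x; exact: cvgZr.
Qed.

Lemma borel_sm_shift (h : R) f : borel_sm f -> borel_sm (fun x => f (x + h)).
Proof.
move=> [s [ss sf]]; exists (fun n x => s n (x + h)); split => //.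
by move=> n; exact: simple_map_shift.
Qed.

Lemma borel_sm_continuous f : continuous f -> borel_sm f.
Proof.
move=> cf; exists (fun n x => f (grid n x)); split.
  by move=> n; exact: (simple_map_comp f (simple_map_grid n)).
by move=> x; apply: continuous_cvg; [exact: cf|exact: cvg_grid].
Qed.

Lemma borel_smM (h : R -> R) f : continuous h -> borel_sm f ->
  borel_sm (fun x => (h x)%:C%C *: f x).
Proof.
move=> ch [s [ss sf]]; exists (fun n x => (h (grid n x))%:C%C *: s n x); split.
  move=> n; apply: (simple_map_comp2 (fun (r : R) (e : E) => (h r)%:C%C *: e)) => //.
  exact: simple_map_grid.
move=> x; apply/cvg_rnormP.
have hx : h (grid n x) @[n --> \oo] --> h x.
  by apply: continuous_cvg; [exact: ch|exact: cvg_grid].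
have /cvg_rnormP fx := sf x.
apply: (@squeeze_cvgr _ _ _ _ (cst 0)
  (fun n => `|h (grid n x)| * rnorm (s n x - f x) + `|h (grid n x) - h x| * rnorm (f x))).
- near=> n; rewrite rnorm_ge0 /= -!rnormZr.
  rewrite (_ : _ - _ = (h (grid n x))%:C%C *: (s n x - f x) +
    (h (grid n x) - h x)%:C%C *: f x); first exact: ler_rnormD.
  by rewrite scalerBr rmorphB scalerBl addrA subrK.
- exact: cvg_cst.
- rewrite -[X in _ --> X](_ : `|h x| * 0 + 0 * rnorm (f x) = 0); last first.
    by rewrite mulr0 mul0r addr0.
  apply: cvgD; apply: cvgM => //.
  - exact: cvg_norm.
  - rewrite -(normr0 R) -(subrr (h x)).
    apply: (@cvg_norm _ _ _ _ _ (fun n => h (grid n x) - h x)).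
    by apply: cvgB => //; exact: cvg_cst.
  - exact: cvg_cst.
Unshelve. all: end_near. Qed.

Lemma measurable_rnorm f : borel_sm f ->
  measurable_fun [set: measurableTypeR R] (fun x => rnorm (f x)).
Proof.
move=> [s [ss sf]]; apply: (measurable_fun_cvg (h := fun n x => rnorm (s n x))).
  by move=> n; exact: (simple_map_measurable (@rnorm R E)).
by move=> x _; apply: continuous_cvg (sf x); exact: continuous_rnorm.
Qed.

(** Joint measurability is what Tonelli's theorem asks for when an average of
    differences [f (x + t) - f x] is integrated in [x] and [t]. *)
Lemma measurable_rnorm_diff f : borel_sm f ->
  measurable_fun [set: (measurableTypeR R * measurableTypeR R)%type]
    (fun z => rnorm (f (z.1 + z.2) - f z.1)).
Proof.
move=> [s [ss sf]].
apply: (@measurable_fun_cvg _ _ _ _ (fun n (z : (measurableTypeR R * measurableTypeR R)%type) => rnorm (s n (z.1 + z.2) - s n z.1))).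
  move=> n _ Y mY; rewrite setTI.
  rewrite (_ : _ @^-1` _ = \bigcup_(e in range (s n) `*` range (s n) `&`
      [set e | Y (rnorm (e.1 - e.2))])
      (((s n \o (fun z : R * R => z.1 + z.2)) @^-1` [set e.1]) `&`
      ((s n \o fst) @^-1` [set e.2]))); last first.
    apply/seteqP; split => [z /= Yz|z /= [[a b] /= [_ Yab]] [-> ->]//].
    by exists (s n (z.1 + z.2), s n z.1) => //; split.
  apply: fin_bigcup_measurable.
    by apply: finite_setIl; apply: finite_setX; exact: (ss n).1.
  move=> e _; apply: measurableI.
    apply: (simple_map_precomp _ (ss n) [set e.1]).
    by apply: measurable_funD; [exact: measurable_fst|exact: measurable_snd].
  by apply: (simple_map_precomp _ (ss n) [set e.2]); exact: measurable_fst.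
move=> z _; apply: continuous_cvg; first exact: continuous_rnorm.
by apply: cvgB; exact: sf.
Qed.

Lemma sm_borel D f : measurable (D : set (measurableTypeR R)) ->
  strongly_measurable D f ->
  exists2 g, borel_sm g & {ae leb, forall x, D x -> f x = g x}.
Proof.
move=> mD [s [ss [N [mN N0 sN]]]].
have mDN : measurable (D `\` N : set (measurableTypeR R)) by exact: measurableD.
exists (fun x => if x \in D `\` N then f x else 0).
  exists (fun n x => if x \in D `\` N then s n x else 0); split.
    by move=> n; apply: simple_map_if => //; [exact: ss|exact: simple_map_cst].
  move=> x; case: ifPn => [/set_mem[Dx Nx]|_]; last exact: cvg_cst.
  by apply: contrapT => h; apply: Nx; apply: sN => h'; apply: h; exact: h'.
exists N; split => // x /= /not_implyP[Dx]; apply: contra_notP => Nx.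
by rewrite mem_set//; split.
Qed.

Lemma borel_ae_sm D f g : borel_sm g -> {ae leb, forall x, D x -> f x = g x} ->
  strongly_measurable D f.
Proof.
move=> [s [ss sg]] fg; exists s; split; first exact: ss.
by apply: filterS fg => x fg Dx; rewrite fg.
Qed.

Lemma borel_sm_sm D f : borel_sm f -> strongly_measurable D f.
Proof. by move=> bf; apply: (borel_ae_sm bf); exact: aeW. Qed.

Lemma sm_subset (A B : set R) f : A `<=` B -> strongly_measurable B f ->
  strongly_measurable A f.
Proof.
move=> AB [s [ss sf]]; exists s; split => //.
by apply: filterS sf => x h /AB.
Qed.

Lemma sm_ae_eq D f g : {ae leb, forall x, D x -> f x = g x} ->
  strongly_measurable D f -> strongly_measurable D g.
Proof.
move=> fg [s [ss sf]]; exists s; split => //.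
by apply: filterS2 fg sf => x fg sf Dx; rewrite -fg//; exact: sf.
Qed.

Lemma smD D f g : measurable (D : set (measurableTypeR R)) ->
  strongly_measurable D f -> strongly_measurable D g ->
  strongly_measurable D (f + g).
Proof.
move=> mD /(sm_borel mD)[f' bf ff'] /(sm_borel mD)[g' bg gg'].
apply: (borel_ae_sm (borel_smD bf bg)).
by apply: filterS2 ff' gg' => x ff' gg' Dx; rewrite /GRing.add /= ff'// gg'.
Qed.

Lemma smZ D (c : R[i]) f : measurable (D : set (measurableTypeR R)) ->
  strongly_measurable D f -> strongly_measurable D (c *: f).
Proof.
move=> mD /(sm_borel mD)[f' bf ff'].
apply: (borel_ae_sm (borel_smZ c bf)).
by apply: filterS ff' => x ff' Dx; rewrite /GRing.scale /= ff'.
Qed.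

Lemma smM D (h : R -> R) f : measurable (D : set (measurableTypeR R)) ->
  continuous h -> strongly_measurable D f ->
  strongly_measurable D (fun x => (h x)%:C%C *: f x).
Proof.
move=> mD ch /(sm_borel mD)[f' bf ff'].
apply: (borel_ae_sm (borel_smM ch bf)).
by apply: filterS ff' => x ff' Dx; rewrite ff'.
Qed.

Lemma sm_shift D (h : R) f : strongly_measurable D f ->
  strongly_measurable ((fun x => x + h) @^-1` D) (fun x => f (x + h)).
Proof.
move=> [s [ss sf]]; exists (fun n x => s n (x + h)); split.
  by move=> n; exact: (simple_map_shift h (ss n)).
exact: (negligible_shift h sf).
Qed.

Lemma ae_shift (P : R -> Prop) (h : R) :
  {ae leb, forall x, P x} -> {ae leb, forall x, P (x + h)}.
Proof. exact: negligible_shift. Qed.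

Lemma rnorm_ae_measurable D (phi : R -> R -> \bar R) f :
  measurable (D : set (measurableTypeR R)) ->
  (forall g : R -> R, measurable_fun [set: measurableTypeR R] g ->
     measurable_fun [set: measurableTypeR R] (fun x => phi x (g x))) ->
  strongly_measurable D f ->
  ae_measurable leb D (fun x => phi x (rnorm (f x))).
Proof.
move=> mD mphi /(sm_borel mD)[g bg fg].
exists (fun x => phi x (rnorm (g x))); first exact: mphi (measurable_rnorm bg).
by apply: filterS fg => x fg Dx; rewrite fg.
Qed.

Lemma rnorm_ae_measurable1 D f :
  measurable (D : set (measurableTypeR R)) -> strongly_measurable D f ->
  ae_measurable leb D (fun x => (rnorm (f x))%:E).
Proof.
move=> mD; apply: (@rnorm_ae_measurable _ (fun _ r => r%:E)) => // g mg.
exact/measurable_EFinP.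
Qed.

End StrongMeasurability.

(** * The Bochner integral *)

Section SimpleIntegral.
Context {R : realType} {E : completeNormedModType R[i]}.
Notation leb := (@lebesgue_measure R).
Implicit Types (s : R -> E) (D : set R).

(** The integral may be computed from any partition on whose pieces the function is
    constant, not only from its level sets. With a common partition for two simple
    functions, linearity is termwise. *)
Lemma simple_integralE D (T : choiceType) (h : R -> T) (phi : T -> E) :
  measurable (D : set (measurableTypeR R)) -> simple_map h ->
  (forall t : T, phi t != 0 -> (leb (D `&` h @^-1` [set t]) < +oo)%E) ->
  simple_integral D (phi \o h) =
  \sum_(t \in range h) (fine (leb (D `&` h @^-1` [set t])))%:C%C *: phi t.
Proof.
move=> mD [fh mh] hfin.
have fA : finite_set (range h) by [].
have -> : simple_integral D (phi \o h) =
  \sum_(e \in phi @` range h)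
    (fine (leb (D `&` (phi \o h) @^-1` [set e])))%:C%C *: e.
  by rewrite /simple_integral image_comp.
rewrite fsbig_finite; last exact: finite_image.
rewrite (fset_set_image phi fA) [RHS]fsbig_finite//= (finmap.partition_big_imfset _ phi) /=.
apply: eq_bigr => e _.
rewrite (eq_bigr (fun t => (fine (leb (D `&` h @^-1` [set t])))%:C%C *: e)); last first.
  by move=> t /eqP ->.
rewrite -scaler_suml.
have [->|e0] := eqVneq e 0; first by rewrite !scaler0.
congr (_ *: _).
pose B := range h `&` phi @^-1` [set e].
have fB : finite_set B by exact: finite_setIl.
have -> : D `&` (phi \o h) @^-1` [set e] = \bigcup_(t in B) (D `&` h @^-1` [set t]).
  apply/seteqP; split => [x [Dx /= hx]|x [t [_ /= <-] [Dx /= ->]]//].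
  by exists (h x) => //; split => //; exists x.
rewrite measure_fin_bigcup//; last 2 first.
- by move=> t u _ _ [x [[_ /= <-] [_ /= <-]]].
- by move=> t _; apply: measurableI => //; exact: mh.
rewrite (eq_fsbigr (fun t => (fine (leb (D `&` h @^-1` [set t])))%:E)); last first.
  move=> t /set_mem[_ /= te]; rewrite fineK// ge0_fin_numE//.
  by apply: hfin; rewrite te.
rewrite fsumEFin//= /B fsbig_mkcondr fsbig_finite//= rmorph_sum/= [RHS]big_mkcond/=.
apply: eq_bigr => t _; case: ifPn => [/set_mem /= ->|]; first by rewrite eqxx.
by rewrite notin_setE /= => /eqP/negbTE ->.
Qed.

Lemma norm_integral_simple D (T : choiceType) (h : R -> T) (phi : T -> E) :
  measurable (D : set (measurableTypeR R)) -> simple_map h ->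
  norm_integral D (phi \o h) =
  (\sum_(t \in range h) ((rnorm (phi t))%:E * leb (D `&` h @^-1` [set t])))%E.
Proof.
move=> mD [fh mh]; rewrite /norm_integral.
transitivity (\int[leb]_(x in D) (\sum_(t \in range h)
    (rnorm (phi t) * \1_(h @^-1` [set t]) x)%:E))%E.
  apply: eq_integral => x _.
  rewrite fsumEFin//; congr (_%:E).
  rewrite (fsbigD1 (h x))//=; last by exists x.
  rewrite indicE mem_set// mulr1 fsbig1 ?addr0// => t [_ /= thx].
  by rewrite indicE memNset ?mulr0//= => /esym.
rewrite ge0_integral_fsum//; last 2 first.
- by move=> t; apply/measurable_EFinP/measurable_funM.
- by move=> t x _; rewrite lee_fin mulr_ge0// ?rnorm_ge0// indicE.
apply: eq_fsbigr => t _.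
under eq_integral do rewrite EFinM.
rewrite ge0_integralZl_EFin//; last 2 first.
- exact/measurable_EFinP/measurable_funTS/measurable_indic.
- exact: rnorm_ge0.
by rewrite integral_indic// setIC.
Qed.

Lemma simple_fin D s e : measurable (D : set (measurableTypeR R)) ->
  simple_fun s -> (norm_integral D s < +oo)%E -> e != 0 ->
  (leb (D `&` s @^-1` [set e]) < +oo)%E.
Proof.
move=> mD ss; rewrite (norm_integral_simple id mD ss) => si e0.
have [[x _ sxe]|se] := pselect (range s e); last first.
  rewrite (_ : _ `&` _ = set0) ?measure0//.
  by apply/seteqP; split => // x [_ /= xe]; apply: se; exists x.
rewrite ltNge leye_eq; apply/negP => /eqP h.
move: si; rewrite (fsbigD1 e)//=; last 2 first.
- exact: ss.1.
- by exists x.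
rewrite h gt0_muley ?lte_fin ?lt_neqAle ?rnorm_ge0 ?andbT; last first.
  by rewrite eq_sym; apply: contra_neq e0; exact: rnorm0_eq0.
rewrite addye// ?ltxx//.
rewrite -ltNye (@lt_le_trans _ _ 0%E)// fsume_ge0// => t _.
by rewrite mule_ge0// lee_fin rnorm_ge0.
Qed.

Lemma simple_integral_lin D (c : R[i]) s (t : R -> E) :
  measurable (D : set (measurableTypeR R)) -> simple_fun s -> simple_fun t ->
  (norm_integral D s < +oo)%E -> (norm_integral D t < +oo)%E ->
  simple_integral D (c *: s + t) = c *: simple_integral D s + simple_integral D t.
Proof.
move=> mD ss st si ti.
pose h x := (s x, t x).
have sh : simple_map h by exact: simple_map_pair.
have hle (A B : set R) : measurable (A : set (measurableTypeR R)) ->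
   measurable (B : set (measurableTypeR R)) -> A `<=` B ->
   (leb B < +oo)%E -> (leb A < +oo)%E.
  by move=> mA mB AB; apply: le_lt_trans; apply: le_measure; rewrite ?inE.
have hs e : measurable (D `&` s @^-1` [set e] : set (measurableTypeR R)).
  by apply: measurableI => //; exact: ss.2.
have ht e : measurable (D `&` t @^-1` [set e] : set (measurableTypeR R)).
  by apply: measurableI => //; exact: st.2.
have hh e : measurable (D `&` h @^-1` [set e] : set (measurableTypeR R)).
  by apply: measurableI => //; exact: sh.2.
have h1 (e : E * E) : e.1 != 0 -> (leb (D `&` h @^-1` [set e]) < +oo)%E.
  move=> /(simple_fin mD ss si); apply: hle => //.
  by move=> x [Dx /= <-].
have h2 (e : E * E) : e.2 != 0 -> (leb (D `&` h @^-1` [set e]) < +oo)%E.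
  move=> /(simple_fin mD st ti); apply: hle => //.
  by move=> x [Dx /= <-].
have -> : c *: s + t = (fun e : E * E => c *: e.1 + e.2) \o h by [].
rewrite -[simple_integral D s]/(simple_integral D (fst \o h)).
rewrite -[simple_integral D t]/(simple_integral D (snd \o h)).
rewrite !simple_integralE//; last first.
  move=> e; have [e1|e1 _] := eqVneq e.1 0; last exact: h1.
  by rewrite e1 scaler0 add0r; exact: h2.
have fh := sh.1.
rewrite !fsbig_finite//= scaler_sumr -big_split/=.
by apply: eq_bigr => e _; rewrite scalerDr !scalerA mulrC.
Qed.

Lemma rnorm_simple_integral D s :
  measurable (D : set (measurableTypeR R)) -> simple_fun s ->
  (norm_integral D s < +oo)%E ->
  ((rnorm (simple_integral D s))%:E <= norm_integral D s)%E.
Proof.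
move=> mD ss si.
rewrite (norm_integral_simple id mD ss) /simple_integral.
have fs := ss.1.
rewrite !fsbig_finite//=.
apply: (@le_trans _ _ (\sum_(i <- finmap.enum_fset (fset_set (range s)))
    rnorm ((fine (leb (D `&` s @^-1` [set i])))%:C%C *: i))%:E).
  by rewrite lee_fin; exact: ler_rnorm_sum.
rewrite -sumEFin; apply: lee_sum => e _.
have [->|e0] := eqVneq e 0; first by rewrite scaler0 rnorm0 mul0e.
rewrite rnormZr ger0_norm ?fine_ge0// mulrC EFinM fineK// ge0_fin_numE//.
exact: simple_fin.
Qed.
End SimpleIntegral.

Section NonnegLimits.
Context {R : realType}.

Lemma cvge0P {T : Type} (F : set_system T) {FF : Filter F} (a : T -> \bar R) :
  (forall x, (0 <= a x)%E) ->
  (a x @[x --> F] --> 0%E) <->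
  (forall e : R, 0 < e -> \forall x \near F, (a x <= e%:E)%E).
Proof.
move=> a0; split.
  move=> /fine_cvgP[afin] /cvgrPdist_le h e e0; near=> x.
  have fx : a x \is a fin_num by near: x.
  rewrite -(fineK fx) lee_fin.
  have : `|0 - (fine \o a) x| <= e by near: x; exact: h.
  by rewrite sub0r normrN /= ger0_norm ?fine_ge0.
move=> h; apply/fine_cvgP; split.
  near=> x; rewrite ge0_fin_numE//; apply: (@le_lt_trans _ _ 1%:E); last exact: ltry.
  by near: x; exact: h.
apply/cvgrPdist_le => e e0; near=> x.
have ax : (a x <= e%:E)%E by near: x; exact: h.
have fx : a x \is a fin_num.
  by rewrite ge0_fin_numE//; apply: (le_lt_trans ax); exact: ltry.
by rewrite sub0r normrN /= ger0_norm ?fine_ge0// -lee_fin fineK.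
Unshelve. all: end_near. Qed.

End NonnegLimits.

Section Bochner.
Context {R : realType} {E : completeNormedModType R[i]}.
Notation leb := (@lebesgue_measure R).
Implicit Types (f g u s : R -> E) (D : set (measurableTypeR R)).

Definition bochner_integrable D f :=
  strongly_measurable D f /\ (norm_integral D f < +oo)%E.

Lemma norm_integral_ge0 D f : (0 <= norm_integral D f)%E.
Proof. by apply: integral_ge0 => x _; rewrite lee_fin rnorm_ge0. Qed.

Lemma norm_integral_ae_eq D f g : measurable D ->
  {ae leb, forall x, D x -> f x = g x} -> norm_integral D f = norm_integral D g.
Proof.
move=> mD fg; apply: ae_eq_nnintegral => //.
- by move=> x _; rewrite lee_fin rnorm_ge0.
- by move=> x _; rewrite lee_fin rnorm_ge0.
- by apply: filterS fg => x fg Dx; rewrite fg.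
Qed.

Lemma norm_integralD D f g : measurable D ->
  strongly_measurable D f -> strongly_measurable D g ->
  (norm_integral D (f + g)%R <= norm_integral D f + norm_integral D g)%E.
Proof.
move=> mD sf sg; rewrite /norm_integral -nnintegralD//.
- apply: le_nnintegral => // x _; first by rewrite lee_fin rnorm_ge0.
  by rewrite -EFinD lee_fin; exact: ler_rnormD.
- by move=> x _; rewrite lee_fin rnorm_ge0.
- by move=> x _; rewrite lee_fin rnorm_ge0.
- exact: rnorm_ae_measurable1.
- exact: rnorm_ae_measurable1.
Qed.

Lemma norm_integralZ D (c : R[i]) f : measurable D -> strongly_measurable D f ->
  norm_integral D (c *: f) = ((complex.Re `|c|)%:E * norm_integral D f)%E.
Proof.
move=> mD sf; rewrite /norm_integral -nnintegralZ//.
- by apply: eq_integral => x _; rewrite -EFinM /GRing.scale/= rnormZ.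
- by have := normr_ge0 c; case: (`|c|) => a b; rewrite lecE /= => /andP[].
- by move=> x _; rewrite lee_fin rnorm_ge0.
- exact: rnorm_ae_measurable1.
Qed.

Lemma norm_integralN D f : norm_integral D (- f) = norm_integral D f.
Proof. by apply: eq_integral => x _; rewrite rnormN. Qed.

Lemma bochner_integrable_lin D (c : R[i]) f g : measurable D ->
  bochner_integrable D f -> bochner_integrable D g ->
  bochner_integrable D (c *: f + g).
Proof.
move=> mD [sf fi] [sg gi]; split; first exact: smD (smZ _ _ _) _.
apply: le_lt_trans (norm_integralD mD (smZ c mD sf) sg) _.
rewrite norm_integralZ//; apply: lte_add_pinfty => //.
by rewrite lte_mul_pinfty// lee_fin; have := normr_ge0 c;
  case: (`|c|) => a b; rewrite lecE /= => /andP[].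
Qed.

(** Discarding the values [t n x] with norm larger than twice that of the limit turns
    almost everywhere convergence into dominated convergence. *)
Lemma bochner_approx D f : measurable D -> bochner_integrable D f ->
  exists s : nat -> R -> E,
    [/\ forall n, simple_fun (s n) /\ (norm_integral D (s n) < +oo)%E,
        {ae leb, forall x, D x -> s n x @[n --> \oo] --> f x} &
        norm_integral D (f - s n) @[n --> \oo] --> 0%E].
Proof.
move=> mD [sf fi]; have [g bg fg] := sm_borel mD sf.
have gi : (norm_integral D g < +oo)%E by rewrite -(norm_integral_ae_eq mD fg).
have [t [st tg]] := bg.
pose A n : set (measurableTypeR R) := [set x | rnorm (t n x) <= 2 * rnorm (g x)].
have mA n : measurable (A n).
  have mt : measurable_fun [set: measurableTypeR R] (fun x => rnorm (t n x)).
    exact: (simple_map_measurable (@rnorm R E) (st n)).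
  have mg : measurable_fun [set: measurableTypeR R] (fun x => 2 * rnorm (g x)).
    by apply: measurable_funM => //; exact: measurable_rnorm.
  have mtrue : measurable [set true] by [].
  have := measurable_fun_ler mt mg measurableT mtrue.
  by rewrite setTI.
pose s n x := if x \in A n then t n x else 0.
have ss n : simple_map (s n).
  by apply: simple_map_if => //; exact: simple_map_cst.
have sle n x : rnorm (s n x) <= 2 * rnorm (g x).
  rewrite /s; case: ifPn => [/set_mem//|_].
  by rewrite rnorm0 mulr_ge0// rnorm_ge0.
have sg x : s n x @[n --> \oo] --> g x.
  have [gx0|gx0] := eqVneq (rnorm (g x)) 0.
    rewrite (_ : (fun n => s n x) = cst (g x)); first exact: cvg_cst.
    apply/funext => n; rewrite /cst (rnorm0_eq0 gx0); apply: rnorm0_eq0.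
    apply/eqP; rewrite eq_le rnorm_ge0 andbT.
    by apply: (le_trans (sle _ _)); rewrite gx0 mulr0.
  have gx : 0 < rnorm (g x) by rewrite lt_neqAle eq_sym gx0 rnorm_ge0.
  have /cvg_rnormP/cvgrPdist_le/(_ _ gx) h := tg x.
  apply: cvg_trans (tg x); apply: near_eq_cvg; near=> n.
  rewrite /s mem_set// /A /=.
  have : `|0 - rnorm (t n x - g x)| <= rnorm (g x) by near: n.
  rewrite sub0r normrN ger0_norm ?rnorm_ge0// => h1.
  have := ler_rnormD (t n x - g x) (g x); rewrite subrK => /le_trans; apply.
  by rewrite mulr2n mulrDl mul1r lerD2r.
have bgs n : borel_sm (g - s n).
  rewrite -scaleN1r; apply: borel_smD => //; apply: borel_smZ.
  exact: borel_sm_simple.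
exists s; split.
- move=> n; split; first exact: ss.
  apply: (@le_lt_trans _ _ (2%:E * norm_integral D g)%E); last first.
    by rewrite lte_mul_pinfty.
  rewrite /norm_integral -nnintegralZ//.
  + by apply: le_nnintegral => // x _; rewrite lee_fin ?rnorm_ge0// sle.
  + by move=> x _; rewrite lee_fin rnorm_ge0.
  + by apply: rnorm_ae_measurable1 => //; exact: borel_sm_sm.
- by apply: filterS fg => x fg Dx; rewrite fg.
- have -> : (fun n => norm_integral D (f - s n)) = (fun n => norm_integral D (g - s n)).
    apply/funext => n; apply: norm_integral_ae_eq => //.
    by apply: filterS fg => x fg Dx; rewrite /GRing.add/= fg.
  pose F n x := (rnorm ((g - s n) x))%:E.
  pose G x := ((3 * rnorm (g x))%:E : \bar R).
  have mF n : measurable_fun D (F n).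
    by apply/measurable_EFinP/measurable_funTS; exact: measurable_rnorm.
  have [] := @dominated_convergence _ _ _ leb D mD F (cst 0%E) G mF.
  + exact: measurable_cst.
  + apply: aeW => x Dx; rewrite /F.
    have /cvg_rnormP h := sg x.
    apply: cvg_EFin; first by near=> n.
    rewrite (_ : _ \o _ = (fun n => rnorm (s n x - g x))) //.
    by apply/funext => n /=; rewrite rnormB.
  + apply/integrableP; split.
      apply/measurable_EFinP/measurable_funTS; apply: measurable_funM => //.
      exact: measurable_rnorm.
    rewrite (_ : (\int[_]_(_ in _) _)%E = (3%:E * norm_integral D g)%E).
      by rewrite lte_mul_pinfty.
    rewrite /norm_integral -nnintegralZ//.
    * apply: eq_integral => x _; rewrite /G gee0_abs ?EFinM// lee_fin.
      by rewrite mulr_ge0// rnorm_ge0.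
    * by move=> x _; rewrite lee_fin rnorm_ge0.
    * by apply: rnorm_ae_measurable1 => //; exact: borel_sm_sm.
  + apply: aeW => x n Dx; rewrite /F /G gee0_abs ?lee_fin ?rnorm_ge0//.
    apply: (le_trans (ler_rnormB _ _)).
    rewrite (_ : 3 = 1 + 2 :> R)// mulrDl mul1r; apply: lerD => //.
  + by move=> _ _; rewrite integral0.
Unshelve. all: end_near. Qed.

Lemma is_bochner_sm D f I : measurable D -> is_bochner_integral D f I ->
  strongly_measurable D f.
Proof. by move=> mD [s [ss sf _ _]]; exists s; split => // n; have [] := ss n. Qed.

Lemma simple_sm D s : simple_fun s -> strongly_measurable D s.
Proof. by move=> ss; apply/borel_sm_sm/borel_sm_simple. Qed.

Lemma smB D f g : measurable D -> strongly_measurable D f ->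
  strongly_measurable D g -> strongly_measurable D (f - g).
Proof. by move=> mD sf sg; rewrite -scaleN1r; apply: smD => //; exact: smZ. Qed.

Lemma Re_norm_ge0 (c : R[i]) : 0 <= complex.Re `|c|.
Proof. by have := normr_ge0 c; case: (`|c|) => a b; rewrite lecE /= => /andP[]. Qed.

Lemma is_bochner_lin D (c : R[i]) f g I J : measurable D ->
  is_bochner_integral D f I -> is_bochner_integral D g J ->
  is_bochner_integral D (c *: f + g) (c *: I + J).
Proof.
move=> mD hf hg.
have sf := is_bochner_sm mD hf; have sg := is_bochner_sm mD hg.
have [s [ss s1 s2 s3]] := hf; have [t [tt t1 t2 t3]] := hg.
exists (fun n => c *: s n + t n); split.
- move=> n; have [sn1 sn2] := ss n; have [tn1 tn2] := tt n.
  split; first exact: (simple_map_comp2 (fun a b : E => c *: a + b)).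
  by have [] := bochner_integrable_lin c mD (conj (simple_sm D sn1) sn2)
    (conj (simple_sm D tn1) tn2).
- apply: filterS2 s1 t1 => x s1 t1 Dx.
  by apply: cvgD; [apply: cvgZr; exact: s1|exact: t1].
- apply/cvge0P => [n|e e0]; first exact: norm_integral_ge0.
  have /cvge0P h1 := s2; have /cvge0P h2 := t2.
  pose k := complex.Re `|c| + 1.
  have k0 : 0 < k by rewrite /k ltr_wpDl// Re_norm_ge0.
  near=> n.
  have e1 : (norm_integral D (f - s n)%R <= (e / 2 / k)%:E)%E.
    by near: n; apply: h1 => [n|]; [exact: norm_integral_ge0|rewrite !divr_gt0].
  have e2 : (norm_integral D (g - t n)%R <= (e / 2)%:E)%E.
    by near: n; apply: h2 => [n|]; [exact: norm_integral_ge0|rewrite divr_gt0].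
  have -> : c *: f + g - (c *: s n + t n) = c *: (f - s n) + (g - t n).
    by rewrite scalerBr opprD addrACA.
  have sfn : strongly_measurable D (f - s n).
    by apply: smB => //; apply: simple_sm; have [] := ss n.
  have sgn : strongly_measurable D (g - t n).
    by apply: smB => //; apply: simple_sm; have [] := tt n.
  apply: (le_trans (norm_integralD mD (smZ c mD sfn) sgn)).
  rewrite norm_integralZ// (splitr e) EFinD; apply: leeD => //.
  apply: (@le_trans _ _ (k%:E * (e / 2 / k)%:E)%E).
    apply: lee_pmul => //; rewrite ?lee_fin ?Re_norm_ge0 ?norm_integral_ge0//.
    by rewrite /k lerDl.
  by rewrite -EFinM lee_fin mulrCA divff ?mulr1// gt_eqF.
- have -> : (fun n => simple_integral D (c *: s n + t n)) =
     (fun n => c *: simple_integral D (s n) + simple_integral D (t n)).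
    apply/funext => n; have [sn1 sn2] := ss n; have [tn1 tn2] := tt n.
    exact: simple_integral_lin.
  by apply: cvgD => //; exact: cvgZr.
Unshelve. all: end_near. Qed.

Lemma rnorm_is_bochner D f I : measurable D -> is_bochner_integral D f I ->
  ((rnorm I)%:E <= norm_integral D f)%E.
Proof.
move=> mD hf; have sf := is_bochner_sm mD hf.
have [s [ss s1 s2 /cvg_rnormP/cvgrPdist_le s3]] := hf.
apply/lee_addgt0Pr => e e0.
have /cvge0P h1 := s2.
have [n [e1 e2]] : exists n, rnorm (simple_integral D (s n) - I) <= e / 2 /\
    (norm_integral D (f - s n)%R <= (e / 2)%:E)%E.
  near \oo%classic => n; exists n; split; last first.
    by near: n; apply: h1 => [n|]; [exact: norm_integral_ge0|rewrite divr_gt0].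
  have : `|0 - rnorm (simple_integral D (s n) - I)| <= e / 2.
    by near: n; apply: s3; rewrite divr_gt0.
  by rewrite sub0r normrN ger0_norm ?rnorm_ge0.
have [sn1 sn2] := ss n.
have hn := rnorm_simple_integral mD sn1 sn2.
have sn := simple_sm D sn1.
have hle : (norm_integral D (s n) <= norm_integral D f + (e / 2)%:E)%E.
  have -> : s n = f + - (f - s n) by rewrite opprB addrC subrK.
  apply: (le_trans (norm_integralD mD sf _)).
    by rewrite -scaleN1r; apply: smZ => //; exact: smB.
  by rewrite norm_integralN leeD2l.
have : rnorm I <= rnorm (simple_integral D (s n)) + e / 2.
  rewrite -lerBlDl; apply: le_trans e1.
  rewrite rnormB lerBlDr; have := ler_rnormD (I - simple_integral D (s n)) (simple_integral D (s n)).
  by rewrite subrK.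
rewrite -lee_fin EFinD => /le_trans; apply.
apply: (le_trans (leeD2r _ (le_trans hn hle))).
by rewrite -addeA -EFinD -splitr.
Unshelve. all: end_near. Qed.

Lemma norm_integral0 D : norm_integral D (0 : R -> E) = 0%E.
Proof.
by rewrite /norm_integral integral0_eq// => x _; rewrite /GRing.zero/= rnorm0.
Qed.

Lemma is_bochner_unique D f I J : measurable D ->
  is_bochner_integral D f I -> is_bochner_integral D f J -> I = J.
Proof.
move=> mD hI hJ; apply/eqP; rewrite -subr_eq0; apply/eqP/rnorm0_eq0.
have := rnorm_is_bochner mD (is_bochner_lin (-1) mD hJ hI).
rewrite !scaleN1r addNr norm_integral0 lee_fin addrC => h.
by apply/eqP; rewrite eq_le h rnorm_ge0.
Qed.

Lemma bochnerE D f I : measurable D -> is_bochner_integral D f I -> bochner D f = I.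
Proof.
move=> mD hI; rewrite /bochner; case: xgetP => [J _ hJ|]; last by move=> /(_ I).
exact: is_bochner_unique hJ hI.
Qed.

Lemma cauchy_rnorm (u : nat -> E) :
  (forall e : R, 0 < e -> exists N, forall n m, (N <= n)%N -> (N <= m)%N ->
    rnorm (u n - u m) <= e) -> cvgn u.
Proof.
move=> h; apply: cauchy_cvg; apply/cauchy_ballP => -[a b].
rewrite ltcE /= => /andP[/eqP b0 a0].
have [N hN] := h (a / 2) (divr_gt0 a0 (ltr0n _ 2)).
exists (u @` [set n | (N <= n)%N], u @` [set n | (N <= n)%N]) => /=.
  by split; exists N => // n Nn; exists n.
move=> [_ _] /= [[n Nn <-] [m Nm <-]]; rewrite -ball_normE /= normE_rnorm b0 ltcR.
by apply: le_lt_trans (hN _ _ Nn Nm) _; rewrite ltr_pdivrMr// mulr_natr mulr2n ltrDl.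
Qed.

(** The integrals of the approximating simple functions form a Cauchy sequence, and
    [E] is complete. *)
Lemma bochnerP D f : measurable D -> bochner_integrable D f ->
  is_bochner_integral D f (bochner D f).
Proof.
move=> mD bf; have [s [ss s1 s2]] := bochner_approx mD bf.
have sf := bf.1.
suff /cvg_ex[I hI] : cvgn (fun n => simple_integral D (s n)).
  suff hh : is_bochner_integral D f I by rewrite (bochnerE mD hh).
  by exists s; split.
have /cvge0P h1 := s2.
apply: cauchy_rnorm => e e0.
have [N _ hN] : \forall n \near \oo, (norm_integral D (f - s n)%R <= (e / 2)%:E)%E.
  by apply: h1 => [n|]; [exact: norm_integral_ge0|rewrite divr_gt0].
exists N => n m Nn Nm.
have [sn1 sn2] := ss n; have [sm1 sm2] := ss m.
have ssn := simple_sm D sn1; have ssm := simple_sm D sm1.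
have -> : simple_integral D (s n) - simple_integral D (s m) =
    simple_integral D (s n - s m).
  by rewrite addrC -scaleN1r -simple_integral_lin// scaleN1r addrC.
rewrite -lee_fin.
have snm : simple_fun (s n - s m).
  exact: (simple_map_comp2 (fun a b : E => a - b)).
have hle : (norm_integral D (s n - s m)%R <= e%:E)%E.
  have -> : s n - s m = (f - s m) + - (f - s n) by rewrite opprB [RHS]addrC [RHS]addrA subrK.
  apply: (le_trans (norm_integralD mD _ _)).
  - exact: smB.
  - by rewrite -scaleN1r; apply: smZ => //; exact: smB.
  - by rewrite norm_integralN (splitr e) EFinD; apply: leeD; exact: hN.
apply: (le_trans _ hle); apply: rnorm_simple_integral => //.
by apply: (le_lt_trans hle); exact: ltry.
Qed.

Lemma bochner_lin D (c : R[i]) f g : measurable D ->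
  bochner_integrable D f -> bochner_integrable D g ->
  bochner D (c *: f + g) = c *: bochner D f + bochner D g.
Proof.
move=> mD bf bg; apply: bochnerE => //.
by apply: is_bochner_lin => //; exact: bochnerP.
Qed.

Lemma rnorm_bochner D f : measurable D -> strongly_measurable D f ->
  ((rnorm (bochner D f))%:E <= norm_integral D f)%E.
Proof.
move=> mD sf; have [fi|] := ltP (norm_integral D f) +oo%E.
  by apply: rnorm_is_bochner => //; exact: bochnerP.
by rewrite leye_eq => /eqP ->; rewrite leey.
Qed.

Lemma is_bochner_ae_eq D f g I : measurable D ->
  {ae leb, forall x, D x -> f x = g x} ->
  is_bochner_integral D f I -> is_bochner_integral D g I.
Proof.
move=> mD fg [s [ss s1 s2 s3]]; exists s; split => //.
  by apply: filterS2 fg s1 => x fg s1 Dx; rewrite -fg//; exact: s1.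
rewrite (_ : (fun n => _) = (fun n => norm_integral D (f - s n)))//.
apply/funext => n; apply: norm_integral_ae_eq => //.
by apply: filterS fg => x fg Dx; rewrite /GRing.add/= fg.
Qed.

Lemma bochner_ae_eq D f g : measurable D ->
  {ae leb, forall x, D x -> f x = g x} -> bochner D f = bochner D g.
Proof.
move=> mD fg; rewrite /bochner; congr xget; apply/seteqP; split => I /=.
  exact: is_bochner_ae_eq.
apply: is_bochner_ae_eq => //; apply: filterS fg => x fg Dx.
by rewrite fg.
Qed.

Lemma is_bochner_shift D (h : R) f I : measurable D ->
  is_bochner_integral D f I ->
  is_bochner_integral ((fun x => x + h) @^-1` D) (fun x => f (x + h)) I.
Proof.
move=> mD [s [ss s1 s2 s3]]; exists (fun n x => s n (x + h)).
have ni (u : R -> E) : norm_integral ((fun x => x + h) @^-1` D) (fun x => u (x + h)) =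
    norm_integral D u.
  apply: (@nnintegral_shift R h D (fun x => (rnorm (u x))%:E)).
  by move=> x _; rewrite lee_fin rnorm_ge0.
split.
- by move=> n; rewrite ni; have [sn1 sn2] := ss n; split => //; exact: simple_map_shift.
- exact: (ae_shift h s1).
- by under eq_cvg do rewrite (ni (f - s _)).
- rewrite (_ : (fun n => _) = (fun n => simple_integral D (s n)))//.
  apply/funext => n; rewrite /simple_integral.
  have -> : range (fun x => s n (x + h)) = range (s n).
    apply/seteqP; split => [_ [x _ <-]|_ [x _ <-]]; first by exists (x + h).
    by exists (x - h) => //; rewrite subrK.
  apply: eq_fsbigr => e _; congr ((fine _)%:C%C *: _).
  apply: (lebesgue_measure_shift h (A := D `&` s n @^-1` [set e])).
  by apply: measurableI => //; have [sn1 _] := ss n; exact: sn1.2.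
Qed.

Lemma bochner_shift D (h : R) f : measurable D -> bochner_integrable D f ->
  bochner ((fun x => x + h) @^-1` D) (fun x => f (x + h)) = bochner D f.
Proof.
move=> mD bf; apply: bochnerE.
  by rewrite -[X in measurable X]setTI; exact: measurable_addr.
by apply: is_bochner_shift => //; exact: bochnerP.
Qed.

Lemma bochner_cst D (e : E) : measurable D -> (leb D < +oo)%E ->
  bochner D (cst e) = (fine (leb D))%:C%C *: e.
Proof.
move=> mD Dfin; apply: bochnerE => //.
have sc : simple_map (cst e : R -> E) by exact: simple_map_cst.
have rc : range (cst e : R -> E) = [set e].
  by apply/seteqP; split => [_ [x _ <-]//|_ ->]; exists 0.
have pc (t : E) : (leb (D `&` (cst e : R -> E) @^-1` [set t]) < +oo)%E.
  apply: le_lt_trans Dfin; apply: le_measure; rewrite ?inE//.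
  by apply: measurableI => //; exact: sc.2.
have Dc : D `&` (cst e : R -> E) @^-1` [set e] = D.
  by apply/seteqP; split => [x []//|x Dx]; split.
exists (fun=> cst e); split.
- move=> _; split => //.
  rewrite (norm_integral_simple id mD sc) rc fsbig_set1 Dc lte_mul_pinfty//.
  by rewrite lee_fin rnorm_ge0.
- by apply: aeW => x Dx; exact: cvg_cst.
- rewrite (_ : (fun=> _) = cst 0%E); first exact: cvg_cst.
  by apply/funext => n; rewrite subrr norm_integral0.
- rewrite (_ : (fun=> _) = cst ((fine (leb D))%:C%C *: e)); first exact: cvg_cst.
  apply/funext => n; rewrite (simple_integralE (phi := id) mD sc).
    by rewrite rc fsbig_set1 Dc.
  by move=> e' _; exact: pc.
Qed.

Lemma bochner_integrable_cst D (e : E) : measurable D -> (leb D < +oo)%E ->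
  bochner_integrable D (cst e).
Proof.
move=> mD Dfin; split.
  by apply: simple_sm; exact: simple_map_cst.
rewrite /norm_integral /= integral_cst// lte_mul_pinfty//.
by rewrite lee_fin rnorm_ge0.
Qed.

Lemma norm_integral_cut D (A : set R) f :
  norm_integral D (fun x => if x \in A then f x else 0) = norm_integral (D `&` A) f.
Proof.
rewrite /norm_integral [in RHS]integral_mkcondr; apply: eq_integral => x _.
by rewrite patchE; case: ifPn => //; rewrite rnorm0.
Qed.

(** Cutting the approximating functions off leaves their integrals unchanged, which
    identifies integrals over subsets with integrals of functions extended by [0]. *)
Lemma is_bochner_cut D (A : set (measurableTypeR R)) f I :
  measurable D -> measurable A ->
  is_bochner_integral (D `&` A) f I ->
  is_bochner_integral D (fun x => if x \in A then f x else 0) I.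
Proof.
move=> mD mA [s [ss s1 s2 s3]].
have mDA : measurable (D `&` A) by exact: measurableI.
exists (fun n x => if x \in A then s n x else 0); split.
- move=> n; have [sn1 sn2] := ss n; split; last by rewrite norm_integral_cut.
  by apply: simple_map_if => //; exact: simple_map_cst.
- apply: filterS s1 => x s1 Dx; case: ifPn => [/set_mem Ax|_]; last exact: cvg_cst.
  by apply: s1.
- rewrite (_ : (fun n => _) = (fun n => norm_integral (D `&` A) (f - s n)))//.
  apply/funext => n; rewrite -norm_integral_cut; congr norm_integral.
  apply/funext => x; rewrite /GRing.add/= /GRing.opp/=.
  by case: ifPn => // _; rewrite subr0.
- rewrite (_ : (fun n => _) = (fun n => simple_integral (D `&` A) (s n)))//.
  apply/funext => n; have [sn1 sn2] := ss n.
  pose h x := (x \in A, s n x).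
  have sh : simple_map h by apply: simple_map_pair => //; exact: simple_map_mem.
  have mh (z : bool * E) : measurable (D `&` h @^-1` [set z]).
    by apply: measurableI => //; exact: sh.2.
  have hfin (z : bool * E) : z.2 != 0 -> (leb (D `&` A `&` h @^-1` [set z]) < +oo)%E.
    move=> /(simple_fin mDA sn1 sn2); apply: le_lt_trans; apply: le_measure.
    - by rewrite inE; apply: measurableI => //; exact: sh.2.
    - by rewrite inE; apply: measurableI => //; exact: sn1.2.
    - by move=> x [DAx <-].
  have hA (e : E) : D `&` h @^-1` [set (true, e)] = D `&` A `&` h @^-1` [set (true, e)].
    apply/seteqP; split => [x [Dx [/set_mem Ax <-]]|x [[Dx _] hx]]; last by split.
    by rewrite /h /= mem_set.
  transitivity (simple_integral D ((fun z : bool * E => if z.1 then z.2 else 0) \o h)).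
    by [].
  rewrite -[s n in RHS]/(snd \o h).
  rewrite !simple_integralE//; last first.
    by case=> -[] e /=; [rewrite hA; exact: (hfin (true, e))|rewrite eqxx].
  apply: eq_fsbigr => -[[] e] _ /=; first by rewrite hA.
  rewrite scaler0 (_ : _ `&` _ `&` _ = set0) ?measure0 ?scale0r//.
  by apply/seteqP; split => // x [[_ Ax] [/negbT]]; rewrite notin_setE.
Qed.

Lemma bochner_cut D (A : set (measurableTypeR R)) f :
  measurable D -> measurable A -> bochner_integrable (D `&` A) f ->
  bochner D (fun x => if x \in A then f x else 0) = bochner (D `&` A) f.
Proof.
move=> mD mA bf; apply: bochnerE => //; apply: is_bochner_cut => //.
by apply: bochnerP => //; exact: measurableI.
Qed.

Lemma bochner_integrable_cut D (A : set (measurableTypeR R)) f :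
  measurable D -> measurable A -> bochner_integrable (D `&` A) f ->
  bochner_integrable D (fun x => if x \in A then f x else 0).
Proof.
move=> mD mA [sf fi]; split; last by rewrite norm_integral_cut.
have [g bg fg] := sm_borel (measurableI _ _ mD mA) sf.
apply: (borel_ae_sm (borel_sm_cut mA bg)).
apply: filterS fg => x fg Dx; case: ifPn => // /set_mem Ax.
by apply: fg.
Qed.

Lemma bochner_integrable_subset (A D : set (measurableTypeR R)) f :
  measurable A -> measurable D -> A `<=` D -> bochner_integrable D f ->
  bochner_integrable A f.
Proof.
move=> mA mD AD [sf fi]; split; first exact: sm_subset sf.
apply: le_lt_trans fi; apply: subset_nnintegral => //.
by move=> x _; rewrite lee_fin rnorm_ge0.
Qed.

Lemma bochner_split (A B D : set (measurableTypeR R)) f :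
  measurable A -> measurable B -> measurable D -> A `|` B = D ->
  leb (A `&` B) = 0%E -> bochner_integrable D f ->
  bochner D f = bochner A f + bochner B f.
Proof.
move=> mA mB mD ABD AB0 bf.
have AD : D `&` A = A by rewrite -ABD; apply/setIidPr; exact: subsetUl.
have BD : D `&` B = B by rewrite -ABD; apply/setIidPr; exact: subsetUr.
have bA : bochner_integrable A f.
  by apply: bochner_integrable_subset bf => //; rewrite -ABD; exact: subsetUl.
have bB : bochner_integrable B f.
  by apply: bochner_integrable_subset bf => //; rewrite -ABD; exact: subsetUr.
rewrite -{1}AD -{1}BD -!bochner_cut ?AD ?BD//.
set F := fun x => if x \in A then _ else _.
set G := fun x => if x \in B then _ else _.
have bF : bochner_integrable D F by apply: bochner_integrable_cut => //; rewrite AD.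
have bG : bochner_integrable D G by apply: bochner_integrable_cut => //; rewrite BD.
rewrite -[bochner D F]scale1r -(bochner_lin 1 mD bF bG).
apply: bochner_ae_eq => //; exists (A `&` B); split => //.
  exact: measurableI.
move=> x /= /not_implyP[Dx]; rewrite /GRing.add/= /F /G scale1r.
apply: contra_notP => ABx.
case: ifPn => [/set_mem Ax|]; last first.
  rewrite notin_setE => Ax; rewrite mem_set ?add0r//.
  by move: Dx; rewrite -ABD => -[].
by rewrite ifF ?addr0//; apply/negbTE; rewrite notin_setE => Bx; apply: ABx.
Qed.

Lemma norm_integral_shift D (h : R) f :
  norm_integral ((fun x => x + h) @^-1` D) (fun x => f (x + h)) = norm_integral D f.
Proof.
apply: (@nnintegral_shift R h D (fun x => (rnorm (f x))%:E)).
by move=> x _; rewrite lee_fin rnorm_ge0.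
Qed.

Lemma bochner_integrable_shift D (h : R) f : bochner_integrable D f ->
  bochner_integrable ((fun x => x + h) @^-1` D) (fun x => f (x + h)).
Proof.
move=> [sf fi]; split; first exact: sm_shift.
by rewrite norm_integral_shift.
Qed.

(** Composition with the roundings [grid n] approximates the function by simple ones:
    openness puts the rounded point in [U] from some index on. *)
Lemma sm_continuous (U : set R) f : open U -> (forall x, U x -> f y @[y --> x] --> f x) ->
  strongly_measurable U f.
Proof.
move=> oU cf; exists (fun n x => if grid n x \in U then f (grid n x) else 0); split.
  move=> n; apply: (simple_map_comp (fun y => if y \in U then f y else 0)).
  exact: simple_map_grid.
apply: aeW => x Ux; have gx := @cvg_grid R x.
have h : f (grid n x) @[n --> \oo] --> f x by apply: continuous_cvg; [exact: cf|].
apply: cvg_trans h; apply: near_eq_cvg; near=> n.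
rewrite mem_set//; near: n; apply: gx; exact: open_nbhs_nbhs.
Unshelve. all: end_near. Qed.

End Bochner.

(** * Continuity of translations in L_1 *)

Section L1Translation.
Context {R : realType} {E : completeNormedModType R[i]}.
Notation leb := (@lebesgue_measure R).
Implicit Types (f g u : R -> E) (A D : set (measurableTypeR R)).

(** Regularity: between a compact subset [K] and an open superset [U] of nearly the
    same measure, small translations map [K] into [U]. *)
Lemma leb_exit_shift A : measurable A -> (leb A < +oo)%E ->
  leb [set x | A x /\ ~ A (x + t)] @[t --> (0 : R)] --> 0%E.
Proof.
move=> mA Afin; apply/cvge0P => [t|e e0]; first exact: measure_ge0.
have e2 : 0 < e / 2 by rewrite divr_gt0.
have [K [cK KA AK]] := lebesgue_regularity_inner mA Afin e2.
have [U [oU AU UA]] := lebesgue_regularity_outer mA Afin e2.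
have KU : \forall t \near (0 : R), K `<=` (fun x => U (x + t)).
  apply: ((compact_near_coveringP K).1 cK R (nbhs (0 : R)) (fun t x => U (x + t))) => x Kx.
  have : U (x + 0) by rewrite addr0; apply/AU/KA.
  have cx : {for (x, 0 : R), continuous (fun z : R * R => z.1 + z.2)}.
    exact: add_continuous.
  by move=> Ux; apply: cx; exact: open_nbhs_nbhs.
have mU := open_measurable oU; have mK := compact_measurable cK.
have mUA : measurable (U `\` A : set (measurableTypeR R)) by exact: measurableD.
have mAK : measurable (A `\` K : set (measurableTypeR R)) by exact: measurableD.
near=> t.
have ht : K `<=` (fun x => U (x + t)) by near: t.
have ms (B : set (measurableTypeR R)) : measurable B ->
    measurable ((fun x => x + t) @^-1` B : set (measurableTypeR R)).
  by move=> mB; rewrite -[X in measurable X]setTI; exact: measurable_addr.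
have mS : measurable ([set x | A x /\ ~ A (x + t)] : set (measurableTypeR R)).
  by apply: measurableI => //; apply: measurableC; exact: ms.
apply: (@le_trans _ _ (leb ((A `\` K) `|` (fun x => x + t) @^-1` (U `\` A)))).
  apply: le_measure; rewrite ?inE//; first by apply: measurableU => //; exact: ms.
  move=> x [Ax Axt]; have [Kx|Kx] := pselect (K x); last by left.
  by right; split => //; exact: ht.
apply: (le_trans (measureU2 _ _ _)) => //; first exact: ms.
rewrite (splitr e) EFinD; apply: leeD; first exact: ltW.
by rewrite [leLHS](lebesgue_measure_shift t mUA); exact: ltW.
Unshelve. all: end_near. Qed.

Definition L1_shift_continuous f :=
  norm_integral setT (fun x => f (x + t) - f x) @[t --> (0 : R)] --> 0%E.

Lemma L1_shift_indic A (e : E) : measurable A -> (leb A < +oo)%E ->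
  L1_shift_continuous (fun x => if x \in A then e else 0).
Proof.
move=> mA Afin; apply/cvge0P => [t|eps e0]; first exact: norm_integral_ge0.
have k0 : 0 < 2 * (rnorm e + 1) by rewrite mulr_gt0// ltr_wpDl// rnorm_ge0.
have := leb_exit_shift mA Afin.
move=> /cvge0P => /(_ (fun t => measure_ge0 _ _)) h.
have {}h := h _ (divr_gt0 e0 k0).
have h' : \forall t \near (0 : R),
    (leb [set x | A x /\ ~ A (x + - t)%R] <= (eps / (2 * (rnorm e + 1)))%:E)%E.
  have : (fun t : R => - t) @ 0 --> (0 : R).
    by rewrite -[X in _ --> X]oppr0; apply: cvgN; exact: cvg_id.
  by move=> /(_ _ h).
near=> t.
have hS : (leb [set x | A x /\ ~ A (x + t)%R] <= (eps / (2 * (rnorm e + 1)))%:E)%E by near: t.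
have hS' : (leb [set x | A x /\ ~ A (x + - t)%R] <= (eps / (2 * (rnorm e + 1)))%:E)%E by near: t.
have ms (r : R) (B : set (measurableTypeR R)) : measurable B ->
    measurable ((fun x => x + r) @^-1` B : set (measurableTypeR R)).
  by move=> mB; rewrite -[X in measurable X]setTI; exact: measurable_addr.
pose S := [set x | A x /\ ~ A (x + t)] : set (measurableTypeR R).
pose S' := [set x | ~ A x /\ A (x + t)] : set (measurableTypeR R).
have mS : measurable S.
  by apply: measurableI => //; apply: measurableC; exact: ms.
have mS' : measurable S'.
  by apply: measurableI => //; [exact: measurableC|exact: ms].
have S'E : leb S' = leb [set x | A x /\ ~ A (x + - t)%R].
  have mS1 : measurable ([set x | A x /\ ~ A (x + - t)] : set (measurableTypeR R)).
    by apply: measurableI => //; apply: measurableC; exact: ms.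
  rewrite -(lebesgue_measure_shift t mS1); congr (leb _).
  by apply/seteqP; split => x /=; rewrite addrK => -[].
apply: (@le_trans _ _ ((rnorm e)%:E * (leb S + leb S'))%E); last first.
  apply: (@le_trans _ _ ((rnorm e + 1)%:E * ((eps / (2 * (rnorm e + 1)))%:E + (eps / (2 * (rnorm e + 1)))%:E))%E).
    apply: lee_pmul; rewrite ?lee_fin ?rnorm_ge0 ?adde_ge0 ?lerDl//.
    by apply: leeD => //; rewrite S'E.
  rewrite -EFinD -EFinM lee_fin.
  rewrite le_eqVlt; apply/orP; left; apply/eqP; field.
  by rewrite gt_eqF// ltr_wpDl// rnorm_ge0.
have SE z : (z \in S) = (z \in A) && (z + t \notin A).
  apply/idP/andP => [/set_mem[Az Azt]|[/set_mem Az /negP Azt]].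
    by rewrite mem_set// memNset.
  by apply/mem_set; split => // /mem_set.
have S'E' z : (z \in S') = (z \notin A) && (z + t \in A).
  apply/idP/andP => [/set_mem[Az Azt]|[/negP Az /set_mem Azt]].
    by rewrite memNset// mem_set.
  by apply/mem_set; split => // /mem_set.
have iS (B : set (measurableTypeR R)) : measurable B ->
    leb B = (\int[leb]_(x in [set: measurableTypeR R]) (\1_B x)%:E)%E.
  by move=> mB; rewrite integral_indic// setIT.
rewrite !iS// -nnintegralD//; last 2 first.
- exists (fun x => (\1_S x)%:E); last exact: aeW.
  by apply/measurable_EFinP; exact: measurable_indic.
- exists (fun x => (\1_S' x)%:E); last exact: aeW.
  by apply/measurable_EFinP; exact: measurable_indic.
rewrite -nnintegralZ//; last 3 first.
- exact: rnorm_ge0.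
- by move=> x _; rewrite adde_ge0// lee_fin.
- exists (fun x => (\1_S x)%:E + (\1_S' x)%:E)%E; last exact: aeW.
  by apply: emeasurable_funD; apply/measurable_EFinP; exact: measurable_indic.
apply: le_nnintegral => // x _; first by rewrite lee_fin rnorm_ge0.
rewrite -EFinD -EFinM lee_fin !indicE SE S'E'.
case: (x \in A); case: (x + t \in A) => /=.
- by rewrite subrr rnorm0 mulr_ge0// ?rnorm_ge0// addr_ge0.
- by rewrite sub0r rnormN addr0 mulr1.
- by rewrite subr0 add0r mulr1.
- by rewrite subrr rnorm0 mulr_ge0// ?rnorm_ge0// addr_ge0.
Unshelve. all: end_near. Qed.

Lemma L1_shift_continuousD f g : borel_sm f -> borel_sm g ->
  L1_shift_continuous f -> L1_shift_continuous g -> L1_shift_continuous (f + g).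
Proof.
move=> bf bg /cvge0P hf /cvge0P hg; apply/cvge0P => [t|e e0].
  exact: norm_integral_ge0.
have bd (u : R -> E) t : borel_sm u -> borel_sm (fun x => u (x + t) - u x).
  move=> bu; rewrite (_ : (fun x => _) = (fun x => u (x + t)) + (- 1) *: u).
    by apply: borel_smD; [exact: borel_sm_shift|exact: borel_smZ].
  by apply/funext => x; rewrite scaleN1r.
near=> t.
have e1 : (norm_integral setT (fun x => f (x + t) - f x)%R <= (e / 2)%:E)%E.
  by near: t; apply: hf => [t|]; [exact: norm_integral_ge0|rewrite divr_gt0].
have e2 : (norm_integral setT (fun x => g (x + t) - g x)%R <= (e / 2)%:E)%E.
  by near: t; apply: hg => [t|]; [exact: norm_integral_ge0|rewrite divr_gt0].
rewrite (_ : (fun x => _) = (fun x => f (x + t) - f x) + (fun x => g (x + t) - g x)); last first.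
  by apply/funext => x; rewrite /GRing.add/= opprD addrACA.
apply: (le_trans (norm_integralD _ _ _)) => //.
- by apply: borel_sm_sm; exact: bd.
- by apply: borel_sm_sm; exact: bd.
- by rewrite (splitr e) EFinD; exact: leeD.
Unshelve. all: end_near. Qed.

Lemma L1_shift_simple f : simple_fun f -> (norm_integral setT f < +oo)%E ->
  L1_shift_continuous f.
Proof.
move=> sf fi; have fs := sf.1.
have -> : f = \sum_(e <- finmap.enum_fset (fset_set (range f)))
    (fun x => if x \in f @^-1` [set e] then e else 0).
  apply/funext => x; rewrite fct_sumE.
  have fx : f x \in finmap.enum_fset (fset_set (range f)).
    by rewrite in_fset_set// inE; exists x.
  rewrite (bigD1_seq (f x))//=; last exact: finmap.fset_uniq.
  rewrite mem_set// big1 ?addr0// => e /eqP ne.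
  by rewrite ifF//; apply/negbTE; rewrite notin_setE /= => /esym.
suff : borel_sm (\sum_(e <- finmap.enum_fset (fset_set (range f)))
    (fun x => if x \in f @^-1` [set e] then e else 0)) /\
  L1_shift_continuous (\sum_(e <- finmap.enum_fset (fset_set (range f)))
    (fun x => if x \in f @^-1` [set e] then e else 0)) by case.
elim/big_rec : _ => [|e u _ [bu hu]].
  split; first by apply: borel_sm_simple; exact: simple_map_cst.
  rewrite /L1_shift_continuous (_ : (fun t => _) = cst 0%E); first exact: cvg_cst.
  apply/funext => t; rewrite (_ : (fun x => _) = 0) ?norm_integral0//.
  by apply/funext => x; rewrite subrr.
have mfe : measurable (f @^-1` [set e] : set (measurableTypeR R)) by exact: sf.2.
have be : borel_sm (fun x => if x \in f @^-1` [set e] then e else 0).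
  apply: borel_sm_simple; apply: simple_map_if => //; exact: simple_map_cst.
split; first exact: borel_smD.
apply: L1_shift_continuousD => //.
have [->|e0] := eqVneq e 0.
  rewrite /L1_shift_continuous (_ : (fun t => _) = cst 0%E); first exact: cvg_cst.
  apply/funext => t; rewrite (_ : (fun x => _) = 0) ?norm_integral0//.
  by apply/funext => x; rewrite !if_same subrr.
apply: L1_shift_indic => //.
by have := simple_fin measurableT sf fi e0; rewrite setTI.
Qed.

(** Translations are isometric in [L_1], so it suffices to approximate by simple
    functions, for which [leb_exit_shift] applies to each level set. *)
Lemma L1_shift f : bochner_integrable setT f -> L1_shift_continuous f.
Proof.
move=> bf; have [s [ss _ /cvge0P s2]] := bochner_approx measurableT bf.
apply/cvge0P => [t|e e0]; first exact: norm_integral_ge0.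
have e3 : 0 < e / 3 by rewrite divr_gt0.
have [n hn] : exists n, (norm_integral setT (f - s n)%R <= (e / 3)%:E)%E.
  have [N _ hN] := s2 (fun n => norm_integral_ge0 _ _) _ e3.
  by exists N; apply: hN => /=.
have [sn1 sn2] := ss n.
have /cvge0P hs := L1_shift_simple sn1 sn2.
have sd : strongly_measurable setT (f - s n).
  by apply: smB => //; [exact: bf.1|exact: simple_sm].
near=> t.
have h : (norm_integral setT (fun x => s n (x + t) - s n x)%R <= (e / 3)%:E)%E.
  by near: t; apply: hs => // t; exact: norm_integral_ge0.
have sdt : strongly_measurable setT (fun x => (f - s n) (x + t)).
  exact: (sm_shift t sd).
have hT : norm_integral setT (fun x => (f - s n) (x + t)) = norm_integral setT (f - s n).
  exact: (norm_integral_shift setT t (f - s n)).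
rewrite (_ : (fun x => _) = (fun x => (f - s n) (x + t)) +
    ((fun x => s n (x + t) - s n x) + - (f - s n))); last first.
  apply/funext => x; rewrite /GRing.add/= /GRing.opp/= opprB addrA subrKA.
  by rewrite addrA subrK.
have bst : strongly_measurable setT (fun x => s n (x + t) - s n x).
  apply: simple_sm; apply: (simple_map_comp2 (fun a b : E => a - b)) => //.
  exact: simple_map_shift.
have sNd : strongly_measurable setT (- (f - s n)).
  by rewrite -scaleN1r; exact: smZ.
have three : e = e / 3 + (e / 3 + e / 3).
  by field.
apply: (le_trans (norm_integralD measurableT sdt (smD measurableT bst sNd))).
rewrite three EFinD hT; apply: leeD => //.
apply: (le_trans (norm_integralD measurableT bst sNd)).
by rewrite EFinD norm_integralN; exact: leeD.
Unshelve. all: end_near. Qed.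

End L1Translation.

(** * Local integrability and primitives *)

Section CountableUnion.
Context {R : realType} {E : completeNormedModType R[i]}.
Notation leb := (@lebesgue_measure R).
Variables (D : nat -> set (measurableTypeR R)) (t : nat -> nat -> R -> E).

(** Selects, at [x], the sequence that belongs to the first set [D i] containing [x]; the
    search is bounded by [k], which will tend to infinity together with [m]. *)
Fixpoint first_cover (j k m : nat) (x : R) : E :=
  if k is k'.+1 then
    if x \in D j then t j m x else first_cover j.+1 k' m x
  else 0.

Lemma first_coverE n j k m x : x \in D n -> (forall i, (i < n)%N -> x \notin D i) ->
  (j <= n < j + k)%N -> first_cover j k m x = t n m x.
Proof.
move=> xn xi; elim: k j => [|k IH] j /=; first by rewrite addn0; case: leqP.
rewrite leq_eqVlt => /andP[/orP[/eqP ->|jn] nk]; first by rewrite xn.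
by rewrite (negbTE (xi _ jn)) IH// jn addSnnS.
Qed.

Lemma first_cover_simple j k m : (forall n, measurable (D n)) ->
  (forall n m, simple_map (t n m)) -> simple_map (first_cover j k m).
Proof.
move=> mD st; elim: k j => [|k IH] j /=; first exact: simple_map_cst.
exact: simple_map_if.
Qed.
End CountableUnion.

Lemma sm_bigcup {R : realType} {E : completeNormedModType R[i]}
    (D : nat -> set (measurableTypeR R)) (f : R -> E) :
  (forall n, measurable (D n)) -> (forall n, strongly_measurable (D n) f) ->
  strongly_measurable (\bigcup_n D n) f.
Proof.
move=> mD /choice[t tP].
exists (fun m => first_cover D t 0 m m); split.
  by move=> m; apply: first_cover_simple => // n k; exact: (tP n).1.
have : {ae (@lebesgue_measure R), forall x, forall n, D n x -> t n m x @[m --> \oo] --> f x}.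
  by apply: ae_foralln => n; exact: (tP n).2.
apply: filterS => x h [n _ Dnx].
have ex : exists n, x \in D n by exists n; rewrite inE.
case: (ex_minnP ex) => k xk kmin.
have hk : t k m x @[m --> \oo] --> f x by apply: h; exact/set_mem.
apply: cvg_trans hk; apply: near_eq_cvg; exists k.+1 => // m /= km.
apply/esym; apply: first_coverE => //.
by move=> i ik; apply/negP => /kmin; rewrite leqNgt ik.
Qed.

Section Primitive.
Context {R : realType} {E : completeNormedModType R[i]}.
Notation leb := (@lebesgue_measure R).
Implicit Types (u v : R -> E).

Lemma L1loc_integrable v a b : L1loc v -> 0 < a -> bochner_integrable `[a, b] v.
Proof.
move=> lv a0; have ab : a < Num.max b (a + 1) by rewrite lt_max ltrDl ltr01 orbT.
apply: (bochner_integrable_subset _ _ _ (lv _ _ a0 ab)) => //.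
by apply: subset_itv => //; rewrite bnd_simp le_max lexx.
Qed.

Lemma L1loc_sm v : L1loc v -> strongly_measurable halfline v.
Proof.
move=> lv.
have -> : halfline = \bigcup_n (`[n.+1%:R^-1, n.+1%:R]%classic : set (measurableTypeR R)).
  apply/seteqP; split => x; rewrite /halfline /= in_itv/= andbT.
    move=> x0; pose k := maxn (Num.bound x) (Num.bound x^-1).
    exists k => //=; rewrite in_itv/=; apply/andP; split.
      rewrite -[leRHS]invrK lef_pV2 ?posrE ?invr_gt0//.
      have := archi_boundP (_ : 0 <= x^-1); rewrite invr_ge0 => /(_ (ltW x0))/ltW/le_trans; apply.
      by rewrite ler_nat (leq_trans (leq_maxr _ _) (leqnSn _)).
    have := archi_boundP (ltW x0) => /ltW/le_trans; apply.
    by rewrite ler_nat (leq_trans (leq_maxl _ _) (leqnSn _)).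
  by move=> [n _] /=; rewrite in_itv/= => /andP[+ _]; apply: lt_le_trans; rewrite invr_gt0.
apply: sm_bigcup => // n; have [] // := L1loc_integrable n.+1%:R lv (_ : 0 < n.+1%:R^-1).
Qed.

Lemma bochner_itv_split v a b c : L1loc v -> 0 < a -> a <= b -> b <= c ->
  bochner `[a, c] v = bochner `[a, b] v + bochner `[b, c] v.
Proof.
move=> lv a0 ab bc; apply: bochner_split => //.
- apply/seteqP; split => x /=; rewrite !in_itv/=.
    by case=> /andP[h1 h2]; rewrite ?h1 ?h2 ?(le_trans h2)// ?(le_trans ab).
  by move=> /andP[-> ->]; rewrite /= andbT; apply/orP; exact: le_total.
- apply: (@subset_measure0 _ _ _ leb _ [set b]) => //.
  + exact: measurableI.
  + move=> x [] /=; rewrite !in_itv/= => /andP[_ xb] /andP[bx _].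
    by apply/eqP; rewrite eq_le xb bx.
  + exact: lebesgue_measure_set1.
- exact: L1loc_integrable.
Qed.

(** The base point is [1] because functions need not be integrable near [0]. *)
Definition primitive v (x : R) : E :=
  if 1 <= x then bochner `[1, x] v else - bochner `[x, 1] v.

Lemma primitiveB v x y : L1loc v -> 0 < x -> x <= y ->
  primitive v y - primitive v x = bochner `[x, y] v.
Proof.
move=> lv x0 xy; rewrite /primitive.
have [x1|x1] := leP 1 x.
  rewrite (le_trans x1 xy) (@bochner_itv_split _ 1 x y)//.
  by rewrite addrC addKr.
have [y1|y1] := leP 1 y.
  by rewrite opprK addrC -bochner_itv_split// ltW.
rewrite opprK (@bochner_itv_split _ x y 1)//; last exact: ltW.
by rewrite addrC addrK.
Qed.

Lemma leb_itv (a b : R) : a <= b -> leb `[a, b] = (b - a)%:E.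
Proof.
move=> ab; rewrite lebesgue_measure_itv/= lte_fin; case: ifPn => //.
by rewrite -leNgt => ba; rewrite (@le_anti _ _ a b) ?subrr// ab ba.
Qed.

(** Absolute continuity of the integral: up to a small error the function is simple,
    hence bounded. *)
Lemma norm_integral_small v a b e : bochner_integrable `[a, b] v -> 0 < e ->
  exists2 d, 0 < d & forall x y, a <= x -> x <= y -> y <= b -> y - x <= d ->
    (norm_integral `[x, y] v <= e%:E)%E.
Proof.
move=> bv e0; have mab : measurable (`[a, b] : set (measurableTypeR R)) by [].
have [s [ss _ /cvge0P s2]] := bochner_approx mab bv.
have e2 : 0 < e / 2 by rewrite divr_gt0.
have [n hn] : exists n, (norm_integral `[a, b] (v - s n)%R <= (e / 2)%:E)%E.
  have [N _ hN] := s2 (fun n => norm_integral_ge0 _ _) _ e2.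
  by exists N; apply: hN => /=.
have [sn1 _] := ss n.
pose M := \sum_(e <- finmap.enum_fset (fset_set (range (s n)))) rnorm e + 1.
have M0 : 0 < M by rewrite ltr_wpDl// sumr_ge0// => z _; exact: rnorm_ge0.
have sM x : rnorm (s n x) <= M.
  rewrite /M (bigD1_seq (s n x))//=; last exact: finmap.fset_uniq.
    by rewrite -addrA lerDl addr_ge0// sumr_ge0// => z _; exact: rnorm_ge0.
  by rewrite in_fset_set ?inE; [exists x|exact: sn1.1].
exists (e / 2 / M); first by rewrite divr_gt0.
move=> x y ax xy yb xyd.
have mxy : measurable (`[x, y] : set (measurableTypeR R)) by [].
have sub : `[x, y] `<=` `[a, b] by apply: subset_itv; rewrite bnd_simp.
have sv : strongly_measurable `[x, y] (v - s n).
  by apply: smB => //; [exact: sm_subset bv.1|exact: simple_sm].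
have -> : v = (v - s n) + s n by rewrite subrK.
apply: (le_trans (norm_integralD mxy sv (simple_sm _ sn1))).
rewrite (splitr e) EFinD; apply: leeD.
  apply: le_trans hn; apply: subset_nnintegral => //.
  by move=> z _; rewrite lee_fin rnorm_ge0.
apply: (@le_trans _ _ (\int[leb]_(z in `[x, y]) (M%:E))%E).
  apply: le_nnintegral => // z _; first by rewrite lee_fin rnorm_ge0.
  by rewrite lee_fin.
rewrite [leLHS](_ : _ = (M%:E * leb `[x, y])%E) ?integral_cst// leb_itv// -EFinM lee_fin.
by apply: (le_trans (ler_wpM2l (ltW M0) xyd)); rewrite mulrCA divff ?mulr1// gt_eqF.
Qed.

Lemma continuous_primitive v (x : R) : L1loc v -> 0 < x ->
  primitive v y @[y --> x] --> primitive v x.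
Proof.
move=> lv x0; apply/cvg_rnormP/cvgrPdist_le => e e0.
have x2 : 0 < x / 2 by rewrite divr_gt0.
have [d d0 hd] := norm_integral_small (L1loc_integrable (x + 1) lv x2) e0.
have xx2 : x / 2 <= x by rewrite ler_pdivrMr// mulr_natr mulr2n lerDl ltW.
near=> y.
have y3 : `|x - y| <= d by near: y; apply: cvgr_dist_le.
have y1 : x / 2 <= y.
  have : `|x - y| <= x / 2 by near: y; apply: cvgr_dist_le.
  by rewrite ler_norml => /andP[_]; lra.
have y2 : y <= x + 1.
  have : `|x - y| <= 1 by near: y; apply: cvgr_dist_le.
  by rewrite ler_norml => /andP[+ _]; lra.
have y0 : 0 < y by exact: lt_le_trans y1.
rewrite sub0r normrN ger0_norm ?rnorm_ge0// -lee_fin.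
have [xy|yx] := leP x y.
  rewrite primitiveB//; apply: le_trans (rnorm_bochner _ _) _ => //.
    by have [] := L1loc_integrable y lv x0.
  apply: hd => //; apply: le_trans y3.
  by rewrite distrC ler_norm.
rewrite rnormB primitiveB//; last exact: ltW.
apply: le_trans (rnorm_bochner _ _) _ => //.
  by have [] := L1loc_integrable x lv y0.
apply: hd => //; first exact: ltW.
  by rewrite lerDl.
by apply: le_trans y3; rewrite ler_norm.
Unshelve. all: end_near. Qed.

End Primitive.

(** * The weighted spaces L_(p,mu) *)

Section Powers.
Context {R : realType}.
Implicit Types (a b x lam p c : R).

(** Young's inequality with parameter: for [x >= lam] the second summand alone is at
    least [x], as [p >= 1]. Optimising in [lam] will replace Jensen's and Hoelder's
    inequalities, up to a factor [2]. *)
Lemma young_pow x lam p : 0 <= x -> 0 < lam -> 1 <= p ->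
  x <= lam + lam `^ (1 - p) * x `^ p.
Proof.
move=> x0 l0 p1; have [xl|lx] := leP x lam.
  by apply: (le_trans xl); rewrite lerDl mulr_ge0 ?powR_ge0.
have x1 : 0 < x by exact: lt_trans lx.
apply: (@le_trans _ _ (lam `^ (1 - p) * x `^ p)); last by rewrite lerDr ltW.
rewrite -(mulr_powRB1 x0 (lt_le_trans ltr01 p1)) mulrCA ler_peMr//.
rewrite -[1 - p]opprB powRN mulrC ler_pdivlMr ?powR_gt0// mul1r.
by apply: ge0_ler_powR; rewrite ?nnegrE ?subr_ge0// ltW.
Qed.

Lemma powR_addr_le a b p : 0 <= a -> 0 <= b -> 0 <= p ->
  (a + b) `^ p <= 2 `^ p * (a `^ p + b `^ p).
Proof.
move=> a0 b0 p0.
wlog ab : a b a0 b0 / a <= b.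
  by move=> h; case: (leP a b) => [|/ltW] ab; [|rewrite addrC [X in _ * X]addrC]; exact: h.
apply: (@le_trans _ _ ((2 * b) `^ p)).
  apply: ge0_ler_powR; rewrite ?nnegrE ?addr_ge0 ?mulr_ge0//.
  by rewrite mulr2n mulrDl mul1r lerD2r.
by rewrite powRM// ler_wpM2l ?powR_ge0// lerDr powR_ge0.
Qed.

(** Norms are handled through their balls, on which the [p]-th root disappears. *)
Lemma poweR_leP (I : \bar R) c p : 0 < p -> (0 <= I)%E -> 0 <= c ->
  ((I `^ p^-1) <= c%:E)%E <-> (I <= (c `^ p)%:E)%E.
Proof.
move=> p0 I0 c0; have pV0 : 0 < p^-1 by rewrite invr_gt0.
have pn0 : p != 0 by rewrite gt_eqF.
split=> h.
  have -> : (I = (I `^ p^-1) `^ p)%E by rewrite -poweRrM mulVf// poweRe1.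
  rewrite -poweR_EFin; apply: gt0_ler_poweR => //; first exact: ltW.
  - by rewrite in_itv/= poweR_ge0 leey.
  - by rewrite in_itv/= lee_fin c0 leey.
have -> : c%:E = ((c `^ p)%:E `^ p^-1)%E.
  by rewrite poweR_EFin -powRrM mulfV// powRr1.
apply: gt0_ler_poweR => //; first exact: ltW.
- by rewrite in_itv/= I0 leey.
- by rewrite in_itv/= lee_fin powR_ge0 leey.
Qed.

(** Jensen's inequality, up to the constant [2]: average [young_pow] over [D], and let
    [lam] decrease to the [p]-th root of the average of [phi `^ p]. *)
Lemma average_pow_le (D : set (measurableTypeR R)) (phi : R -> R) h p :
  measurable D -> lebesgue_measure D = h%:E -> 0 < h -> 1 <= p ->
  measurable_fun [set: measurableTypeR R] phi -> (forall x, 0 <= phi x) ->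
  (((h^-1)%:E * \int[@lebesgue_measure R]_(x in D) (phi x)%:E) `^ p <=
   (2 `^ p)%:E * ((h^-1)%:E * \int[@lebesgue_measure R]_(x in D) (phi x `^ p)%:E))%E.
Proof.
move=> mD Dh h0 p1 mphi phi0.
have p0 : 0 < p by exact: lt_le_trans p1.
have hV0 : 0 <= h^-1 by rewrite invr_ge0 ltW.
set A := (_ * \int[_]_(x in D) (phi x)%:E)%E.
set J' := ((h^-1)%:E * \int[_]_(_ in _) _)%E.
have J0 : (0 <= J')%E.
  by apply: mule_ge0 => //; apply: integral_ge0 => x _; rewrite lee_fin powR_ge0.
have A0 : (0 <= A)%E.
  by apply: mule_ge0 => //; apply: integral_ge0 => x _; rewrite lee_fin.
have [Jfin|] := ltP J' +oo%E; last first.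
  rewrite leye_eq => /eqP ->; rewrite gt0_muley ?leey// lte_fin powR_gt0//.
have Jf : J' \is a fin_num by rewrite ge0_fin_numE.
pose c := (fine J') `^ p^-1.
have c0 : 0 <= c by exact: powR_ge0.
have cp : c `^ p = fine J' by rewrite /c -powRrM mulVf ?gt_eqF// powRr1// fine_ge0.
have mphip : measurable_fun [set: measurableTypeR R] (fun x => phi x `^ p).
  exact: (measurableT_comp (measurable_powR p) mphi).
have key (l : R) : c < l -> (A <= (2 * l)%:E)%E.
  move=> cl; have l0 : 0 < l by exact: le_lt_trans cl.
  have : (\int[@lebesgue_measure R]_(x in D) (phi x)%:E <=
     \int[@lebesgue_measure R]_(x in D) (l%:E + (l `^ (1 - p))%:E * (phi x `^ p)%:E))%E.
    apply: le_nnintegral => // x _; first by rewrite lee_fin.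
    by rewrite -EFinM -EFinD lee_fin; exact: young_pow.
  rewrite nnintegralD//; last 4 first.
  - by move=> x _; rewrite lee_fin ltW.
  - by move=> x _; rewrite -EFinM lee_fin mulr_ge0 ?powR_ge0.
  - by exists (cst l%:E); [exact: measurable_cst|exact: aeW].
  - exists (fun x => (l `^ (1 - p))%:E * (phi x `^ p)%:E)%E; last exact: aeW.
    by apply: measurable_funeM; exact/measurable_EFinP.
  rewrite integral_cst// [X in (l%:E * X)%E]Dh nnintegralZ ?powR_ge0//; last 2 first.
  - by move=> x _; rewrite lee_fin powR_ge0.
  - by exists (fun x => (phi x `^ p)%:E); [exact/measurable_EFinP|exact: aeW].
  move=> /(lee_wpmul2l (_ : 0 <= (h^-1)%:E)%E); rewrite lee_fin => /(_ hV0).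
  rewrite -/A => /le_trans; apply.
  rewrite ge0_muleDr; last 2 first.
  - by rewrite -EFinM lee_fin mulr_ge0// ltW.
  - by rewrite mule_ge0// ?lee_fin ?powR_ge0// integral_ge0// => x _; rewrite lee_fin powR_ge0.
  rewrite -EFinM mulrCA mulVf ?gt_eqF// mulr1 muleCA -/J' -(fineK Jf) -cp -EFinM -EFinD.
  rewrite lee_fin [2 * l]mulrDl mul1r lerD2l.
  apply: (@le_trans _ _ (l `^ (1 - p) * l `^ p)).
    rewrite ler_wpM2l ?powR_ge0//; apply: ge0_ler_powR; rewrite ?nnegrE ?(ltW p0) ?(ltW l0)//.
    exact: ltW.
  by rewrite -powRD ?subrK ?powRr1 ?(ltW l0)// gt_eqF// implybT.
have Ale : (A <= (2 * c)%:E)%E.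
  apply/lee_addgt0Pr => e e0.
  have := key (c + e / 2); rewrite ltrDl divr_gt0// => /(_ isT).
  by rewrite mulrDr mulrCA divff ?mulr1// EFinD.
rewrite -(fineK Jf) -cp -EFinM -powRM// -poweR_EFin.
apply: gt0_ler_poweR => //; first exact: ltW.
- by rewrite in_itv/= A0 leey.
- by rewrite in_itv/= lee_fin mulr_ge0// leey.
Qed.

End Powers.

Section WeightedLp.
Context {R : realType} {E : completeNormedModType R[i]}.
Notation leb := (@lebesgue_measure R).
Context (p mu : R) (p1 : 1 <= p) (mu1 : mu <= 1).
Implicit Types (u v : R -> E).

Let p0 : 0 < p. Proof. exact: lt_le_trans p1. Qed.
Let pn0 : p != 0. Proof. by rewrite gt_eqF. Qed.
Let w x : R := x `^ (1 - mu).
Let w0 x : 0 <= w x. Proof. exact: powR_ge0. Qed.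

Definition modular u : \bar R :=
  (\int[leb]_(x in halfline) ((x `^ (1 - mu) * rnorm (u x)) `^ p)%:E)%E.

Lemma LpmuE u : Lpmu_norm p mu u =
  if `[< strongly_measurable halfline u >] then (modular u `^ p^-1)%E else +oo%E.
Proof. by []. Qed.

Lemma measurable_halfline : measurable (halfline : set (measurableTypeR R)).
Proof. exact: measurable_itv. Qed.
#[local] Hint Resolve measurable_halfline : core.

Lemma modular_ge0 u : (0 <= modular u)%E.
Proof. by apply: integral_ge0 => x _; rewrite lee_fin powR_ge0. Qed.

Lemma Lpmu_norm_ge0 u : (0 <= Lpmu_norm p mu u)%E.
Proof.
rewrite /Lpmu_norm /weighted_Lnorm; case: ifPn => // _.
exact: poweR_ge0.
Qed.

Lemma Lpmu_leP u c : 0 <= c -> (Lpmu_norm p mu u <= c%:E)%E <->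
  strongly_measurable halfline u /\ (modular u <= (c `^ p)%:E)%E.
Proof.
move=> c0; rewrite /Lpmu_norm /weighted_Lnorm; case: asboolP => su.
  by rewrite poweR_leP ?modular_ge0//; split => [|[]].
by split => // -[].
Qed.

Lemma Lpmu_lty_sm u : (Lpmu_norm p mu u < +oo)%E -> strongly_measurable halfline u.
Proof. by rewrite /Lpmu_norm /weighted_Lnorm; case: asboolP. Qed.

Lemma Lpmu_lty u : (Lpmu_norm p mu u < +oo)%E ->
  exists2 c, 0 <= c & Lpmu_norm p mu u = c%:E.
Proof.
move=> h; exists (fine (Lpmu_norm p mu u)); first by rewrite fine_ge0// Lpmu_norm_ge0.
by rewrite fineK// ge0_fin_numE// Lpmu_norm_ge0.
Qed.

Lemma measurable_modulus (g : R -> R) : measurable_fun [set: measurableTypeR R] g ->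
  measurable_fun [set: measurableTypeR R] (fun x => ((x `^ (1 - mu) * g x) `^ p)%:E).
Proof.
move=> mg; apply/measurable_EFinP.
by apply: (measurableT_comp (measurable_powR p)); exact: measurable_funM.
Qed.

Lemma modulus_ae_measurable u : strongly_measurable halfline u ->
  ae_measurable leb halfline (fun x => ((x `^ (1 - mu) * rnorm (u x)) `^ p)%:E).
Proof.
move=> su; apply: (rnorm_ae_measurable (phi := fun x r => ((x `^ (1 - mu) * r) `^ p)%:E)) => //.
exact: measurable_modulus.
Qed.

Lemma modular_ae_eq u v : {ae leb, forall x, halfline x -> u x = v x} ->
  modular u = modular v.
Proof.
move=> uv; apply: ae_eq_nnintegral => //.
- by move=> x _; rewrite lee_fin powR_ge0.
- by move=> x _; rewrite lee_fin powR_ge0.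
- by apply: filterS uv => x uv hx; rewrite uv.
Qed.

Lemma Lpmu_ae_eq u v : {ae leb, forall x, halfline x -> u x = v x} ->
  Lpmu_norm p mu u = Lpmu_norm p mu v.
Proof.
move=> uv; rewrite !LpmuE (modular_ae_eq uv).
have -> : `[< strongly_measurable halfline u >] = `[< strongly_measurable halfline v >].
  apply: asbool_equiv_eq; split; first exact: sm_ae_eq.
  by apply: sm_ae_eq; apply: filterS uv => x uv hx; rewrite uv.
by [].
Qed.

Lemma Lpmu0 : Lpmu_norm p mu (0 : R -> E) = 0%E.
Proof.
apply/eqP; rewrite eq_le Lpmu_norm_ge0 andbT; apply/Lpmu_leP => //; split.
  by apply: simple_sm; exact: simple_map_cst.
rewrite /modular integral0_eq ?lee_fin ?powR_ge0// => x _.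
by rewrite rnorm0 mulr0 powR0// gt_eqF.
Qed.

Lemma Lpmu_leD u v c : 0 <= c -> (Lpmu_norm p mu u <= c%:E)%E ->
  (Lpmu_norm p mu v <= c%:E)%E -> (Lpmu_norm p mu (u + v)%R <= (4 * c)%:E)%E.
Proof.
move=> c0 /(Lpmu_leP _ c0)[su uc] /(Lpmu_leP _ c0)[sv vc].
apply/Lpmu_leP; first by rewrite mulr_ge0.
split; first exact: smD.
apply: (@le_trans _ _ ((2 `^ p)%:E * (modular u + modular v))%E).
  rewrite /modular -nnintegralD//; [|by move=> x _; rewrite lee_fin powR_ge0..|
    exact: modulus_ae_measurable|exact: modulus_ae_measurable].
  rewrite -nnintegralZ ?powR_ge0//; last 2 first.
  - by move=> x _; rewrite -EFinD lee_fin addr_ge0// powR_ge0.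
  - have [g mg ug] := modulus_ae_measurable su.
    have [g' mg' vg'] := modulus_ae_measurable sv.
    exists (fun x => g x + g' x)%E; first exact: emeasurable_funD.
    by apply: filterS2 ug vg' => x ug vg' hx; rewrite ug// vg'.
  apply: le_nnintegral => // x _; first by rewrite lee_fin powR_ge0.
  rewrite -EFinD -EFinM lee_fin; apply: (@le_trans _ _
    ((x `^ (1 - mu) * rnorm (u x) + x `^ (1 - mu) * rnorm (v x)) `^ p)).
    apply: ge0_ler_powR; rewrite ?nnegrE ?(ltW p0) ?addr_ge0 ?mulr_ge0 ?rnorm_ge0 ?powR_ge0//.
    by rewrite -mulrDr ler_wpM2l ?powR_ge0// ler_rnormD.
  by apply: powR_addr_le; rewrite ?(ltW p0)// mulr_ge0 ?rnorm_ge0 ?powR_ge0.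
apply: (@le_trans _ _ ((2 `^ p)%:E * ((c `^ p)%:E + (c `^ p)%:E))%E).
  by apply: lee_wpmul2l; [rewrite lee_fin powR_ge0|exact: (leeD uc vc)].
rewrite -EFinD -EFinM lee_fin.
have -> : 4 * c = 2 * (2 * c) by rewrite mulrA; congr (_ * _); ring.
rewrite powRM ?mulr_ge0// ler_wpM2l ?powR_ge0// powRM//.
rewrite -mulr2n -[leLHS]mulr_natl ler_wpM2r ?powR_ge0//.
by rewrite -[leLHS]powRr1// ler_powR// ler1n.
Qed.

Lemma Lpmu_leZ (k : R[i]) u c : 0 <= c -> (Lpmu_norm p mu u <= c%:E)%E ->
  (Lpmu_norm p mu (k *: u) <= (complex.Re `|k| * c)%:E)%E.
Proof.
move=> c0 /(Lpmu_leP _ c0)[su uc]; have k0 := Re_norm_ge0 k.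
apply/Lpmu_leP; first by rewrite mulr_ge0.
split; first exact: smZ.
rewrite powRM// EFinM; apply: le_trans (lee_wpmul2l _ uc); last by rewrite lee_fin powR_ge0.
rewrite /modular -nnintegralZ ?powR_ge0//; last 2 first.
- by move=> x _; rewrite lee_fin powR_ge0.
- exact: modulus_ae_measurable.
apply: le_nnintegral => // x _; first by rewrite lee_fin powR_ge0.
rewrite -EFinM lee_fin -powRM ?mulr_ge0 ?powR_ge0 ?rnorm_ge0//.
by rewrite (_ : (k *: u) x = k *: u x)// rnormZ mulrCA.
Qed.

Lemma halflineP (x : R) : halfline x <-> 0 < x.
Proof. by rewrite /halfline /= in_itv/= andbT. Qed.

Lemma halfline_shift (t : R) : (fun x => x + t) @^-1` `]t, +oo[ = halfline.
Proof.
by apply/seteqP; split => x; rewrite /halfline /= !in_itv/= !andbT ltrDr.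
Qed.

Lemma sm_left_translation t u : 0 <= t -> strongly_measurable halfline u ->
  strongly_measurable halfline (left_translation t u).
Proof.
move=> t0 su; rewrite -(halfline_shift t); apply: sm_shift.
apply: sm_subset su => x; rewrite /halfline /= !in_itv/= !andbT.
exact: le_lt_trans.
Qed.

Lemma modular_left_translation t u : 0 <= t ->
  (modular (left_translation t u) <= modular u)%E.
Proof.
move=> t0; apply: (@le_trans _ _
  (\int[leb]_(x in halfline) (((x + t) `^ (1 - mu) * rnorm (u (x + t))) `^ p)%:E)%E).
  rewrite /modular /left_translation; apply: le_nnintegral => [//|x _|x /halflineP x0].
    by rewrite lee_fin powR_ge0.
  rewrite lee_fin; apply: ge0_ler_powR; rewrite ?nnegrE ?(ltW p0) ?mulr_ge0 ?powR_ge0 ?rnorm_ge0//.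
  rewrite ler_wpM2r ?rnorm_ge0//; apply: ge0_ler_powR; rewrite ?nnegrE ?subr_ge0 ?(ltW x0)//.
    by rewrite addr_ge0// ltW.
  by rewrite lerDl.
rewrite -(halfline_shift t).
rewrite (@nnintegral_shift R t `]t, +oo[ (fun x => ((x `^ (1 - mu) * rnorm (u x)) `^ p)%:E)).
  apply: subset_nnintegral => //; last by move=> x _; rewrite lee_fin powR_ge0.
  by move=> x; rewrite /halfline /= !in_itv/= !andbT; exact: le_lt_trans.
by move=> x _; rewrite lee_fin powR_ge0.
Qed.

(** The weight is nondecreasing because [mu <= 1], so it is larger at [x + t], where [u] is
    evaluated, than at [x]. *)
Lemma Lpmu_left_translation t u : 0 <= t ->
  (Lpmu_norm p mu (left_translation t u) <= Lpmu_norm p mu u)%E.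
Proof.
move=> t0; have [uy|] := ltP (Lpmu_norm p mu u) +oo%E; last first.
  by rewrite leye_eq => /eqP ->; rewrite leey.
have [c c0 uc] := Lpmu_lty uy; rewrite uc; apply/(Lpmu_leP _ c0).
have /(Lpmu_leP _ c0)[su hu] : (Lpmu_norm p mu u <= c%:E)%E by rewrite uc.
split; first exact: sm_left_translation.
exact: le_trans (modular_left_translation _ t0) hu.
Qed.

(** On [[a, b]] the weight is at least its value at [a], and [young_pow] bounds the [L_1] norm
    by the [L_p] norm. *)
Lemma Lpmu_L1 a b : 0 < a -> a < b -> exists2 C, 0 < C &
  forall u c, 0 < c -> (Lpmu_norm p mu u <= c%:E)%E ->
    (norm_integral `[a, b] u <= (C * c)%:E)%E.
Proof.
move=> a0 ab; have wa : 0 < w a by rewrite powR_gt0.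
exists ((w a)^-1 * (b - a + 1)).
  by rewrite mulr_gt0 ?invr_gt0// addr_gt0// subr_gt0.
move=> u c c0 /(Lpmu_leP _ (ltW c0))[su uc].
pose l := (w a)^-1 * c; have l0 : 0 < l by rewrite mulr_gt0 ?invr_gt0.
have sub : `[a, b] `<=` (halfline : set R).
  by move=> x; rewrite /halfline /= !in_itv/= andbT => /andP[ax _]; exact: lt_le_trans ax.
have sab : strongly_measurable `[a, b] u by exact: sm_subset su.
have mab : measurable (`[a, b] : set (measurableTypeR R)) by [].
have mup : ae_measurable leb `[a, b] (fun x => (rnorm (u x) `^ p)%:E).
  apply: (rnorm_ae_measurable (phi := fun _ r => (r `^ p)%:E)) => // g mg.
  by apply/measurable_EFinP; exact: (measurableT_comp (measurable_powR p) mg).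
have h1 : (\int[leb]_(x in `[a, b]) (rnorm (u x) `^ p)%:E <= (l `^ p)%:E)%E.
  rewrite /l powRM ?(ltW c0) ?invr_ge0 ?(ltW wa)// EFinM.
  apply: le_trans (lee_wpmul2l _ uc); last by rewrite lee_fin powR_ge0.
  rewrite /modular -nnintegralZ ?powR_ge0//; last 2 first.
  - by move=> x _; rewrite lee_fin powR_ge0.
  - exact: modulus_ae_measurable.
  apply: (@le_trans _ _ (\int[leb]_(x in `[a, b]) (((w a)^-1 `^ p)%:E * ((x `^ (1 - mu) * rnorm (u x)) `^ p)%:E))%E); last first.
    apply: subset_nnintegral => // x _.
    by rewrite -EFinM lee_fin mulr_ge0// powR_ge0.
  apply: le_nnintegral => // x; first by rewrite lee_fin powR_ge0.
  rewrite /= in_itv/= => /andP[ax _].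
  rewrite -EFinM lee_fin -powRM ?mulr_ge0 ?invr_ge0 ?rnorm_ge0 ?powR_ge0//.
  apply: ge0_ler_powR; rewrite ?nnegrE ?(ltW p0) ?mulr_ge0 ?invr_ge0 ?rnorm_ge0 ?powR_ge0//.
  rewrite mulrA ler_peMl ?rnorm_ge0// mulrC ler_pdivlMr// mul1r.
  apply: ge0_ler_powR; rewrite ?nnegrE ?subr_ge0 ?(ltW a0)//.
  by rewrite (le_trans (ltW a0)).
apply: (@le_trans _ _ (\int[leb]_(x in `[a, b]) (l%:E + (l `^ (1 - p))%:E * (rnorm (u x) `^ p)%:E))%E).
  apply: le_nnintegral => // x _; first by rewrite lee_fin rnorm_ge0.
  by rewrite -EFinM -EFinD lee_fin young_pow// rnorm_ge0.
rewrite nnintegralD//; last 4 first.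
- by move=> x _; rewrite lee_fin ltW.
- by move=> x _; rewrite -EFinM lee_fin mulr_ge0 ?powR_ge0.
- by exists (cst l%:E); [exact: measurable_cst|exact: aeW].
- have [g mg ug] := mup; exists (fun x => (l `^ (1 - p))%:E * g x)%E.
    exact: measurable_funeM.
  by apply: filterS ug => x ug hx; rewrite ug.
rewrite nnintegralZ ?powR_ge0//; last by move=> x _; rewrite lee_fin powR_ge0.
rewrite [X in (X + _)%E](_ : _ = (l%:E * leb `[a, b])%E) ?integral_cst// leb_itv ?(ltW ab)//.
apply: (@le_trans _ _ (l%:E * (b - a)%:E + (l `^ (1 - p))%:E * (l `^ p)%:E)%E).
  by apply: leeD2l; apply: lee_wpmul2l h1; rewrite lee_fin powR_ge0.
have ll : l `^ (1 - p) * l `^ p = l.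
  by rewrite -powRD ?subrK ?powRr1 ?(ltW l0)// gt_eqF// implybT.
rewrite -!EFinM -EFinD lee_fin ll.
by rewrite le_eqVlt; apply/orP; left; apply/eqP; rewrite /l; ring.
Qed.


Lemma sm_primitive v h : L1loc v -> 0 <= h ->
  strongly_measurable halfline (fun x => primitive v (x + h)).
Proof.
move=> lv h0; apply: sm_continuous; first exact: interval_open.
move=> x /halflineP x0.
apply: (@cvg_comp _ _ _ (fun y => y + h) (primitive v) _ (nbhs (x + h))).
  by apply: cvgD; [exact: cvg_id|exact: cvg_cst].
by apply: continuous_primitive => //; rewrite ltr_wpDr.
Qed.

Definition average (h : R) v : R -> E :=
  fun x => (h^-1)%:C%C *: (primitive v (x + h) - primitive v x).

Lemma sm_average h v : L1loc v -> 0 <= h ->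
  strongly_measurable halfline (average h v).
Proof.
move=> lv h0; apply: (smZ _ measurable_halfline).
apply: (smB measurable_halfline); first exact: sm_primitive.
rewrite (_ : primitive v = fun x => primitive v (x + 0)); first exact: sm_primitive.
by apply/funext => x; rewrite addr0.
Qed.

Lemma shift_itv (x h : R) : (fun t => t + x) @^-1` `[x, x + h] = `[0, h]%classic.
Proof.
apply/seteqP; split => t /=; rewrite !in_itv/=.
  by rewrite lerDr (addrC x) lerD2r.
by rewrite lerDr (addrC x) lerD2r.
Qed.

(** As [v x] is the average of the constant [v x], the left-hand side is the norm of
    the average of the differences [v (x + t) - v x]. *)
Lemma average_diff_le h v x : L1loc v -> 0 < h -> 0 < x ->
  ((rnorm (average h v x - v x))%:E <=
   (h^-1)%:E * \int[leb]_(t in `[0%R, h]) (rnorm (v (x + t) - v x))%:E)%E.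
Proof.
move=> lv h0 x0; have mI : measurable (`[x, x + h] : set (measurableTypeR R)) by [].
have xh : x <= x + h by rewrite lerDl ltW.
have hx : leb `[x, x + h] = h%:E by rewrite leb_itv// addrC addKr.
have hfin : (leb `[x, (x + h)%R] < +oo)%E by rewrite hx ltry.
have bv := L1loc_integrable (x + h) lv x0.
have bc := bochner_integrable_cst (v x) mI hfin.
have -> : average h v x - v x = (h^-1)%:C%C *: bochner `[x, x + h] (v - cst (v x)).
  have -> : v - cst (v x) = - 1 *: cst (v x) + v by rewrite scaleN1r addrC.
  rewrite bochner_lin// bochner_cst// [leb _]hx /= scalerDr scaleN1r scalerN scalerA.
  rewrite -rmorphM mulVf ?gt_eqF// scale1r addrC /average.
  by rewrite primitiveB.
rewrite rnormZr ger0_norm ?invr_ge0 ?(ltW h0)// EFinM.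
apply: lee_wpmul2l; first by rewrite lee_fin invr_ge0 ltW.
have sd : strongly_measurable `[x, x + h] (v - cst (v x)).
  by apply: smB => //; [exact: bv.1|exact: bc.1].
apply: (le_trans (rnorm_bochner mI sd)).
rewrite -(norm_integral_shift _ x) shift_itv /norm_integral.
apply: le_nnintegral => // t _; first by rewrite lee_fin rnorm_ge0.
by rewrite (addrC t).
Qed.

(** Raise [average_diff_le] to the power [p] by [average_pow_le], multiply by the weight,
    integrate in [x] and exchange the integrals: what remains is the average over
    [[0, h]] of the modulars of [left_translation t v - v]. *)
Lemma Lpmu_average h v c : L1loc v -> 0 < h -> 0 <= c ->
  (forall t, 0 <= t <= h ->
     (Lpmu_norm p mu (left_translation t v - v)%R <= c%:E)%E) ->
  (Lpmu_norm p mu (average h v - v)%R <= (2 * c)%:E)%E.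
Proof.
move=> lv h0 c0 hc.
have sv := L1loc_sm lv.
apply/Lpmu_leP; first by rewrite mulr_ge0.
split; first by apply: smB => //; apply: sm_average => //; exact: ltW.
have [b bb vb] := sm_borel measurable_halfline sv.
pose K x t : R := rnorm (b (x + t) - b x).
have mK : measurable_fun [set: (measurableTypeR R * measurableTypeR R)%type]
    (fun z => K z.1 z.2) by exact: measurable_rnorm_diff.
have mIh : measurable (`[0, h] : set (measurableTypeR R)) by [].
have Ih : leb `[0, h] = h%:E by rewrite leb_itv ?subr0// ltW.
(* The integrand, extended by [0] so that Tonelli applies on the whole plane. *)
pose f (z : measurableTypeR R * measurableTypeR R) : \bar R :=
  ((\1_(halfline : set (measurableTypeR R)) z.1 * \1_(`[0, h]%classic : set (measurableTypeR R)) z.2) *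
   ((z.1 `^ (1 - mu) * K z.1 z.2) `^ p))%:E.
have m1 : measurable_fun [set: measurableTypeR R] (\1_(halfline : set (measurableTypeR R)) : _ -> R).
  exact: measurable_indic.
have m2 : measurable_fun [set: measurableTypeR R] (\1_(`[0, h]%classic : set (measurableTypeR R)) : _ -> R).
  exact: measurable_indic.
have mf : measurable_fun setT f.
  apply/measurable_EFinP; apply: measurable_funM.
    apply: measurable_funM.
      exact: (measurableT_comp m1 measurable_fst).
    exact: (measurableT_comp m2 measurable_snd).
  apply: (measurableT_comp (measurable_powR p)); apply: measurable_funM => //.
  exact: (measurableT_comp (measurable_powR (1 - mu)) measurable_fst).
have f0 z : (0 <= f z)%E by rewrite lee_fin mulr_ge0 ?powR_ge0// mulr_ge0// indicE.
have fx x : halfline x -> (\int[leb]_t f (x, t) =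
    \int[leb]_(t in `[0%R, h]) ((x `^ (1 - mu) * K x t) `^ p)%:E)%E.
  move=> hx; rewrite [RHS]integral_mkcond; apply: eq_integral => t _.
  rewrite patchE /f /= !indicE (mem_set hx) mul1r.
  by case: (t \in _); rewrite ?mul1r ?mul0r.
have ft t : (\int[leb]_x f (x, t) <= (c `^ p)%:E * (\1_(`[0, h]%classic : set (measurableTypeR R)) t)%:E)%E.
  have [th|th] := boolP (t \in (`[0, h]%classic : set R)); last first.
    rewrite indicE (negbTE th) mule0 integral0_eq// => x _.
    by rewrite /f /= !indicE (negbTE th) mulr0 mul0r.
  rewrite indicE th mule1.
  have tt : 0 <= t <= h by move: th; rewrite inE /= in_itv.
  have /andP[t0 _] := tt.
  have /Lpmu_leP := hc t tt => /(_ c0)[_]; apply: le_trans.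
  rewrite le_eqVlt; apply/orP; left; apply/eqP.
  transitivity (\int[leb]_(x in halfline) ((x `^ (1 - mu) * K x t) `^ p)%:E)%E.
    rewrite [RHS]integral_mkcond; apply: eq_integral => x _.
    rewrite patchE /f /= !indicE th mulr1.
    by case: (x \in _); rewrite ?mul1r ?mul0r.
  apply: ae_eq_nnintegral => [//|x _|x _|]; rewrite ?lee_fin ?powR_ge0//.
  have vbt := ae_shift t vb.
  apply: filterS2 vb vbt => x vbx vbxt hx.
  rewrite /K (_ : (left_translation t v - v) x = v (x + t) - v x)// vbx// vbxt//.
  by apply/halflineP; rewrite ltr_wpDr//; apply/halflineP.
have int1 : (modular (average h v - v)%R <=
    (2 `^ p)%:E * ((h^-1)%:E * \int[leb]_x \int[leb]_t f (x, t)))%E.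
  have mF : measurable_fun [set: measurableTypeR R] (fun x => \int[leb]_t f (x, t))%E.
    exact: measurable_fun_fubini_tonelli_F.
  have F0 x : (0 <= \int[leb]_t f (x, t))%E by apply: integral_ge0 => t _; exact: f0.
  have hV0 : 0 <= h^-1 by rewrite invr_ge0 ltW.
  apply: (@le_trans _ _ ((2 `^ p)%:E * ((h^-1)%:E * \int[leb]_(x in halfline) \int[leb]_t f (x, t)))%E).
    rewrite -nnintegralZ//; last first.
      by exists (fun x => \int[leb]_t f (x, t))%E; [exact: mF|exact: aeW].
    rewrite -nnintegralZ ?powR_ge0//; last 2 first.
    - by move=> x _; rewrite mule_ge0.
    - exists (fun x => (h^-1)%:E * \int[leb]_t f (x, t))%E; last exact: aeW.
      exact: measurable_funeM.
    apply: ae_le_nnintegral => [//|x _|x _|].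
    - by rewrite lee_fin powR_ge0.
    - by rewrite mule_ge0 ?lee_fin ?powR_ge0// mule_ge0.
    - have vb' := vb; apply: filterS vb => x vbx hx; have x0 := (halflineP x).1 hx.
      rewrite (_ : (average h v - v) x = average h v x - v x)// fx//.
      have mKx : measurable_fun [set: measurableTypeR R] (fun t => x `^ (1 - mu) * K x t).
        apply: measurable_funM => //.
        exact: (measurableT_comp mK (measurable_pair1 x)).
      have K0 t : 0 <= x `^ (1 - mu) * K x t by rewrite mulr_ge0 ?powR_ge0 ?rnorm_ge0.
      have := average_pow_le mIh Ih h0 p1 mKx K0; apply: le_trans.
      rewrite -poweR_EFin; apply: gt0_ler_poweR; first exact: ltW.
      + by rewrite in_itv/= lee_fin mulr_ge0 ?powR_ge0 ?rnorm_ge0// leey.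
      + rewrite in_itv/= leey andbT mule_ge0// integral_ge0// => t _.
        by rewrite lee_fin.
      have mKx' : measurable_fun [set: measurableTypeR R] (fun t => K x t).
        exact: (measurableT_comp mK (measurable_pair1 x)).
      rewrite (_ : (\int[leb]_(t in `[0%R, h]) (x `^ (1 - mu) * K x t)%:E =
        (x `^ (1 - mu))%:E * \int[leb]_(t in `[0%R, h]) (rnorm (v (x + t) - v x))%:E)%E); last first.
        under eq_integral do rewrite EFinM.
        rewrite nnintegralZ ?powR_ge0//; last 2 first.
        - by move=> t _; rewrite lee_fin rnorm_ge0.
        - by exists (fun t => (K x t)%:E); [exact/measurable_EFinP|exact: aeW].
        congr (_ * _)%E; apply: ae_eq_nnintegral => [//|t _|t _|]; rewrite ?lee_fin ?rnorm_ge0//.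
        have vbt := ae_shift x vb'; apply: filterS vbt => t vbt; rewrite /= in_itv/= => /andP[t0 _].
        rewrite /K vbx// (addrC x) vbt//.
        by apply/halflineP; rewrite ltr_wpDl.
      rewrite EFinM muleCA; apply: lee_wpmul2l; first by rewrite lee_fin powR_ge0.
      exact: average_diff_le.
  apply: lee_wpmul2l; first by rewrite lee_fin powR_ge0.
  apply: lee_wpmul2l; first by rewrite lee_fin.
  by apply: subset_nnintegral.
apply: (le_trans int1).
rewrite powRM// EFinM; apply: lee_wpmul2l; first by rewrite lee_fin powR_ge0.
have -> : (\int[leb]_x \int[leb]_t f (x, t) = \int[leb]_t \int[leb]_x f (x, t))%E.
  exact: (fubini_tonelli f mf f0).
apply: (@le_trans _ _ ((h^-1)%:E * \int[leb]_t ((c `^ p)%:E * (\1_(`[0, h]%classic : set (measurableTypeR R)) t)%:E))%E).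
  apply: lee_wpmul2l; first by rewrite lee_fin invr_ge0 ltW.
  apply: le_nnintegral => // t _.
  by apply: integral_ge0 => x _; exact: f0.
rewrite nnintegralZ ?powR_ge0//; last first.
  by exists (fun t => (\1_(`[0, h]%classic : set (measurableTypeR R)) t)%:E); [exact/measurable_EFinP|exact: aeW].
rewrite integral_indic// setIT [X in (_ * (_ * X))%E]Ih -!EFinM lee_fin.
by rewrite mulrCA mulVf ?mulr1// gt_eqF.
Qed.


(** For bounded [f] the [p]-th power of the difference is at most [(2 * M) `^ (p - 1)]
    times the difference, and the integrand vanishes for [x > b], where the weight
    would be unbounded. *)
Lemma modular_shift_bounded f a b M t : 0 < a -> a < b -> 0 < M -> 0 <= t ->
  (forall x, rnorm (f x) <= M) -> (forall x, x \notin `[a, b] -> f x = 0) ->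
  strongly_measurable setT f ->
  (modular (left_translation t f - f)%R <=
   ((b `^ (1 - mu)) `^ p * (2 * M) `^ (p - 1))%:E *
     norm_integral setT (fun x => f (x + t) - f x)%R)%E.
Proof.
move=> a0 ab M0 t0 fM f0 sf; have b0 : 0 < b by exact: lt_trans ab.
have mT : measurable ([set: measurableTypeR R]) by [].
have sd : strongly_measurable setT (fun x => f (x + t) - f x).
  by apply: smB => //; exact: (sm_shift t sf).
rewrite /norm_integral -nnintegralZ ?mulr_ge0 ?powR_ge0//; last 2 first.
- by move=> x _; rewrite lee_fin rnorm_ge0.
- exact: rnorm_ae_measurable1.
apply: (@le_trans _ _ (\int[leb]_(x in halfline) (((b `^ (1 - mu)) `^ p * (2 * M) `^ (p - 1))%:E *
  (rnorm (f (x + t) - f x))%:E))%E); last first.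
  apply: subset_nnintegral => // x _.
  by rewrite -EFinM lee_fin !mulr_ge0 ?powR_ge0 ?rnorm_ge0.
rewrite /modular; apply: le_nnintegral => [//|x _|x /halflineP x0].
  by rewrite lee_fin powR_ge0.
rewrite (_ : (left_translation t f - f) x = f (x + t) - f x)//.
set y := rnorm _; have y0 : 0 <= y by exact: rnorm_ge0.
rewrite -EFinM lee_fin.
have [xb|bx] := leP x b; last first.
  have z c : b < c -> f c = 0.
    by move=> bc; apply: f0; rewrite in_itv/= negb_and -!ltNge bc orbT.
  rewrite /y !z ?subrr ?rnorm0 ?mulr0 ?powR0 ?gt_eqF//.
  by apply: lt_le_trans bx _; rewrite lerDl.
rewrite (powRM _ (powR_ge0 _ _) y0) -mulrA.
apply: ler_pM; [exact: powR_ge0|exact: powR_ge0| |].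
  apply: ge0_ler_powR; rewrite ?nnegrE ?(ltW p0) ?powR_ge0//.
  by apply: ge0_ler_powR; rewrite ?nnegrE ?subr_ge0// ltW.
rewrite -(mulr_powRB1 y0 p0) mulrC ler_wpM2r//.
apply: ge0_ler_powR; rewrite ?nnegrE ?subr_ge0 ?mulr_ge0 ?(ltW M0)//.
apply: le_trans (ler_rnormB _ _) _.
by rewrite mulr2n mulrDl mul1r lerD.
Qed.

(** Dominated convergence for the truncations of [u] to the points of [[1/n, n]] where its norm is
    at most [n]. *)
Lemma Lpmu_approx u e : (Lpmu_norm p mu u < +oo)%E -> 0 < e ->
  exists (f : R -> E) (a b M : R), [/\ 0 < a /\ a < b, 0 < M, borel_sm f,
    (forall x, rnorm (f x) <= M) /\ (forall x, x \notin `[a, b] -> f x = 0) &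
    (Lpmu_norm p mu (u - f)%R <= e%:E)%E].
Proof.
move=> uy e0; have [c c0 uc] := Lpmu_lty uy.
have /Lpmu_leP : (Lpmu_norm p mu u <= c%:E)%E by rewrite uc.
move=> /(_ c0)[su mc].
have [b bb ub] := sm_borel measurable_halfline su.
have mb : (modular b < +oo)%E.
  rewrite (_ : modular b = modular u); first by apply: (le_lt_trans mc); exact: ltry.
  by apply: modular_ae_eq; apply: filterS ub => x ub hx; rewrite ub.
clear uc mc.
pose A n : set (measurableTypeR R) :=
  `[n.+2%:R^-1, n.+1%:R] `&` [set x | rnorm (b x) <= n.+1%:R].
have mA n : measurable (A n).
  apply: measurableI => //.
  have mtrue : measurable [set true] by [].
  have := measurable_fun_ler (measurable_rnorm bb) (measurable_cst (n.+1%:R : R)) measurableT mtrue.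
  by rewrite setTI.
pose f n x := if x \in A n then b x else 0.
have bf n : borel_sm (f n) by exact: borel_sm_cut.
pose G x : \bar R := ((x `^ (1 - mu) * rnorm (b x)) `^ p)%:E.
pose F n x : \bar R := ((x `^ (1 - mu) * rnorm (b x - f n x)) `^ p)%:E.
have mF n : measurable_fun halfline (F n).
  apply: measurable_funTS; apply: (measurable_modulus (g := fun x => rnorm (b x - f n x))).
  have bd : borel_sm (b - f n) by rewrite -scaleN1r; apply: borel_smD => //; exact: borel_smZ.
  exact: (measurable_rnorm bd).
have G0 x : (0 <= G x)%E by rewrite lee_fin powR_ge0.
have := @dominated_convergence _ _ _ leb halfline measurable_halfline F (cst 0%E) G mF.
case.
- exact: measurable_cst.
- apply: aeW => x /halflineP x0.
  apply: cvg_near_cst; near=> n; apply/eqP.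
  suff An : A n x.
    have -> : F n x = ((x `^ (1 - mu) * rnorm (b x - b x)) `^ p)%:E.
      by rewrite /F /f mem_set.
    by rewrite subrr rnorm0 mulr0 powR0.
  split; rewrite /= ?in_itv/=.
    apply/andP; split.
      rewrite -[leRHS]invrK lef_pV2 ?posrE ?invr_gt0//.
      apply: (@le_trans _ _ n%:R); last by rewrite ler_nat; exact: leq_trans (leqnSn _) (leqnSn _).
      by near: n; exact: nbhs_infty_ger.
    apply: (@le_trans _ _ n%:R); last by rewrite ler_nat.
    by near: n; exact: nbhs_infty_ger.
  apply: (@le_trans _ _ n%:R); last by rewrite ler_nat.
  by near: n; exact: nbhs_infty_ger.
- apply/integrableP; split.
    by apply: measurable_funTS; apply: measurable_modulus; exact: measurable_rnorm.
  have -> : (\int[leb]_(x in halfline) `|G x|)%E = modular b.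
    by apply: eq_integral => x _; rewrite gee0_abs.
  exact: mb.
- apply: aeW => x n _; rewrite gee0_abs ?lee_fin ?powR_ge0//.
  apply: ge0_ler_powR; rewrite ?nnegrE ?(ltW p0) ?mulr_ge0 ?powR_ge0 ?rnorm_ge0//.
  rewrite ler_wpM2l ?powR_ge0// /f; case: ifPn => _; last by rewrite subr0.
  by rewrite subrr rnorm0 rnorm_ge0.
move=> _ _; rewrite integral0 => /cvge0P h.
have I0 n : (0 <= \int[leb]_(x in halfline) F n x)%E.
  by apply: integral_ge0 => x _; rewrite lee_fin powR_ge0.
have [n hn] : exists n, (\int[leb]_(x in halfline) F n x <= (e `^ p)%:E)%E.
  have [N _ hN] := h I0 _ (powR_gt0 p e0).
  by exists N; apply: hN => /=.
have n2 : (0 : R) < n.+2%:R^-1 by rewrite invr_gt0.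
exists (f n), n.+2%:R^-1, n.+1%:R, n.+1%:R; split => //.
- split => //; apply: (@lt_le_trans _ _ 1); last by rewrite ler1n.
  by rewrite invf_lt1// ltr1n.
- split => x; rewrite /f.
    by case: ifPn => [/set_mem[]//|_]; rewrite rnorm0.
  move=> xn; rewrite ifF//; apply/negbTE; rewrite notin_setE => -[/= xx _].
  by rewrite xx in xn.
- apply/Lpmu_leP; first exact: ltW.
  split.
    by apply: smB => //; exact: borel_sm_sm.
  apply: le_trans hn; rewrite le_eqVlt; apply/orP; left; apply/eqP.
  apply: ae_eq_nnintegral => [//|x _|x _|]; rewrite ?lee_fin ?powR_ge0//.
  apply: filterS ub => x ub hx.
  by rewrite /F (_ : (u - f n) x = u x - f n x)// ub.
Unshelve. all: end_near. Qed.

(** By contractivity it suffices to translate the approximations of [Lpmu_approx], for which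
    [modular_shift_bounded] reduces the claim to [L1_shift]. *)
Lemma Lpmu_shift_continuous u : (Lpmu_norm p mu u < +oo)%E ->
  Lpmu_norm p mu (left_translation t u - u)%R @[t --> 0^'+] --> 0%E.
Proof.
move=> uy; apply/cvge0P => [t|e e0]; first exact: Lpmu_norm_ge0.
have e16 : 0 < e / 16 by rewrite divr_gt0.
have [f [a [b [M [[a0 ab] M0 bf [fM f0] uf]]]]] := Lpmu_approx uy e16.
have mI : measurable (`[a, b] : set (measurableTypeR R)) by [].
have bi : bochner_integrable setT f.
  split; first exact: borel_sm_sm.
  apply: (@le_lt_trans _ _ (\int[leb]_(x in setT) (M%:E * (\1_(`[a, b]%classic : set (measurableTypeR R)) x)%:E)%E)%E).
    apply: le_nnintegral => // x _; first by rewrite lee_fin rnorm_ge0.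
    rewrite -EFinM lee_fin indicE; have [xI|xI] := boolP (x \in _).
      by rewrite mulr1.
    rewrite f0 ?rnorm0 ?mulr0//; apply/negP => h; move/negP : xI; apply.
    by rewrite inE.
  rewrite nnintegralZ ?(ltW M0)//; last first.
    exists (fun x => (\1_(`[a, b]%classic : set (measurableTypeR R)) x)%:E); last exact: aeW.
    by apply/measurable_EFinP; exact: measurable_indic.
  rewrite integral_indic// setIT [X in (_ * X)%E](_ : _ = leb `[a, b])// leb_itv ?(ltW ab)//.
  by rewrite -EFinM ltry.
pose C := (b `^ (1 - mu)) `^ p * (2 * M) `^ (p - 1).
have b0 : 0 < b by exact: lt_trans ab.
have C0 : 0 < C by rewrite mulr_gt0// powR_gt0// ?powR_gt0// mulr_gt0.
have /cvge0P h := L1_shift bi.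
have {}h := h (fun t => norm_integral_ge0 _ _) _ (divr_gt0 (powR_gt0 p e16) C0).
have {}h : \forall t \near 0^'+, (norm_integral setT (fun x => f (x + t) - f x)%R <= ((e / 16) `^ p / C)%:E)%E.
  exact: cvg_at_right_filter h.
near=> t.
have t0 : 0 <= t by [].
have h1 : (norm_integral setT (fun x => f (x + t) - f x)%R <= ((e / 16) `^ p / C)%:E)%E by near: t.
have sf : strongly_measurable setT f by exact: borel_sm_sm.
have h2 : (Lpmu_norm p mu (left_translation t f - f)%R <= (e / 16)%:E)%E.
  apply/Lpmu_leP; first exact: ltW.
  split.
    by apply: smB => //; [apply: sm_left_translation => //|]; exact: borel_sm_sm.
  apply: (le_trans (modular_shift_bounded a0 ab M0 t0 fM f0 sf)).
  apply: (@le_trans _ _ (C%:E * ((e / 16) `^ p / C)%:E)%E).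
    by apply: lee_wpmul2l h1; rewrite lee_fin ltW.
  by rewrite -EFinM lee_fin mulrCA divff ?mulr1// gt_eqF.
have h3 : (Lpmu_norm p mu (left_translation t (u - f)%R) <= (e / 16)%:E)%E.
  exact: le_trans (Lpmu_left_translation _ t0) uf.
have h4 : (Lpmu_norm p mu (- 1 *: (u - f))%R <= (e / 16)%:E)%E.
  have := Lpmu_leZ (-1) (ltW e16) uf.
  by rewrite normrN1 /= mul1r.
have -> : left_translation t u - u =
    left_translation t (u - f) + ((left_translation t f - f) + - 1 *: (u - f)).
  apply/funext => x; rewrite scaleN1r /left_translation /GRing.add/= /GRing.opp/=.
  by rewrite opprB addrA subrKA addrA subrK.
(* Each of the two additions costs a factor 4, see [Lpmu_leD]. *)
have -> : e = 4 * (4 * (e / 16)) by field.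
apply: Lpmu_leD; first by rewrite mulr_ge0// ltW.
  by apply: (le_trans h3); rewrite lee_fin ler_peMl ?(ltW e16)// ler1n.
exact: (Lpmu_leD (ltW e16) h2 h4).
Unshelve. all: end_near. Qed.

End WeightedLp.

(** * Test functions *)

Section Smooth.
Context {R : realType}.
Implicit Types (f g phi : R -> R) (x a b : R).

(** [n]-fold differentiability with the derivatives given as witnesses: unlike
    iterated [derive1], it is stable under the operations below by plain induction on
    [n]. *)
Fixpoint csmooth (n : nat) f : Prop :=
  if n is n'.+1 then
    exists2 g : R -> R, (forall x, is_derive x 1 f (g x)) & csmooth n' g
  else True.

Lemma csmooth_derive1n f : (forall n, csmooth n f) ->
  forall n x, derivable (derive1n n f) x 1.
Proof.
move=> sf n; have := sf n.+1; elim: n f {sf} => [|n IH] f [g fg sg] x.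
  by have := fg x; case.
rewrite derive1Sn (_ : derive1 f = g); first exact: IH.
by apply/funext => y; rewrite derive1E; have := fg y => ?; rewrite derive_val.
Qed.

Lemma derive1n_csmooth f : (forall n x, derivable (derive1n n f) x 1) ->
  forall n, csmooth n f.
Proof.
move=> df n; elim: n f df => [//|n IH] f df /=.
exists (derive1 f); first by move=> x; rewrite derive1E; apply/derivableP; exact: (df 0%N).
by apply: IH => m x; rewrite -derive1Sn; exact: df.
Qed.

Lemma csmoothS n f : csmooth n.+1 f -> csmooth n f.
Proof.
elim: n f => [//|n IH] f [g fg sg].
by exists g => //; exact: IH.
Qed.

Lemma csmooth_cst n (c : R) : csmooth n (cst c).
Proof.
by elim: n c => [//|n IH] c; exists (cst 0) => // x; exact: is_derive_cst.
Qed.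

Lemma csmoothD n f g : csmooth n f -> csmooth n g -> csmooth n (fun x => f x + g x).
Proof.
elim: n f g => [//|n IH] f g [f' ff' sf] [g' gg' sg].
exists (fun x => f' x + g' x); last exact: IH.
by move=> x; exact: is_deriveD.
Qed.

Lemma csmoothM n f g : csmooth n f -> csmooth n g -> csmooth n (fun x => f x * g x).
Proof.
elim: n f g => [//|n IH] f g hf hg.
have [f' ff' sf] := hf; have [g' gg' sg] := hg.
exists (fun x => f x * g' x + g x * f' x); last first.
  by apply: csmoothD; apply: IH => //; exact: csmoothS.
by move=> x; exact: is_deriveM.
Qed.

Lemma csmooth_expR n f : csmooth n f -> csmooth n (fun x => expR (f x)).
Proof.
elim: n f => [//|n IH] f hf; have [f' ff' sf] := hf.
exists (fun x => expR (f x) * f' x); last first.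
  by apply: csmoothM => //; apply: IH; exact: csmoothS.
by move=> x; exact: is_derive1_comp.
Qed.

Lemma csmooth_affine n f a b : csmooth n f -> csmooth n (fun x => f (a * x + b)).
Proof.
elim: n f => [//|n IH] f [f' ff' sf].
exists (fun x => f' (a * x + b) * a); last first.
  by apply: csmoothM; [exact: IH|exact: csmooth_cst].
move=> x; apply: (@is_derive1_comp _ f (fun x => a * x + b)) => //.
rewrite -[X in is_derive _ _ _ X]addr0; apply: is_deriveD.
by rewrite -[X in is_derive _ _ _ X]mulr1; apply: is_deriveZ.
Qed.

(** The functions [x^-k * exp (- 1/x)], extended by [0] to the left: the derivative of each is a
    combination of two others, so all of them are smooth. *)
Definition flat (k : nat) (x : R) : R :=
  if 0 < x then x^-1 ^+ k * expR (- x^-1) else 0.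

Lemma flat_ge0 k x : 0 <= flat k x.
Proof.
rewrite /flat; case: ifPn => // x0.
by rewrite mulr_ge0 ?expR_ge0// exprn_ge0// invr_ge0 ltW.
Qed.

(** Flatness at the origin, from [(y / (k+2))^(k+2) <= exp y] for [y = 1/x]. *)
Lemma flat_le k x : flat k x <= (k.+2%:R ^+ k.+2) * x ^+ 2.
Proof.
rewrite /flat; case: ifPn => x0; last by apply: mulr_ge0; [exact: exprn_ge0|exact: sqr_ge0].
have alg (c z : R) : c != 0 -> z != 0 ->
    z ^+ k = c ^+ k.+2 * z^-1 ^+ 2 * (z / c) ^+ k.+2.
  move=> c0 z0; rewrite expr_div_n -[in z ^+ k.+2]addn2 exprD.
  have := expf_neq0 k.+2 c0; set C := c ^+ k.+2; set Z := z ^+ k; move=> C0.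
  clearbody C Z; field; by rewrite C0 z0.
have y0 : 0 < x^-1 by rewrite invr_gt0.
set y := x^-1 in y0 *.
have h : (y / k.+2%:R) ^+ k.+2 <= expR y.
  have -> : expR y = expR (y / k.+2%:R) ^+ k.+2.
    by rewrite -expRM_natl mulrC divfK// pnatr_eq0.
  rewrite lerXn2r ?nnegrE ?expR_ge0 ?divr_ge0 ?(ltW y0)//.
  by apply: le_trans (expR_ge1Dx _); rewrite lerDr.
rewrite expRN ler_pdivrMr ?expR_gt0//.
have -> : x = y^-1 by rewrite /y invrK.
apply: (@le_trans _ _ (k.+2%:R ^+ k.+2 * y^-1 ^+ 2 * (y / k.+2%:R) ^+ k.+2)).
  by rewrite -alg// ?pnatr_eq0// gt_eqF.
by rewrite ler_wpM2l// mulr_ge0 ?exprn_ge0// invr_ge0 ltW.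
Qed.

Lemma is_derive_flat k x :
  is_derive x 1 (flat k) (flat k.+2 x - k%:R * flat k.+1 x).
Proof.
have [x0|x0|x0] := ltgtP x 0.
- have -> : flat k.+2 x - k%:R * flat k.+1 x = 0.
    by rewrite /flat ltNge (ltW x0) /= mulr0 subr0.
  have := @near_eq_is_derive R R R (cst 0) (flat k) x 1 0 _ (is_derive_cst 0 x 1).
  apply; near=> y; rewrite /flat ltNge ltW//=; near: y; exact: lt_nbhsl.
- suff dF : is_derive x 1 (fun y => y^-1 ^+ k * expR (- y^-1))
      (flat k.+2 x - k%:R * flat k.+1 x).
    have := @near_eq_is_derive R R R (fun y => y^-1 ^+ k * expR (- y^-1)) (flat k) x 1 _ _ dF.
    by apply; near=> y; rewrite /flat ifT//; near: y; exact: lt_nbhsr.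
  have xn0 : x != 0 by rewrite gt_eqF.
  have dV : is_derive x 1 (fun y : R => y^-1) (- (x ^- 2)).
    have := @is_deriveV _ id x 1 1 xn0 _.
    by rewrite /= -[_ *: _]/(_ * 1) mulr1; apply; exact: is_derive_id.
  have dE : is_derive x 1 (fun y : R => expR (- y^-1)) (expR (- x^-1) * x ^- 2).
    apply: (@is_derive1_comp _ expR (fun y : R => - y^-1)).
    by rewrite -[X in is_derive _ _ _ X]opprK; exact: is_deriveN.
  have dX := is_deriveX k dV.
  have powE (j : nat) (y : R) : ((fun z : R => z^-1) ^+ j) y = y^-1 ^+ j.
    by elim: j => [//|j IHj]; rewrite !exprS -IHj.
  have -> : (fun y => y^-1 ^+ k * expR (- y^-1)) =
      (fun z : R => z^-1) ^+ k * (fun y => expR (- y^-1)).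
    by apply/funext => y; rewrite -powE.
  apply: (is_derive_eq (is_deriveM dX dE)).
  rewrite /flat x0 -![_ *: _]/(_ * _) powE.
  rewrite -exprVn; set y := x^-1; set e := expR _; clearbody y e.
  case: k {dX} => [|k] /=; rewrite ?mulr0 ?mul0r ?addr0 ?subr0 !exprS ?expr0; ring.
- rewrite x0 {x0 x}; have -> : flat k.+2 0 - k%:R * flat k.+1 0 = 0.
    by rewrite /flat ltxx mulr0 subr0.
  apply/is_derive1_caratheodory.
  exists (fun z => flat k z / z); split.
  + move=> z; rewrite /flat ltxx !subr0; have [->|z0] := eqVneq z 0.
      by rewrite ltxx mulr0.
    by rewrite divfK.
  + suff : flat k z / z @[z --> (0 : R)] --> (0 : R).
      by rewrite /prop_for /continuous_at invr0 mulr0.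
    apply/cvgrPdist_le => e e0.
    pose C : R := k.+2%:R ^+ k.+2.
    have C0 : 0 < C by rewrite exprn_gt0.
    near=> z.
    have zd : `|0 - z| <= e / C.
      by near: z; apply: cvgr_dist_le => //; rewrite divr_gt0.
    rewrite sub0r normrN.
    have f0 := flat_ge0 k z; have fC := flat_le k z.
    have [z0|z0] := ltP 0 z; last first.
      by rewrite /flat ltNge z0/= mul0r normr0 ltW.
    rewrite ger0_norm ?divr_ge0 ?(ltW z0)// ler_pdivrMr//.
    apply: (le_trans fC); rewrite -/C expr2 mulrA ler_wpM2r ?(ltW z0)//.
    move: zd; rewrite sub0r normrN gtr0_norm// ler_pdivlMr// mulrC.
    by [].
  + by rewrite /flat ltxx mul0r.
Unshelve. all: end_near. Qed.

Lemma csmooth_flat n k : csmooth n (flat k).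
Proof.
elim: n k => [//|n IH] k.
exists (fun x => flat k.+2 x - k%:R * flat k.+1 x); first exact: is_derive_flat.
have -> : (fun x => flat k.+2 x - k%:R * flat k.+1 x) =
    (fun x => flat k.+2 x + (- k%:R) * flat k.+1 x).
  by apply/funext => x; rewrite mulNr.
by apply: csmoothD => //; apply: csmoothM => //; exact: csmooth_cst.
Qed.

Definition bump (a b x : R) : R := flat 0 (x - a) * flat 0 (b - x).

Lemma bump_ge0 a b x : 0 <= bump a b x.
Proof. by rewrite mulr_ge0 ?flat_ge0. Qed.

Lemma bump_gt0 a b x : a < x -> x < b -> 0 < bump a b x.
Proof.
move=> ax xb; rewrite /bump /flat !subr_gt0 ax xb !expr0 !mul1r.
by rewrite mulr_gt0// expR_gt0.
Qed.

Lemma bump_out a b x : x \notin `[a, b] -> bump a b x = 0.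
Proof.
rewrite in_itv/= negb_and -!ltNge /bump /flat !subr_gt0 => /orP[xa|bx].
  by rewrite ltNge (ltW xa) /= mul0r.
by rewrite [x < b]ltNge (ltW bx) /= mulr0.
Qed.

Lemma csmooth_bump n a b : csmooth n (bump a b).
Proof.
apply: csmoothM.
  rewrite (_ : (fun x => _) = (fun x => flat 0 (1 * x + - a))).
    exact/csmooth_affine/csmooth_flat.
  by apply/funext => x; rewrite mul1r.
rewrite (_ : (fun x => _) = (fun x => flat 0 (-1 * x + b))).
  exact/csmooth_affine/csmooth_flat.
by apply/funext => x; rewrite mulN1r addrC.
Qed.

(** Test functions that increase to the indicator of [`]a, b[]. *)
Definition plateau (a b : R) (n : nat) (x : R) : R := 1 - expR (- n%:R * bump a b x).

Lemma csmooth_plateau m a b n : csmooth m (plateau a b n).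
Proof.
rewrite /plateau (_ : (fun x => _) = (fun x => 1 + -1 * expR (- n%:R * bump a b x))).
  apply: csmoothD; first exact: csmooth_cst.
  apply: csmoothM; first exact: csmooth_cst.
  by apply: csmooth_expR; apply: csmoothM; [exact: csmooth_cst|exact: csmooth_bump].
by apply/funext => x; rewrite mulN1r.
Qed.

Lemma plateau_itv a b n x : 0 <= plateau a b n x <= 1.
Proof.
rewrite /plateau subr_ge0 gerBl expR_ge0 andbT mulNr expR_le1 ?oppr_le0 //.
by rewrite mulr_ge0// bump_ge0.
Qed.

Lemma plateau_out a b n x : x \notin `[a, b] -> plateau a b n x = 0.
Proof. by move=> h; rewrite /plateau bump_out// mulr0 expR0 subrr. Qed.

Lemma cvg_plateau a b x : a < x -> x < b -> plateau a b n x @[n --> \oo] --> (1 : R).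
Proof.
move=> ax xb; have B0 := bump_gt0 ax xb.
apply/cvgrPdist_le => e e0; near=> n.
rewrite /plateau opprB addrC subrK ger0_norm ?expR_ge0//.
rewrite mulNr expRN invf_ple ?posrE ?expR_gt0//.
apply: le_trans (expR_ge1Dx _).
apply: (@le_trans _ _ (n%:R * bump a b x)); last by rewrite lerDr.
rewrite -ler_pdivrMr//; near: n; exact: nbhs_infty_ger.
Unshelve. all: end_near. Qed.

Lemma test_function_plateau a b n : 0 < a -> a < b -> test_function (plateau a b n).
Proof.
move=> a0 ab; split.
  by apply: csmooth_derive1n => m; exact: csmooth_plateau.
by exists a, b; split => // x; exact: plateau_out.
Qed.

Lemma test_function_derivable phi x : test_function phi -> derivable phi x 1.
Proof. by move=> [sp _]; exact: (sp 0%N). Qed.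

Lemma test_function_continuous phi : test_function phi -> continuous phi.
Proof.
move=> tp x; apply: differentiable_continuous; apply/derivable1_diffP.
exact: test_function_derivable.
Qed.

Lemma derive1_out phi a b x : (forall x, x \notin `[a, b] -> phi x = 0) ->
  x \notin `[a, b] -> derive1 phi x = 0.
Proof.
move=> p0 xab.
suff h : is_derive x 1 phi 0 by rewrite derive1E derive_val.
have := @near_eq_is_derive R R R (cst 0) phi x 1 0 _ (is_derive_cst 0 x 1); apply.
move: xab; rewrite in_itv/= negb_and -!ltNge => /orP[xa|bx].
  near=> y; rewrite p0// in_itv/= negb_and -!ltNge; apply/orP; left.
  near: y; exact: lt_nbhsl.
near=> y; rewrite p0// in_itv/= negb_and -!ltNge; apply/orP; right.
near: y; exact: lt_nbhsr.
Unshelve. all: end_near. Qed.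

Lemma test_function_derive1 phi : test_function phi -> test_function (derive1 phi).
Proof.
move=> [sp [a [b [a0 ab pab]]]]; split.
  by move=> n x; rewrite -derive1Sn; exact: sp.
by exists a, b; split => // x; exact: derive1_out pab.
Qed.

Lemma continuous_bounded phi a b : continuous phi ->
  (forall x, x \notin `[a, b] -> phi x = 0) -> exists2 M : R, 0 < M & forall x, `|phi x| <= M.
Proof.
move=> cp p0; have : compact (phi @` `[a, b]).
  apply: continuous_compact; last exact: segment_compact.
  exact: continuous_subspaceT.
move=> /compact_bounded[N [_ hN]].
exists (`|N| + 1); first by rewrite ltr_wpDl.
move=> x; have [xab|xab] := boolP (x \in `[a, b]); last first.
  by rewrite p0// normr0 addr_ge0.
apply: (hN (`|N| + 1)); first by rewrite (le_lt_trans (ler_norm _))// ltrDl.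
by exists x.
Qed.

Lemma test_function_shift phi t : 0 <= t -> test_function phi ->
  test_function (fun x => phi (x - t)).
Proof.
move=> t0 [sp [a [b [a0 ab pab]]]]; split.
  apply: csmooth_derive1n => n.
  rewrite (_ : (fun x => _) = (fun x => phi (1 * x + - t))); last first.
    by apply/funext => x; rewrite mul1r.
  exact/csmooth_affine/derive1n_csmooth.
exists (a + t), (b + t); split; [by rewrite ltr_wpDr|by rewrite ltrD2r|].
move=> x xab; apply: pab; apply: contra xab.
by rewrite !in_itv/= lerBrDr lerBlDr.
Qed.

Lemma derive1_shift phi (t x : R) : (forall y : R, derivable phi y 1) ->
  derive1 (fun x => phi (x - t)) x = derive1 phi (x - t).
Proof.
move=> dp; suff h : is_derive x 1 (fun x => phi (x - t)) (derive1 phi (x - t) * 1).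
  by rewrite derive1E derive_val mulr1.
apply: (@is_derive1_comp _ phi (fun x => x - t)).
  by rewrite derive1E; exact/derivableP.
by rewrite -[X in is_derive _ _ _ X]subr0; apply: is_deriveB.
Qed.

(** With a primitive [F] of [phi], constant outside the support of [phi], the function
    [F x - F (x - h)] has compact support. *)
Lemma test_function_primitive phi h : 0 <= h -> test_function phi ->
  exists2 Phi, test_function Phi & forall x, derive1 Phi x = phi x - phi (x - h).
Proof.
move=> h0 tp; have cp := test_function_continuous tp.
have [sp [a [b [a0 ab pab]]]] := tp.
pose F x : R := (\int[@lebesgue_measure R]_(t in [set` Interval -oo%O (BRight x)]) phi t)%R.
have ip u : (@lebesgue_measure R).-integrable [set` Interval -oo%O (BRight u)] (EFin \o phi).
  have [M M0 hM] := continuous_bounded cp pab.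
  apply/integrableP; split.
    by apply/measurable_EFinP/measurable_funTS; exact: continuous_measurable_fun.
  apply: (@le_lt_trans _ _ (\int[@lebesgue_measure R]_(x in setT) (M%:E * (\1_(`[a, b]%classic : set (measurableTypeR R)) x)%:E))%E).
    apply: (@le_trans _ _ (\int[@lebesgue_measure R]_(x in setT) `|(EFin \o phi) x|)%E).
      exact: subset_nnintegral.
    apply: le_nnintegral => // x _; rewrite -EFinM lee_fin indicE.
    have [xI|xI] := boolP (x \in _); first by rewrite mulr1.
    rewrite pab ?normr0 ?mulr0//; apply/negP => h1; move/negP : xI; apply.
    by rewrite inE.
  rewrite nnintegralZ ?(ltW M0)//; last first.
    exists (fun x => (\1_(`[a, b]%classic : set (measurableTypeR R)) x)%:E); last exact: aeW.
    by apply/measurable_EFinP; exact: measurable_indic.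
  rewrite integral_indic// setIT.
  by rewrite [X in (_ * X)%E](_ : _ = lebesgue_measure `[a, b])// leb_itv ?(ltW ab)// -EFinM ltry.
have dF x : is_derive x 1 F (phi x).
  have xx1 : x < x + 1 by rewrite ltrDl.
  have [|dFx eFx] := @continuous_FTC1 R phi -oo%O x (x + 1) xx1 (ip _) _ (cp x).
    exact: ltNyr.
  by rewrite -eFx derive1E; exact/derivableP.
have F0 x : x < a -> F x = 0.
  move=> xa; rewrite /F /Rintegral integral0_eq// => t; rewrite /= in_itv/= => tx.
  by rewrite pab// in_itv/= negb_and -!ltNge (le_lt_trans tx xa).
have Fb x : b <= x -> F x = F b.
  move=> bx; rewrite /F /Rintegral; congr fine.
  rewrite integral_mkcond [RHS]integral_mkcond; apply: eq_integral => t _.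
  rewrite !patchE; have [tb|bt] := leP t b.
    by rewrite !mem_set//= in_itv/= ?tb// (le_trans tb).
  have -> : phi t = 0 by apply: pab; rewrite in_itv/= negb_and -!ltNge bt orbT.
  by rewrite !if_same.
have dFh x : is_derive x 1 (fun x => F (x - h)) (phi (x - h)).
  rewrite -[phi (x - h)]mulr1; apply: (@is_derive1_comp _ F (fun x => x - h)).
  by rewrite -[X in is_derive _ _ _ X]subr0; apply: is_deriveB.
pose Phi x := F x - F (x - h).
have dPhi x : is_derive x 1 Phi (phi x - phi (x - h)) by exact: is_deriveB.
have dPhi1 x : derive1 Phi x = phi x - phi (x - h).
  by rewrite derive1E; have := dPhi x => ?; rewrite derive_val.
exists Phi; last exact: dPhi1.
split.
  apply: csmooth_derive1n => -[//|n]; exists (fun x => phi x - phi (x - h)) => //.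
  rewrite (_ : (fun x => _) = (fun x => phi x + -1 * phi (1 * x + - h))); last first.
    by apply/funext => x; rewrite mulN1r mul1r.
  apply: csmoothD; first exact: derive1n_csmooth.
  apply: csmoothM; first exact: csmooth_cst.
  exact/csmooth_affine/derive1n_csmooth.
exists a, (b + h); split => //; first by rewrite ltr_wpDr.
move=> x; rewrite in_itv/= negb_and -!ltNge /Phi => /orP[xa|bx].
  by rewrite !F0 ?subrr// (le_lt_trans _ xa)// gerBl.
by rewrite !Fb ?subrr// ?lerBrDr ?(ltW bx)// (le_trans _ (ltW bx))// lerDl.
Qed.

End Smooth.

(** * Weak derivatives *)

Lemma near_right0_ex {R : realType} (P : R -> Prop) :
  (\forall h \near 0^'+, P h) -> exists2 h, 0 < h & P h.
Proof.
move=> h; have [x [x0 Px]] := filter_ex (filterI (nbhs_right_gt 0) h).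
by exists x.
Qed.

Section WeakDerivatives.
Context {R : realType} {E : completeNormedModType R[i]}.
Notation leb := (@lebesgue_measure R).
Implicit Types (u v w z : R -> E) (phi : R -> R).

(** Difference quotients of test functions are again weights, and continuity is all that
    pairing with a locally integrable function asks for. *)
Definition weight phi (a b : R) : Prop :=
  [/\ continuous phi, 0 < a & forall x, x \notin `[a, b] -> phi x = 0].

Definition pairing phi u : E := bochner halfline (fun x => (phi x)%:C%C *: u x).

Lemma test_function_weight phi : test_function phi -> exists a b, weight phi a b.
Proof.
move=> tp; have [_ [a [b [a0 ab pab]]]] := tp.
by exists a, b; split => //; exact: test_function_continuous.
Qed.

Lemma weight_bound phi a b : weight phi a b ->
  exists2 M : R, 0 < M & forall x, `|phi x| <= M.
Proof. by move=> [cp _ p0]; exact: continuous_bounded p0. Qed.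

Lemma L1loc_norm_integral_weight phi u a b M : weight phi a b -> L1loc u ->
  (forall x, `|phi x| <= M) ->
  (norm_integral halfline (fun x => (phi x)%:C%C *: u x)
     <= M%:E * norm_integral `[a, b] u)%E.
Proof.
move=> [cp a0 p0] lu hM.
have mI : measurable (`[a, b] : set (measurableTypeR R)) by [].
have M0 : 0 <= M by exact: le_trans (hM 0).
rewrite (_ : (fun x => _) = (fun x => if x \in (`[a, b]%classic : set R)
    then (phi x)%:C%C *: u x else 0)); last first.
  apply/funext => x; case: ifPn => // xab; rewrite p0 ?scale0r//.
  by apply/negP => h; move/negP : xab; apply; rewrite inE.
rewrite norm_integral_cut.
apply: (@le_trans _ _ (\int[leb]_(x in `[a, b]) (M%:E * (rnorm (u x))%:E))%E).
  apply: (@le_trans _ _ (norm_integral `[a, b] (fun x => (phi x)%:C%C *: u x))).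
    apply: subset_nnintegral => //.
    - by apply: measurableI => //; exact: measurable_halfline.
    - by move=> x _; rewrite lee_fin rnorm_ge0.
  apply: le_nnintegral => // x _; first by rewrite lee_fin rnorm_ge0.
  by rewrite -EFinM lee_fin rnormZr ler_wpM2r ?rnorm_ge0.
rewrite nnintegralZ//; first by move=> x _; rewrite lee_fin rnorm_ge0.
apply: rnorm_ae_measurable1 => //.
by have [] := L1loc_integrable b lu a0.
Qed.

Lemma weight_integrable phi u a b : weight phi a b -> L1loc u ->
  bochner_integrable halfline (fun x => (phi x)%:C%C *: u x).
Proof.
move=> wp lu; have [M M0 hM] := weight_bound wp; split.
  apply: smM; [exact: measurable_halfline|by case: wp|exact: L1loc_sm].
apply: le_lt_trans (L1loc_norm_integral_weight wp lu hM) _.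
apply: lte_mul_pinfty; rewrite ?lee_fin ?(ltW M0)//.
by have [_ a0 _] := wp; have [] := L1loc_integrable b lu a0.
Qed.

Lemma rnorm_pairing phi u a b M : weight phi a b -> L1loc u ->
  (forall x, `|phi x| <= M) ->
  ((rnorm (pairing phi u))%:E <= M%:E * norm_integral `[a, b] u)%E.
Proof.
move=> wp lu hM; apply: le_trans (L1loc_norm_integral_weight wp lu hM).
apply: rnorm_bochner; first exact: measurable_halfline.
by have [] := weight_integrable wp lu.
Qed.

Lemma pairing_lin phi a b (c : R[i]) u v : weight phi a b -> L1loc u -> L1loc v ->
  pairing phi (c *: u + v) = c *: pairing phi u + pairing phi v.
Proof.
move=> wp lu lv; rewrite /pairing -bochner_lin; last 3 first.
- exact: measurable_halfline.
- exact: weight_integrable wp lu.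
- exact: weight_integrable wp lv.
congr bochner; apply/funext => x.
by rewrite !fctE /= scalerDr !scalerA mulrC.
Qed.

Lemma pairingB phi a b u v : weight phi a b -> L1loc u -> L1loc v ->
  pairing phi (u - v) = pairing phi u - pairing phi v.
Proof.
move=> wp lu lv; have := pairing_lin (-1) wp lv lu.
by rewrite !scaleN1r addrC => ->; rewrite addrC.
Qed.

Lemma pairing_weightB (phi psi : R -> R) a b c d u : weight phi a b -> weight psi c d -> L1loc u ->
  pairing (fun x => phi x - psi x) u = pairing phi u - pairing psi u.
Proof.
move=> wp wq lu; rewrite /pairing addrC -scaleN1r -bochner_lin; last 3 first.
- exact: measurable_halfline.
- exact: weight_integrable wq lu.
- exact: weight_integrable wp lu.
congr bochner; apply/funext => x.
by rewrite !fctE /= scaleN1r rmorphB/= scalerBl addrC.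
Qed.

Lemma pairing_weightZ phi (r : R) a b u : weight phi a b -> L1loc u ->
  pairing (fun x => r * phi x) u = r%:C%C *: pairing phi u.
Proof.
move=> wp lu; rewrite /pairing -[RHS]addr0.
have h0 : bochner halfline (0 : R -> E) = 0.
  apply: rnorm0_eq0; apply/eqP; rewrite eq_le rnorm_ge0 andbT -lee_fin.
  rewrite -[leRHS](norm_integral0 (E := E) halfline); apply: rnorm_bochner.
    exact: measurable_halfline.
  exact/borel_sm_sm/borel_sm_simple/simple_map_cst.
rewrite -h0 -bochner_lin; last 3 first.
- exact: measurable_halfline.
- exact: weight_integrable wp lu.
- split; last by rewrite norm_integral0.
  exact/borel_sm_sm/borel_sm_simple/simple_map_cst.
congr bochner; apply/funext => x.
by rewrite !fctE /= addr0 rmorphM/= scalerA.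
Qed.

Lemma pairing_ae_eq phi u v : {ae leb, forall x, halfline x -> u x = v x} ->
  pairing phi u = pairing phi v.
Proof.
move=> uv; apply: bochner_ae_eq; first exact: measurable_halfline.
by apply: filterS uv => x uv hx; rewrite uv.
Qed.

Lemma weight_shift phi a b t : 0 <= t -> weight phi a b ->
  weight (fun x => phi (x - t)) (a + t) (b + t).
Proof.
move=> t0 [cp a0 p0]; split; last 2 first.
- by rewrite ltr_wpDr.
- move=> x xab; apply: p0; apply: contra xab.
  by rewrite !in_itv/= lerBrDr lerBlDr.
- move=> x; apply: (@continuous_comp _ _ _ (fun x => x - t) phi); last exact: cp.
  apply: cvgB; [exact: cvg_id|exact: cvg_cst].
Qed.

(** Since [phi] vanishes on the negative half-line, the change of variables [x |-> x +
    t] loses nothing. *)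
Lemma pairing_shift phi a b u t : 0 <= t -> weight phi a b -> L1loc u ->
  pairing (fun x => phi (x - t)) u = pairing phi (left_translation t u).
Proof.
move=> t0 wp lu; have ws := weight_shift t0 wp.
have [cp a0 p0] := wp.
have mt : measurable (`]t, +oo[ : set (measurableTypeR R)) by [].
have mH := measurable_halfline (R := R).
have -> : pairing (fun x => phi (x - t)) u =
    bochner (halfline `&` `]t, +oo[) (fun x => (phi (x - t))%:C%C *: u x).
  have bi : bochner_integrable (halfline `&` `]t, +oo[) (fun x => (phi (x - t))%:C%C *: u x).
    apply: bochner_integrable_subset (weight_integrable ws lu); last exact: subIsetl.
      exact: measurableI.
    exact: mH.
  rewrite -(bochner_cut mH mt bi).
  congr bochner; apply/funext => x; case: ifPn => // xt.
  rewrite p0 ?scale0r//; apply/negP; rewrite in_itv/= => /andP[h _].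
  move/negP : xt; apply; rewrite inE/= in_itv/= andbT.
  by rewrite -subr_gt0 (lt_le_trans a0).
have -> : (halfline `&` `]t, +oo[ : set R) = `]t, +oo[%classic.
  apply/seteqP; split => [x []//|x xt]; split => //.
  apply/halflineP; move: xt; rewrite /= in_itv/= andbT; exact: le_lt_trans.
have bi : bochner_integrable `]t, +oo[ (fun x => (phi (x - t))%:C%C *: u x).
  apply: bochner_integrable_subset (weight_integrable ws lu); [exact: mt|exact: mH|].
  move=> x; rewrite /= in_itv/= andbT => tx.
  by apply/halflineP; exact: le_lt_trans tx.
rewrite -(bochner_shift t mt bi).
rewrite halfline_shift; congr bochner; apply/funext => x.
by rewrite addrK.
Qed.

Lemma L1loc_lin (c : R[i]) u v : L1loc u -> L1loc v -> L1loc (c *: u + v).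
Proof.
by move=> lu lv a b a0 ab; exact: bochner_integrable_lin (lu _ _ a0 ab) (lv _ _ a0 ab).
Qed.

Lemma L1locB u v : L1loc u -> L1loc v -> L1loc (u - v).
Proof. by move=> lu lv; rewrite addrC -scaleN1r; exact: L1loc_lin. Qed.

Lemma L1loc0 : L1loc (0 : R -> E).
Proof.
move=> a b a0 ab; split; last by rewrite norm_integral0.
exact/borel_sm_sm/borel_sm_simple/simple_map_cst.
Qed.

Lemma L1locZ (c : R[i]) u : L1loc u -> L1loc (c *: u).
Proof. by move=> lu; rewrite -[_ *: _]addr0; apply: L1loc_lin => //; exact: L1loc0. Qed.

Lemma ae_itv (P : R -> Prop) (a b : R) : 0 < a -> {ae leb, forall x, halfline x -> P x} ->
  {ae leb, forall x, `[a, b]%classic x -> P x}.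
Proof.
move=> a0; apply: filterS => x h xab; apply: h; apply/halflineP.
by move: xab; rewrite /= in_itv/= => /andP[h _]; exact: lt_le_trans h.
Qed.

Lemma L1loc_ae_eq u v : {ae leb, forall x, halfline x -> u x = v x} ->
  L1loc u -> L1loc v.
Proof.
move=> uv lu a b a0 ab; have [su fu] := lu a b a0 ab.
have uv' := ae_itv b a0 uv; split; first exact: sm_ae_eq su.
by rewrite -(norm_integral_ae_eq (f := u)).
Qed.

Lemma shift_itv_preimage (a b t : R) :
  (fun x => x + t) @^-1` `[a + t, b + t] = `[a, b]%classic.
Proof.
by apply/seteqP; split => x; rewrite /= !in_itv/= !lerD2r.
Qed.

Lemma L1loc_shift u t : 0 <= t -> L1loc u -> L1loc (left_translation t u).
Proof.
move=> t0 lu a b a0 ab.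
have := bochner_integrable_shift t (lu (a + t) (b + t) (ltr_wpDr t0 a0) _).
by rewrite ltrD2r shift_itv_preimage; exact.
Qed.

Lemma primitive_bound v a b x : L1loc v -> 0 < a -> a <= x -> x <= b ->
  rnorm (primitive v x) <= rnorm (primitive v a) + fine (norm_integral `[a, b] v).
Proof.
move=> lv a0 ax xb; have [sv fv] := L1loc_integrable b lv a0.
rewrite -[X in rnorm X <= _](subrK (primitive v a)) addrC.
apply: (le_trans (ler_rnormD _ _)); rewrite lerD2l (primitiveB lv a0 ax).
rewrite -lee_fin fineK ?ge0_fin_numE ?norm_integral_ge0//.
apply: (@le_trans _ _ (norm_integral `[a, x] v)).
  by apply: rnorm_bochner => //; have [] := L1loc_integrable x lv a0.
apply: subset_nnintegral => //; last by move=> y _; rewrite lee_fin rnorm_ge0.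
by move=> y; rewrite /= !in_itv/= => /andP[-> yx]; exact: le_trans xb.
Qed.

Lemma L1loc_primitive v : L1loc v -> L1loc (primitive v).
Proof.
move=> lv a b a0 ab; split.
  apply: (@sm_subset _ _ _ halfline).
    move=> x; rewrite /= in_itv/= => /andP[ax _].
    by apply/halflineP; exact: lt_le_trans ax.
  by have := sm_primitive lv (lexx 0); under eq_fun do rewrite addr0.
pose M := rnorm (primitive v a) + fine (norm_integral `[a, b] v).
apply: (@le_lt_trans _ _ (\int[leb]_(x in `[a, b]) (cst M%:E x))%E).
  apply: le_nnintegral => //; first by move=> x _; rewrite lee_fin rnorm_ge0.
  move=> x; rewrite /= in_itv/= => /andP[ax xb]; rewrite lee_fin.
  exact: primitive_bound.
by rewrite integral_cst// [X in (_ * X)%E](_ : _ = leb `[a, b])// leb_itv ?(ltW ab)// -EFinM ltry.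
Qed.

Lemma L1loc_average h v : 0 <= h -> L1loc v -> L1loc (average h v).
Proof.
move=> h0 lv; have lP := L1loc_primitive lv.
rewrite (_ : average h v = (h^-1)%:C%C *: (left_translation h (primitive v) - primitive v))//.
exact: L1locZ (L1locB (L1loc_shift h0 lP) lP).
Qed.

Lemma Lpmu11 u : strongly_measurable halfline u ->
  Lpmu_norm 1 1 u = norm_integral halfline u.
Proof.
move=> su; rewrite LpmuE asboolT// invr1 poweRe1; last exact: modular_ge0.
apply: eq_integral => x _.
by rewrite subrr powRr0 mul1r powRr1 ?rnorm_ge0.
Qed.

(** Cut [v] off outside [[a, b + 1]], which does not affect averages over intervals of
    length at most [1], and apply [Lpmu_average] with [p = mu = 1]. *)
Lemma local_average v a b : L1loc v -> 0 < a -> a < b ->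
  norm_integral `[a, b] (average h v - v)%R @[h --> 0^'+] --> 0%E.
Proof.
move=> lv a0 ab; apply/cvge0P => [h|e e0]; first exact: norm_integral_ge0.
have mH := measurable_halfline (R := R).
pose A : set R := `[a, b + 1]%classic.
have mA : measurable (A : set (measurableTypeR R)) by exact: measurable_itv.
pose v' x := if x \in A then v x else 0.
have AH : A `<=` halfline.
  move=> x; rewrite /A/= in_itv/= => /andP[ax _].
  by apply/halflineP; exact: lt_le_trans ax.
have HA : halfline `&` A = A by apply/setIidPr.
have iv' : bochner_integrable halfline v'.
  apply: bochner_integrable_cut => //; rewrite HA.
  exact: L1loc_integrable.
have lv' : L1loc v'.
  move=> x y x0 xy; apply: bochner_integrable_subset iv' => //.
  move=> z; rewrite /= in_itv/= => /andP[xz _].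
  by apply/halflineP; exact: lt_le_trans xz.
have [sv' fv'] := iv'.
have fv1 : (Lpmu_norm 1 1 v' < +oo)%E by rewrite Lpmu11.
have e2 : 0 < e / 2 by rewrite divr_gt0.
have /cvge0P hc := Lpmu_shift_continuous (lexx 1) (lexx 1) fv1.
have {}hc := hc (fun t => Lpmu_norm_ge0 _ _ _) _ e2.
have [d /= d0 hd] := hc.
near=> h.
have h0 : 0 < h by [].
have h1 : h <= 1 by near: h; exact: nbhs_right_le.
have hd' : h < d by near: h; exact: nbhs_right_lt.
have sm : forall t, 0 <= t <= h ->
    (Lpmu_norm 1 1 (left_translation t v' - v')%R <= (e / 2)%:E)%E.
  move=> t /andP[]; rewrite le_eqVlt => /predU1P[<- _|t0 th].
    have -> : left_translation 0 v' - v' = 0.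
      by apply/funext => x; rewrite !fctE /left_translation addr0 subrr.
    have -> : Lpmu_norm 1 1 (0 : R -> E) = 0%E by exact: Lpmu0.
    by rewrite lee_fin ltW.
  apply: hd => //=; rewrite sub0r normrN gtr0_norm//.
  exact: le_lt_trans hd'.
have := Lpmu_average (lexx 1) lv' h0 (ltW e2) sm.
have sa : strongly_measurable halfline (average h v' - v').
  by apply: smB => //; apply: sm_average => //; exact: ltW.
rewrite Lpmu11// mulrC divfK// => hle; apply: le_trans hle.
apply: (@le_trans _ _ (norm_integral `[a, b] (average h v' - v')%R)).
  rewrite le_eqVlt; apply/orP; left; apply/eqP.
  apply: eq_integral => x; rewrite inE/= in_itv/= => /andP[ax xb].
  have x0 : 0 < x by exact: lt_le_trans ax.
  have xh : x <= x + h by rewrite lerDl ltW.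
  congr (_%:E); congr (rnorm _).
  change (average h v x - v x = average h v' x - v' x).
  have xA : x \in A by rewrite inE /A/= in_itv/= ax (le_trans xb)// lerDl.
  rewrite /average (primitiveB lv' x0 xh) (primitiveB lv x0 xh) {2}/v' xA.
  suff -> : bochner `[x, x + h] v' = bochner `[x, x + h] v by exact: erefl.
  apply: bochner_ae_eq; first exact: measurable_itv.
  apply: aeW => y; rewrite /= in_itv/= => /andP[xy yh].
  rewrite /v' ifT// inE /A/= in_itv/= (le_trans ax)//=.
  by rewrite (le_trans yh)// lerD.
apply: subset_nnintegral => //; last by move=> x _; rewrite lee_fin rnorm_ge0.
move=> x; rewrite /= in_itv/= => /andP[ax _].
by apply/halflineP; exact: lt_le_trans ax.
Unshelve. all: end_near. Qed.

Lemma norm_integral_eq0 u (D : set (measurableTypeR R)) : measurable D ->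
  strongly_measurable D u -> norm_integral D u = 0%E ->
  {ae leb, forall x, D x -> u x = 0}.
Proof.
move=> mD su u0; have [g bg ug] := sm_borel mD su.
have mg : measurable_fun D (fun x => (rnorm (g x))%:E).
  by apply/measurable_EFinP; apply: measurable_funTS; exact: measurable_rnorm.
have : (\int[leb]_(x in D) `|(rnorm (g x))%:E|)%E = 0%E.
  rewrite -u0; apply: ae_eq_nnintegral => //.
    by move=> x _; rewrite lee_fin rnorm_ge0.
  by apply: filterS ug => x ug Dx; rewrite ug// gee0_abs// lee_fin rnorm_ge0.
move/(ae_eq_integral_abs leb mD mg) => g0.
apply: filterS2 ug g0 => x ug g0 Dx; rewrite ug//; apply: rnorm0_eq0.
by have := g0 Dx => -[].
Qed.

Lemma ae_halfline (P : R -> Prop) :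
  (forall a b : R, 0 < a -> a < b -> {ae leb, forall x, `[a, b]%classic x -> P x}) ->
  {ae leb, forall x, halfline x -> P x}.
Proof.
move=> h; have n2 n : (0 : R) < n.+2%:R^-1 by rewrite invr_gt0.
have n3 n : (n.+2%:R^-1 : R) < n.+1%:R.
  by apply: (@lt_le_trans _ _ 1); [rewrite invf_lt1// ltr1n|rewrite ler1n].
have := @ae_foralln _ _ _ leb (fun n x => `[n.+2%:R^-1, n.+1%:R]%classic x -> P x)
  (fun n => h _ _ (n2 n) (n3 n)).
apply: filterS => x hx /halflineP x0.
have [n hn] : exists n, n.+2%:R^-1 <= x /\ x <= n.+1%:R.
  near (\oo : set_system nat) => n; exists n; split.
    rewrite -[leRHS]invrK lef_pV2 ?posrE ?invr_gt0//.
    apply: (@le_trans _ _ n%:R); first by near: n; exact: nbhs_infty_ger.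
    by rewrite ler_nat ltnW// ltnW.
  apply: (@le_trans _ _ n%:R); first by near: n; exact: nbhs_infty_ger.
  by rewrite ler_nat ltnW.
by apply: (hx n); rewrite /= in_itv/=; apply/andP.
Unshelve. all: end_near. Qed.

(** The functions [plateau c d n] increase to the indicator of [`]c, d[], so the integral of
    [w] over every interval vanishes; then all averages of [w] vanish, and they converge to [w]. *)
Lemma pairing_eq0 w : L1loc w -> (forall phi, test_function phi -> pairing phi w = 0) ->
  {ae leb, forall x, halfline x -> w x = 0}.
Proof.
move=> lw w0; have mH := measurable_halfline (R := R).
have I0 c d : 0 < c -> c < d -> bochner `[c, d] w = 0.
  move=> c0 cd; pose I : set R := `[c, d]%classic.
  have mI : measurable (I : set (measurableTypeR R)) by exact: measurable_itv.
  have IH : halfline `&` I = I.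
    apply/setIidPr => x; rewrite /I/= in_itv/= => /andP[h _].
    by apply/halflineP; exact: lt_le_trans h.
  have [sw fw] := L1loc_integrable d lw c0.
  have [g bg wg] := sm_borel mI sw.
  pose F n x : \bar R := ((1 - plateau c d n x) * rnorm (g x))%:E.
  have mF n : measurable_fun I (F n).
    apply/measurable_EFinP; apply: measurable_funTS; apply: measurable_funM.
      apply: continuous_measurable_fun => x; apply: cvgB; first exact: cvg_cst.
      exact: test_function_continuous (test_function_plateau n c0 cd) x.
    exact: measurable_rnorm.
  have Fb n x : 0 <= 1 - plateau c d n x <= 1.
    by have := plateau_itv c d n x; lra.
  have := @dominated_convergence _ _ _ leb I mI F (cst 0%E) (fun x => (rnorm (g x))%:E) mF.
  case.
  - exact: measurable_cst.
  - have N : leb.-negligible [set c; d].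
      apply/negligibleP; first exact: measurableU.
      apply: (@null_set_setU _ _ _ leb) => //; exact: lebesgue_measure_set1.
    apply: (negligibleS _ N) => x /= h; have [->|xc] := eqVneq x c; first by left.
    have [->|xd] := eqVneq x d; first by right.
    exfalso; apply: h => xI; apply/fine_cvgP; split; first by near=> n.
    have -> : (0 : R) = (1 - 1) * rnorm (g x) by rewrite subrr mul0r.
    apply: cvgM; last exact: cvg_cst.
    apply: cvgB; first exact: cvg_cst.
    move: xI; rewrite /I/= in_itv/= !le_eqVlt eq_sym (negbTE xc) (negbTE xd)/= => /andP[? ?].
    exact: cvg_plateau.
  - apply/integrableP; split.
      by apply/measurable_EFinP; apply: measurable_funTS; exact: measurable_rnorm.
    rewrite (_ : (\int[_]_(_ in _) _)%E = norm_integral I w)//.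
    rewrite (norm_integral_ae_eq mI wg); apply: eq_integral => x _.
    by rewrite gee0_abs// lee_fin rnorm_ge0.
  - apply: aeW => x n _; rewrite /F gee0_abs; last first.
      by rewrite lee_fin mulr_ge0 ?rnorm_ge0//; have /andP[] := Fb n x.
    by rewrite lee_fin ler_piMl ?rnorm_ge0//; have /andP[] := Fb n x.
  move=> _ _; rewrite integral0 => /cvge0P hF.
  have hF0 n : (0 <= \int[leb]_(x in I) F n x)%E.
    apply: integral_ge0 => x _.
    by rewrite lee_fin mulr_ge0 ?rnorm_ge0//; have /andP[] := Fb n x.
  apply: rnorm0_eq0; apply/eqP; rewrite eq_le rnorm_ge0 andbT.
  apply/ler_addgt0Pr => e e0; rewrite add0r.
  have [n _ /(_ n (leqnn n)) /= hn] := hF hF0 _ e0.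
  have tp := test_function_plateau n c0 cd.
  have wp : weight (plateau c d n) c d.
    by split => //; [exact: test_function_continuous|exact: plateau_out].
  have eI : bochner I w = bochner halfline (fun x => if x \in I then w x else 0).
    by rewrite bochner_cut// IH.
  have bI : bochner_integrable halfline (fun x => if x \in I then w x else 0).
    by apply: (bochner_integrable_cut mH mI); rewrite IH; exact: conj sw fw.
  have -> : bochner I w = -1 *: pairing (plateau c d n) w +
      bochner halfline (fun x => if x \in I then w x else 0).
    by rewrite (w0 _ tp) scaler0 add0r; exact: eI.
  rewrite -lee_fin /pairing -(bochner_lin (-1) mH (weight_integrable wp lw) bI).
  have bl := bochner_integrable_lin (-1) mH (weight_integrable wp lw) bI.
  apply: (le_trans (rnorm_bochner mH bl.1)); apply: le_trans hn.
  rewrite /norm_integral (_ : (fun x => _) = (fun x => (rnorm (if x \in I then (1 - plateau c d n x)%:C%C *: w x else 0))%:E)).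
    rewrite -/(norm_integral _ _) norm_integral_cut IH.
    rewrite /norm_integral; apply: ae_le_nnintegral; first exact: mI.
    - by move=> x _; rewrite lee_fin rnorm_ge0.
    - by move=> x _; rewrite lee_fin mulr_ge0 ?rnorm_ge0//; have /andP[] := Fb n x.
    apply: filterS wg => x wg xI; rewrite rnormZr (wg xI) ger0_norm; first exact: lexx.
    by have /andP[] := Fb n x.
  apply/funext => x; rewrite !fctE scaleN1r; case: ifPn => xI.
    congr (rnorm _)%:E.
    move: (plateau c d n x) => q.
    by rewrite rmorphB rmorph1 scalerBl scale1r addrC.
  rewrite plateau_out ?scale0r ?oppr0 ?addr0//.
  by apply/negP => h; move/negP : xI; apply; rewrite inE.
apply: ae_halfline => a b a0 ab.
have [sw fw] := L1loc_integrable b lw a0.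
apply: norm_integral_eq0 => //.
have /cvge0P la := local_average lw a0 ab.
have {}la := la (fun h => norm_integral_ge0 _ _).
apply/eqP; rewrite eq_le norm_integral_ge0 andbT.
apply/lee_addgt0Pr => e e0; rewrite add0e.
have [h h0] := near_right0_ex (la _ e0).
congr (_ <= _)%E; apply: eq_integral => x; rewrite inE/= in_itv/= => /andP[ax xb].
have x0 : 0 < x by exact: lt_le_trans ax.
rewrite !fctE /average primitiveB// ?lerDl ?(ltW h0)//.
by rewrite I0 ?ltrDl// scaler0 sub0r rnormN.
Unshelve. all: end_near. Qed.

(** Two applications of the mean value theorem; [M] bounds the second derivative. *)
Lemma test_function_quotient phi : test_function phi ->
  exists2 M : R, 0 < M & forall h x : R, 0 < h ->
    `|h^-1 * (phi x - phi (x - h)) - derive1 phi x| <= M * h.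
Proof.
move=> tp; have tp1 := test_function_derive1 tp; have tp2 := test_function_derive1 tp1.
have [a [b /weight_bound[M M0 hM]]] := test_function_weight tp2.
exists M => // h x h0; have xh : x - h < x by rewrite gtrBl.
have dtf (psi : R -> R) (y : R) : test_function psi -> is_derive y 1 psi (derive1 psi y).
  by move=> tpsi; rewrite derive1E; apply/derivableP; exact: test_function_derivable.
have [c] := MVT xh (fun y _ => dtf phi y tp) (continuous_subspaceT (test_function_continuous tp)).
rewrite in_itv/= => /andP[xc cx] ->.
have -> : x - (x - h) = h by rewrite opprB addrC subrK.
rewrite mulrCA mulVf ?gt_eqF// mulr1.
have [d _ e] := MVT cx (fun y _ => dtf _ y tp1) (continuous_subspaceT (test_function_continuous tp1)).
rewrite distrC e normrM; apply: ler_pM => //.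
by rewrite gtr0_norm ?subr_gt0// lerBlDr -lerBlDl ltW.
Qed.

(** The identity of difference quotients
    [\int h^-1 (phi x - phi (x - h)) P x dx = - \int phi x average h v x dx],
    where [P] is a primitive of [v], becomes the definition of the weak derivative
    when [h] tends to [0]. *)
Lemma weak_derivative_primitive v : L1loc v -> weak_derivative (primitive v) v.
Proof.
move=> lv; have lP := L1loc_primitive lv; split => // phi tp.
have [a [b wp]] := test_function_weight tp.
have [cp a0 p0] := wp.
(* One unit of room on the right for the support of [phi (x - h)], [h <= 1]. *)
pose b' := Num.max b a + 1.
have ab' : a < b' by rewrite /b' ltr_pwDr// le_max lexx orbT.
have bb' : b + 1 <= b' by rewrite /b' lerD2r le_max lexx.
have wp' : weight phi a b'.
  split => // x xab; apply: p0; apply: contra xab; rewrite !in_itv/= => /andP[-> xb].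
  by rewrite (le_trans xb)// (le_trans _ bb')// lerDl.
have wp1 : weight (derive1 phi) a b'.
  split => //; first exact/test_function_continuous/test_function_derive1.
  by case: wp' => _ _ h; move=> x; exact: derive1_out h.
have [M M0 hM] := weight_bound wp'.
have [L L0 hL] := test_function_quotient tp.
rewrite -/(pairing (derive1 phi) (primitive v)) -/(pairing phi v).
apply/eqP; rewrite -subr_eq0 opprK; apply/eqP; apply: rnorm0_eq0; apply/eqP.
rewrite eq_le rnorm_ge0 andbT; apply/ler_addgt0Pr => e e0; rewrite add0r.
pose N := fine (norm_integral `[a, b'] (primitive v)).
have NE : norm_integral `[a, b'] (primitive v) = N%:E.
  have [_ h] := L1loc_integrable b' lP a0.
  by rewrite fineK// ge0_fin_numE ?norm_integral_ge0.
have N0 : 0 <= N by rewrite -lee_fin -NE norm_integral_ge0.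
have /cvge0P la := local_average lv a0 ab'.
have eM : 0 < e / 2 / M by rewrite !divr_gt0.
have {}la := la (fun h => norm_integral_ge0 _ _) _ eM.
have eN : 0 < e / 2 / (L * (N + 1)).
  by rewrite divr_gt0 ?divr_gt0// mulr_gt0// ltr_wpDl.
have [h h0 [[h1 hN] ha]] := near_right0_ex
  (filterI (filterI (nbhs_right_le ltr01) (nbhs_right_le eN)) la).
have hh := ltW h0.
have wps : weight (fun x => phi (x - h)) a b'.
  have [cs _ ps] := weight_shift hh wp; split => // x xab; apply: ps.
  apply: contra xab; rewrite !in_itv/= => /andP[hx xb]; apply/andP; split.
    by apply: le_trans hx; rewrite lerDl.
  by apply: (le_trans xb); apply: le_trans bb'; rewrite lerD2l.
pose psi x := h^-1 * (phi x - phi (x - h)).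
have wd : weight (fun x => phi x - phi (x - h)) a b'.
  have [cs _ ps] := wps; case: wp' => _ _ pb; split => //.
    by move=> x; apply: cvgB; [exact: cp|exact: cs].
  by move=> x xab; rewrite pb// ps// subrr.
have wpsi : weight psi a b'.
  have [cs _ ps] := wd; split => //; last by move=> x xab; rewrite /psi ps// mulr0.
  by move=> x; apply: cvgM; [exact: cvg_cst|exact: cs].
have key : pairing psi (primitive v) = - pairing phi (average h v).
  rewrite /psi (pairing_weightZ _ wd lP) (pairing_weightB wp' wps lP).
  rewrite (pairing_shift hh wp lP).
  have lT := L1loc_shift hh lP.
  rewrite (_ : average h v = (h^-1)%:C%C *: (left_translation h (primitive v) - primitive v) + 0); last first.
    by rewrite addr0.
  rewrite (pairing_lin _ wp'); [|exact: L1locB|exact: L1loc0].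
  rewrite (pairingB wp')//.
  have -> : pairing phi (0 : R -> E) = 0.
    have := pairingB wp' L1loc0 L1loc0; rewrite subrr => {1}->.
    by rewrite subrr.
  by rewrite addr0 -scalerN opprB.
have -> : pairing (derive1 phi) (primitive v) + pairing phi v =
  (- pairing (fun x => psi x - derive1 phi x) (primitive v)) -
  pairing phi (average h v - v).
  rewrite (pairing_weightB wpsi wp1 lP) key (pairingB wp')//; last exact: L1loc_average.
  move: (pairing phi (average h v)) (pairing phi v) (pairing (derive1 phi) (primitive v)).
  by clear=> x y z; rewrite !opprD !opprK addrA [x + _]addrC addrK.
have wpd : weight (fun x => psi x - derive1 phi x) a b'.
  have [cs _ ps] := wpsi; have [c1 _ p1] := wp1; split => //.
    by move=> x; apply: cvgB; [exact: cs|exact: c1].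
  by move=> x xab; rewrite ps// p1// subrr.
apply: (le_trans (ler_rnormB _ _)); rewrite rnormN.
rewrite (splitr e); apply: lerD.
  rewrite -lee_fin; apply: (le_trans (rnorm_pairing wpd lP (M := L * h) _)).
    by move=> x; exact: hL.
  rewrite NE -EFinM lee_fin.
  have LN : 0 < L * (N + 1) by rewrite mulr_gt0// ltr_wpDl.
  move: hN; rewrite ler_pdivlMr//; apply: le_trans.
  by rewrite (mulrC L) -mulrA ler_wpM2l// ler_wpM2l ?(ltW L0)// lerDl.
rewrite -lee_fin; apply: (le_trans (rnorm_pairing wp' _ hM)).
  by apply: L1locB => //; exact: L1loc_average.
apply: (@le_trans _ _ (M%:E * (e / 2 / M)%:E)%E).
  by apply: lee_wpmul2l; rewrite ?lee_fin ?(ltW M0).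
by rewrite -EFinM lee_fin mulrCA divff ?mulr1// gt_eqF.
Unshelve. all: end_near. Qed.

Lemma weak_derivativeP u v : weak_derivative u v <->
  [/\ L1loc u, L1loc v &
      forall phi, test_function phi -> pairing (derive1 phi) u = - pairing phi v].
Proof. by []. Qed.

Lemma pairing0 phi a b : weight phi a b -> pairing phi (0 : R -> E) = 0.
Proof.
by move=> wp; have := pairingB wp L1loc0 L1loc0; rewrite subrr => {1}->; rewrite subrr.
Qed.

Lemma weak_derivative_lin (c : R[i]) u1 v1 u2 v2 : weak_derivative u1 v1 ->
  weak_derivative u2 v2 -> weak_derivative (c *: u1 + u2) (c *: v1 + v2).
Proof.
move=> /weak_derivativeP[lu1 lv1 d1] /weak_derivativeP[lu2 lv2 d2].
apply/weak_derivativeP; split; [exact: L1loc_lin|exact: L1loc_lin|].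
move=> phi tp; have [a [b wp]] := test_function_weight tp.
have [a' [b' wp']] := test_function_weight (test_function_derive1 tp).
by rewrite (pairing_lin _ wp')// (pairing_lin _ wp)// d1// d2// opprD scalerN.
Qed.

Lemma weak_derivativeB u1 v1 u2 v2 : weak_derivative u1 v1 ->
  weak_derivative u2 v2 -> weak_derivative (u1 - u2) (v1 - v2).
Proof.
by move=> d1 d2; have := weak_derivative_lin (-1) d2 d1; rewrite !scaleN1r ![- _ + _]addrC.
Qed.

Lemma weak_derivative0 : weak_derivative (0 : R -> E) 0.
Proof.
apply/weak_derivativeP; split; [exact: L1loc0|exact: L1loc0|move=> phi tp].
have [a [b wp]] := test_function_weight tp.
have [a' [b' wp']] := test_function_weight (test_function_derive1 tp).
by rewrite (pairing0 wp) (pairing0 wp') oppr0.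
Qed.

Lemma weak_derivativeZ (c : R[i]) u v : weak_derivative u v ->
  weak_derivative (c *: u) (c *: v).
Proof.
by move=> d; have := weak_derivative_lin c d weak_derivative0; rewrite !addr0.
Qed.

Lemma weak_derivative_ae_eq u v u' v' :
  {ae leb, forall x, halfline x -> u x = u' x} ->
  {ae leb, forall x, halfline x -> v x = v' x} ->
  weak_derivative u v -> weak_derivative u' v'.
Proof.
move=> uu vv /weak_derivativeP[lu lv d]; apply/weak_derivativeP; split; [exact: L1loc_ae_eq lu|exact: L1loc_ae_eq lv|].
move=> phi tp; have := d phi tp.
by rewrite (pairing_ae_eq _ uu) (pairing_ae_eq _ vv).
Qed.

Lemma weak_derivative_shift u v t : 0 <= t -> weak_derivative u v ->
  weak_derivative (left_translation t u) (left_translation t v).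
Proof.
move=> t0 /weak_derivativeP[lu lv d]; apply/weak_derivativeP.
split; [exact: L1loc_shift|exact: L1loc_shift|move=> phi tp].
have [a [b wp]] := test_function_weight tp.
have [a' [b' wp']] := test_function_weight (test_function_derive1 tp).
rewrite -(pairing_shift t0 wp)// -(pairing_shift t0 wp')//.
rewrite -(d _ (test_function_shift t0 tp)).
congr (pairing _ u); apply/funext => x.
by apply/esym/derive1_shift => y; exact: test_function_derivable.
Qed.

Lemma weak_derivative_unique u v v' : weak_derivative u v -> weak_derivative u v' ->
  {ae leb, forall x, halfline x -> v x = v' x}.
Proof.
move=> /weak_derivativeP[lu lv d] /weak_derivativeP[_ lv' d'].
have : {ae leb, forall x, halfline x -> (v - v') x = 0}.
  apply: pairing_eq0; first exact: L1locB.
  move=> phi tp; have [a [b wp]] := test_function_weight tp.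
  rewrite (pairingB wp)//; apply/eqP; rewrite subr_eq0; apply/eqP.
  by apply: oppr_inj; rewrite -(d _ tp) -(d' _ tp).
by apply: filterS => x h hx; apply/eqP; rewrite -subr_eq0; apply/eqP; exact: h.
Qed.

(** The increment of a test function is the derivative of a test function
    ([test_function_primitive]), on which [z] vanishes by assumption; this identifies
    the pairings of [z] and of its translate. *)
Lemma weak_derivative0_shift z t : 0 <= t -> weak_derivative z 0 ->
  {ae leb, forall x, halfline x -> left_translation t z x = z x}.
Proof.
move=> t0 /weak_derivativeP[lz l0 d].
have : {ae leb, forall x, halfline x -> (left_translation t z - z) x = 0}.
  have lT := L1loc_shift t0 lz.
  apply: pairing_eq0; first exact: L1locB.
  move=> phi tp; have [a [b wp]] := test_function_weight tp.
  have [Phi tPhi ePhi] := test_function_primitive t0 tp.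
  have ws := weight_shift t0 wp.
  rewrite (pairingB wp)// -(pairing_shift t0 wp)// -opprB -(pairing_weightB wp ws)//.
  apply/eqP; rewrite oppr_eq0; apply/eqP.
  have := d _ tPhi; rewrite (_ : derive1 Phi = (fun x => phi x - phi (x - t))); last exact/funext.
  have [a' [b' wp']] := test_function_weight tPhi.
  by move=> ->; rewrite (pairing0 wp') oppr0.
by apply: filterS => x h hx; apply/eqP; rewrite -subr_eq0; apply/eqP; exact: h.
Qed.

(** A weakly differentiable function differs from a primitive of its derivative by
    a function with zero derivative, which is translation invariant. *)
Lemma weak_derivative_average u v h : 0 < h -> weak_derivative u v ->
  {ae leb, forall x, halfline x ->
    ((h^-1)%:C%C *: (left_translation h u - u)) x = average h v x}.
Proof.
move=> h0 du; have [lu lv _] := du.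
have dz := weak_derivativeB du (weak_derivative_primitive lv).
rewrite subrr in dz.
apply: filterS (weak_derivative0_shift (ltW h0) dz) => x hz hx.
rewrite !fctE /average; congr (_ *: _).
have := hz hx; rewrite /left_translation !fctE => /eqP.
by rewrite subr_eq => /eqP ->; rewrite addrAC [u x - _]addrC addrK addrC.
Qed.

Lemma weak_derivative_increment v : L1loc v ->
  weak_derivative (left_translation 1 (primitive v) - primitive v)
    (left_translation 1 v - v).
Proof.
move=> lv; have d := weak_derivative_primitive lv.
exact: weak_derivativeB (weak_derivative_shift ler01 d) d.
Qed.

End WeakDerivatives.

(** * Quasi-norms modulo null elements *)

Lemma lee_addgt0 {R : realType} (x : \bar R) (c : R) :
  (forall e : R, 0 < e -> (x <= (c + e)%:E)%E) -> (x <= c%:E)%E.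
Proof. by move=> h; apply/lee_addgt0Pr => e e0; rewrite -EFinD; exact: h. Qed.

Lemma fin_bound {R : realType} (x : \bar R) : (0 <= x)%E -> (x < +oo)%E ->
  exists2 c : R, 0 <= c & x = c%:E.
Proof.
move=> x0 xy; exists (fine x); first exact: fine_ge0.
by rewrite fineK// ge0_fin_numE.
Qed.

Lemma ltey_pmull {R : realType} (t : R) (x : \bar R) : 0 < t -> (0 <= x)%E ->
  (t%:E * x < +oo)%E -> (x < +oo)%E.
Proof.
by move=> t0; case: x => [r _ _|_|//]; [exact: ltry|rewrite gt0_muley ?lte_fin].
Qed.

Section QuasiNorms.
Context {R : realType} {F : lmodType R[i]}.
Variable nul : F -> Prop.
Implicit Types (N : F -> \bar R) (u v n : F) (k : R[i]) (c t : R).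

Definition cabs k : R := complex.Re `|k|.

(** What is used of the endpoint norms. The constant in [qn_add] absorbs crude
    estimates of sums of [p]-th powers, and limits do not see it. Elements with [nul
    n] are those identified with [0]; here they will be the functions that vanish
    almost everywhere. *)
Record qnorm N : Prop := QNorm {
  qn_ge0 : forall u, (0 <= N u)%E;
  qn_zero : N 0 = 0%E;
  qn_add : exists2 K : R, 1 <= K & forall u v c, 0 < c ->
    (N u <= c%:E)%E -> (N v <= c%:E)%E -> (N (u + v)%R <= (K * c)%:E)%E;
  qn_scale : forall k u c, 0 <= c -> (N u <= c%:E)%E -> (N (k *: u)%R <= (cabs k * c)%:E)%E;
  qn_null : forall u n, nul n -> (N (u + n)%R <= N u)%E }.

Lemma qn_lty N u : qnorm N -> (N u < +oo)%E -> exists2 c, 0 < c & (N u <= c%:E)%E.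
Proof.
move=> qN uy; have [c c0 ->] := fin_bound (qn_ge0 qN u) uy.
by exists (c + 1); [rewrite ltr_wpDl|rewrite lee_fin lerDl].
Qed.

Lemma qn_lin_lty N k u v : qnorm N -> (N u < +oo)%E -> (N v < +oo)%E ->
  (N (k *: u + v)%R < +oo)%E.
Proof.
move=> qN /(qn_lty qN)[c c0 uc] /(qn_lty qN)[d d0 vd].
have [K K1 hK] := qn_add qN.
have k0 : 0 <= cabs k by exact: Re_norm_ge0.
apply: le_lt_trans (ltry (K * (cabs k * c + d))); apply: hK.
- by rewrite ltr_wpDl// mulr_ge0// ltW.
- apply: (le_trans (qn_scale qN k (ltW c0) uc)).
  by rewrite lee_fin lerDl ltW.
- by apply: (le_trans vd); rewrite lee_fin lerDr mulr_ge0// ltW.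
Qed.

Lemma cabs_real (r : R) : cabs (r%:C)%C = `|r|.
Proof. by rewrite /cabs normc_def/= expr0n addr0 sqrtr_sqr. Qed.

Lemma cabsN1 : cabs (-1) = 1.
Proof. by rewrite /cabs normrN1. Qed.

Lemma cabsM k l : cabs (k * l) = cabs k * cabs l.
Proof.
by rewrite /cabs normrM -(RRe_real (normr_real k)) -(RRe_real (normr_real l)) -rmorphM.
Qed.

Lemma qn_linB N u v : qnorm N -> (N u < +oo)%E -> (N v < +oo)%E -> (N (u - v)%R < +oo)%E.
Proof. by move=> qN uy vy; rewrite addrC -scaleN1r; exact: qn_lin_lty. Qed.

(** Convergence of [N (f x)] to [0] in terms of balls, the form in which [bounded_map]
    passes it on. *)
Definition small {T : Type} (G : set_system T) N (f : T -> F) :=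
  forall e : R, 0 < e -> \forall x \near G, (N (f x) <= e%:E)%E.

Lemma smallP {T : Type} (G : set_system T) {FG : Filter G} N f : qnorm N ->
  (N (f x) @[x --> G] --> 0%E) <-> small G N f.
Proof. by move=> qN; exact/cvge0P/(fun x => qn_ge0 qN (f x)). Qed.

Lemma smallD {T : Type} (G : set_system T) {FG : Filter G} N f g : qnorm N ->
  small G N f -> small G N g -> small G N (fun x => f x + g x).
Proof.
move=> qN sf sg e e0; have [K K1 hK] := qn_add qN.
have K0 : 0 < K by exact: lt_le_trans K1.
have eK : 0 < e / K by rewrite divr_gt0.
apply: filterS2 (sf _ eK) (sg _ eK) => x fx gx.
by apply: le_trans (hK _ _ _ eK fx gx) _; rewrite mulrC divfK ?gt_eqF.
Qed.

Lemma smallZ {T : Type} (G : set_system T) {FG : Filter G} N (k : T -> R[i]) f M : qnorm N ->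
  (\forall x \near G, cabs (k x) <= M) -> small G N f -> small G N (fun x => k x *: f x).
Proof.
move=> qN kM sf e e0; have M0 : 0 < `|M| + 1 by rewrite ltr_wpDl.
have eM : 0 < e / (`|M| + 1) by rewrite divr_gt0.
apply: filterS2 kM (sf _ eM) => x kx fx.
apply: le_trans (qn_scale qN (k x) (ltW eM) fx) _; rewrite lee_fin.
rewrite mulrCA -[leRHS]mulr1 ler_wpM2l ?(ltW e0)// ler_pdivrMr// mul1r.
by apply: (le_trans kx); rewrite (le_trans (ler_norm _))// lerDl.
Qed.

Lemma smallZ0 {T : Type} (G : set_system T) {FG : Filter G} N (k : T -> R[i]) u : qnorm N ->
  (N u < +oo)%E -> (forall e, 0 < e -> \forall x \near G, cabs (k x) <= e) ->
  small G N (fun x => k x *: u).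
Proof.
move=> qN /(qn_lty qN)[c c0 uc] k0 e e0.
have ec : 0 < e / c by rewrite divr_gt0.
apply: filterS (k0 _ ec) => x kx.
apply: le_trans (qn_scale qN (k x) (ltW c0) uc) _; rewrite lee_fin.
by rewrite -ler_pdivlMr.
Qed.

(** Operators are defined on representatives, and the choice of a weak derivative, for
    instance, is linear only up to null functions. *)
Definition linear_mod N (S : F -> F) := forall k u v, (N u < +oo)%E -> (N v < +oo)%E ->
  nul (S (k *: u + v) - (k *: S u + S v)).

(** Quantifying over balls avoids products with infinite norms. *)
Definition bounded_map N N' (S : F -> F) C := forall u c, 0 <= c ->
  (N u <= c%:E)%E -> (N' (S u) <= (C * c)%:E)%E.

End QuasiNorms.

(** * The real method *)

Section KMethod.
Context {R : realType} {F : lmodType R[i]}.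
Variable nul : F -> Prop.
Implicit Types (N : F -> \bar R) (u v : F) (k : R[i]) (c t s : R).

Section Couple.
Variables (N0 N1 : F -> \bar R) (q0 : qnorm nul N0) (q1 : qnorm nul N1).
Local Notation K := (Kfunctional N0 N1).

Let N1t_ge0 t u : 0 < t -> (0 <= t%:E * N1 u)%E.
Proof. by move=> t0; rewrite mule_ge0 ?lee_fin ?(ltW t0)//; exact: (qn_ge0 q1). Qed.

Lemma K_le t a b : (K t (a + b)%R <= N0 a + t%:E * N1 b)%E.
Proof. by apply: ereal_inf_lbound; exists (a, b). Qed.

Lemma K_lt t u c : (K t u < c%:E)%E -> exists a b, a + b = u /\ (N0 a + t%:E * N1 b < c%:E)%E.
Proof. by move=> /ereal_inf_lt[_ [[a b] /= ab <-] h]; exists a, b. Qed.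

Lemma K_ge0 t u : 0 < t -> (0 <= K t u)%E.
Proof.
move=> t0; apply: le_ereal_inf_tmp => _ [[a b] _ <-].
by rewrite adde_ge0//; [exact: (qn_ge0 q0)|exact: N1t_ge0].
Qed.

Lemma K_lt_parts t u c : 0 < t -> (K t u < c%:E)%E ->
  exists a b, [/\ a + b = u, (N0 a <= c%:E)%E & (N1 b <= (c / t)%:E)%E].
Proof.
move=> t0 /K_lt[a [b [ab h]]]; exists a, b; split => //.
  by apply: le_trans (ltW h); rewrite leeDl// N1t_ge0.
have h1 : (t%:E * N1 b <= c%:E)%E.
  by apply: le_trans (ltW h); rewrite leeDr//; exact: (qn_ge0 q0).
by rewrite mulrC EFinM lee_pdivlMl.
Qed.

Lemma K_le_parts t a b c d : 0 < t -> (N0 a <= c%:E)%E -> (N1 b <= d%:E)%E ->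
  (K t (a + b)%R <= (c + t * d)%:E)%E.
Proof.
move=> t0 ac bd; apply: (le_trans (K_le _ _ _)); rewrite EFinD EFinM.
by apply: leeD => //; apply: lee_wpmul2l => //; rewrite lee_fin ltW.
Qed.

Lemma qnormK t : 0 < t -> qnorm nul (K t).
Proof.
move=> t0; split.
- by move=> u; exact: K_ge0.
- apply/eqP; rewrite eq_le K_ge0// andbT.
  have := @K_le_parts t 0 0 0 0 t0.
  by rewrite !addr0 mulr0 addr0 (qn_zero q0) (qn_zero q1); apply.
- have [k0 k01 h0] := qn_add q0; have [k1 k11 h1] := qn_add q1.
  have k00 : 0 < k0 by exact: lt_le_trans k01.
  have k10 : 0 < k1 by exact: lt_le_trans k11.
  exists (2 * (k0 + k1)); first by lra.
  move=> u v c c0 uc vc.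
  have cc : (c%:E < (2 * c)%:E)%E by rewrite lte_fin; lra.
  have c2 : 0 < 2 * c by lra.
  have c2t : 0 < 2 * c / t by rewrite divr_gt0.
  have [a [b [<- a0 b1]]] := K_lt_parts t0 (le_lt_trans uc cc).
  have [a' [b' [<- a0' b1']]] := K_lt_parts t0 (le_lt_trans vc cc).
  rewrite addrACA.
  apply: (le_trans (K_le_parts t0 (h0 _ _ _ c2 a0 a0') (h1 _ _ _ c2t b1 b1'))).
  rewrite lee_fin le_eqVlt; apply/orP; left; apply/eqP.
  by field; rewrite gt_eqF.
- move=> k u c c0 uc; apply: lee_addgt0 => e e0.
  have k0 : 0 <= cabs k by exact: Re_norm_ge0.
  have d0 : 0 < e / (cabs k + 1) by rewrite divr_gt0// ltr_wpDl.
  have /K_lt[a [b [<- ab]]] : (K t u < (c + e / (cabs k + 1))%:E)%E.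
    by apply: (le_lt_trans uc); rewrite lte_fin ltrDl.
  have a0 := qn_ge0 q0 a; have b0 := qn_ge0 q1 b.
  have [||x x0 ax] := @fin_bound _ (N0 a) => //.
    by apply: le_lt_trans (ltry _); apply: le_trans (ltW ab); rewrite leeDl// N1t_ge0.
  have [||y y0 byy] := @fin_bound _ (N1 b) => //.
    apply: (ltey_pmull t0 b0).
    by apply: le_lt_trans (ltry _); apply: le_trans (ltW ab); rewrite leeDr.
  rewrite scalerDr; apply: (le_trans (K_le_parts t0 (qn_scale q0 k x0 _) (qn_scale q1 k y0 _))).
  + by rewrite ax.
  + by rewrite byy.
  move: ab; rewrite ax byy -EFinM -EFinD lte_fin lee_fin => ab.
  rewrite mulrCA -mulrDr.
  apply: (@le_trans _ _ (cabs k * (c + e / (cabs k + 1)))).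
    by rewrite ler_wpM2l// ltW.
  rewrite mulrDr lerD2l mulrCA -[leRHS]mulr1 ler_wpM2l ?(ltW e0)//.
  by rewrite ler_pdivrMr ?mul1r ?lerDl// ltr_wpDl.
- move=> u n nn; apply: le_ereal_inf_tmp => _ [[a b] /= <- <-].
  rewrite addrAC; apply: (le_trans (K_le _ _ _)).
  by rewrite leeD2r//; exact: (qn_null q0).
Qed.

Lemma K_comparable s t u c : 0 < s -> 0 < t -> 0 <= c ->
  (K s u <= c%:E)%E -> (K t u <= (Num.max 1 (t / s) * c)%:E)%E.
Proof.
move=> s0 t0 c0 uc; apply: lee_addgt0 => e e0.
set m := Num.max _ _; have m1 : 1 <= m by rewrite le_max lexx.
have ms : t <= m * s by rewrite -ler_pdivrMr// le_max lexx orbT.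
have m0 : 0 < m by exact: lt_le_trans m1.
have d0 : 0 < e / m by rewrite divr_gt0.
have /K_lt[a [b [<- ab]]] : (K s u < (c + e / m)%:E)%E.
  by apply: (le_lt_trans uc); rewrite lte_fin ltrDl.
apply: (le_trans (K_le _ _ _)).
apply: (@le_trans _ _ (m%:E * (c + e / m)%:E)%E); last first.
  by rewrite -EFinM lee_fin mulrDr [m * (e / m)]mulrC divfK ?gt_eqF.
apply: le_trans (lee_wpmul2l _ (ltW ab)); last by rewrite lee_fin ltW.
have a0 := qn_ge0 q0 a; have b0 := qn_ge0 q1 b.
rewrite ge0_muleDr//; last exact: N1t_ge0.
apply: leeD; first by rewrite -[leLHS]mul1e lee_wpmul2r ?lee_fin.
by rewrite muleA -EFinM lee_wpmul2r ?lee_fin.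
Qed.

Lemma K_lty s t u : 0 < s -> 0 < t -> (K s u < +oo)%E -> (K t u < +oo)%E.
Proof.
move=> s0 t0 uy; have [c c0 uc] := fin_bound (K_ge0 u s0) uy.
apply: le_lt_trans (K_comparable s0 t0 c0 _) (ltry _).
by rewrite uc.
Qed.

Lemma K_nondecreasing s t u : 0 < s -> s <= t -> (K s u <= K t u)%E.
Proof.
move=> s0 st; have t0 : 0 < t by exact: lt_le_trans st.
apply: le_ereal_inf_tmp => _ [[a b] /= <- <-].
apply: (le_trans (K_le _ _ _)); rewrite leeD2l// lee_wpmul2r ?lee_fin//.
exact: (qn_ge0 q1).
Qed.

Lemma sum_norm_le0 u : (sum_norm N0 N1 u <= N0 u)%E.
Proof.
have := K_le 1 u 0; rewrite addr0 (qn_zero q1) mule0 adde0; exact.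
Qed.

Lemma sum_norm_le1 u : (sum_norm N0 N1 u <= N1 u)%E.
Proof.
have := K_le 1 0 u; rewrite add0r (qn_zero q0) mul1e add0e; exact.
Qed.

Lemma sum_normP u : (sum_norm N0 N1 u < +oo)%E ->
  exists a b, [/\ a + b = u, (N0 a < +oo)%E & (N1 b < +oo)%E].
Proof.
move=> uy; have [c c0 uc] := fin_bound (K_ge0 u ltr01) uy.
have /(K_lt_parts ltr01)[a [b [ab ac bc]]] : (K 1 u < (c + 1)%:E)%E.
  by rewrite uc lte_fin ltrDl.
by exists a, b; split => //; [exact: le_lt_trans ac (ltry _)|exact: le_lt_trans bc (ltry _)].
Qed.

End Couple.

(** Apply [S] to both parts of a decomposition; the defect of additivity is a null
    element and may be added to the first part. *)
Lemma bounded_mapK (X0 X1 Y0 Y1 : F -> \bar R) (S : F -> F) C t :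
  qnorm nul X0 -> qnorm nul X1 -> qnorm nul Y0 -> qnorm nul Y1 ->
  0 < C -> 0 < t -> linear_mod nul (sum_norm Y0 Y1) S ->
  bounded_map Y0 X0 S C -> bounded_map Y1 X1 S C ->
  bounded_map (Kfunctional Y0 Y1 t) (Kfunctional X0 X1 t) S C.
Proof.
move=> qX0 qX1 qY0 qY1 C0 t0 lS b0 b1 u c c0 uc; apply: lee_addgt0 => e e0.
have d0 : 0 < e / C by rewrite divr_gt0.
have /K_lt[a [b [<- ab]]] : (Kfunctional Y0 Y1 t u < (c + e / C)%:E)%E.
  by apply: (le_lt_trans uc); rewrite lte_fin ltrDl.
have a0 := qn_ge0 qY0 a; have bb0 := qn_ge0 qY1 b.
have ay : (Y0 a < +oo)%E.
  apply: le_lt_trans (ltry _); apply: le_trans (ltW ab).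
  by rewrite leeDl// mule_ge0// lee_fin ltW.
have by_ : (Y1 b < +oo)%E.
  apply: (ltey_pmull t0 bb0).
  by apply: le_lt_trans (ltry _); apply: le_trans (ltW ab); rewrite leeDr.
have [x x0 ax] := fin_bound a0 ay; have [y y0 bx] := fin_bound bb0 by_.
have nn := lS 1 a b (le_lt_trans (sum_norm_le0 _ qY1 a) ay) (le_lt_trans (sum_norm_le1 _ qY0 b) by_).
rewrite !scale1r in nn.
have -> : S (a + b) = (S a + (S (a + b) - (S a + S b))) + S b.
  by rewrite addrAC [RHS]addrC subrK.
apply: (le_trans (K_le_parts (c := C * x) (d := C * y) t0 _ _)).
- apply: le_trans (qn_null qX0 _ nn) _; apply: b0 => //; by rewrite ax.
- by apply: b1 => //; rewrite bx.
move: ab; rewrite ax bx -EFinM -EFinD lte_fin lee_fin => ab.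
rewrite mulrCA -mulrDr; apply: (@le_trans _ _ (C * (c + e / C))).
  by rewrite ler_wpM2l ?(ltW C0)// ltW.
by rewrite mulrDr [C * (e / C)]mulrC divfK ?gt_eqF.
Qed.

Lemma small_K (X0 X1 Y0 Y1 : F -> \bar R) (S : R -> F -> F) t u :
  qnorm nul X0 -> qnorm nul X1 -> qnorm nul Y0 -> qnorm nul Y1 -> 0 < t ->
  (forall h, 0 < h -> linear_mod nul (sum_norm Y0 Y1) (S h)) ->
  (forall v, (Y0 v < +oo)%E -> small 0^'+ X0 (S^~ v)) ->
  (forall v, (Y1 v < +oo)%E -> small 0^'+ X1 (S^~ v)) ->
  (sum_norm Y0 Y1 u < +oo)%E -> small 0^'+ (Kfunctional X0 X1 t) (S^~ u).
Proof.
move=> qX0 qX1 qY0 qY1 t0 lS s0 s1 /(sum_normP qY0 qY1)[a [b [<- ay by_]]] e e0.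
have e2 : 0 < e / 2 by rewrite divr_gt0.
have e2t : 0 < e / 2 / t by rewrite divr_gt0.
have hp : \forall h \near (0 : R)^'+, 0 < h by exact: nbhs_right_gt.
apply: filterS3 hp (s0 _ ay _ e2) (s1 _ by_ _ e2t) => h h0 ha hb.
have nn := lS h h0 1 a b (le_lt_trans (sum_norm_le0 _ qY1 a) ay) (le_lt_trans (sum_norm_le1 _ qY0 b) by_).
rewrite !scale1r in nn.
have -> : S h (a + b) = (S h a + (S h (a + b) - (S h a + S h b))) + S h b.
  by rewrite addrAC [RHS]addrC subrK.
apply: (le_trans (K_le_parts t0 (le_trans (qn_null qX0 _ nn) ha) hb)).
by rewrite lee_fin [t * _]mulrC divfK ?gt_eqF// -splitr.
Qed.

Section RealMethod.
Variables (theta p : R) (p1 : 1 <= p).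
Notation leb := (@lebesgue_measure R).
Let p0 : 0 < p. Proof. exact: lt_le_trans p1. Qed.

Definition Kmodular N0 N1 u : \bar R :=
  (\int[leb]_(t in `]0%R, +oo[)
      (((t `^ (- theta))%:E * Kfunctional N0 N1 t u) `^ p * (t^-1)%:E))%E.

Let integrand_ge0 N0 N1 u t : 0 < t ->
  (0 <= ((t `^ (- theta))%:E * Kfunctional N0 N1 t u) `^ p * (t^-1)%:E)%E.
Proof. by move=> t0; rewrite mule_ge0 ?poweR_ge0// lee_fin invr_ge0 ltW. Qed.

Lemma Kmodular_ge0 N0 N1 u : (0 <= Kmodular N0 N1 u)%E.
Proof.
apply: integral_ge0 => t; rewrite /= in_itv/= andbT => t0.
exact: integrand_ge0.
Qed.

Lemma real_leP N0 N1 u c : 0 <= c ->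
  (real_interpolation N0 N1 theta p u <= c%:E)%E <-> (Kmodular N0 N1 u <= (c `^ p)%:E)%E.
Proof. by move=> c0; apply: poweR_leP => //; exact: Kmodular_ge0. Qed.

Lemma real_lty N0 N1 u : (real_interpolation N0 N1 theta p u < +oo)%E <-> (Kmodular N0 N1 u < +oo)%E.
Proof.
split => h.
  have [c c0 uc] := fin_bound (poweR_ge0 _ _) h.
  apply: le_lt_trans (ltry (c `^ p)); apply/real_leP => //.
  by rewrite -uc.
have [c c0 uc] := fin_bound (Kmodular_ge0 _ _ _) h.
apply: le_lt_trans (ltry (c `^ p^-1)); apply/real_leP; first exact: powR_ge0.
by rewrite uc -powRrM mulVf ?gt_eqF// powRr1.
Qed.

Lemma Kmodular_mono M0 M1 N0 N1 u v :
  (forall t, 0 < t -> (0 <= Kfunctional M0 M1 t u)%E) ->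
  (forall t, 0 < t -> (Kfunctional M0 M1 t u <= Kfunctional N0 N1 t v)%E) ->
  (Kmodular M0 M1 u <= Kmodular N0 N1 v)%E.
Proof.
move=> u0 uv; apply: le_nnintegral => //.
  move=> t; rewrite /= in_itv/= andbT => t0.
  exact: integrand_ge0.
move=> t; rewrite /= in_itv/= andbT => t0.
apply: lee_wpmul2r; first by rewrite lee_fin invr_ge0 ltW.
have tt : (0 <= (t `^ (- theta))%:E)%E by rewrite lee_fin powR_ge0.
apply: gt0_ler_poweR; rewrite ?in_itv/= ?leey ?andbT ?mule_ge0 ?(ltW p0) ?u0//.
  exact: le_trans (u0 _ t0) (uv _ t0).
by apply: lee_wpmul2l => //; exact: uv.
Qed.

Section Couple.
Variables (N0 N1 : F -> \bar R) (q0 : qnorm nul N0) (q1 : qnorm nul N1).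
Local Notation K := (Kfunctional N0 N1).

(** For elements of the sum, [K t u] is finite and nondecreasing in [t], hence Borel. *)
Definition kfun u t : R := if 0 < t then fine (K t u) else 0.

Lemma kfunE u t : (sum_norm N0 N1 u < +oo)%E -> 0 < t -> K t u = (kfun u t)%:E.
Proof.
move=> uy t0; rewrite /kfun t0 fineK// ge0_fin_numE ?K_ge0//.
exact: (K_lty q0 q1 ltr01 t0 uy).
Qed.

Lemma kfun_ge0 u t : 0 <= kfun u t.
Proof. by rewrite /kfun; case: ifPn => // t0; apply: fine_ge0; exact: K_ge0. Qed.

Lemma measurable_kfun u : (sum_norm N0 N1 u < +oo)%E ->
  measurable_fun [set: measurableTypeR R] (kfun u).
Proof.
move=> uy; apply: nondecreasing_measurable => // s t st.
have [s0|s0] := ltP 0 s; last by rewrite {1}/kfun ltNge s0 kfun_ge0.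
have t0 : 0 < t by exact: lt_le_trans st.
by rewrite -lee_fin -!kfunE//; exact: K_nondecreasing.
Qed.

Definition kint u t : R := (t `^ (- theta) * kfun u t) `^ p * t `^ (- 1).

Lemma measurable_kint u : (sum_norm N0 N1 u < +oo)%E ->
  measurable_fun [set: measurableTypeR R] (fun t => (kint u t)%:E).
Proof.
move=> uy; apply/measurable_EFinP; apply: measurable_funM; last exact: measurable_powR.
apply: (@measurableT_comp _ _ _ _ _ _ (fun x : R => x `^ p)); first exact: measurable_powR.
apply: measurable_funM; last exact: measurable_kfun.
exact: measurable_powR.
Qed.

Lemma kint_ge0 u t : 0 <= kint u t.
Proof. by rewrite mulr_ge0 ?powR_ge0. Qed.

Lemma KmodularE u : (sum_norm N0 N1 u < +oo)%E ->
  Kmodular N0 N1 u = (\int[leb]_(t in `]0%R, +oo[) (kint u t)%:E)%E.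
Proof.
move=> uy; apply: eq_integral => t; rewrite inE/= in_itv/= andbT => t0.
by rewrite (kfunE uy t0) -(EFinM (t `^ (- theta))) poweR_EFin /kint powR_inv1// ltW.
Qed.

(** The part of the integral over [[1, 2]] controls [K 1 u], because [K] is nondecreasing in [t]; the
    maximum with [2 `^ theta] covers both signs of [theta]. *)
Lemma real_sum_norm : exists2 C, 0 < C & forall u c, 0 <= c ->
  (real_interpolation N0 N1 theta p u <= c%:E)%E -> (sum_norm N0 N1 u <= (C * c)%:E)%E.
Proof.
pose m := Num.max 1 (2 `^ theta) * 2 `^ p^-1.
have m0 : 0 < m by rewrite mulr_gt0 ?powR_gt0// lt_max ltr01.
exists m => // u c c0 /(real_leP _ _ _ c0) uc.
have key (x : R) : 0 <= x -> (x%:E <= sum_norm N0 N1 u)%E -> x <= m * c.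
  move=> x0 xu.
  have h : (((x / Num.max 1 (2 `^ theta)) `^ p / 2)%:E <= (c `^ p)%:E)%E.
    apply: le_trans uc.
    have -> : ((x / Num.max 1 (2 `^ theta)) `^ p / 2)%:E =
       (\int[leb]_(t in `[1%R, 2%R]) (cst ((x / Num.max 1 (2 `^ theta)) `^ p / 2)%:E t))%E.
      rewrite integral_cst// [X in (_ * X)%E](_ : _ = leb `[1%R, 2%R])// leb_itv ?ler1n//.
      by rewrite -EFinM [2 - 1](_ : _ = 1) ?mulr1//; ring.
    apply: (@le_trans _ _ (\int[leb]_(t in `[1%R, 2%R])
        (((t `^ (- theta))%:E * K t u) `^ p * (t^-1)%:E))%E); last first.
      apply: subset_nnintegral => //.
        by move=> t; rewrite /= !in_itv/= andbT => /andP[t1 _]; exact: lt_le_trans t1.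
      move=> t; rewrite /= in_itv/= andbT => t0.
      exact: integrand_ge0.
    apply: le_nnintegral => //.
      move=> t _; rewrite lee_fin mulr_ge0 ?powR_ge0//.
    move=> t; rewrite /= in_itv/= => /andP[t1 t2].
    have t0 : 0 < t by exact: lt_le_trans t1.
    rewrite EFinM; apply: lee_pmul.
    - by rewrite lee_fin powR_ge0.
    - by rewrite lee_fin.
    - rewrite -poweR_EFin; apply: gt0_ler_poweR; rewrite ?in_itv/= ?leey ?andbT ?(ltW p0)//.
      + by rewrite lee_fin divr_ge0// le_max ler01.
      + by rewrite mule_ge0 ?lee_fin ?powR_ge0//; exact: K_ge0.
      rewrite mulrC EFinM; apply: lee_pmul.
      + by rewrite lee_fin invr_ge0 le_max ler01.
      + by rewrite lee_fin.
      + rewrite lee_fin powRN lef_pV2 ?posrE ?powR_gt0 ?lt_max ?ltr01//.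
        rewrite le_max; have [th|th] := leP 0 theta.
          by rewrite orbC ge0_ler_powR ?nnegrE// ltW.
        apply/orP; left; rewrite -[leRHS](powRr0 t) ler_powR//; exact: ltW.
      + by apply: (le_trans xu); exact: K_nondecreasing.
    - by rewrite lee_fin lef_pV2 ?posrE.
  have M0 : 0 < Num.max 1 (2 `^ theta) :> R by rewrite lt_max ltr01.
  move: h; rewrite lee_fin ler_pdivrMr// => h.
  rewrite /m -mulrA mulrC -ler_pdivrMr//.
  have xm0 : 0 <= x / Num.max 1 (2 `^ theta) by rewrite divr_ge0// ltW.
  rewrite leNgt; apply/negP => hlt.
  have c20 : 0 <= 2 `^ p^-1 * c by rewrite mulr_ge0 ?powR_ge0.
  have := gt0_ltr_powR p0 _ _ hlt; rewrite !nnegrE => /(_ c20 xm0).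
  rewrite powRM ?powR_ge0// -powRrM mulVf ?gt_eqF// powRr1//.
  by rewrite mulrC ltNge h.
have [uy|] := boolP (sum_norm N0 N1 u < +oo)%E.
  have [x x0] := fin_bound (K_ge0 q0 q1 u ltr01) uy; rewrite -/(sum_norm N0 N1 u) => ux.
  by rewrite ux lee_fin; apply: key => //; rewrite ux.
rewrite -leNgt leye_eq => /eqP uy; exfalso.
have := key (m * c + 1) _ _; rewrite uy leey => /(_ _ isT).
by rewrite gerDl ler10 => h; have := h (addr_ge0 (mulr_ge0 (ltW m0) c0) ler01).
Qed.

Lemma real_zero : real_interpolation N0 N1 theta p 0 = 0%E.
Proof.
apply/eqP; rewrite eq_le poweR_ge0 andbT; apply/real_leP => //.
rewrite powR0 ?gt_eqF// /Kmodular integral0_eq// => t; rewrite /= in_itv/= andbT => t0.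
by rewrite (qn_zero (qnormK q0 q1 t0)) mule0 poweR0r ?gt_eqF// mul0e.
Qed.

Lemma real_null u n : nul n ->
  (real_interpolation N0 N1 theta p (u + n)%R <= real_interpolation N0 N1 theta p u)%E.
Proof.
move=> nn; have [|] := boolP (real_interpolation N0 N1 theta p u < +oo)%E; last first.
  by rewrite -leNgt leye_eq => /eqP ->; rewrite leey.
move=> /(fin_bound (poweR_ge0 _ _))[c c0 uc]; rewrite [leRHS]uc.
apply/real_leP => //; have /(real_leP _ _ _ c0) : (real_interpolation N0 N1 theta p u <= c%:E)%E by rewrite -uc.
apply: le_trans; apply: Kmodular_mono => t t0; first exact: K_ge0.
exact: (qn_null (qnormK q0 q1 t0)).
Qed.

Lemma real_sum_lty u : (real_interpolation N0 N1 theta p u < +oo)%E ->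
  (sum_norm N0 N1 u < +oo)%E.
Proof.
move=> /(fin_bound (poweR_ge0 _ _))[c c0 uc]; have [C C0 h] := real_sum_norm.
by apply: le_lt_trans (ltry (C * c)); apply: h => //; rewrite -uc.
Qed.

Lemma real_add_lty u v : (real_interpolation N0 N1 theta p u < +oo)%E ->
  (real_interpolation N0 N1 theta p v < +oo)%E ->
  (real_interpolation N0 N1 theta p (u + v)%R < +oo)%E.
Proof.
move=> uy vy; have us := real_sum_lty uy; have vs := real_sum_lty vy.
have uvs : (sum_norm N0 N1 (u + v)%R < +oo)%E.
  by have := qn_lin_lty 1 (qnormK q0 q1 ltr01) us vs; rewrite scale1r.
apply/real_lty; move/real_lty : uy; move/real_lty : vy.
rewrite (KmodularE us) (KmodularE vs) (KmodularE uvs) => vy uy.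
have [k0 k01 h0] := qn_add q0; have [k1 k11 h1] := qn_add q1.
pose k := k0 + k1.
have kk : 0 <= k by rewrite /k; lra.
have hK t : 0 < t -> kfun (u + v) t <= k * (kfun u t + kfun v t).
  move=> t0; rewrite -lee_fin -kfunE//; apply: lee_addgt0 => e e0.
  have d0 : 0 < e / (k + 1) / 2 by rewrite !divr_gt0// ltr_wpDl.
  set d := e / _ / _ in d0.
  have /K_lt[a [b [ab abu]]] : (K t u < (kfun u t + d)%:E)%E by rewrite kfunE// lte_fin ltrDl.
  have /K_lt[a' [b' [ab' abv]]] : (K t v < (kfun v t + d)%:E)%E by rewrite kfunE// lte_fin ltrDl.
  have fin (N : F -> \bar R) x y z : (0 <= N x)%E -> (0 <= y)%E -> (N x + y < z%:E)%E ->
      exists2 r : R, 0 <= r & N x = r%:E.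
    move=> Nx y0 h; apply: fin_bound => //; apply: le_lt_trans (ltry z).
    by apply: le_trans (ltW h); rewrite leeDl.
  have fin1 x y z : (0 <= y)%E -> (y + t%:E * N1 x < z%:E)%E ->
      exists2 r : R, 0 <= r & N1 x = r%:E.
    move=> y0 h; apply: (fin_bound (qn_ge0 q1 x)); apply: (ltey_pmull t0 (qn_ge0 q1 x)).
    by apply: le_lt_trans (ltry z); apply: le_trans (ltW h); rewrite leeDr.
  have tN1_ge0 z : (0 <= t%:E * N1 z)%E by rewrite mule_ge0 ?lee_fin ?(ltW t0)//; exact: (qn_ge0 q1).
  have [x x0 ax] := fin N0 _ _ _ (qn_ge0 q0 a) (tN1_ge0 b) abu.
  have [x' x0' ax'] := fin N0 _ _ _ (qn_ge0 q0 a') (tN1_ge0 b') abv.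
  have [y y0 byy] := fin1 _ _ _ (qn_ge0 q0 a) abu.
  have [y' y0' byy'] := fin1 _ _ _ (qn_ge0 q0 a') abv.
  have add N kk0 r r' w w' : (forall u v c, 0 < c -> (N u <= c%:E)%E -> (N v <= c%:E)%E ->
      (N (u + v)%R <= (kk0 * c)%:E)%E) -> 1 <= kk0 -> 0 <= r -> 0 <= r' ->
      N w = r%:E -> N w' = r'%:E -> (N (w + w')%R <= (kk0 * (r + r'))%:E)%E.
    move=> hN kk1 r0 r0' wr wr'; apply: lee_addgt0 => e' e0'.
    have kk00 : 0 < kk0 by exact: lt_le_trans kk1.
    have ek : 0 < e' / kk0 by rewrite divr_gt0.
    have := hN w w' (r + r' + e' / kk0); rewrite mulrDr [kk0 * (e' / _)]mulrC divfK ?gt_eqF//.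
    apply; first by rewrite ltr_wpDl// addr_ge0.
      by rewrite wr lee_fin -addrA lerDl addr_ge0// ltW.
    by rewrite wr' lee_fin [r + _]addrC -addrA lerDl addr_ge0// ltW.
  rewrite -ab -ab' addrACA.
  apply: (le_trans (K_le_parts t0 (add N0 _ _ _ _ _ h0 k01 x0 x0' ax ax') (add N1 _ _ _ _ _ h1 k11 y0 y0' byy byy'))).
  move: abu abv; rewrite ax ax' byy byy' -!EFinM -!EFinD !lte_fin lee_fin => abu abv.
  apply: (@le_trans _ _ (k * (kfun u t + kfun v t + 2 * d))).
    apply: (@le_trans _ _ (k * (x + x' + t * (y + y')))).
      have P0 : 0 <= t * (y + y') by rewrite mulr_ge0 ?addr_ge0// ltW.
      have Q0 : 0 <= x + x' by rewrite addr_ge0.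
      rewrite [t * (k1 * _)]mulrCA [leRHS]mulrDr.
      by apply: lerD; rewrite ler_wpM2r// /k; lra.
    rewrite ler_wpM2l//; lra.
  rewrite ab ab' mulrDr lerD2l /d [2 * _]mulrC divfK// mulrCA -[leRHS]mulr1 ler_wpM2l ?(ltW e0)//.
  by rewrite ler_pdivrMr ?mul1r ?lerDl// ltr_wpDl.
clearbody k.
have mI : measurable (`]0, +oo[ : set (measurableTypeR R)) by exact: measurable_itv.
apply: (@le_lt_trans _ _ (\int[leb]_(t in `]0%R, +oo[)
   ((k `^ p * 2 `^ p)%:E * ((kint u t)%:E + (kint v t)%:E)))%E).
  apply: le_nnintegral; first exact: mI.
    by move=> t _; rewrite lee_fin kint_ge0.
  move=> t; rewrite /= in_itv/= andbT => t0; rewrite -EFinD -EFinM lee_fin /kint.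
  rewrite -mulrDl mulrA ler_wpM2r ?powR_ge0//.
  set A := t `^ _; have A0 : 0 <= A by exact: powR_ge0.
  apply: (@le_trans _ _ ((k * (A * kfun u t + A * kfun v t)) `^ p)).
    apply: ge0_ler_powR; rewrite ?nnegrE ?(ltW p0)// ?mulr_ge0 ?addr_ge0 ?mulr_ge0 ?kfun_ge0//.
    by rewrite -mulrDr mulrCA ler_wpM2l// hK.
  rewrite powRM// ?addr_ge0 ?mulr_ge0 ?kfun_ge0// -mulrA ler_wpM2l ?powR_ge0//.
  by apply: powR_addr_le; rewrite ?mulr_ge0 ?kfun_ge0// ltW.
have mu' := measurable_kint us; have mv' := measurable_kint vs.
rewrite nnintegralZ; last 4 first.
- exact: mI.
- by rewrite mulr_ge0 ?powR_ge0.
- by move=> t _; rewrite -EFinD lee_fin addr_ge0 ?kint_ge0.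
- exists (fun t => ((kint u t)%:E + (kint v t)%:E)%E); last exact: aeW.
  exact: (emeasurable_funD mu' mv').
rewrite nnintegralD; last 5 first.
- exact: mI.
- by move=> t _; rewrite lee_fin kint_ge0.
- by move=> t _; rewrite lee_fin kint_ge0.
- by exists (fun t => (kint u t)%:E); [exact: mu'|exact: aeW].
- by exists (fun t => (kint v t)%:E); [exact: mv'|exact: aeW].
apply: lte_mul_pinfty; rewrite ?lee_fin ?mulr_ge0 ?powR_ge0//.
exact: (lte_add_pinfty uy vy).
Qed.

End Couple.

Section Maps.
Variables (X0 X1 Y0 Y1 : F -> \bar R) (qX0 : qnorm nul X0) (qX1 : qnorm nul X1)
  (qY0 : qnorm nul Y0) (qY1 : qnorm nul Y1).

Lemma real_map (S : F -> F) C : 0 < C -> linear_mod nul (sum_norm Y0 Y1) S ->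
  bounded_map Y0 X0 S C -> bounded_map Y1 X1 S C ->
  bounded_map (real_interpolation Y0 Y1 theta p) (real_interpolation X0 X1 theta p) S C.
Proof.
move=> C0 lS b0 b1 u c c0 uc.
have us : (sum_norm Y0 Y1 u < +oo)%E.
  by apply: (real_sum_lty qY0 qY1); exact: le_lt_trans uc (ltry _).
have bK t (t0 : 0 < t) := bounded_mapK qX0 qX1 qY0 qY1 C0 t0 lS b0 b1.
have Ss : (sum_norm X0 X1 (S u) < +oo)%E.
  have [d d0 ud] := fin_bound (K_ge0 qY0 qY1 u ltr01) us.
  by apply: le_lt_trans (bK 1 ltr01 u d d0 _) (ltry _); rewrite -ud.
have C1 : 0 <= C * c by rewrite mulr_ge0// ltW.
move/(real_leP _ _ _ c0) : uc => uc; apply/real_leP => //.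
rewrite powRM ?(ltW C0)// EFinM; apply: le_trans (lee_wpmul2l _ uc); last first.
  by rewrite lee_fin powR_ge0.
rewrite (KmodularE qX0 qX1)// (KmodularE qY0 qY1)//.
rewrite -nnintegralZ; last 4 first.
- exact: measurable_itv.
- exact: powR_ge0.
- by move=> t _; rewrite lee_fin kint_ge0.
- exists (fun t => (kint Y0 Y1 u t)%:E); last exact: aeW.
  exact: (measurable_kint qY0 qY1 us).
apply: le_nnintegral; first exact: measurable_itv.
  by move=> t _; rewrite lee_fin kint_ge0.
move=> t; rewrite /= in_itv/= andbT => t0; rewrite -EFinM lee_fin /kint mulrA.
rewrite ler_wpM2r ?powR_ge0// -powRM ?(ltW C0) ?mulr_ge0 ?powR_ge0 ?(kfun_ge0 qY0 qY1)//.
apply: ge0_ler_powR; rewrite ?nnegrE ?(ltW p0)//.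
- by rewrite mulr_ge0 ?powR_ge0 ?(kfun_ge0 qX0 qX1).
- by rewrite !mulr_ge0 ?(ltW C0) ?powR_ge0 ?(kfun_ge0 qY0 qY1).
rewrite mulrCA ler_wpM2l ?powR_ge0// -lee_fin -(kfunE qX0 qX1)//.
by apply: bK => //; [exact: (kfun_ge0 qY0 qY1)|rewrite -(kfunE qY0 qY1)].
Qed.

(** For each [t] the K-functional of [S h u] tends to [0], and it is at most [C] times
    that of [u], so dominated convergence applies. *)
Lemma real_strong (S : R -> F -> F) C u : 0 < C ->
  (forall h, 0 < h -> linear_mod nul (sum_norm Y0 Y1) (S h)) ->
  (forall h, 0 < h -> h <= 1 -> bounded_map Y0 X0 (S h) C) ->
  (forall h, 0 < h -> h <= 1 -> bounded_map Y1 X1 (S h) C) ->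
  (forall v, (Y0 v < +oo)%E -> small 0^'+ X0 (S^~ v)) ->
  (forall v, (Y1 v < +oo)%E -> small 0^'+ X1 (S^~ v)) ->
  (real_interpolation Y0 Y1 theta p u < +oo)%E ->
  small 0^'+ (real_interpolation X0 X1 theta p) (S^~ u).
Proof.
move=> C0 lS b0 b1 s0 s1 uy e e0.
have us := real_sum_lty qY0 qY1 uy.
have mI : measurable (`]0, +oo[ : set (measurableTypeR R)) by exact: measurable_itv.
have [//|hN] := pselect (\forall h \near 0^'+, (real_interpolation X0 X1 theta p (S h u) <= e%:E)%E).
(* Dominated convergence is about sequences: a family that does not converge fails along
   a sequence of steps. *)
have [h hh] : exists h : nat -> R, forall n : nat, [/\ 0 < h n, h n < n.+1%:R^-1 &
    ~ (real_interpolation X0 X1 theta p (S (h n) u) <= e%:E)%E].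
  suff : forall n : nat, exists h : R, [/\ 0 < h, h < n.+1%:R^-1 &
      ~ (real_interpolation X0 X1 theta p (S h u) <= e%:E)%E].
    by move=> /(@choice _ _) [h hh]; exists h.
  move=> n; apply: contra_notP hN => hn.
  have n0 : (0 : R) < n.+1%:R^-1 by rewrite invr_gt0.
  have hp : \forall h \near (0 : R)^'+, 0 < h by exact: nbhs_right_gt.
  apply: filterS2 hp (nbhs_right_lt n0) => h h0 h1.
  by apply: contrapT => hh; apply: hn; exists h.
have h0 n : 0 < h n by have [] := hh n.
have h1 n : h n <= 1.
  by have [_ /ltW hn _] := hh n; apply: (le_trans hn); rewrite invf_le1// ler1n.
have bK n t (t0 : 0 < t) := bounded_mapK qX0 qX1 qY0 qY1 C0 t0 (lS _ (h0 n)) (b0 _ (h0 n) (h1 n)) (b1 _ (h0 n) (h1 n)).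
have Ss n : (sum_norm X0 X1 (S (h n) u) < +oo)%E.
  have [d d0 ud] := fin_bound (K_ge0 qY0 qY1 u ltr01) us.
  by apply: le_lt_trans (bK n 1 ltr01 u d d0 _) (ltry _); rewrite -ud.
have := @dominated_convergence _ _ _ leb `]0%R, +oo[%classic mI
  (fun n t => (kint X0 X1 (S (h n) u) t)%:E) (cst 0%E)
  (fun t => ((C `^ p)%:E * (kint Y0 Y1 u t)%:E)%E).
case.
- by move=> n; apply: measurable_funTS; exact: (measurable_kint qX0 qX1).
- exact: measurable_cst.
- apply: aeW => t; rewrite /= in_itv/= andbT => t0.
  have kp := nbhs_right_gt (0 : R).
  apply/cvge0P; first by move=> n; rewrite lee_fin kint_ge0.
  move=> d d0.
  pose A := t `^ (- theta); pose B := t `^ (- 1).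
  have A0 : 0 < A by rewrite powR_gt0.
  have B0 : 0 < B by rewrite powR_gt0.
  have d1 : 0 < (d / B) `^ p^-1 / A by rewrite divr_gt0// powR_gt0 ?divr_gt0.
  have [r /= r0 hr] := small_K qX0 qX1 qY0 qY1 t0 lS s0 s1 us d1.
  have hcvg : \forall n \near \oo, n.+1%:R^-1 <= r.
    near=> n; rewrite -[leRHS]invrK lef_pV2 ?posrE ?invr_gt0//.
    apply: (@le_trans _ _ n%:R); last by rewrite ler_nat.
    near: n; exact: nbhs_infty_ger.
  apply: filterS hcvg => n hn.
  have : (Kfunctional X0 X1 t (S (h n) u) <= ((d / B) `^ p^-1 / A)%:E)%E.
    apply: hr; last exact: h0.
    rewrite /= sub0r normrN gtr0_norm//; have [_ h2 _] := hh n.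
    exact: lt_le_trans h2 hn.
  rewrite (kfunE qX0 qX1)// lee_fin ler_pdivlMr// => hk.
  rewrite lee_fin /kint -/A -/B -ler_pdivlMr//.
  have dB : 0 <= d / B by rewrite divr_ge0 ?ltW.
  rewrite -[leRHS]powRr1// -(mulVf (lt0r_neq0 p0)) powRrM.
  apply: ge0_ler_powR; rewrite ?nnegrE ?powR_ge0 ?(ltW p0)//.
    by rewrite mulr_ge0 ?(kfun_ge0 qX0 qX1)// ltW.
  by rewrite mulrC.
- apply/integrableP; split.
    apply: measurable_funTS; apply: emeasurable_funM; first exact: measurable_cst.
    exact: (measurable_kint qY0 qY1 us).
  apply: (@le_lt_trans _ _ (\int[leb]_(t in `]0%R, +oo[) ((C `^ p)%:E * (kint Y0 Y1 u t)%:E))%E).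
    apply: le_nnintegral; first exact: mI.
      by move=> t _; exact: abse_ge0.
    by move=> t _; rewrite gee0_abs// mule_ge0 ?lee_fin ?powR_ge0 ?kint_ge0.
  rewrite nnintegralZ; last 4 first.
  - exact: mI.
  - exact: powR_ge0.
  - by move=> t _; rewrite lee_fin kint_ge0.
  - exists (fun t => (kint Y0 Y1 u t)%:E); last exact: aeW.
    exact: (measurable_kint qY0 qY1 us).
  rewrite -(KmodularE qY0 qY1)//; apply: lte_mul_pinfty; rewrite ?lee_fin ?powR_ge0//.
  exact/real_lty.
- apply: aeW => t n; rewrite /= in_itv/= andbT => t0.
  rewrite ger0_norm ?kint_ge0// -EFinM lee_fin /kint mulrA.
  rewrite ler_wpM2r ?powR_ge0// -powRM ?(ltW C0) ?mulr_ge0 ?powR_ge0 ?(kfun_ge0 qY0 qY1)//.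
  apply: ge0_ler_powR; rewrite ?nnegrE ?(ltW p0)//.
  + by rewrite mulr_ge0 ?powR_ge0 ?(kfun_ge0 qX0 qX1).
  + by rewrite !mulr_ge0 ?(ltW C0) ?powR_ge0 ?(kfun_ge0 qY0 qY1).
  rewrite mulrCA ler_wpM2l ?powR_ge0// -lee_fin -(kfunE qX0 qX1)//.
  by apply: bK => //; [exact: (kfun_ge0 qY0 qY1)|rewrite -(kfunE qY0 qY1)].
move=> _ _; rewrite integral0 => /cvge0P hI.
have I0 n : (0 <= \int[leb]_(t in `]0%R, +oo[) (kint X0 X1 (S (h n) u) t)%:E)%E.
  by apply: integral_ge0 => t _; rewrite lee_fin kint_ge0.
have [n _ /(_ n (leqnn n)) /= hn] := hI I0 _ (powR_gt0 p e0).
exfalso; have [_ _] := hh n; apply; apply/real_leP; first exact: ltW.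
by rewrite (KmodularE qX0 qX1).
Unshelve. all: end_near. Qed.

End Maps.

End RealMethod.
End KMethod.

(** * The complex method *)

Section ComplexMethod.
Context {R : realType} {F : lmodType R[i]}.
Variable nul : F -> Prop.
Hypothesis nul0 : nul 0.
Hypothesis nul_lin : forall (k : R[i]) n m, nul n -> nul m -> nul (k *: n + m).
Implicit Types (N : F -> \bar R) (u v : F) (f g : R[i]^o -> F) (z w : R[i]^o) (t theta : R).

Lemma nulN n : nul n -> nul (- n).
Proof. by move=> nn; rewrite -[- n]addr0 -scaleN1r; exact: nul_lin. Qed.

Lemma nulD n m : nul n -> nul m -> nul (n + m).
Proof. by move=> nn nm; rewrite -[n]scale1r; exact: nul_lin. Qed.

Lemma qn_nul N n : qnorm nul N -> nul n -> N n = 0%E.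
Proof.
move=> qN nn; apply/eqP; rewrite eq_le (qn_ge0 qN) andbT.
by have := qn_null qN 0 nn; rewrite add0r (qn_zero qN).
Qed.

Lemma small_eq_mod {T : Type} (G : set_system T) {FG : Filter G} N (f g : T -> F) : qnorm nul N ->
  (\forall x \near G, nul (f x - g x)) -> small G N g -> small G N f.
Proof.
move=> qN fg sg e e0; apply: filterS2 fg (sg _ e0) => x fgx gx.
have -> : f x = g x + (f x - g x) by rewrite addrC subrK.
exact: le_trans (qn_null qN _ fgx) gx.
Qed.

Lemma bounded_small {T : Type} (G : set_system T) {FG : Filter G} N N' (S : F -> F) C (f : T -> F) :
  0 < C -> bounded_map N N' S C -> small G N f -> small G N' (fun x => S (f x)).
Proof.
move=> C0 bS sf e e0; have eC : 0 < e / C by rewrite divr_gt0.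
apply: filterS (sf _ eC) => x fx.
by have := bS _ _ (ltW eC) fx; rewrite mulrC divfK ?gt_eqF.
Qed.

Section LinearMod.
Variables (N : F -> \bar R) (S : F -> F).
Hypotheses (qN : qnorm nul N) (lS : linear_mod nul N S).

Lemma linear_modB a b : (N a < +oo)%E -> (N b < +oo)%E -> nul (S a - S b - S (a - b)).
Proof.
move=> ay by_; have := nulN (lS (-1) by_ ay).
by rewrite !scaleN1r opprB ![- _ + _]addrC.
Qed.

Lemma linear_mod_quotient k a b d : (N a < +oo)%E -> (N b < +oo)%E -> (N d < +oo)%E ->
  nul (k *: (S a - S b) - S d - S (k *: (a - b) - d)).
Proof.
move=> ay by_ dy; have aby := qn_linB qN ay by_.
have ky : (N (k *: (a - b))%R < +oo)%E.
  by have := qn_lin_lty k qN aby (_ : N 0 < +oo)%E; rewrite addr0; apply; rewrite (qn_zero qN).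
have h1 := linear_modB ky dy.
have h2 : nul (k *: (S a - S b) - S (k *: (a - b))).
  have h0 : (N 0%R < +oo)%E by rewrite (qn_zero qN).
  have h3 := lS k aby h0; rewrite addr0 in h3.
  have h6 : nul (S 0).
    by have := nulN (linear_modB h0 h0); rewrite !subrr sub0r opprK.
  have h7 : nul (k *: S (a - b) - S (k *: (a - b))).
    by have := nulD (nulN h3) (nulN h6); rewrite opprB addrAC addrK.
  have h8 := nul_lin k (linear_modB ay by_) h7.
  by move: h8; rewrite (scalerBr k (S a - S b)) addrA subrK.
by have := nulD h2 h1; rewrite !addrA subrK.
Qed.

End LinearMod.

Lemma calderonP N0 N1 f : qnorm nul N0 -> qnorm nul N1 ->
  calderon_function N0 N1 f <->
  [/\ exists2 C : R, 0 <= C & forall z, closed_strip z -> (sum_norm N0 N1 (f z) <= C%:E)%E,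
      forall z, closed_strip z ->
        small (within closed_strip (nbhs z)) (sum_norm N0 N1) (fun w => f w - f z),
      forall z, open_strip z -> exists d : F, (sum_norm N0 N1 d < +oo)%E /\
        small z^' (sum_norm N0 N1) (fun w => (w - z)^-1 *: (f w - f z) - d),
      forall t : R, small (nbhs t) N0 (fun r => f (0 +i* r)%C - f (0 +i* t)%C) &
      forall t : R, small (nbhs t) N1 (fun r => f (1 +i* r)%C - f (1 +i* t)%C)].
Proof.
move=> q0 q1; have qs : qnorm nul (sum_norm N0 N1) by exact: (qnormK q0 q1 ltr01).
split=> [[b c d b0 b1]|[b c d b0 b1]]; split.
- have [C hC] := b; exists (Num.max C 0); first by rewrite le_max lexx orbT.
  by move=> z /hC h; apply: (le_trans h); rewrite lee_fin le_max lexx.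
- by move=> z /c h; apply: (proj1 (smallP _ qs)).
- by move=> z /d[d' [d'y h]]; exists d'; split => //; apply: (proj1 (smallP _ qs)).
- by move=> t; apply: (proj1 (smallP _ q0)); exact: b0.
- by move=> t; apply: (proj1 (smallP _ q1)); exact: b1.
- by have [C C0 hC] := b; exists C.
- by move=> z /c h; apply: (proj2 (smallP _ qs)).
- by move=> z /d[d' [d'y h]]; exists d'; split => //; apply: (proj2 (smallP _ qs)).
- by move=> t; apply: (proj2 (smallP _ q0)); exact: b0.
- by move=> t; apply: (proj2 (smallP _ q1)); exact: b1.
Qed.

Lemma closed_strip0 t : closed_strip ((0 +i* t)%C : R[i]^o).
Proof. by rewrite /closed_strip /= lexx ler01. Qed.

Lemma closed_strip1 t : closed_strip ((1 +i* t)%C : R[i]^o).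
Proof. by rewrite /closed_strip /= lexx ler01. Qed.

Lemma open_closed_strip z : open_strip z -> closed_strip z.
Proof. by move=> /andP[z0 z1]; apply/andP; split; exact: ltW. Qed.

(** Neighbourhoods in terms of real and imaginary parts, the coordinates in which
    holomorphic functions are handled below. *)
Lemma near_box z (P : R[i]^o -> Prop) : (\forall w \near z, P w) <->
  exists2 d : R, 0 < d & forall w, `|complex.Re w - complex.Re z| <= d ->
    `|complex.Im w - complex.Im z| <= d -> P w.
Proof.
split.
- move=> /nbhs_ballP[/= e e0 he].
  have er : e = (complex.Re e)%:C%C by rewrite RRe_real// gtr0_real.
  have e1 : 0 < complex.Re e by move: e0; rewrite er ltcR.
  exists (complex.Re e / 3); first by rewrite divr_gt0.
  move=> w; case: w => a b; case: z he => c d he /= ac bd; apply: he.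
  rewrite -ball_normE/= er.
  have -> : ((c +i* d)%C : R[i]) - (a +i* b)%C = (c - a)%:C%C + 'i%C * (d - b)%:C%C.
    by apply/eqP; rewrite eq_complex /=; apply/andP; split; apply/eqP; ring.
  apply: (le_lt_trans (ler_normD _ _)); rewrite normrM.
  have n1 (x : R) : `|x%:C%C| = `|x|%:C%C :> R[i] by rewrite normc_def/= expr0n addr0 sqrtr_sqr.
  rewrite !n1 (_ : `|'i%C| = 1); last by rewrite normc_def/= expr0n expr1n add0r sqrtr1.
  rewrite mul1r -rmorphD ltcR distrC [`|d - b|]distrC.
  by apply: (le_lt_trans (lerD ac bd)); rewrite -mulrDl ltr_pdivrMr//; lra.
- move=> [d d0 h]; apply/nbhs_ballP; exists d%:C%C; first by rewrite /= ltcR.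
  move=> w; rewrite -ball_normE/= => zw.
  have hh : complex.Re `|z - w| <= d.
    move: zw; rewrite -(RRe_real (normr_real (z - w))) ltcR => /ltW; exact.
  have le1 : forall x y : R, `|x| <= Num.sqrt (x ^+ 2 + y ^+ 2).
    by move=> x y; rewrite -sqrtr_sqr ler_wsqrtr// lerDl sqr_ge0.
  have le2 : forall x y : R, `|y| <= Num.sqrt (x ^+ 2 + y ^+ 2).
    by move=> x y; rewrite addrC; exact: le1.
  apply: h.
    apply: le_trans hh; rewrite distrC normc_def/=; case: z w {zw} => [a b] [c e] /=.
    exact: le1.
  apply: le_trans hh; rewrite distrC normc_def/=; case: z w {zw} => [a b] [c e] /=.
  exact: le2.
Qed.

Lemma near_open_strip z : open_strip z -> \forall w \near z, open_strip w.
Proof.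
move=> /andP[z0 z1]; apply/near_box.
have d0 : 0 < Num.min (complex.Re z) (1 - complex.Re z) / 2.
  by rewrite divr_gt0// lt_min z0 subr_gt0.
exists (Num.min (complex.Re z) (1 - complex.Re z) / 2) => // w.
set d := Num.min _ _ / 2 in d0 * => h _.
have [h1 h2] : d <= complex.Re z / 2 /\ d <= (1 - complex.Re z) / 2.
  by rewrite /d !ler_pM2r ?invr_gt0// !ge_min !lexx orbT.
move: h; rewrite ler_distl => /andP[h3 h4]; rewrite /open_strip/=.
apply/andP; split; lra.
Qed.

Lemma near_dnbhs z (P : R[i]^o -> Prop) : (\forall w \near z, P w) -> \forall w \near z^', P w.
Proof. by move=> h; rewrite /dnbhs near_withinE; apply: filterS h. Qed.

Lemma calderon_lin N0 N1 (k : R[i]) f g : qnorm nul N0 -> qnorm nul N1 ->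
  calderon_function N0 N1 f -> calderon_function N0 N1 g ->
  calderon_function N0 N1 (fun z => k *: f z + g z).
Proof.
move=> q0 q1 /(calderonP _ q0 q1)[[C C0 b] c d b0 b1] /(calderonP _ q0 q1)[[C' C0' b'] c' d' b0' b1'].
have qs : qnorm nul (sum_norm N0 N1) by exact: (qnormK q0 q1 ltr01).
have eq w z : k *: f w + g w - (k *: f z + g z) = k *: (f w - f z) + (g w - g z).
  by rewrite scalerBr opprD addrACA.
have lin (T : Type) (G : set_system T) (FG : Filter G) N (F1 F2 : T -> F) : qnorm nul N ->
    small G N F1 -> small G N F2 -> small G N (fun x => k *: F1 x + F2 x).
  move=> qN s1 s2; apply: (smallD qN) s2.
  by apply: (smallZ (k := cst k) (M := cabs k) qN _ s1); near=> x.
apply/(calderonP _ q0 q1); split.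
- have [K K1 hK] := qn_add qs.
  have k0 : 0 <= cabs k by exact: Re_norm_ge0.
  have kC : 0 <= cabs k * C by rewrite mulr_ge0.
  exists (K * (cabs k * C + C' + 1)).
    by rewrite mulr_ge0 ?addr_ge0// (le_trans ler01).
  move=> z zs; apply: hK; first by rewrite ltr_wpDl// addr_ge0.
    apply: (le_trans (qn_scale qs k C0 (b z zs))).
    by rewrite lee_fin -addrA lerDl addr_ge0.
  by apply: (le_trans (b' z zs)); rewrite lee_fin addrAC lerDr addr_ge0.
- by move=> z zs; under [X in small _ _ X]eq_fun do rewrite eq; apply: lin => //; [exact: c|exact: c'].
- move=> z zs; have [e [ey se]] := d z zs; have [e' [ey' se']] := d' z zs.
  exists (k *: e + e'); split; first exact: (qn_lin_lty k qs ey ey').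
  have eq2 : (fun w => (w - z)^-1 *: (k *: f w + g w - (k *: f z + g z)) - (k *: e + e')) =
      (fun w => k *: ((w - z)^-1 *: (f w - f z) - e) + ((w - z)^-1 *: (g w - g z) - e')).
    apply/funext => w; rewrite eq scalerDr [k *: (_ - e)]scalerBr !scalerA [k * _]mulrC.
    by rewrite opprD addrACA.
  by rewrite eq2; exact: lin.
- by move=> t; under [X in small _ _ X]eq_fun do rewrite eq; exact: lin.
- by move=> t; under [X in small _ _ X]eq_fun do rewrite eq; exact: lin.
Unshelve. all: end_near. Qed.

Lemma calderon_nul N0 N1 n : qnorm nul N0 -> qnorm nul N1 -> nul n ->
  calderon_function N0 N1 (fun=> n).
Proof.
move=> q0 q1 nn; have qs : qnorm nul (sum_norm N0 N1) by exact: (qnormK q0 q1 ltr01).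
have sm (T : Type) (G : set_system T) (FG : Filter G) N : qnorm nul N -> small G N (fun _ : T => n - n).
  by move=> qN e e0; near=> x; rewrite subrr (qn_zero qN) lee_fin ltW.
apply/(calderonP _ q0 q1); split.
- by exists 0 => // z _; rewrite (qn_nul qs nn).
- by move=> z _; exact: sm.
- move=> z _; exists 0; split; first by rewrite (qn_zero qs).
  by move=> e e0; near=> x; rewrite subrr scaler0 subrr (qn_zero qs) lee_fin ltW.
- by move=> t; exact: sm.
- by move=> t; exact: sm.
Unshelve. all: end_near. Qed.

Lemma boundary_leP N0 N1 f (c : R) : (boundary_norm N0 N1 f <= c%:E)%E <->
  (forall t, (N0 (f (Complex 0%R t)) <= c%:E)%E) /\ (forall t, (N1 (f (Complex 1%R t)) <= c%:E)%E).
Proof.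
rewrite /boundary_norm ge_max; split.
  move=> /andP[h0 h1]; split => t.
    by apply: le_trans h0; apply: ereal_sup_ubound; exists t.
  by apply: le_trans h1; apply: ereal_sup_ubound; exists t.
move=> [h0 h1]; apply/andP; split; apply: ge_ereal_sup => _ [t _ <-]; [exact: h0|exact: h1].
Qed.

Lemma boundary_norm_ge0 N0 N1 f : qnorm nul N0 -> (0 <= boundary_norm N0 N1 f)%E.
Proof.
move=> q0; rewrite le_max; apply/orP; left.
by apply: le_trans (qn_ge0 q0 (f (0 +i* 0)%C)) _; apply: ereal_sup_ubound; exists 0.
Qed.

Lemma complex_le N0 N1 theta f c : calderon_function N0 N1 f ->
  (boundary_norm N0 N1 f <= c%:E)%E ->
  (complex_interpolation N0 N1 theta (f (theta%:C)%C) <= c%:E)%E.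
Proof. by move=> cf; apply: le_trans; apply: ereal_inf_lbound; exists f. Qed.

Lemma complex_lt N0 N1 theta u c : (complex_interpolation N0 N1 theta u < c%:E)%E ->
  exists f, [/\ calderon_function N0 N1 f, f (theta%:C)%C = u & (boundary_norm N0 N1 f <= c%:E)%E].
Proof. by move=> /ereal_inf_lt[_ [f [cf fu] <-] /ltW h]; exists f. Qed.

Section Couple.
Variables (N0 N1 : F -> \bar R) (q0 : qnorm nul N0) (q1 : qnorm nul N1) (theta : R).
Hypothesis th : 0 < theta < 1.

Lemma complex_ge0 u : (0 <= complex_interpolation N0 N1 theta u)%E.
Proof. by apply: le_ereal_inf_tmp => _ [f _ <-]; exact: boundary_norm_ge0. Qed.

Lemma complex_zero : complex_interpolation N0 N1 theta 0 = 0%E.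
Proof.
apply/eqP; rewrite eq_le complex_ge0 andbT.
apply: (@complex_le N0 N1 theta (fun=> 0)); first exact: calderon_nul.
by apply/boundary_leP; rewrite (qn_zero q0) (qn_zero q1).
Qed.

Lemma complex_lty u : (complex_interpolation N0 N1 theta u < +oo)%E ->
  exists c f, [/\ 0 < c, calderon_function N0 N1 f, f (theta%:C)%C = u & (boundary_norm N0 N1 f <= c%:E)%E].
Proof.
move=> uy; have [c c0 uc] := fin_bound (complex_ge0 u) uy.
have /complex_lt[f [cf fu fc]] : (complex_interpolation N0 N1 theta u < (c + 1)%:E)%E.
  by rewrite uc lte_fin ltrDl.
by exists (c + 1), f; split => //; rewrite ltr_wpDl.
Qed.

Lemma complex_null u n : nul n ->
  (complex_interpolation N0 N1 theta (u + n)%R <= complex_interpolation N0 N1 theta u)%E.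
Proof.
move=> nn; apply: le_ereal_inf_tmp => _ [f [cf <-] <-].
have [|] := boolP (boundary_norm N0 N1 f < +oo)%E; last first.
  by rewrite -leNgt leye_eq => /eqP ->; rewrite leey.
move=> /(fin_bound (boundary_norm_ge0 _ _ q0))[c c0 fc]; rewrite fc.
have /boundary_leP[h0 h1] : (boundary_norm N0 N1 f <= c%:E)%E by rewrite fc.
have := @complex_le N0 N1 theta (fun z => 1 *: f z + n) c.
rewrite scale1r; apply; first by apply: calderon_lin => //; exact: calderon_nul.
apply/boundary_leP; split => t; rewrite scale1r.
  exact: le_trans (qn_null q0 _ nn) (h0 t).
exact: le_trans (qn_null q1 _ nn) (h1 t).
Qed.

Lemma complex_sum_lty u : (complex_interpolation N0 N1 theta u < +oo)%E ->
  (sum_norm N0 N1 u < +oo)%E.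
Proof.
move=> /complex_lty[c [f [c0 /(calderonP _ q0 q1)[[C C0 b] _ _ _ _] <- _]]].
apply: le_lt_trans (b _ _) (ltry C).
by apply: open_closed_strip.
Qed.

Lemma complex_add_lty u v : (complex_interpolation N0 N1 theta u < +oo)%E ->
  (complex_interpolation N0 N1 theta v < +oo)%E ->
  (complex_interpolation N0 N1 theta (u + v)%R < +oo)%E.
Proof.
move=> /complex_lty[c [f [c0 cf <- fc]]] /complex_lty[d [g [d0 cg <- gd]]].
have [K K1 hK] := qn_add q0; have [L L1 hL] := qn_add q1.
apply: (@le_lt_trans _ _ (((K + L) * (c + d))%:E)%E); last exact: ltry.
have := @complex_le N0 N1 theta (fun z => 1 *: f z + g z) ((K + L) * (c + d)).
rewrite scale1r; apply; first exact: calderon_lin.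
have cd0 : 0 < c + d by rewrite addr_gt0.
move/boundary_leP : fc => [f0 f1]; move/boundary_leP : gd => [g0 g1].
have hc (x : \bar R) : (x <= c%:E)%E -> (x <= (c + d)%:E)%E.
  by move=> h; apply: (le_trans h); rewrite lee_fin lerDl ltW.
have hd (x : \bar R) : (x <= d%:E)%E -> (x <= (c + d)%:E)%E.
  by move=> h; apply: (le_trans h); rewrite lee_fin lerDr ltW.
apply/boundary_leP; split => t; rewrite scale1r.
  apply: (le_trans (hK _ _ _ cd0 (hc _ (f0 t)) (hd _ (g0 t)))).
  by rewrite lee_fin ler_wpM2r ?(ltW cd0)// lerDl (le_trans ler01).
apply: (le_trans (hL _ _ _ cd0 (hc _ (f1 t)) (hd _ (g1 t)))).
by rewrite lee_fin ler_wpM2r ?(ltW cd0)// lerDr (le_trans ler01).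
Qed.

End Couple.

(** Multiplication by this function makes Calderon functions decay at infinity without
    changing their value at [theta]. *)
Definition damping theta z : R[i] := (1 + theta)%:C%C / (1 + z).

Lemma cabsE (k : R[i]) : cabs k = Num.sqrt (complex.Re k ^+ 2 + complex.Im k ^+ 2).
Proof. by rewrite /cabs normc_def; case: k. Qed.

Lemma cabsV (k : R[i]) : cabs k^-1 = (cabs k)^-1.
Proof.
have [->|k0] := eqVneq k 0; first by rewrite invr0 /cabs normr0 invr0.
have c0 : cabs k != 0.
  apply: contra k0 => /eqP c0; rewrite -normr_eq0 -(RRe_real (normr_real k)).
  by move: c0; rewrite /cabs => ->.
apply: (mulfI c0); rewrite -cabsM !divff//.
by rewrite /cabs normr1.
Qed.

Lemma cabs_Re (k : R[i]) : `|complex.Re k| <= cabs k.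
Proof. by rewrite cabsE -sqrtr_sqr ler_wsqrtr// lerDl sqr_ge0. Qed.

Lemma cabs_Im (k : R[i]) : `|complex.Im k| <= cabs k.
Proof. by rewrite cabsE -sqrtr_sqr ler_wsqrtr// lerDr sqr_ge0. Qed.

Lemma cabs_le (k : R[i]) : cabs k <= `|complex.Re k| + `|complex.Im k|.
Proof.
rewrite cabsE -[leRHS]ger0_norm ?addr_ge0// -sqrtr_sqr ler_wsqrtr//.
rewrite sqrrD !real_normK ?num_real// -addrA lerD2l lerDr.
by rewrite mulrn_wge0// mulr_ge0.
Qed.

Lemma cabs_ge0 (k : R[i]) : 0 <= cabs k.
Proof. exact: Re_norm_ge0. Qed.

Lemma cabs_addr1 z : closed_strip z -> 1 <= cabs (1 + z).
Proof.
move=> /andP[z0 _]; apply: le_trans (cabs_Re _).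
by rewrite raddfD/= ger0_norm ?addr_ge0// lerDl.
Qed.

Lemma addr1_neq0 z : closed_strip z -> 1 + z != 0.
Proof.
move=> /cabs_addr1; apply: contraTneq => ->.
by rewrite /cabs normr0 /= ler10.
Qed.

Section Damping.
Variable theta : R.
Hypothesis th : 0 < theta < 1.

Lemma damping_theta : damping theta (theta%:C)%C = 1.
Proof.
have cs : closed_strip ((theta%:C)%C : R[i]^o).
  by apply: open_closed_strip.
by rewrite /damping rmorphD rmorph1 divff// addr1_neq0.
Qed.

Lemma cabs_damping z : closed_strip z -> cabs (damping theta z) <= 2 / cabs (1 + z).
Proof.
move=> zs; rewrite /damping cabsM cabs_real cabsV.
rewrite ler_wpM2r ?invr_ge0 ?cabs_ge0//.
by case/andP: th => t0 t1; rewrite ger0_norm; lra.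
Qed.

Lemma cabs_damping2 z : closed_strip z -> cabs (damping theta z) <= 2.
Proof.
move=> zs; apply: (le_trans (cabs_damping zs)).
have h := cabs_addr1 zs.
by rewrite ler_pdivrMr ?(lt_le_trans ltr01)// ler_peMr.
Qed.

Lemma cabs_damping_decay z : closed_strip z ->
  cabs (damping theta z) <= 4 / (1 + `|complex.Im z|).
Proof.
move=> zs; apply: (le_trans (cabs_damping zs)).
have h := cabs_addr1 zs.
have h2 : `|complex.Im z| <= cabs (1 + z).
  by apply: le_trans (cabs_Im _); rewrite raddfD/= add0r.
have p0 : 0 < cabs (1 + z) by exact: lt_le_trans h.
rewrite ler_pdivrMr// mulrAC ler_pdivlMr; last by rewrite ltr_pwDl.
lra.
Qed.

Lemma dampingB z w : closed_strip z -> closed_strip w ->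
  damping theta w - damping theta z = - damping theta w * (w - z) / (1 + z).
Proof.
move=> /addr1_neq0 z0 /addr1_neq0 w0; rewrite /damping.
have -> : w - z = (1 + w) - (1 + z) by rewrite opprD addrACA subrr add0r.
move: (1 + z) (1 + w) z0 w0 ((1 + theta)%:C%C) => a b a0 b0 c.
by field; rewrite a0.
Qed.

Lemma cabs_dampingB z w : closed_strip z -> closed_strip w ->
  cabs (damping theta w - damping theta z) <= 2 * cabs (w - z).
Proof.
move=> zs ws; rewrite dampingB// !cabsM cabsV.
have -> : cabs (- damping theta w) = cabs (damping theta w) by rewrite /cabs normrN.
have h := cabs_addr1 zs.
rewrite ler_pdivrMr ?(lt_le_trans ltr01)//.
apply: (@le_trans _ _ (2 * cabs (w - z))).
  by rewrite ler_wpM2r ?cabs_ge0// cabs_damping2.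
by rewrite ler_peMr// mulr_ge0 ?cabs_ge0.
Qed.

Lemma near_damping z e : closed_strip z -> 0 < e ->
  \forall w \near z, closed_strip w -> cabs (damping theta w - damping theta z) <= e.
Proof.
move=> zs e0; apply/near_box; exists (e / 4); first by rewrite divr_gt0.
move=> w h1 h2 ws; apply: (le_trans (cabs_dampingB zs ws)).
have := cabs_le (w - z); rewrite !raddfB /= => h3.
lra.
Qed.

Lemma near_damping_line (x t e : R) : (forall r : R, closed_strip ((x +i* r)%C : R[i]^o)) -> 0 < e ->
  \forall r \near t, cabs (damping theta (x +i* r)%C - damping theta (x +i* t)%C) <= e.
Proof.
move=> cs e0; have e2 : 0 < e / 2 by rewrite divr_gt0.
near=> r; apply: (le_trans (cabs_dampingB (cs t) (cs r))).
have -> : cabs ((x +i* r)%C - (x +i* t)%C) = `|t - r|.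
  by rewrite cabsE/= subrr expr0n add0r sqrtr_sqr distrC.
rewrite mulrC -ler_pdivlMr//; near: r; exact: cvgr_dist_le.
Unshelve. all: end_near. Qed.

(** The derivative of [damping theta z *: f z] is [damping theta z *: (f' z - (1 +
    z)^-1 *: f z)], by the product rule. *)
Lemma calderon_damping N0 N1 f : qnorm nul N0 -> qnorm nul N1 ->
  calderon_function N0 N1 f ->
  (forall t, (N0 (f (Complex 0%R t)) < +oo)%E) -> (forall t, (N1 (f (Complex 1%R t)) < +oo)%E) ->
  calderon_function N0 N1 (fun z => damping theta z *: f z).
Proof.
move=> q0 q1 /(calderonP _ q0 q1)[[C C0 b] c d b0 b1] fin0 fin1.
have qs : qnorm nul (sum_norm N0 N1) by exact: (qnormK q0 q1 ltr01).
have eq w z : damping theta w *: f w - damping theta z *: f z =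
    damping theta w *: (f w - f z) + (damping theta w - damping theta z) *: f z.
  by rewrite scalerBr scalerBl addrA subrK.
have fin z : closed_strip z -> (sum_norm N0 N1 (f z) < +oo)%E.
  by move=> /b h; exact: le_lt_trans h (ltry C).
apply/(calderonP _ q0 q1); split.
- exists (2 * C); first by rewrite mulr_ge0.
  move=> z zs; apply: (le_trans (qn_scale qs _ C0 (b z zs))).
  by rewrite lee_fin ler_wpM2r// cabs_damping2.
- move=> z zs; under [X in small _ _ X]eq_fun do rewrite eq.
  apply: (smallD qs).
    apply: (smallZ (M := 2) qs); last exact: c.
    by rewrite near_withinE; near=> w => ws; exact: cabs_damping2.
  apply: (smallZ0 qs); first exact: fin.
  by move=> e e0; rewrite near_withinE; exact: near_damping.
- move=> z zs; have zc := open_closed_strip zs; have [d' [dy sd]] := d z zs.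
  pose D := d' - (1 + z)^-1 *: f z.
  have Dy : (sum_norm N0 N1 D < +oo)%E.
    apply: (qn_linB qs) => //.
    have := qn_lin_lty (1 + z)^-1 qs (fin _ zc) (_ : sum_norm N0 N1 0%R < +oo)%E.
    by rewrite addr0; apply; rewrite (qn_zero qs).
  exists (damping theta z *: D); split.
    have := qn_lin_lty (damping theta z) qs Dy (_ : sum_norm N0 N1 0%R < +oo)%E.
    by rewrite addr0; apply; rewrite (qn_zero qs).
  have nws := near_dnbhs (near_open_strip zs).
  apply: (small_eq_mod (g := fun w => damping theta w *: ((w - z)^-1 *: (f w - f z) - d') +
      (damping theta w - damping theta z) *: D) qs).
    have nz : \forall w \near z^', w != z by exact: nbhs_dnbhs_neq.
    apply: filterS2 nz nws => w wz ws; have wc := open_closed_strip ws.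
    set A := (X in nul X); suff -> : A = 0 by [].
    rewrite /A eq dampingB// [in X in X - _]scalerDr !scalerA.
    have -> : (w - z)^-1 * (- damping theta w * (w - z) / (1 + z)) =
        - (damping theta w / (1 + z)).
      have wz0 : w - z != 0 by rewrite subr_eq0.
      move: (w - z) (damping theta w) (1 + z) wz0 (addr1_neq0 zc) => x y a x0 a0.
      by field; rewrite a0 x0.
    rewrite -dampingB//.
    move: (damping theta w) (damping theta z) (f w - f z) => x y a.
    rewrite [(w - z)^-1 * x]mulrC -!scalerA.
    move: ((w - z)^-1 *: a) => {}a.
    rewrite /D scalerBr scalerBl scaleNr -!scalerA; move: ((1 + z)^-1 *: f z) => e.
    rewrite ![_ *: (d' - e)]scalerBr !opprD !opprK.
    rewrite (scalerBr x a d').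
    move: (x *: a) (x *: e) (y *: d') (y *: e) (x *: d') => p q r t v.
    rewrite opprB [v - p]addrC -[- v + q + _]addrA [- p + v + _]addrA addrK.
    by apply/eqP; rewrite addr_eq0 !opprD !opprK !addrA.
  apply: (smallD qs).
    apply: (smallZ (M := 2) qs) => //.
    by apply: filterS nws => w ws; apply: cabs_damping2; exact: open_closed_strip.
  apply: (smallZ0 qs) => // e e0.
  apply: filterS2 nws (near_dnbhs (near_damping zc e0)) => w ws h; apply: h.
  exact: open_closed_strip.
- move=> t; under [X in small _ _ X]eq_fun do rewrite eq.
  apply: (smallD q0); last by apply: (smallZ0 q0) => // e; exact: near_damping_line (@closed_strip0).
  by apply: (smallZ (M := 2) q0) => //; near=> r; apply: cabs_damping2; exact: closed_strip0.
- move=> t; under [X in small _ _ X]eq_fun do rewrite eq.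
  apply: (smallD q1); last by apply: (smallZ0 q1) => // e; exact: near_damping_line (@closed_strip1).
  by apply: (smallZ (M := 2) q1) => //; near=> r; apply: cabs_damping2; exact: closed_strip1.
Unshelve. all: end_near. Qed.

End Damping.

(** For [|t| > T] the decay of [phi] bounds [S h (phi t)] uniformly in [h]; on the
    compact interval [[- T, T]] smallness at each [t] is uniform because [phi] is
    continuous and the [S h] are uniformly bounded. *)
Lemma small_uniform N (X Y : F -> \bar R) (S : R -> F -> F) (phi : R -> F) C c : qnorm nul N -> qnorm nul X -> 0 < C -> 0 < c ->
  (forall h, 0 < h -> linear_mod nul N (S h)) ->
  (forall h, 0 < h -> h <= 1 -> bounded_map Y X (S h) C) ->
  (forall t, (N (phi t) < +oo)%E) ->
  (forall t, (Y (phi t) <= (c / (1 + `|t|))%:E)%E) ->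
  (forall t, small (nbhs t) Y (fun r => phi r - phi t)) ->
  (forall t, small 0^'+ X (fun h => S h (phi t))) ->
  forall e, 0 < e -> \forall h \near 0^'+, forall t, (X (S h (phi t)) <= e%:E)%E.
Proof.
move=> qN qX C0 c0 lS bS fin dec cont sm e e0.
have hp : \forall h \near (0 : R)^'+, 0 < h by exact: nbhs_right_gt.
have h1 : \forall h \near (0 : R)^'+, h <= 1 by exact: nbhs_right_le.
(* Beyond [T] the bound [C * c / (1 + |t|)] is below [e]. *)
pose T := C * c / e.
have T0 : 0 < T by rewrite divr_gt0// mulr_gt0.
have [K K1 hK] := qn_add qX.
have K0 : 0 < K by exact: lt_le_trans K1.
have eK : 0 < e / K by rewrite divr_gt0.
have eKC : 0 < e / K / C by rewrite divr_gt0.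
have cpt : \forall h \near (0 : R)^'+, `[- T, T]%classic `<=` (fun t => (X (S h (phi t)) <= e%:E)%E).
  have := @segment_compact R (- T) T => /compact_near_coveringP.
  apply => t _.
  have hpp := hp.
  exists ([set r : R | (Y (phi r - phi t)%R <= (e / K / C)%:E)%E],
          [set h : R | [/\ 0 < h, h <= 1 & (X (S h (phi t)) <= (e / K)%:E)%E]]).
    split => /=; first exact: cont.
    by apply: filterS3 hp h1 (sm t _ eK) => h *; split.
  move=> [r h] [/= hr [h0 hle ht]].
  have nn := lS h h0 1 (phi t) (phi r - phi t).
  have -> : S h (phi r) = (S h (phi t) + (S h (phi r - phi t))) + (S h (phi r) - (S h (phi t) + S h (phi r - phi t))).
    by rewrite addrC subrK.
  apply: (@le_trans _ _ (X (S h (phi t) + S h (phi r - phi t))%R)).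
    apply: (qn_null qX).
    have := nn (fin t) (qn_linB qN (fin r) (fin t)).
    by rewrite !scale1r [phi t + _]addrC subrK.
  have := hK (S h (phi t)) (S h (phi r - phi t)) (e / K) eK ht.
  rewrite [K * (e / K)]mulrC divfK ?gt_eqF//; apply.
  have := bS h h0 hle (phi r - phi t) (e / K / C) (ltW eKC) hr.
  by rewrite [C * _]mulrC divfK ?gt_eqF.
apply: filterS3 hp h1 cpt => h h0 hle ht t.
have [tT|tT] := leP `|t| T; first by apply: ht; rewrite /= in_itv/= -ler_norml.
have t1 : 0 < 1 + `|t| by rewrite ltr_pwDl.
have cc : 0 <= c / (1 + `|t|) by rewrite divr_ge0 ?ltW.
apply: (le_trans (bS h h0 hle _ _ cc (dec t))); rewrite lee_fin mulrA.
rewrite ler_pdivrMr//; move: tT; rewrite /T ltr_pdivrMr// => tT.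
by apply: (le_trans (ltW tT)); rewrite mulrC ler_wpM2l ?(ltW e0)// lerDr.
Unshelve. all: end_near. Qed.

Section Maps.
Variables (X0 X1 Y0 Y1 : F -> \bar R) (qX0 : qnorm nul X0) (qX1 : qnorm nul X1)
  (qY0 : qnorm nul Y0) (qY1 : qnorm nul Y1).

Lemma calderon_map (S : F -> F) C f : 0 < C -> linear_mod nul (sum_norm Y0 Y1) S ->
  bounded_map Y0 X0 S C -> bounded_map Y1 X1 S C ->
  calderon_function Y0 Y1 f -> calderon_function X0 X1 (fun z => S (f z)).
Proof.
move=> C0 lS b0 b1 /(calderonP _ qY0 qY1)[[B B0 b] c d d0 d1].
have qY := qnormK qY0 qY1 ltr01; have qX := qnormK qX0 qX1 ltr01.
have bS := bounded_mapK qX0 qX1 qY0 qY1 C0 ltr01 lS b0 b1.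
have fin z : closed_strip z -> (sum_norm Y0 Y1 (f z) < +oo)%E.
  by move=> /b h; exact: le_lt_trans h (ltry B).
apply/(calderonP _ qX0 qX1); split.
- by exists (C * B); [rewrite mulr_ge0// ltW|move=> z /b h; exact: bS].
- move=> z zs; apply: (small_eq_mod (g := fun w => S (f w - f z)) qX).
    rewrite near_withinE; near=> w => ws.
    by apply: (linear_modB lS); exact: fin.
  by apply: (bounded_small C0 bS); exact: c.
- move=> z zs; have [e [ey se]] := d z zs; exists (S e); split.
    have [r r0 er] := fin_bound (qn_ge0 qY e) ey.
    by apply: le_lt_trans (bS e r r0 _) (ltry _); rewrite -er.
  apply: (small_eq_mod (g := fun w => S ((w - z)^-1 *: (f w - f z) - e)) qX).
    apply: filterS (near_dnbhs (near_open_strip zs)) => w ws.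
    apply: (linear_mod_quotient qY lS) => //; apply: fin; exact: open_closed_strip.
  exact: (bounded_small C0 bS).
- move=> t; apply: (small_eq_mod (g := fun r => S (f (0 +i* r)%C - f (0 +i* t)%C)) qX0).
    by near=> r; apply: (linear_modB lS); apply: fin; exact: closed_strip0.
  by apply: (bounded_small C0 b0); exact: d0.
- move=> t; apply: (small_eq_mod (g := fun r => S (f (1 +i* r)%C - f (1 +i* t)%C)) qX1).
    by near=> r; apply: (linear_modB lS); apply: fin; exact: closed_strip1.
  by apply: (bounded_small C0 b1); exact: d1.
Unshelve. all: end_near. Qed.

Lemma complex_map (S : F -> F) C theta : 0 < theta < 1 -> 0 < C -> linear_mod nul (sum_norm Y0 Y1) S ->
  bounded_map Y0 X0 S C -> bounded_map Y1 X1 S C ->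
  bounded_map (complex_interpolation Y0 Y1 theta) (complex_interpolation X0 X1 theta) S C.
Proof.
move=> th C0 lS b0 b1 u c c0 uc; apply: lee_addgt0 => e e0.
have d0 : 0 < e / C by rewrite divr_gt0.
have /complex_lt[f [cf <- fc]] : (complex_interpolation Y0 Y1 theta u < (c + e / C)%:E)%E.
  by apply: (le_lt_trans uc); rewrite lte_fin ltrDl.
apply: (@complex_le X0 X1 theta (fun z => S (f z))).
  exact: (calderon_map C0 lS b0 b1 cf).
move/boundary_leP : fc => [f0 f1].
have ce0 : 0 <= c + e / C by rewrite addr_ge0// ltW.
have -> : C * c + e = C * (c + e / C).
  by rewrite mulrDr [C * (e / C)]mulrC divfK ?gt_eqF.
by apply/boundary_leP; split => t; [exact: b0|exact: b1].
Qed.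

(** Replace a Calderon function [f] with value [u] by [damping theta z *: f z]. It
    decays on the boundary, where [S h] of it is therefore uniformly small by
    [small_uniform]; this bounds the interpolation norm of [S h u]. *)
Lemma complex_strong (S : R -> F -> F) C theta u : 0 < theta < 1 -> 0 < C ->
  (forall h, 0 < h -> linear_mod nul (sum_norm Y0 Y1) (S h)) ->
  (forall h, 0 < h -> h <= 1 -> bounded_map Y0 X0 (S h) C) ->
  (forall h, 0 < h -> h <= 1 -> bounded_map Y1 X1 (S h) C) ->
  (forall v, (Y0 v < +oo)%E -> small 0^'+ X0 (S^~ v)) ->
  (forall v, (Y1 v < +oo)%E -> small 0^'+ X1 (S^~ v)) ->
  (complex_interpolation Y0 Y1 theta u < +oo)%E ->
  small 0^'+ (complex_interpolation X0 X1 theta) (S^~ u).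
Proof.
move=> th C0 lS b0 b1 s0 s1 /(complex_lty qY0)[c [f [c0 cf <- /boundary_leP[f0 f1]]]] e e0.
have qY := qnormK qY0 qY1 ltr01.
pose g z := damping theta z *: f z.
have cg : calderon_function Y0 Y1 g.
  by apply: calderon_damping => // t; [exact: le_lt_trans (f0 t) (ltry c)|exact: le_lt_trans (f1 t) (ltry c)].
have gth : g (theta%:C)%C = f (theta%:C)%C by rewrite /g damping_theta// scale1r.
have [[B B0 bg] _ _ g0 g1] := (iffLR (calderonP _ qY0 qY1)) cg.
have fin z : closed_strip z -> (sum_norm Y0 Y1 (g z) < +oo)%E.
  by move=> /bg h; exact: le_lt_trans h (ltry B).
have dec (Y : F -> \bar R) (x t : R) : qnorm nul Y -> closed_strip ((x +i* t)%C : R[i]^o) ->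
    (Y (f (Complex x t)) <= c%:E)%E -> (Y (g (Complex x t)) <= ((4 * c) / (1 + `|t|))%:E)%E.
  move=> qY' cs h; apply: (le_trans (qn_scale qY' _ (ltW c0) h)).
  by rewrite lee_fin mulrAC ler_wpM2r ?(ltW c0)//; exact: cabs_damping_decay.
have c4 : 0 < 4 * c by rewrite mulr_gt0.
have fy (Y : F -> \bar R) (x t : R) : (Y (g (Complex x t)) <= ((4 * c) / (1 + `|t|))%:E)%E ->
    (Y (g (Complex x t)) < +oo)%E by move=> h; exact: le_lt_trans h (ltry _).
have h0 := small_uniform (phi := fun t => g (Complex 0 t)) qY qX0 C0 c4 lS b0
  (fun t => fin _ (closed_strip0 t)) (fun t => dec _ _ _ qY0 (closed_strip0 t) (f0 t)) g0
  (fun t => s0 _ (fy _ _ _ (dec _ _ _ qY0 (closed_strip0 t) (f0 t)))) e0.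
have h1 := small_uniform (phi := fun t => g (Complex 1 t)) qY qX1 C0 c4 lS b1
  (fun t => fin _ (closed_strip1 t)) (fun t => dec _ _ _ qY1 (closed_strip1 t) (f1 t)) g1
  (fun t => s1 _ (fy _ _ _ (dec _ _ _ qY1 (closed_strip1 t) (f1 t)))) e0.
have hp : \forall h \near (0 : R)^'+, 0 < h <= 1.
  near=> h; apply/andP; split; first by [].
  by near: h; exact: nbhs_right_le.
apply: filterS3 hp h0 h1 => h /andP[hpos hle] k0 k1.
rewrite -gth; apply: (@complex_le X0 X1 theta (fun z => S h (g z))).
  by apply: (calderon_map C0 (lS h hpos)) cg; [exact: b0|exact: b1].
by apply/boundary_leP.
Unshelve. all: end_near. Qed.

End Maps.

End ComplexMethod.

(** * Holomorphic functions on a strip *)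

Lemma subrACA {V : zmodType} (a b c d : V) : a - b - (c - d) = a - c - (b - d).
Proof. by rewrite !opprB [d - c]addrC addrACA [_ + d]addrC. Qed.

(** The remainder in the product rule for [k *: A], where [k] is the kernel [1 / (z -
    theta)], written as the remainder for [A] plus a quadratic term. *)
Lemma product_identity {K : comRingType} {V : lmodType K} (k' k D : K) (A B d : V) :
  k' - k = - D * (k' * k) ->
  k' *: A - k *: B - D *: (k *: d - k ^+ 2 *: B) =
  k' *: (A - B - D *: d) + (D * (k' - k)) *: (d - k *: B).
Proof.
move=> kk; transitivity (k' *: A + (D * k ^+ 2 - k) *: B - (D * k) *: d).
  rewrite scalerBr !scalerA opprB addrA scalerBl addrA.
  by rewrite [k' *: A - k *: B + _]addrAC.
rewrite !scalerBr !scalerA [_ *: d - (_ * k) *: B]addrC addrACA.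
have -> : D * k ^+ 2 - k = - k' - D * (k' - k) * k.
  have -> : - k' - D * (k' - k) * k = - (k' - k) - k - D * (k' * k) + D * k ^+ 2 by ring.
  by rewrite kk; ring.
have -> : - ((k' * D) *: d) + (D * (k' - k)) *: d = - ((D * k) *: d).
  by rewrite -!scaleNr -scalerDl; congr (_ *: _); ring.
by rewrite scalerBl scaleNr !addrA.
Qed.

Section Contour.
Context {R : realType} {E : completeNormedModType R[i]}.
Implicit Types (f g : R -> E) (G H : R -> R -> E) (x y a b w h e : R).
Notation leb := (@lebesgue_measure R).

Lemma continuousP f : (forall x e, 0 < e -> exists2 d : R, 0 < d &
    forall y, `|y - x| <= d -> rnorm (f y - f x) <= e) <-> continuous f.
Proof.
split=> [h x|cf x e e0].
  apply/cvg_rnormP/cvgrPdist_le => e e0; have [d d0 hd] := h x e e0.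
  near=> y; rewrite sub0r normrN ger0_norm ?rnorm_ge0//; apply: hd.
  by rewrite distrC; near: y; exact: cvgr_dist_le.
have /cvg_rnormP/cvgrPdist_le/(_ _ e0) := cf x.
move=> /nbhs_ballP[d /= d0 hd]; exists (d / 2); first by rewrite divr_gt0.
move=> y yx; have := hd y; rewrite sub0r normrN ger0_norm ?rnorm_ge0//; apply.
rewrite -ball_normE/= distrC; apply: (le_lt_trans yx).
by rewrite ltr_pdivrMr// ltr_pMr// ltr1n.
Unshelve. all: end_near. Qed.

Lemma continuous_integrable f a b : continuous f -> bochner_integrable `[a, b] f.
Proof.
move=> cf; have sf : borel_sm f by exact: borel_sm_continuous.
split; first exact: borel_sm_sm.
have cn : continuous (rnorm \o f).
  by move=> x; apply: continuous_comp; [exact: cf|exact: continuous_rnorm].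
have : compact ((rnorm \o f) @` `[a, b]).
  apply: continuous_compact; last exact: segment_compact.
  exact: continuous_subspaceT.
move=> /compact_bounded[M [_ hM]].
apply: (@le_lt_trans _ _ (\int[leb]_(x in `[a, b]) (cst (`|M| + 1)%:E x))%E).
  apply: le_nnintegral => //; first by move=> x _; rewrite lee_fin rnorm_ge0.
  move=> x xab; rewrite lee_fin -[leLHS]ger0_norm ?rnorm_ge0//.
  apply: (hM (`|M| + 1)); first by rewrite (le_lt_trans (ler_norm _))// ltrDl.
  by exists x.
rewrite integral_cst// [X in (_ * X)%E](_ : _ = leb `[a, b])//.
have [ab|ba] := leP a b; first by rewrite leb_itv// -EFinM ltry.
by rewrite set_itv_ge ?measure0 ?mule0// bnd_simp -ltNge.
Qed.

Lemma itv_integral_le f a b M : continuous f -> a <= b -> 0 <= M ->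
  (forall x, a <= x -> x <= b -> rnorm (f x) <= M) ->
  rnorm (bochner `[a, b] f) <= M * (b - a).
Proof.
move=> cf ab M0 hM; rewrite -lee_fin.
have mI : measurable (`[a, b] : set (measurableTypeR R)) by exact: measurable_itv.
apply: (le_trans (rnorm_bochner mI (continuous_integrable a b cf).1)).
apply: (@le_trans _ _ (\int[leb]_(x in `[a, b]) (cst M%:E x))%E).
  apply: le_nnintegral; first exact: mI.
    by move=> x _; rewrite lee_fin rnorm_ge0.
  by move=> x; rewrite /= in_itv/= => /andP[ax xb]; rewrite lee_fin hM.
by rewrite integral_cst// [X in (_ * X)%E](_ : _ = leb `[a, b])// leb_itv// -EFinM.
Qed.

Lemma itv_integralB f g a b : continuous f -> continuous g ->
  bochner `[a, b] (fun x => f x - g x) = bochner `[a, b] f - bochner `[a, b] g.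
Proof.
move=> cf cg; have mI : measurable (`[a, b] : set (measurableTypeR R)) by exact: measurable_itv.
have := bochner_lin (-1) mI (continuous_integrable a b cg) (continuous_integrable a b cf).
rewrite !scaleN1r addrC => h; rewrite [RHS]addrC -h.
by congr bochner; apply/funext => x; rewrite !fctE scaleN1r addrC.
Qed.

Lemma itv_integral_split f a c b : continuous f -> a <= c -> c <= b ->
  bochner `[a, b] f = bochner `[a, c] f + bochner `[c, b] f.
Proof.
move=> cf ac cb; apply: bochner_split; try exact: measurable_itv.
- apply/seteqP; split => x /=; rewrite !in_itv/=.
    by case=> /andP[h1 h2]; apply/andP; split => //; [exact: le_trans cb|exact: le_trans h1].
  by move=> /andP[h1 h2]; have [h|h] := leP x c; [left|right]; rewrite ?h1 ?h2 ?(ltW h).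
- rewrite (_ : _ `&` _ = [set c]); first exact: lebesgue_measure_set1.
  apply/seteqP; split => x /=; rewrite !in_itv/=.
    by move=> [/andP[_ h1] /andP[h2 _]]; apply/eqP; rewrite eq_le h1.
  by move=> ->; rewrite ac cb lexx.
- exact: continuous_integrable.
Qed.

Lemma itv_integral_cst (k : E) a b : a <= b -> bochner `[a, b] (fun=> k) = (b - a)%:C%C *: k.
Proof.
move=> ab; rewrite (bochner_cst _ (measurable_itv _)); rewrite [leb _](leb_itv ab) ?ltry//.
Qed.

Definition continuous2 G := forall x y e, 0 < e -> exists2 d : R, 0 < d &
  forall x' y', `|x' - x| <= d -> `|y' - y| <= d -> rnorm (G x' y' - G x y) <= e.

Lemma continuous2l G y : continuous2 G -> continuous (G^~ y).
Proof.
move=> cG; apply/continuousP => x e e0; have [d d0 hd] := cG x y e e0.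
by exists d => // x' h; apply: hd => //; rewrite subrr normr0 ltW.
Qed.

Lemma continuous2r G x : continuous2 G -> continuous (G x).
Proof.
move=> cG; apply/continuousP => y e e0; have [d d0 hd] := cG x y e e0.
by exists d => // y' h; apply: hd => //; rewrite subrr normr0 ltW.
Qed.

Lemma continuousB2 f g : continuous f -> continuous g -> continuous (fun x => f x - g x).
Proof. by move=> cf cg x; apply: cvgB; [exact: cf|exact: cg]. Qed.

(** The contour integral along the boundary of a rectangle; opposite sides are paired,
    so that it visibly vanishes on affine functions. *)
Definition contour G x1 x2 y1 y2 : E :=
  'i%C *: bochner `[y1, y2] (fun y => G x2 y - G x1 y) -
  bochner `[x1, x2] (fun x => G x y2 - G x y1).

Lemma contour_splitx G x1 xm x2 y1 y2 : continuous2 G -> x1 <= xm -> xm <= x2 ->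
  contour G x1 x2 y1 y2 = contour G x1 xm y1 y2 + contour G xm x2 y1 y2.
Proof.
move=> cG h1 h2; have cr x : continuous (G x) by exact: continuous2r.
have cx : continuous (fun x => G x y2 - G x y1) by apply: continuousB2; exact: continuous2l.
rewrite /contour (itv_integral_split cx h1 h2).
rewrite (itv_integralB y1 y2 (cr x2) (cr x1)) (itv_integralB y1 y2 (cr xm) (cr x1)).
rewrite (itv_integralB y1 y2 (cr x2) (cr xm)) [RHS]addrACA -opprD -scalerDr.
by congr ('i%C *: _ - _); rewrite [RHS]addrC addrA subrK.
Qed.

Lemma contour_splity G x1 x2 y1 ym y2 : continuous2 G -> y1 <= ym -> ym <= y2 ->
  contour G x1 x2 y1 y2 = contour G x1 x2 y1 ym + contour G x1 x2 ym y2.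
Proof.
move=> cG h1 h2; have cl y : continuous (G^~ y) by exact: continuous2l.
have cy : continuous (fun y => G x2 y - G x1 y) by apply: continuousB2; exact: continuous2r.
rewrite /contour (itv_integral_split cy h1 h2).
rewrite (itv_integralB x1 x2 (cl y2) (cl y1)) (itv_integralB x1 x2 (cl ym) (cl y1)).
rewrite (itv_integralB x1 x2 (cl y2) (cl ym)) [RHS]addrACA -opprD -scalerDr.
by congr (_ - _); rewrite [RHS]addrC addrA subrK.
Qed.

Lemma rnormi (k : E) : rnorm ('i%C *: k) = rnorm k.
Proof. by rewrite rnormZ normc_def/= expr0n expr1n add0r sqrtr1 mul1r. Qed.

Lemma contour_le G x1 x2 y1 y2 A B : continuous2 G -> x1 <= x2 -> y1 <= y2 ->
  0 <= A -> 0 <= B ->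
  (forall y, y1 <= y -> y <= y2 -> rnorm (G x2 y - G x1 y) <= A) ->
  (forall x, x1 <= x -> x <= x2 -> rnorm (G x y2 - G x y1) <= B) ->
  rnorm (contour G x1 x2 y1 y2) <= A * (y2 - y1) + B * (x2 - x1).
Proof.
move=> cG hx hy A0 B0 hA hB; apply: (le_trans (ler_rnormB _ _)); rewrite rnormi.
apply: lerD; apply: itv_integral_le => //; apply: continuousB2.
- exact: continuous2r.
- exact: continuous2r.
- exact: continuous2l.
- exact: continuous2l.
Qed.

Definition minus_affine G (c d : E) x y : E := G x y - (c + (x +i* y)%C *: d).

Lemma minus_affineB G c d x y x' y' : minus_affine G c d x' y' - minus_affine G c d x y =
  G x' y' - G x y - ((x' - x) +i* (y' - y))%C *: d.
Proof.
rewrite /minus_affine subrACA; congr (_ - _).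
by rewrite opprD addrACA subrr add0r -scalerBl; congr (_ *: _).
Qed.

Lemma continuous2_minus_affine G c d : continuous2 G -> continuous2 (minus_affine G c d).
Proof.
move=> cG x y e e0; have e2 : 0 < e / 2 by rewrite divr_gt0.
have [r r0 hr] := cG x y _ e2.
have D0 : 0 < rnorm d + 1 by rewrite ltr_wpDl// rnorm_ge0.
have eD : 0 < e / 4 / (rnorm d + 1) by rewrite !divr_gt0.
exists (Num.min r (e / 4 / (rnorm d + 1))); first by rewrite lt_min r0.
move=> x' y'; rewrite !le_min => /andP[x1 x2] /andP[y1 y2].
rewrite minus_affineB; apply: (le_trans (ler_rnormB _ _)).
rewrite (splitr e); apply: lerD; first exact: hr.
rewrite rnormZ; apply: (@le_trans _ _ (e / 2 / (rnorm d + 1) * rnorm d)).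
  rewrite ler_wpM2r ?rnorm_ge0// -/(cabs _); apply: (le_trans (cabs_le _)) => /=.
  by apply: (le_trans (lerD x2 y2)); rewrite -mulrDl ler_wpM2r ?invr_ge0 ?(ltW D0)//; lra.
rewrite mulrAC ler_pdivrMr// ler_wpM2l ?(ltW e2)// lerDl//.
Qed.

Lemma contour_affine G (c d : E) x1 x2 y1 y2 : continuous2 G -> x1 <= x2 -> y1 <= y2 ->
  contour (minus_affine G c d) x1 x2 y1 y2 = contour G x1 x2 y1 y2.
Proof.
move=> cG hx hy; rewrite /contour.
have cx : continuous (fun x => G x y2 - G x y1) by apply: continuousB2; exact: continuous2l.
have cy : continuous (fun y => G x2 y - G x1 y) by apply: continuousB2; exact: continuous2r.
have ck (k : E) : continuous ((fun=> k) : R -> E) by move=> ?; exact: cvg_cst.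
have ex : (fun y => minus_affine G c d x2 y - minus_affine G c d x1 y) =
    (fun y => (G x2 y - G x1 y) - ((x2 - x1) +i* 0)%C *: d).
  by apply/funext => y; rewrite minus_affineB subrr.
have ey : (fun x => minus_affine G c d x y2 - minus_affine G c d x y1) =
    (fun x => (G x y2 - G x y1) - (0 +i* (y2 - y1))%C *: d).
  by apply/funext => x; rewrite minus_affineB subrr.
rewrite ex ey (itv_integralB y1 y2 cy (ck _)) (itv_integralB x1 x2 cx (ck _)).
rewrite (itv_integral_cst _ hx) (itv_integral_cst _ hy) scalerBr subrACA.
set k1 := 'i%C *: (_ *: (_ *: d)); set k2 := _ *: (_ *: d).
suff -> : k1 = k2 by rewrite subrr subr0.
rewrite /k1 /k2 !scalerA; congr (_ *: _).
by apply/eqP; rewrite eq_complex /=; apply/andP; split; apply/eqP; ring.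
Qed.

(** Complex differentiability, in terms of the distance [|x' - x| + |y' - y|]. *)
Definition cdifferentiable G x y (d : E) := forall e, 0 < e -> exists2 r : R, 0 < r &
  forall x' y', `|x' - x| <= r -> `|y' - y| <= r ->
    rnorm (G x' y' - G x y - ((x' - x) +i* (y' - y))%C *: d) <= e * (`|x' - x| + `|y' - y|).

Lemma dist_itv (a l z x : R) : a <= z -> z <= a + l -> a <= x -> x <= a + l -> `|x - z| <= l.
Proof. by move=> az za ax xa; rewrite ler_distl; apply/andP; split; lra. Qed.

Lemma quarter (p q r s t : R) : p <= q + r + s + t -> [\/ p / 4 <= q, p / 4 <= r, p / 4 <= s | p / 4 <= t].
Proof.
move=> h; have [h1|h1] := leP (p / 4) q; first by constructor 1.
have [h2|h2] := leP (p / 4) r; first by constructor 2.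
have [h3|h3] := leP (p / 4) s; first by constructor 3.
have [h4|h4] := leP (p / 4) t; first by constructor 4.
exfalso; lra.
Qed.

(** Repeated bisection. In the rectangle of step [n] the function is affine up to
    [o(2^-n)], and affine functions do not contribute ([contour_affine]), so the
    contour integral is [o(4^-n)], while bisection keeps it above [4^-n] times the
    original one. *)
Lemma goursat G x1 x2 y1 y2 : continuous2 G -> x1 <= x2 -> y1 <= y2 ->
  (forall x y, x1 <= x -> x <= x2 -> y1 <= y -> y <= y2 -> exists d, cdifferentiable G x y d) ->
  contour G x1 x2 y1 y2 = 0.
Proof.
move=> cG hx hy dG.
pose w := x2 - x1; pose h := y2 - y1.
have w0 : 0 <= w by rewrite subr_ge0.
have h0 : 0 <= h by rewrite subr_ge0.
pose s n : R := 2^-1 ^+ n.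
have s0 n : 0 < s n by rewrite exprn_gt0// invr_gt0.
have sS n : s n = 2 * s n.+1 by rewrite /s exprS mulrA divff// mul1r.
pose Q n (q : R * R) := contour G q.1 (q.1 + w * s n) q.2 (q.2 + h * s n).
have step n (q : R * R) : exists q' : R * R,
    [/\ rnorm (Q n q) / 4 <= rnorm (Q n.+1 q'), q.1 <= q'.1, q'.1 + w * s n.+1 <= q.1 + w * s n,
        q.2 <= q'.2 & q'.2 + h * s n.+1 <= q.2 + h * s n].
  case: q => x y /=; pose xm := x + w * s n.+1; pose ym := y + h * s n.+1.
  have ex : x + w * s n = xm + w * s n.+1 by rewrite /xm sS; ring.
  have ey : y + h * s n = ym + h * s n.+1 by rewrite /ym sS; ring.
  have ws : 0 <= w * s n.+1 by rewrite mulr_ge0// ltW.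
  have hs : 0 <= h * s n.+1 by rewrite mulr_ge0// ltW.
  have eQ : Q n (x, y) = Q n.+1 (x, y) + Q n.+1 (x, ym) + Q n.+1 (xm, y) + Q n.+1 (xm, ym).
    have hx1 : x <= xm by rewrite lerDl.
    have hx2 : xm <= xm + w * s n.+1 by rewrite lerDl.
    have hy1 : y <= ym by rewrite lerDl.
    have hy2 : ym <= ym + h * s n.+1 by rewrite lerDl.
    rewrite /Q [LHS]/= ex ey (contour_splitx y (ym + h * s n.+1) cG hx1 hx2).
    rewrite (contour_splity x xm cG hy1 hy2) (contour_splity xm (xm + w * s n.+1) cG hy1 hy2).
    exact: addrA.
  have : rnorm (Q n (x, y)) <= rnorm (Q n.+1 (x, y)) + rnorm (Q n.+1 (x, ym)) +
      rnorm (Q n.+1 (xm, y)) + rnorm (Q n.+1 (xm, ym)).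
    rewrite eQ; apply: (le_trans (ler_rnormD _ _)); rewrite lerD2r.
    apply: (le_trans (ler_rnormD _ _)); rewrite lerD2r.
    exact: ler_rnormD.
  by case/quarter => hq; [exists (x, y)|exists (x, ym)|exists (xm, y)|exists (xm, ym)];
    split => //=; rewrite ?ex ?ey ?/xm ?/ym ?lerDl ?lerD2r ?lerDl.
have /(@choice _ _)[nxt hn] : forall nq : nat * (R * R), exists q' : R * R,
    [/\ rnorm (Q nq.1 nq.2) / 4 <= rnorm (Q nq.1.+1 q'), nq.2.1 <= q'.1,
        q'.1 + w * s nq.1.+1 <= nq.2.1 + w * s nq.1,
        nq.2.2 <= q'.2 & q'.2 + h * s nq.1.+1 <= nq.2.2 + h * s nq.1].
  by move=> [n q]; exact: step.
pose q := fix q n := if n is m.+1 then nxt (m, q m) else (x1, y1).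
have hq n : [/\ rnorm (Q n (q n)) / 4 <= rnorm (Q n.+1 (q n.+1)), (q n).1 <= (q n.+1).1,
    (q n.+1).1 + w * s n.+1 <= (q n).1 + w * s n,
    (q n).2 <= (q n.+1).2 & (q n.+1).2 + h * s n.+1 <= (q n).2 + h * s n].
  exact: (hn (n, q n)).
have key (c : nat -> R) (l : R) : (forall n, c n <= c n.+1) ->
    (forall n, c n.+1 + l * s n.+1 <= c n + l * s n) -> 0 <= l ->
    exists z, forall n, c n <= z <= c n + l * s n.
  move=> c1 c2 l0.
  have mono n m : (n <= m)%N -> c n <= c m.
    by elim: m => [|m IH]; [rewrite leqn0 => /eqP ->|rewrite leq_eqVlt => /predU1P[->//|/IH hh]; exact: le_trans hh (c1 m)].
  have mono2 n m : (n <= m)%N -> c m + l * s m <= c n + l * s n.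
    by elim: m => [|m IH]; [rewrite leqn0 => /eqP ->|rewrite leq_eqVlt => /predU1P[->//|/IH hh]; exact: le_trans (c2 m) hh].
  have ls n : 0 <= l * s n by rewrite mulr_ge0// ltW.
  have ub n m : c m <= c n + l * s n.
    have [nm|mn] := leqP n m.
      by apply: le_trans (mono2 _ _ nm); rewrite lerDl.
    by apply: (le_trans (mono _ _ (ltnW mn))); rewrite lerDl.
  exists (sup (range c)) => n; apply/andP; split.
    by apply: ub_le_sup; [exists (c 0%N + l * s 0%N) => _ [m _ <-]; exact: ub|exists n].
  by apply: ge_sup; [exists (c 0%N), 0%N|move=> _ [m _ <-]; exact: ub].
have [X hX] : exists X, forall n, (q n).1 <= X <= (q n).1 + w * s n.
  by apply: (key (fun n => (q n).1)) => // n; have [] := hq n.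
have [Y hY] : exists Y, forall n, (q n).2 <= Y <= (q n).2 + h * s n.
  by apply: (key (fun n => (q n).2)) => // n; have [] := hq n.
have [d dd] : exists d, cdifferentiable G X Y d.
  have := hX 0%N; have := hY 0%N; rewrite /= /s expr0 !mulr1 /w /h ![_ + (_ - _)]addrC !subrK.
  by move=> /andP[? ?] /andP[? ?]; exact: dG.
have lower n : rnorm (contour G x1 x2 y1 y2) * (s n * s n) <= rnorm (Q n (q n)).
  elim: n => [|n IH].
    by rewrite /Q /= /s expr0 !mulr1 /w /h ![_ + (_ - _)]addrC !subrK.
  have [h4 _ _ _ _] := hq n; apply: le_trans h4.
  rewrite ler_pdivlMr//; apply: le_trans IH; rewrite (sS n).
  by rewrite le_eqVlt; apply/orP; left; apply/eqP; ring.
apply: rnorm0_eq0; apply/eqP; rewrite eq_le rnorm_ge0 andbT.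
apply/ler_addgt0Pr => e e0; rewrite add0r.
pose L := w + h + 1.
have L0 : 0 < L by rewrite /L ltr_pwDr// addr_ge0.
have e1 : 0 < e / (2 * L * L) by rewrite divr_gt0// !mulr_gt0.
have [r r0 hr] := dd _ e1.
have [n hn1] : exists n, L * s n <= r.
  have : s n @[n --> \oo] --> (0 : R).
    by apply: cvg_expr; rewrite ger0_norm ?invr_ge0// invf_lt1// ltr1n.
  move=> /cvgrPdist_le/(_ _ (divr_gt0 r0 L0))[N _ hN].
  exists N; have := hN N (leqnn N); rewrite /= sub0r normrN ger0_norm ?(ltW (s0 N))//.
  by rewrite ler_pdivlMr// mulrC.
have /andP[X1 X2] := hX n; have /andP[Y1 Y2] := hY n.
pose Hf := minus_affine G (G X Y - (X +i* Y)%C *: d) d.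
have HE x y : Hf x y = G x y - G X Y - ((x - X) +i* (y - Y))%C *: d.
  rewrite /Hf /minus_affine -[in RHS]addrA -opprD; congr (_ - _).
  rewrite -addrA; congr (_ + _); rewrite addrC -scalerBl; congr (_ *: _).
have cHf : continuous2 Hf by exact: continuous2_minus_affine.
have wsn : 0 <= w * s n by rewrite mulr_ge0// ltW.
have hsn : 0 <= h * s n by rewrite mulr_ge0// ltW.
have rem x y : (q n).1 <= x -> x <= (q n).1 + w * s n -> (q n).2 <= y -> y <= (q n).2 + h * s n ->
    rnorm (Hf x y) <= e / (2 * L * L) * (L * s n).
  move=> xa xb ya yb.
  have dx : `|x - X| <= w * s n by exact: dist_itv X1 X2 xa xb.
  have dy : `|y - Y| <= h * s n by exact: dist_itv Y1 Y2 ya yb.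
  have Ls : w * s n + h * s n <= L * s n by rewrite /L !mulrDl mul1r lerDl ltW.
  rewrite HE; apply: (le_trans (hr x y _ _)).
  - by apply: (le_trans dx); apply: le_trans hn1; apply: le_trans Ls; rewrite lerDl.
  - by apply: (le_trans dy); apply: le_trans hn1; apply: le_trans Ls; rewrite lerDr.
  by rewrite ler_wpM2l ?(ltW e1)//; apply: le_trans Ls; exact: lerD.
have QE : Q n (q n) = contour Hf (q n).1 ((q n).1 + w * s n) (q n).2 ((q n).2 + h * s n).
  by rewrite /Hf contour_affine ?lerDl.
have {}lower := lower n; rewrite QE in lower.
pose D := 2 * (e / (2 * L * L) * (L * s n)).
have D0 : 0 <= D.
  exact: (ltW (mulr_gt0 (ltr0Sn _ 1) (mulr_gt0 e1 (mulr_gt0 L0 (s0 n))))).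
have diff u v : rnorm u <= D / 2 -> rnorm v <= D / 2 -> rnorm (u - v : E) <= D.
  by move=> hu hv; apply: (le_trans (ler_rnormB _ _)); rewrite (splitr D); exact: lerD.
have half (y : R) : 2 * y / 2 = y by rewrite mulrAC divff ?mul1r// pnatr_eq0.
have D2 : D / 2 = e / (2 * L * L) * (L * s n) by exact: half.
have := @contour_le Hf (q n).1 ((q n).1 + w * s n) (q n).2 ((q n).2 + h * s n) D D cHf.
rewrite !lerDl => /(_ wsn hsn D0 D0) cle.
have {}lower : rnorm (contour G x1 x2 y1 y2) * (s n * s n) <= D * (h * s n) + D * (w * s n).
  apply: (le_trans lower); apply: (le_trans (cle _ _)).
  - by move=> y ya yb; apply: diff; rewrite D2; apply: rem; rewrite ?lerDl.
  - by move=> x xa xb; apply: diff; rewrite D2; apply: rem; rewrite ?lerDl.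
  by rewrite le_eqVlt; apply/orP; left; apply/eqP; ring.
have ss0 : 0 < s n * s n by rewrite mulr_gt0.
rewrite -(ler_pM2r ss0); apply: (le_trans lower).
have -> : D * (h * s n) + D * (w * s n) = e * ((w + h) / L) * (s n * s n).
  by rewrite /D; field; rewrite gt_eqF.
apply: (ler_wpM2r (ltW ss0)); rewrite -[leRHS]mulr1; apply: (ler_wpM2l (ltW e0)).
rewrite (ler_pdivrMr _ _ L0) mul1r.
by rewrite /L lerDl.
Qed.


Lemma uniform_line G a y1 y2 e : continuous2 G -> 0 < e -> exists2 d : R, 0 < d &
  forall x, `|x - a| <= d -> forall y, y1 <= y -> y <= y2 -> rnorm (G x y - G a y) <= e.
Proof.
move=> cG e0; have e2 : 0 < e / 2 by rewrite divr_gt0.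
have cpt : \forall x \near a, `[y1, y2]%classic `<=` (fun y => rnorm (G x y - G a y) <= e).
  have /compact_near_coveringP cpt := @segment_compact R y1 y2.
  have := cpt R (nbhs a) (fun x y => rnorm (G x y - G a y) <= e) _.
  apply => y _; have [d d0 hd] := cG a y _ e2.
  exists ([set y' : R | `|y - y'| <= d], [set x : R | `|a - x| <= d]).
    by split => /=; apply/nbhs_ballP; exists d => //= z; rewrite -ball_normE/= => /ltW.
  move=> [y' x] [/= hy hx]; rewrite distrC in hy; rewrite distrC in hx.
  apply: (le_trans (ler_rnorm_distD (G a y) _ _)); rewrite (splitr e); apply: lerD.
    exact: hd.
  by rewrite rnormB; apply: hd => //; rewrite subrr normr0 ltW.
have /nbhs_ballP[d /= d0 hd] := cpt.
exists (d / 2); first by rewrite divr_gt0.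
move=> x xa y ya yb; apply: (hd x); last by rewrite /= in_itv/= ya yb.
rewrite -ball_normE/= distrC; apply: (le_lt_trans xa).
by rewrite ltr_pdivrMr// ltr_pMr// ltr1n.
Qed.

(** The vertical sides nearly cancel by uniform continuity along the line over [a],
    and the horizontal ones are short. *)
Lemma contour_thin G a y1 y2 e : continuous2 G -> y1 <= y2 -> 0 < e -> exists2 d : R, 0 < d &
  forall x1 x2, x1 <= x2 -> `|x1 - a| <= d -> `|x2 - a| <= d ->
    rnorm (contour G x1 x2 y1 y2) <= e.
Proof.
move=> cG hy e0; pose l := y2 - y1 + 1.
have l0 : 0 < l by rewrite /l ltr_wpDl// subr_ge0.
pose e1 := e / (4 * l); have e10 : 0 < e1 by rewrite divr_gt0// mulr_gt0.
have [d d0 hd] := uniform_line a y1 y2 cG e10.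
pose M := rnorm (G a y2 - G a y1) + 2 * e1 + 1.
have M0 : 0 < M by rewrite /M ltr_wpDl// addr_ge0 ?rnorm_ge0// mulr_ge0// ltW.
exists (Num.min d (e / (4 * M))); first by rewrite lt_min d0 divr_gt0// mulr_gt0.
move=> x1 x2 hx; rewrite !le_min => /andP[h1 h1'] /andP[h2 h2'].
have cle := @contour_le G x1 x2 y1 y2 (2 * e1) M cG hx hy (mulr_ge0 (ler0n _ 2) (ltW e10)) (ltW M0).
apply: (le_trans (cle _ _)).
- move=> y ya yb; apply: (le_trans (ler_rnorm_distD (G a y) _ _)).
  have := hd x2 h2 y ya yb; have := hd x1 h1 y ya yb; rewrite rnormB => ha hb.
  by rewrite mulrDl mul1r; exact: lerD.
- move=> x xa xb.
  have xd : `|x - a| <= d.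
    by move: h1 h2; rewrite !ler_distl => /andP[p1 p2] /andP[p3 p4]; apply/andP; split; lra.
  have k1 := hd x xd y1 (lexx _) hy; have k2 := hd x xd y2 hy (lexx _).
  have -> : G x y2 - G x y1 = (G x y2 - G a y2) - (G x y1 - G a y1) + (G a y2 - G a y1).
    by rewrite subrACA subrK.
  apply: (le_trans (ler_rnormD _ _)).
  have kk := le_trans (ler_rnormB (G x y2 - G a y2) (G x y1 - G a y1)) (lerD k2 k1).
  apply: (le_trans (lerD kk (lexx _))); rewrite /M addrC -[leRHS]addrA lerD2l.
  by rewrite mulr2n mulrDl mul1r lerDl.
have x12 : x2 - x1 <= 2 * (e / (4 * M)).
  by move: h1' h2'; rewrite !ler_distl => /andP[p1 p2] /andP[p3 p4]; lra.
rewrite (splitr e); apply: lerD.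
  rewrite /e1; apply: (@le_trans _ _ (2 * (e / (4 * l)) * l)).
    by apply: ler_wpM2l; [rewrite mulr_ge0// (ltW e10)|rewrite /l lerDl].
  by rewrite le_eqVlt; apply/orP; left; apply/eqP; field; rewrite gt_eqF.
apply: (@le_trans _ _ (M * (2 * (e / (4 * M))))); first by rewrite ler_wpM2l// ltW.
by rewrite le_eqVlt; apply/orP; left; apply/eqP; field; rewrite gt_eqF.
Qed.

(** Apply [goursat] after removing thin strips along the vertical sides, where the function
    is merely continuous; by [contour_thin] the strips contribute arbitrarily little. *)
Lemma goursat_open G a b y1 y2 : continuous2 G -> a < b -> y1 <= y2 ->
  (forall x y, a < x -> x < b -> exists d, cdifferentiable G x y d) ->
  contour G a b y1 y2 = 0.
Proof.
move=> cG ab hy dG; apply: rnorm0_eq0; apply/eqP; rewrite eq_le rnorm_ge0 andbT.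
apply/ler_addgt0Pr => e e0; rewrite add0r; have e2 : 0 < e / 2 by rewrite divr_gt0.
have [da da0 ha] := contour_thin a cG hy e2; have [db db0 hb] := contour_thin b cG hy e2.
pose d := Num.min (Num.min da db) ((b - a) / 2).
have ba : 0 < (b - a) / 2 by rewrite divr_gt0// subr_gt0.
have d0 : 0 < d by rewrite !lt_min da0 db0.
have [d1 d2 d3] : [/\ d <= da, d <= db & d <= (b - a) / 2] by rewrite !ge_min !lexx !orbT.
clearbody d.
have h1 : a <= a + d by lra.
have h2 : a + d <= b - d by lra.
have h3 : b - d <= b by lra.
rewrite (contour_splitx _ _ cG (le_trans h1 h2) h3) (contour_splitx _ _ cG h1 h2).
rewrite [contour G (a + d) _ _ _](goursat cG h2 hy) ?addr0; last first.
  move=> x y xa xb _ _; apply: dG; lra.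
apply: (le_trans (ler_rnormD _ _)); rewrite (splitr e); apply: lerD.
  apply: ha => //; first by rewrite subrr normr0 ltW.
  by rewrite addrAC subrr add0r ger0_norm// ltW.
apply: hb => //; last by rewrite subrr normr0 ltW.
by rewrite addrAC subrr add0r normrN ger0_norm// ltW.
Qed.

Lemma rnormZc (k : R[i]) (v : E) : rnorm (k *: v) = cabs k * rnorm v.
Proof. exact: rnormZ. Qed.

Lemma cabsD (k l : R[i]) : cabs (k + l) <= cabs k + cabs l.
Proof.
by have := ler_normD k l; rewrite lecE raddfD => /andP[].
Qed.

(** A kernel with nonnegative real part has no cancellation.  There is no inner product
    with [v] to read off the real part, but a large constant [lambda] replaces it:
    [|lambda - k| <= lambda - Re k + |k|^2 / lambda], so the integral of
    [(lambda - k) *: v] is visibly smaller than that of [lambda *: v]. *)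
Lemma positive_kernel (k : R -> R[i]) (v : E) T B kappa : 1 <= T -> 0 <= kappa ->
  continuous (fun y => k y *: v) ->
  (forall y, cabs (k y) <= B) -> (forall y, 0 <= complex.Re (k y)) ->
  (forall y, `|y| <= 1 -> kappa <= complex.Re (k y)) ->
  2 * kappa * rnorm v <= rnorm (bochner `[- T, T] (fun y => k y *: v)).
Proof.
move=> T1 kappa0 ck hB re0 rek; set I := bochner _ _.
have B0 : 0 <= B by exact: le_trans (cabs_ge0 _) (hB 0).
have v0 := rnorm_ge0 v.
have kB : kappa <= B.
  apply: le_trans (hB 0); apply: le_trans (cabs_Re _).
  by apply: le_trans (ler_norm _); apply: rek; rewrite normr0.
have main lambda : 0 < lambda -> B <= lambda ->
    2 * kappa * rnorm v <= rnorm I + 2 * T * (B ^+ 2 / lambda) * rnorm v.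
  move=> l0 Bl; pose f y := lambda%:C%C *: v - k y *: v.
  have cf : continuous f by apply: continuousB2 => // ?; exact: cvg_cst.
  pose q := B ^+ 2 / lambda; have q0 : 0 <= q by rewrite divr_ge0 ?sqr_ge0// ltW.
  have lq : lambda * q = B ^+ 2 by rewrite /q mulrC divfK ?gt_eqF.
  have fE y : rnorm (f y) <= (lambda - complex.Re (k y) + q) * rnorm v.
    rewrite /f -scalerBl rnormZc ler_wpM2r//.
    have rB : complex.Re (k y) <= B.
      by apply: le_trans (hB y); apply: le_trans (cabs_Re _); exact: ler_norm.
    have p0 : 0 <= lambda - complex.Re (k y) + q by lra.
    rewrite cabsE -[leRHS]ger0_norm// -sqrtr_sqr ler_wsqrtr//.
    have := hB y; rewrite cabsE -[leRHS]ger0_norm// -sqrtr_sqr ler_sqrt ?sqr_ge0//.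
    case: (k y) rB p0 => r s /= rB p0 rs; rewrite sub0r sqrrN.
    have : 0 <= (r - q) ^+ 2 by exact: sqr_ge0.
    have Bs : 0 <= B ^+ 2 by exact: sqr_ge0.
    nra.
  have h1 : - T <= -1 :> R by rewrite lerN2.
  have h2 : (-1 : R) <= 1 by lra.
  have h3 : - T <= (1 : R) by lra.
  have m1 : 0 <= (lambda + q) * rnorm v by rewrite mulr_ge0// addr_ge0// ltW.
  have m2 : 0 <= (lambda - kappa + q) * rnorm v by rewrite mulr_ge0// addr_ge0// subr_ge0 (le_trans kB).
  have If : bochner `[- T, T] f = (T - - T)%:C%C *: (lambda%:C%C *: v) - I.
    by rewrite itv_integralB ?itv_integral_cst//; [lra|move=> ?; exact: cvg_cst].
  have up : rnorm (bochner `[- T, T] f) <= (lambda + q) * rnorm v * (-1 - - T) +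
      (lambda - kappa + q) * rnorm v * (1 - -1) + (lambda + q) * rnorm v * (T - 1).
    rewrite (itv_integral_split cf h3 T1) (itv_integral_split cf h1 h2).
    apply: (le_trans (ler_rnormD _ _)); apply: lerD.
      apply: (le_trans (ler_rnormD _ _)); apply: lerD; apply: itv_integral_le => // y ya yb.
        by apply: (le_trans (fE y)); rewrite ler_wpM2r// lerD2r gerBl.
      apply: (le_trans (fE y)); rewrite ler_wpM2r// lerD2r lerD2l lerN2; apply: rek.
      by rewrite ler_norml ya yb.
    apply: itv_integral_le => // y ya yb.
    by apply: (le_trans (fE y)); rewrite ler_wpM2r// lerD2r gerBl.
  have low : (T - - T) * lambda * rnorm v <= rnorm I + rnorm (bochner `[- T, T] f).
    have -> : (T - - T) * lambda * rnorm v = rnorm ((T - - T)%:C%C *: (lambda%:C%C *: v)).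
      by rewrite !rnormZr !ger0_norm ?mulrA ?(ltW l0)//; lra.
    rewrite -[X in rnorm X <= _](subrK I) -If addrC; exact: ler_rnormD.
  move: (le_trans low (lerD (lexx _) up)); rewrite -/q.
  move: (rnorm v) (rnorm I) => V J; move=> hyp; rewrite -subr_ge0.
  rewrite -subr_ge0 in hyp; move: hyp; congr (0 <= _); ring.
apply/ler_addgt0Pr => e e0.
pose W := 2 * T * B ^+ 2 * rnorm v; have W0 : 0 <= W by rewrite !mulr_ge0 ?sqr_ge0//; lra.
pose lambda := Num.max (B + 1) (W / e).
have l1 : B + 1 <= lambda by rewrite le_max lexx.
have l2 : W / e <= lambda by rewrite le_max lexx orbT.
have l0 : 0 < lambda by apply: lt_le_trans l1; rewrite ltr_wpDl.
have := main lambda l0 (le_trans _ l1); rewrite lerDl ler01 => /(_ isT) h.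
apply: (le_trans h); rewrite lerD2l mulrA mulrAC -/W ler_pdivrMr// mulrC.
by rewrite -ler_pdivrMr.
Qed.


Section Kernel.
Variables (theta : R) (th : 0 < theta < 1).

Definition kernel x y : R[i] := ((x - theta) +i* y)%C^-1.

Let zeta x y : R[i] := ((x - theta) +i* y)%C.

Lemma kernel_local x y : 0 < cabs (zeta x y) -> forall x' y',
  `|x' - x| <= cabs (zeta x y) / 4 -> `|y' - y| <= cabs (zeta x y) / 4 ->
  [/\ zeta x' y' != 0, cabs (kernel x' y') <= 2 / cabs (zeta x y) &
   cabs (kernel x' y' - kernel x y) <= (`|x' - x| + `|y' - y|) * (2 / cabs (zeta x y) ^+ 2)].
Proof.
set r := cabs (zeta x y) => r0 x' y' hx hy.
have eD : zeta x' y' - zeta x y = ((x' - x) +i* (y' - y))%C.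
  by apply/eqP; rewrite eq_complex /=; apply/andP; split; apply/eqP => //; ring.
have dle : cabs (zeta x' y' - zeta x y) <= `|x' - x| + `|y' - y|.
  by rewrite eD; exact: cabs_le.
have h2 : r / 2 <= cabs (zeta x' y').
  have := cabsD (zeta x' y') (- (zeta x' y' - zeta x y)).
  rewrite opprB addrC subrK -/r -opprB /cabs normrN -/(cabs _) -/(cabs _) -/(cabs _) -/r => h.
  lra.
have c0 : 0 < cabs (zeta x' y') by apply: lt_le_trans h2; rewrite divr_gt0.
have nz (k : R[i]) : 0 < cabs k -> k != 0.
  by apply: contraTneq => ->; rewrite /cabs normr0 ltxx.
have k2 : cabs (kernel x' y') <= 2 / r.
  by rewrite /kernel cabsV -[leRHS]invrK lef_pV2 ?posrE ?invr_gt0 ?divr_gt0// invf_div.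
split=> //; first exact: nz.
have -> : kernel x' y' - kernel x y = - (zeta x' y' - zeta x y) * (kernel x' y' * kernel x y).
  rewrite /kernel -/(zeta x' y') -/(zeta x y).
  move: (zeta x' y') (zeta x y) (nz _ c0) (nz _ r0) => a b a0 b0.
  by field; rewrite b0.
rewrite !cabsM {1}/cabs normrN -/(cabs _); apply: ler_pM; rewrite ?mulr_ge0 ?cabs_ge0//.
rewrite [cabs (kernel x y)]cabsV -/(zeta x y) -/r expr2 invfM mulrA.
by rewrite ler_wpM2r// invr_ge0 ltW.
Qed.

Lemma kernel_continuous G x y : continuous2 G -> 0 < cabs (zeta x y) ->
  forall e, 0 < e -> exists2 d : R, 0 < d & forall x' y', `|x' - x| <= d -> `|y' - y| <= d ->
    zeta x' y' != 0 /\ rnorm (kernel x' y' *: G x' y' - kernel x y *: G x y) <= e.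
Proof.
move=> cG r0 e e0; have loc := kernel_local r0.
set r := cabs (zeta x y) in r0 loc *.
have e1 : 0 < e * r / 4 by rewrite divr_gt0// mulr_gt0.
have [d d0 hd] := cG x y _ e1.
pose W := rnorm (G x y) + 1; have W0 : 0 < W by rewrite /W ltr_wpDl// rnorm_ge0.
have d1 : 0 < e * r ^+ 2 / 8 / W by rewrite !divr_gt0// mulr_gt0// exprn_gt0.
exists (Num.min (Num.min d (r / 4)) (e * r ^+ 2 / 8 / W)).
  by rewrite !lt_min d0 d1 divr_gt0.
move=> x' y'; rewrite !le_min => /andP[/andP[x1 x2] x3] /andP[/andP[y1 y2] y3].
have [z0 k2 dk] := loc x' y' x2 y2; split => //.
have -> : kernel x' y' *: G x' y' - kernel x y *: G x y =
    kernel x' y' *: (G x' y' - G x y) + (kernel x' y' - kernel x y) *: G x y.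
  by rewrite scalerBr scalerBl addrA subrK.
apply: (le_trans (ler_rnormD _ _)); rewrite !rnormZc (splitr e); apply: lerD.
  apply: (@le_trans _ _ (2 / r * (e * r / 4))).
    by apply: ler_pM => //; [exact: cabs_ge0|exact: rnorm_ge0|exact: hd].
  by rewrite le_eqVlt; apply/orP; left; apply/eqP; field; rewrite gt_eqF.
apply: (@le_trans _ _ (2 * (e * r ^+ 2 / 8 / W) * (2 / r ^+ 2) * W)).
  apply: ler_pM; rewrite ?cabs_ge0 ?rnorm_ge0//; last by rewrite /W lerDl.
  apply: (le_trans dk); rewrite ler_wpM2r ?divr_ge0 ?sqr_ge0//.
  by rewrite mulr2n mulrDl !mul1r; exact: lerD.
by rewrite le_eqVlt; apply/orP; left; apply/eqP; field; rewrite !gt_eqF.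
Qed.

Lemma kernel_cdifferentiable G x y d : 0 < cabs (zeta x y) -> cdifferentiable G x y d ->
  cdifferentiable (fun x y => kernel x y *: G x y) x y
    (kernel x y *: d - kernel x y ^+ 2 *: G x y).
Proof.
move=> r0 dG e e0; have loc := kernel_local r0.
have kr : cabs (kernel x y) = (cabs (zeta x y))^-1 by exact: cabsV.
set r := cabs (zeta x y) in r0 loc kr *.
have e1 : 0 < e * r / 4 by rewrite divr_gt0// mulr_gt0.
have [s s0 hs] := dG _ e1.
pose W := rnorm d + r^-1 * rnorm (G x y) + 1.
have W0 : 0 < W by rewrite /W ltr_wpDl// addr_ge0 ?mulr_ge0 ?rnorm_ge0// invr_ge0 ltW.
have d1 : 0 < e * r ^+ 2 / 8 / W by rewrite !divr_gt0// mulr_gt0// exprn_gt0.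
exists (Num.min (Num.min s (r / 4)) (e * r ^+ 2 / 8 / W)).
  by rewrite !lt_min s0 d1 divr_gt0.
move=> x' y'; rewrite !le_min => /andP[/andP[x1 x2] x3] /andP[/andP[y1 y2] y3].
have [z0 k2 dk] := loc x' y' x2 y2; have rem := hs x' y' x1 y1.
set N := `|x' - x| + `|y' - y| in rem dk *.
have N0 : 0 <= N by rewrite addr_ge0.
have N1 : N <= 2 * (e * r ^+ 2 / 8 / W) by rewrite /N mulr2n mulrDl !mul1r; exact: lerD.
have cD : cabs ((x' - x) +i* (y' - y))%C <= N by exact: cabs_le.
have kk : kernel x' y' - kernel x y = - ((x' - x) +i* (y' - y))%C * (kernel x' y' * kernel x y).
  have z1 : zeta x y != 0.
    by apply: contraTneq r0 => h; rewrite /r h /cabs normr0 ltxx.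
  have -> : ((x' - x) +i* (y' - y))%C = zeta x' y' - zeta x y.
    by apply/eqP; rewrite eq_complex /=; apply/andP; split; apply/eqP => //; ring.
  rewrite /kernel -/(zeta x' y') -/(zeta x y).
  move: (zeta x' y') (zeta x y) z0 z1 => a b a0 b0.
  by field; rewrite b0.
set D := ((x' - x) +i* (y' - y))%C in rem cD kk *.
move: (kernel x' y') (kernel x y) k2 dk kk kr => k' k k2 dk kk kr.
have -> : k' *: G x' y' - k *: G x y - D *: (k *: d - k ^+ 2 *: G x y) =
    k' *: (G x' y' - G x y - D *: d) + (D * (k' - k)) *: (d - k *: G x y).
  exact: product_identity.
apply: (le_trans (ler_rnormD _ _)); rewrite !rnormZc.
have -> : e * N = 2 / r * (e * r / 4 * N) + e / 2 * N by field; rewrite gt_eqF.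
apply: lerD.
  by apply: ler_pM => //; [exact: cabs_ge0|exact: rnorm_ge0].
have hW : rnorm (d - k *: G x y) <= W.
  apply: (le_trans (ler_rnormB _ _)); rewrite rnormZc kr /W lerDl//.
rewrite cabsM; apply: (@le_trans _ _ (N * (2 * (e * r ^+ 2 / 8 / W) * (2 / r ^+ 2)) * W)).
  apply: ler_pM; rewrite ?mulr_ge0 ?cabs_ge0 ?rnorm_ge0//.
  apply: ler_pM; rewrite ?cabs_ge0//.
  by apply: (le_trans dk); rewrite ler_wpM2r// divr_ge0 ?sqr_ge0.
by rewrite le_eqVlt; apply/orP; left; apply/eqP; field; rewrite !gt_eqF.
Qed.

End Kernel.

(** The primitive of [(1 + y^2)^-1] is the arctangent, which takes its values in an interval
    of length [pi]. *)
Lemma integral_decay (f : R -> E) T C : continuous f -> 0 <= C -> 0 < T ->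
  (forall y, rnorm (f y) <= C * (1 + y ^+ 2)^-1) ->
  rnorm (bochner `[- T, T] f) <= C * pi.
Proof.
move=> cf C0 T0 hf; rewrite -lee_fin.
have mI : measurable (`[- T, T] : set (measurableTypeR R)) by exact: measurable_itv.
have ci : continuous (fun y : R => (1 + y ^+ 2)^-1).
  move=> y; apply: cvgV; first by rewrite gt_eqF// ltr_pwDl// sqr_ge0.
  by apply: cvgD; [exact: cvg_cst|exact: exprn_continuous].
have i0 (y : R) : 0 <= (1 + y ^+ 2)^-1 by rewrite invr_ge0 addr_ge0// sqr_ge0.
apply: (le_trans (rnorm_bochner mI (continuous_integrable _ _ cf).1)).
apply: (@le_trans _ _ (\int[leb]_(y in `[(- T)%R, T]) (C%:E * ((1 + y ^+ 2)^-1)%:E))%E).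
  apply: le_nnintegral; first exact: mI.
    by move=> y _; rewrite lee_fin rnorm_ge0.
  by move=> y _; rewrite -EFinM lee_fin.
have TT : - T < T by rewrite gtrN.
rewrite nnintegralZ; last 4 first.
- exact: mI.
- exact: C0.
- by move=> y _; rewrite lee_fin.
- exists (fun y => ((1 + y ^+ 2)^-1)%:E); last exact: aeW.
  by apply/measurable_EFinP; exact: continuous_measurable_fun.
rewrite (@continuous_FTC2 _ _ (@atan R) _ _ TT); last 3 first.
- exact: continuous_subspaceT.
- split; first by move=> x _; exact: derivable_atan.
    by apply: cvg_at_right_filter; exact: continuous_atan.
  by apply: cvg_at_left_filter; exact: continuous_atan.
- by move=> x _; exact: derive1_atan.
rewrite -EFinB -EFinM lee_fin ler_wpM2l//.
have := atan_ltpi2 T; have := atan_gtNpi2 (- T); lra.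
Qed.

(** The function [G z = (g z - g theta) / (z - theta)], with the derivative [d] of [g] as its value at
    [theta], is continuous, and holomorphic off the vertical line through [theta].  So
    its integral over the boundary of [[0, 1] x [- T, T]] vanishes, and the horizontal
    sides are [O(1/T)].  On the vertical sides, the part with [g z] is bounded by the
    boundary values, and the part with the constant [g theta] is bounded below by
    [positive_kernel], as the difference of the two kernels has positive real part. *)
Lemma strip_bound (g : R -> R -> E) theta M B : 0 < theta < 1 -> continuous2 g ->
  (forall x y, 0 < x -> x < 1 -> exists d, cdifferentiable g x y d) ->
  0 <= B -> (forall x y, 0 <= x -> x <= 1 -> rnorm (g x y) <= B) ->
  0 <= M ->
  (forall y, rnorm (g 0 y) <= M / (1 + `|y|)) -> (forall y, rnorm (g 1 y) <= M / (1 + `|y|)) ->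
  rnorm (g theta 0) <= 4 * pi / (Num.min theta (1 - theta)) ^+ 2 * M.
Proof.
move=> /andP[t0 t1] cg dg B0 gB M0 g0 g1.
pose tau := Num.min theta (1 - theta).
have tau0 : 0 < tau by rewrite lt_min t0 subr_gt0.
have [tau1 tau2] : tau <= theta /\ tau <= 1 - theta by rewrite !ge_min !lexx orbT.
rewrite -/tau; clearbody tau.
pose c := g theta 0.
have [d hd] := dg theta 0 t0 t1.
pose f x y := g x y - c.
have cf : continuous2 f.
  move=> x y e e0; have [r r0 hr] := cg x y e e0; exists r => // x' y' h1 h2.
  by rewrite /f opprB addrA subrK; exact: hr.
have df x y (e : E) : cdifferentiable g x y e -> cdifferentiable f x y e.
  move=> h e' e0'; have [r r0 hr] := h e' e0'; exists r => // x' y' h1 h2.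
  have -> : f x' y' - f x y = g x' y' - g x y by rewrite /f opprB addrA subrK.
  exact: hr.
pose z0 x y := ((x - theta) +i* y)%C == 0.
pose G x y := if z0 x y then d else kernel theta x y *: f x y.
have zpos x y : ~~ z0 x y -> 0 < cabs ((x - theta) +i* y)%C.
  move=> h; rewrite lt_neqAle cabs_ge0 andbT eq_sym; apply: contra h => /eqP h.
  by rewrite /z0 -normr_eq0 -(RRe_real (normr_real _)) -/(cabs _) h.
have nz x y (P : R[i]) : ((x - theta) +i* y)%C != 0 -> G x y = kernel theta x y *: f x y.
  by move=> h; rewrite /G /z0 (negbTE h).
have cG : continuous2 G.
  move=> x y e e0; have [h|h] := boolP (z0 x y); last first.
    have [r r0 hr] := kernel_continuous cf (zpos _ _ h) e0.
    exists r => // x' y' h1 h2; have [h3 h4] := hr x' y' h1 h2.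
    by rewrite !nz.
  have [xE yE] : x = theta /\ y = 0.
    by move: h; rewrite /z0 eq_complex /= subr_eq0 => /andP[/eqP -> /eqP ->].
  have e2 : 0 < e / 2 by rewrite divr_gt0.
  have [r r0 hr] := hd _ e2; exists r => // x' y'; rewrite xE yE => h1 h2.
  have -> : G theta 0 = d by rewrite /G /z0 subrr eqxx.
  have [h3|h3] := boolP (z0 x' y'); first by rewrite /G h3 subrr rnorm0 ltW.
  have z3 := zpos _ _ h3; rewrite (nz _ _ 0)//.
  have := hr x' y' h1 h2; rewrite subr0.
  set Z := ((x' - theta) +i* y')%C in z3 *; move=> hb.
  have Z0 : Z != 0 by [].
  have -> : kernel theta x' y' *: f x' y' - d = Z^-1 *: (g x' y' - g theta 0 - Z *: d).
    by rewrite [RHS]scalerBr scalerA mulVf// scale1r.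
  rewrite rnormZc cabsV mulrC ler_pdivrMr//; apply: (le_trans hb).
  have := cabs_Re Z; have := cabs_Im Z; rewrite /= => i1 i2.
  have -> : e * cabs Z = e / 2 * (cabs Z + cabs Z) by field.
  by rewrite ler_wpM2l ?(ltW e2)//; exact: lerD.
have dG x y : 0 < x -> x < 1 -> x != theta -> exists e : E, cdifferentiable G x y e.
  move=> x0 x1 xt; have h : ~~ z0 x y.
    by rewrite /z0 eq_complex /= subr_eq0 (negbTE xt).
  have zp := zpos _ _ h; have [e he] := dg x y x0 x1.
  have := kernel_cdifferentiable zp (df _ _ _ he); set e' := _ - _ => hk.
  exists e' => eps eps0; have [r r0 hr] := hk eps eps0.
  have [r' r0' hr'] := kernel_continuous cf zp ltr01.
  exists (Num.min r r'); first by rewrite lt_min r0.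
  move=> x' y'; rewrite !le_min => /andP[h1 h1'] /andP[h2 h2'].
  have [h3 _] := hr' x' y' h1' h2'.
  by rewrite !(nz _ _ 0)//; exact: hr.
(* [G] is differentiable between the vertical lines over [0], [theta] and [1]. *)
have vanish T : 0 < T -> contour G 0 1 (- T) T = 0.
  move=> T0; have TT : - T <= T by rewrite ge0_cp// ltW.
  rewrite (contour_splitx _ _ cG (ltW t0) (ltW t1)).
  rewrite (goursat_open cG t0 TT) ?(goursat_open cG t1 TT) ?addr0//.
    by move=> x y tx x1; apply: dG => //; [exact: lt_trans tx|rewrite gt_eqF].
  by move=> x y x0 xt; apply: dG => //; [exact: lt_trans t1|rewrite lt_eqF].
have K0 (y : R) : ((0 - theta) +i* y)%C != 0 by rewrite eq_complex /= sub0r oppr_eq0 gt_eqF.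
have K1 (y : R) : ((1 - theta) +i* y)%C != 0 by rewrite eq_complex /= subr_eq0 gt_eqF.
have cK (h : R -> R -> E) j : continuous2 h -> (forall y, ((j - theta) +i* y)%C != 0) ->
    continuous (fun y => kernel theta j y *: h j y).
  move=> ch hj; apply/continuousP => y e e0.
  have [r r0 hr] := kernel_continuous ch (zpos _ _ (hj y)) e0.
  have jj : `|j - j| <= r by rewrite subrr normr0 ltW.
  by exists r => // y' hy; exact: (hr j y' jj hy).2.
have cc : continuous2 (fun _ _ => c).
  by move=> x y e e0; exists 1 => // x' y' _ _; rewrite subrr rnorm0 ltW.
have cabsK j y : tau <= `|j - theta| -> cabs (kernel theta j y) <= 2 / tau * (1 + `|y|)^-1.
  move=> jt; rewrite cabsV.
  have y1 : 0 < 1 + `|y| by rewrite ltr_pwDl.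
  have := cabs_Re ((j - theta) +i* y)%C; have := cabs_Im ((j - theta) +i* y)%C.
  rewrite /=; set X := cabs _ => i1 i2.
  have X0 : 0 < X by apply: lt_le_trans i2; exact: lt_le_trans jt.
  have tau11 : tau <= 1 by lra.
  rewrite -[leLHS]mul1r ler_pdivrMr// mulrAC ler_pdivlMr// mul1r mulrAC ler_pdivlMr//.
  have : tau * `|y| <= `|y| by rewrite ler_piMl.
  rewrite mulrDl mul1r [`|y| * _]mulrC; lra.
pose I T := bochner `[- T, T] (fun y => (kernel theta 1 y - kernel theta 0 y) *: c).
have up T : 1 <= T -> rnorm (I T) <= 4 * M / tau * pi + 4 * B / T.
  move=> T1; have T0 : 0 < T by exact: lt_le_trans T1.
  pose P y := kernel theta 1 y *: g 1 y - kernel theta 0 y *: g 0 y.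
  pose Q y := G 1 y - G 0 y.
  have cP : continuous P by apply: continuousB2; apply: cK.
  have cQ : continuous Q by apply: continuousB2; exact: continuous2r.
  have -> : I T = bochner `[- T, T] P - bochner `[- T, T] Q.
    rewrite -(itv_integralB _ _ cP cQ); congr bochner; apply/funext => y.
    rewrite /P /Q !(nz _ _ 0)// /f !scalerBr scalerBl.
    by rewrite [RHS]subrACA !subKr.
  apply: (le_trans (ler_rnormB _ _)); apply: lerD.
    apply: integral_decay => // [|y]; first by rewrite divr_ge0 ?mulr_ge0 ?(ltW tau0).
    have y1 : 0 < 1 + `|y| by rewrite ltr_pwDl.
    apply: (le_trans (ler_rnormB _ _)); rewrite !rnormZc.
    apply: (@le_trans _ _ ((2 / tau * (1 + `|y|)^-1) * (M / (1 + `|y|)) +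
        (2 / tau * (1 + `|y|)^-1) * (M / (1 + `|y|)))).
      apply: lerD; apply: ler_pM => //; rewrite ?cabs_ge0 ?rnorm_ge0//; apply: cabsK.
        by rewrite ger0_norm// subr_ge0 ltW.
      by rewrite sub0r normrN gtr0_norm.
    have -> : 2 / tau / (1 + `|y|) * (M / (1 + `|y|)) + 2 / tau / (1 + `|y|) * (M / (1 + `|y|)) =
        4 * M / tau * ((1 + `|y|) ^+ 2)^-1 by field; rewrite !gt_eqF.
    rewrite ler_wpM2l ?divr_ge0 ?mulr_ge0 ?(ltW tau0)//.
    rewrite lef_pV2 ?posrE ?exprn_gt0//; last by rewrite ltr_pwDl// sqr_ge0.
    by rewrite sqrrD expr1n mul1r real_normK ?num_real// lerD2r lerDl mulrn_wge0.
  have := vanish T T0; rewrite /contour => /eqP; rewrite subr_eq0 => /eqP h.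
  rewrite -rnormi -/Q h; have <- : 4 * B / T * (1 - 0) = 4 * B / T by ring.
  apply: itv_integral_le => //.
  - by apply: continuousB2; exact: continuous2l.
  - by rewrite divr_ge0 ?mulr_ge0// ltW.
  move=> x x0 x1.
  have GT y : `|y| = T -> rnorm (G x y) <= 2 * B / T.
    move=> yT; have zy : ((x - theta) +i* y)%C != 0.
      rewrite eq_complex /= negb_and; apply/orP; right.
      by apply: contraTneq T0 => h'; rewrite -yT h' normr0 ltxx.
    rewrite (nz _ _ 0)// rnormZc cabsV mulrC; apply: ler_pM.
    - exact: rnorm_ge0.
    - by rewrite invr_ge0 cabs_ge0.
    - by apply: (le_trans (ler_rnormB _ _)); rewrite mulr2n mulrDl mul1r; apply: lerD; apply: gB => //; exact: ltW.
    rewrite lef_pV2 ?posrE//; last exact: zpos.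
    by rewrite -yT; exact: (cabs_Im ((x - theta) +i* y)%C).
  apply: (le_trans (ler_rnormB _ _)).
  have -> : 4 * B / T = 2 * B / T + 2 * B / T by ring.
  by apply: lerD; apply: GT; rewrite ?normrN gtr0_norm.
have reK j y : complex.Re (kernel theta j y) = (j - theta) / ((j - theta) ^+ 2 + y ^+ 2).
  exact: erefl.
have low T : 1 <= T -> tau * rnorm c <= rnorm (I T).
  move=> T1.
  have cI : continuous (fun y => (kernel theta 1 y - kernel theta 0 y) *: c).
    under eq_fun do rewrite scalerBl.
    by apply: continuousB2; [exact: (cK _ 1 cc)|exact: (cK _ 0 cc)].
  have sq (x y : R) : 0 <= x ^+ 2 + y ^+ 2 by rewrite addr_ge0 ?sqr_ge0.
  have reE y : complex.Re (kernel theta 1 y - kernel theta 0 y) =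
      (1 - theta) / ((1 - theta) ^+ 2 + y ^+ 2) + theta / (theta ^+ 2 + y ^+ 2).
    by rewrite raddfB [X in X - _]reK [X in _ - X]reK sub0r sqrrN mulNr opprK.
  have p1 y : 0 <= theta / (theta ^+ 2 + y ^+ 2) by rewrite divr_ge0 ?sq ?ltW.
  have p2 y : 0 <= (1 - theta) / ((1 - theta) ^+ 2 + y ^+ 2) by rewrite divr_ge0 ?sq ?subr_ge0 ?ltW.
  have := @positive_kernel (fun y => kernel theta 1 y - kernel theta 0 y) c T (4 / tau) (tau / 2) T1 _ cI.
  rewrite mulrCA divff// mulr1; apply.
  - by rewrite divr_ge0// ltW.
  - move=> y; have Y1 : (1 + `|y|)^-1 <= 1 by rewrite invf_le1 ?lerDl// ltr_pwDl.
    apply: (le_trans (cabsD _ _)); rewrite [cabs (- _)]/cabs normrN -/(cabs _).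
    have -> : 4 / tau = 2 / tau * 1 + 2 / tau * 1 by field; rewrite gt_eqF.
    have tp : 0 <= 2 / tau by rewrite divr_ge0// ltW.
    apply: lerD; apply: (le_trans (cabsK _ _ _)); rewrite ?ler_wpM2l//.
      by rewrite ger0_norm// subr_ge0 ltW.
    by rewrite sub0r normrN gtr0_norm.
  - by move=> y; rewrite reE addr_ge0.
  - move=> y y1; rewrite reE; apply: (@le_trans _ _ ((1 - theta) / ((1 - theta) ^+ 2 + y ^+ 2))); last by rewrite lerDl.
    have y2 : y ^+ 2 <= 1 by rewrite -real_normK ?num_real// expr_le1.
    have a0 : 0 < 1 - theta by rewrite subr_gt0.
    have s2 : (1 - theta) ^+ 2 <= 1 by rewrite expr_le1 ?ltW//; lra.
    have s0 : 0 < (1 - theta) ^+ 2 + y ^+ 2 by rewrite ltr_pwDl ?exprn_gt0 ?sqr_ge0.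
    rewrite ler_pdivlMr//; apply: (@le_trans _ _ (tau / 2 * 2)); last by rewrite divfK.
    by rewrite ler_wpM2l ?divr_ge0 ?(ltW tau0)//; lra.
have tc : tau * rnorm c <= 4 * M / tau * pi.
  apply/ler_addgt0Pr => e e0.
  pose T := Num.max 1 (4 * B / e).
  have T1 : 1 <= T by rewrite le_max lexx.
  have T2 : 4 * B / e <= T by rewrite le_max lexx orbT.
  have T0 : 0 < T by exact: lt_le_trans T1.
  apply: (le_trans (low T T1)); apply: (le_trans (up T T1)); rewrite lerD2l.
  by move: T2; rewrite (ler_pdivrMr _ _ e0) (ler_pdivrMr _ _ T0) [e * T]mulrC.
rewrite -(ler_pM2l tau0) -/c; apply: (le_trans tc).
by rewrite le_eqVlt; apply/orP; left; apply/eqP; field; rewrite gt_eqF.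
Qed.

End Contour.

(** * Interpolation methods *)

Section ComplexFunctional.
Context {R : realType} {F : lmodType R[i]} {E : completeNormedModType R[i]}.
Variable nul : F -> Prop.
Hypothesis nul0 : nul 0.
Variables (N0 N1 : F -> \bar R) (q0 : qnorm nul N0) (q1 : qnorm nul N1).
Variables (l : F -> E) (C : R).
Hypothesis C0 : 0 < C.
Hypothesis l_lin : forall (k : R[i]) u v, (sum_norm N0 N1 u < +oo)%E -> (sum_norm N0 N1 v < +oo)%E ->
  l (k *: u + v) = k *: l u + l v.
Hypothesis l_le : forall u c, 0 <= c -> (sum_norm N0 N1 u <= c%:E)%E -> rnorm (l u) <= C * c.

Let qs : qnorm nul (sum_norm N0 N1). Proof. exact: (qnormK q0 q1 ltr01). Qed.

(** Extends functions on the closed strip continuously to the plane, as [strip_bound]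
    expects. *)
Let clamp (x : R) : R := Num.max 0 (Num.min x 1).

Let clamp_itv x : 0 <= clamp x <= 1.
Proof. by rewrite /clamp le_max lexx /= ge_max ler01 ge_min lexx orbT. Qed.

Let clamp_id x : 0 <= x -> x <= 1 -> clamp x = x.
Proof. by move=> x0 x1; rewrite /clamp min_l// max_r. Qed.

Let clamp_lip x y : `|clamp x - clamp y| <= `|x - y|.
Proof.
wlog xy : x y / x <= y.
  by move=> h; have [/h//|/ltW/h] := leP x y; rewrite distrC [`|y - x|]distrC.
have h : clamp x <= clamp y.
  rewrite /clamp ge_max le_max lexx /= le_max; apply/orP; right.
  by rewrite le_min !ge_min xy lexx orbT.
rewrite distrC ger0_norm ?subr_ge0// distrC ger0_norm ?subr_ge0// lerBlDr.
rewrite {1}/clamp ge_max; apply/andP; split.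
  by rewrite addr_ge0 ?subr_ge0//; have /andP[] := clamp_itv x.
rewrite ge_min; have [x1|x1] := leP x 1.
  have : x <= clamp x by rewrite /clamp min_l// le_max lexx orbT.
  by move=> hx; apply/orP; left; lra.
by apply/orP; right; rewrite {1}/clamp min_r ?(ltW x1)// max_r// lerDr subr_ge0.
Qed.

Lemma functionalB u v : (sum_norm N0 N1 u < +oo)%E -> (sum_norm N0 N1 v < +oo)%E ->
  l (u - v) = l u - l v.
Proof.
by move=> uy vy; rewrite addrC -scaleN1r l_lin// scaleN1r addrC.
Qed.

(** For a damped Calderon function [g] the function [l (g z)] is holomorphic with values in
    [E] and decays on the boundary, so that [strip_bound] controls its value [l u] at
    [theta]. *)
Lemma complex_functional theta : 0 < theta < 1 -> exists2 B : R, 0 < B & forall u c, 0 < c ->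
  (complex_interpolation N0 N1 theta u <= c%:E)%E -> rnorm (l u) <= B * c.
Proof.
move=> th; have /andP[th0 th1] := th.
pose tau := Num.min theta (1 - theta).
have tau0 : 0 < tau by rewrite lt_min th0 subr_gt0.
exists (4 * pi / tau ^+ 2 * (C * 8)).
  by rewrite mulr_gt0 ?mulr_gt0 ?invr_gt0 ?exprn_gt0 ?pi_gt0.
move=> u c c0 uc.
have /complex_lt[f [cf fu /boundary_leP[f0 f1]]] : (complex_interpolation N0 N1 theta u < (2 * c)%:E)%E.
  by apply: (le_lt_trans uc); rewrite lte_fin; lra.
pose g z := damping theta z *: f z.
have cg : calderon_function N0 N1 g.
  apply: (calderon_damping nul0 th q0 q1 cf) => t.
    exact: le_lt_trans (f0 t) (ltry _).
  exact: le_lt_trans (f1 t) (ltry _).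
have gth : g (theta%:C)%C = u by rewrite /g damping_theta// scale1r.
have [[B B0 gB] gc gd _ _] := (iffLR (calderonP _ q0 q1)) cg.
have fin z : closed_strip z -> (sum_norm N0 N1 (g z) < +oo)%E.
  by move=> /gB h; exact: le_lt_trans h (ltry B).
pose G x y := l (g (Complex (clamp x) y)).
have cs x y : closed_strip (Complex (clamp x) y : R[i]^o) by exact: clamp_itv.
have -> : l u = G theta 0 by rewrite /G clamp_id ?(ltW th0) ?(ltW th1)// -gth.
have c2 : 0 <= 2 * c by lra.
have M0 : 0 <= C * (8 * c) by rewrite mulr_ge0 ?mulr_ge0// ltW.
have -> : 4 * pi / tau ^+ 2 * (C * 8) * c = 4 * pi / tau ^+ 2 * (C * (8 * c)) by rewrite -!mulrA.
apply: (@strip_bound R E G theta (C * (8 * c)) (C * B) th).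
- move=> x y e e0; have eC : 0 < e / C by rewrite divr_gt0.
  have := gc _ (cs x y) _ eC; rewrite near_withinE => /near_box[d d0 hd].
  exists d => // x' y' hx hy; rewrite /G -functionalB; [|exact: fin|exact: fin].
  have <- : C * (e / C) = e by rewrite mulrC divfK ?gt_eqF.
  apply: l_le; first exact: ltW.
  by apply: hd => //=; exact: le_trans (clamp_lip _ _) hx.
- move=> x y x0 x1; pose z : R[i]^o := Complex x y.
  have zs : open_strip z by rewrite /open_strip /= x0.
  have [d [dy sd]] := gd z zs; exists (l d) => e e0.
  have eC : 0 < e / C by rewrite divr_gt0.
  have := sd _ eC; rewrite /dnbhs near_withinE => /near_box[r r0 hr].
  pose r' := Num.min r (Num.min x (1 - x)).
  have r'0 : 0 < r' by rewrite !lt_min r0 x0 subr_gt0.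
  exists r' => // x' y'; rewrite !le_min => /and3P[hx1 hx2 hx3] /and3P[hy _ _].
  have [x'0 x'1] : 0 <= x' /\ x' <= 1.
    by move: hx2 hx3; rewrite !ler_distl => /andP[h1 _] /andP[_ h2]; split; lra.
  have cx : clamp x = x by rewrite clamp_id ?ltW.
  have cx' : clamp x' = x' by rewrite clamp_id.
  pose w : R[i]^o := Complex x' y'.
  have ws : closed_strip w by rewrite /closed_strip /= x'0.
  have zc := open_closed_strip zs.
  rewrite /G cx cx' -/z -/w.
  have [wz|wz] := eqVneq w z.
    have [-> ->] : x' = x /\ y' = y by move: wz => [].
    have -> : ((x - x) +i* (y - y))%C = 0 by rewrite !subrr.
    by rewrite wz scale0r !subrr rnorm0 normr0 addr0 mulr0.
  have wz0 : w - z != 0 by rewrite subr_eq0.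
  have := hr w hx1 hy wz; set D := _ - d => hD.
  have gwz : (sum_norm N0 N1 (g w - g z)%R < +oo)%E.
    by apply: (qn_linB qs); exact: fin.
  have z0 : (sum_norm N0 N1 0%R < +oo)%E by rewrite (qn_zero qs).
  have kq : (sum_norm N0 N1 ((w - z)^-1 *: (g w - g z))%R < +oo)%E.
    by have := qn_lin_lty (w - z)^-1 qs gwz z0; rewrite addr0.
  have lD : l D = (w - z)^-1 *: (l (g w) - l (g z)) - l d.
    rewrite /D functionalB//; congr (_ - _).
    have l0 : l 0 = 0 by have := functionalB z0 z0; rewrite !subrr.
    have := l_lin (w - z)^-1 gwz z0; rewrite l0 !addr0 => ->.
    by rewrite functionalB//; exact: fin.
  have -> : ((x' - x) +i* (y' - y))%C = w - z by [].
  have -> : l (g w) - l (g z) - (w - z) *: l d = (w - z) *: l D.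
    by rewrite lD scalerBr scalerA divff// scale1r.
  rewrite rnormZc mulrC; have <- : C * (e / C) = e by rewrite mulrC divfK ?gt_eqF.
  apply: ler_pM; rewrite ?rnorm_ge0 ?cabs_ge0//.
    by apply: l_le => //; exact: ltW.
  exact: cabs_le.
- by rewrite mulr_ge0// ltW.
- by move=> x y x0 x1; apply: l_le => //; exact: gB.
- exact: M0.
- move=> y; rewrite /G clamp_id// -mulrA; apply: l_le; first by rewrite divr_ge0// mulr_ge0// ltW.
  apply: (le_trans (sum_norm_le0 _ q1 _)).
  apply: (le_trans (qn_scale q0 _ c2 (f0 y))); rewrite lee_fin.
  have -> : 8 * c / (1 + `|y|) = 4 / (1 + `|y|) * (2 * c) by ring.
  by rewrite ler_wpM2r//; exact: (cabs_damping_decay th (closed_strip0 y)).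
- move=> y; rewrite /G clamp_id// -mulrA; apply: l_le; first by rewrite divr_ge0// mulr_ge0// ltW.
  apply: (le_trans (sum_norm_le1 _ q0 _)).
  apply: (le_trans (qn_scale q1 _ c2 (f1 y))); rewrite lee_fin.
  have -> : 8 * c / (1 + `|y|) = 4 / (1 + `|y|) * (2 * c) by ring.
  by rewrite ler_wpM2r//; exact: (cabs_damping_decay th (closed_strip1 y)).
Qed.

End ComplexFunctional.

Section Methods.
Context {R : realType} {F : lmodType R[i]}.
Variable nul : F -> Prop.
Hypothesis nul0 : nul 0.
Hypothesis nul_lin : forall (k : R[i]) n m, nul n -> nul m -> nul (k *: n + m).

Definition couple (X : (F -> \bar R) * (F -> \bar R)) : Prop := qnorm nul X.1 /\ qnorm nul X.2.

(** The common interface of the three methods. [im_functional] says that the embedding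
    into the sum of the endpoint spaces is continuous, tested with functionals only,
    which is how the complex method gives access to it. *)
Record interpolation_method (Phi : (F -> \bar R) * (F -> \bar R) -> F -> \bar R) : Prop := Method {
  im_ge0 : forall X u, couple X -> (0 <= Phi X u)%E;
  im_zero : forall X, couple X -> Phi X 0 = 0%E;
  im_null : forall X u n, couple X -> nul n -> (Phi X (u + n)%R <= Phi X u)%E;
  im_sum : forall X u, couple X -> (Phi X u < +oo)%E -> (sum_norm X.1 X.2 u < +oo)%E;
  im_add : forall X u v, couple X -> (Phi X u < +oo)%E -> (Phi X v < +oo)%E ->
    (Phi X (u + v)%R < +oo)%E;
  im_map : forall X Y (S : F -> F) C, couple X -> couple Y -> 0 < C ->
    linear_mod nul (sum_norm Y.1 Y.2) S ->
    bounded_map Y.1 X.1 S C -> bounded_map Y.2 X.2 S C -> bounded_map (Phi Y) (Phi X) S C;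
  im_strong : forall X Y (S : R -> F -> F) C u, couple X -> couple Y -> 0 < C ->
    (forall h, 0 < h -> linear_mod nul (sum_norm Y.1 Y.2) (S h)) ->
    (forall h, 0 < h -> h <= 1 -> bounded_map Y.1 X.1 (S h) C) ->
    (forall h, 0 < h -> h <= 1 -> bounded_map Y.2 X.2 (S h) C) ->
    (forall v, (Y.1 v < +oo)%E -> small 0^'+ X.1 (S^~ v)) ->
    (forall v, (Y.2 v < +oo)%E -> small 0^'+ X.2 (S^~ v)) ->
    (Phi Y u < +oo)%E -> small 0^'+ (Phi X) (S^~ u);
  im_functional : forall (E : completeNormedModType R[i]) X (l : F -> E) C, couple X -> 0 < C ->
    (forall (k : R[i]) u v, (sum_norm X.1 X.2 u < +oo)%E -> (sum_norm X.1 X.2 v < +oo)%E ->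
      l (k *: u + v) = k *: l u + l v) ->
    (forall u c, 0 <= c -> (sum_norm X.1 X.2 u <= c%:E)%E -> rnorm (l u) <= C * c) ->
    exists2 B : R, 0 < B & forall u c, 0 < c -> (Phi X u <= c%:E)%E -> rnorm (l u) <= B * c }.

Lemma endpoint_method : interpolation_method (fun X => X.1).
Proof.
split=> //.
- by move=> X u [q0 _]; exact: (qn_ge0 q0).
- by move=> X [q0 _]; exact: (qn_zero q0).
- by move=> X u n [q0 _]; exact: (qn_null q0).
- by move=> X u [_ q1]; apply: le_lt_trans; exact: (sum_norm_le0 _ q1).
- by move=> X u v [q0 _] uy vy; have := qn_lin_lty 1 q0 uy vy; rewrite scale1r.
- by move=> X Y S C u _ _ _ _ _ _ s0 _ uy; exact: s0.
- move=> E X l C [_ q1] C0 _ h; exists C => // u c c0 uc; apply: h; first exact: ltW.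
  exact: le_trans (sum_norm_le0 _ q1 _) uc.
Qed.

Lemma real_method theta p : 1 <= p ->
  interpolation_method (fun X => real_interpolation X.1 X.2 theta p).
Proof.
move=> p1; split.
- by move=> X u _; exact: poweR_ge0.
- by move=> X [q0 q1]; exact: (real_zero _ p1 q0 q1).
- by move=> X u n [q0 q1]; exact: (real_null _ p1 q0 q1).
- by move=> X u [q0 q1]; exact: (real_sum_lty p1 q0 q1).
- by move=> X u v [q0 q1]; exact: (real_add_lty p1 q0 q1).
- by move=> X Y S C [qX0 qX1] [qY0 qY1]; exact: (real_map p1 qX0 qX1 qY0 qY1).
- by move=> X Y S C u [qX0 qX1] [qY0 qY1]; exact: (real_strong p1 qX0 qX1 qY0 qY1).
- move=> E X l C [q0 q1] C0 _ h; have [B B0 hB] := real_sum_norm theta p1 q0 q1.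
  exists (C * B); first exact: mulr_gt0.
  move=> u c c0 uc; rewrite -mulrA; apply: h; first by rewrite mulr_ge0 ?ltW.
  by apply: hB => //; exact: ltW.
Qed.

Lemma complex_method theta : 0 < theta < 1 ->
  interpolation_method (fun X => complex_interpolation X.1 X.2 theta).
Proof.
move=> th; split.
- by move=> X u [q0 _]; exact: (complex_ge0 _ q0).
- by move=> X [q0 q1]; exact: (complex_zero nul0 q0 q1).
- by move=> X u n [q0 q1]; exact: (complex_null q0 q1).
- by move=> X u [q0 q1]; exact: (complex_sum_lty q0 q1 th).
- by move=> X u v [q0 q1]; exact: (complex_add_lty q0 q1).
- move=> X Y S C [qX0 qX1] [qY0 qY1]; exact: (complex_map nul0 nul_lin qX0 qX1 qY0 qY1 th).
- move=> X Y S C u [qX0 qX1] [qY0 qY1]; exact: (complex_strong nul0 nul_lin qX0 qX1 qY0 qY1 th).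
- by move=> E X l C [q0 q1] C0 h1 h2; exact: (complex_functional nul0 q0 q1 C0 h1 h2 th).
Qed.

End Methods.

(** * Sobolev norms of integer order *)

Section SobolevNorm.
Context {R : realType} {E : completeNormedModType R[i]}.
Notation leb := (@lebesgue_measure R).
Context (p mu : R) (p1 : 1 <= p) (mu1 : mu <= 1).
Implicit Types (u v w z : R -> E) (U V : nat -> R -> E) (k : nat).
Local Notation L := (Lpmu_norm p mu).
Local Notation N := (Sobolev_norm p mu).

Let p0 : 0 < p. Proof. exact: lt_le_trans p1. Qed.

Definition ae_zero u : Prop := {ae leb, forall x, halfline x -> u x = 0}.

Lemma ae_zero0 : ae_zero 0.
Proof. exact: aeW. Qed.

Lemma ae_zero_lin (c : R[i]) u v : ae_zero u -> ae_zero v -> ae_zero (c *: u + v).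
Proof.
move=> u0 v0; apply: filterS2 u0 v0 => x ux vx hx /=.
change (c *: u x + v x = 0); by rewrite ux// vx// scaler0 addr0.
Qed.

Lemma ae_zeroN u : ae_zero u -> ae_zero (- u).
Proof. exact: (nulN ae_zero0 ae_zero_lin). Qed.

Lemma ae_zeroB u v : ae_zero (u - v) <-> {ae leb, forall x, halfline x -> u x = v x}.
Proof.
split; apply: filterS => x h hx.
  by have /eqP := h hx; rewrite subr_eq0 => /eqP.
by change (u x - v x = 0); rewrite h// subrr.
Qed.

Lemma ae_zero_sym u v : ae_zero (u - v) -> ae_zero (v - u).
Proof. by move=> /ae_zeroN; rewrite opprB. Qed.

Lemma ae_zero_trans v u w : ae_zero (u - v) -> ae_zero (v - w) -> ae_zero (u - w).
Proof.
move=> uv vw; have := ae_zero_lin 1 uv vw.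
by rewrite scale1r addrA subrK.
Qed.

Lemma weak_derivatives_unique k u v U V : ae_zero (u - v) ->
  weak_derivatives k u U -> weak_derivatives k v V ->
  forall j, (j <= k)%N -> ae_zero (U j - V j).
Proof.
move=> uv [U0 _ hU] [V0 _ hV]; elim => [_|j IH jk]; first by rewrite U0 V0.
have UV := IH (ltnW jk); apply/ae_zeroB.
apply: (weak_derivative_unique _ (hV j jk)).
by apply: (weak_derivative_ae_eq _ _ (hU j jk)); [exact/ae_zeroB|exact: aeW].
Qed.

Lemma weak_derivatives_ae_eq k u v U : ae_zero (u - v) -> weak_derivatives k u U ->
  weak_derivatives k v (fun j => if j is j'.+1 then U j'.+1 else v).
Proof.
move=> uv [U0 lu hU]; split; first exact: erefl.
  by apply: L1loc_ae_eq lu; exact/ae_zeroB.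
move=> [|j] jk; last exact: hU.
apply: (weak_derivative_ae_eq _ _ (hU 0%N jk)); last exact: aeW.
by rewrite U0; exact/ae_zeroB.
Qed.

(** Weak derivatives are unique almost everywhere, so the infimum runs over a single
    value. *)
Lemma Sobolev_normE k u U : weak_derivatives k u U ->
  N k u = ((\sum_(j < k.+1) L (U j) `^ p) `^ p^-1)%E.
Proof.
move=> hU; rewrite /Sobolev_norm; set A := [set _ | _ in _].
suff -> : A = [set ((\sum_(j < k.+1) L (U j) `^ p) `^ p^-1)%E] by rewrite ereal_inf1.
rewrite /A; apply/seteqP; split => [y [V hV <-]|y ->] /=; last by exists U.
have uu : ae_zero (u - u) by rewrite subrr; exact: ae_zero0.
have eL (j : 'I_k.+1) : L (V j) = L (U j).
  by apply: Lpmu_ae_eq; apply/ae_zeroB; exact: (weak_derivatives_unique uu hV hU (ltn_ord j)).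
have eq : (\sum_(j < k.+1) L (V j) `^ p = \sum_(j < k.+1) L (U j) `^ p)%E.
  by apply: eq_bigr => j _; rewrite eL.
exact: (congr1 (fun x => x `^ p^-1)%E eq).
Qed.

Lemma Sobolev_lty k u : (N k u < +oo)%E -> exists U, weak_derivatives k u U.
Proof. by move=> /ereal_inf_lt[y [U hU _] _]; exists U. Qed.

Lemma Sobolev_norm_ge0 k u : (0 <= N k u)%E.
Proof. by apply: le_ereal_inf_tmp => _ [U _ <-]; exact: poweR_ge0. Qed.

Lemma Sobolev_leP k u U c : weak_derivatives k u U -> 0 <= c ->
  (N k u <= c%:E)%E <-> (\sum_(j < k.+1) L (U j) `^ p <= (c `^ p)%:E)%E.
Proof.
move=> hU c0; rewrite (Sobolev_normE hU); apply: poweR_leP => //.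
by apply: sume_ge0 => j _; exact: poweR_ge0.
Qed.

Lemma Lpmu_pow_le u c : 0 <= c -> (L u <= c%:E)%E <-> (L u `^ p <= (c `^ p)%:E)%E.
Proof.
move=> c0; rewrite -(poweR_leP p0 (poweR_ge0 _ _) c0) -poweRrM divff ?gt_eqF//.
by rewrite poweRe1// Lpmu_norm_ge0.
Qed.

Lemma Sobolev_Lpmu_le k u U c j : weak_derivatives k u U -> 0 <= c -> (j <= k)%N ->
  (N k u <= c%:E)%E -> (L (U j) <= c%:E)%E.
Proof.
move=> hU c0 jk /(Sobolev_leP hU c0) h; apply/Lpmu_pow_le => //; apply: le_trans h.
rewrite -ltnS in jk; rewrite (bigD1 (Ordinal jk))//= leeDl//.
by apply: sume_ge0 => i _; exact: poweR_ge0.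
Qed.

Lemma Lpmu_le_Sobolev k u c : 0 <= c -> (N k u <= c%:E)%E -> (L u <= c%:E)%E.
Proof.
move=> c0 uc; have [U hU] := Sobolev_lty (le_lt_trans uc (ltry c)).
by have [<- _ _] := hU; exact: (Sobolev_Lpmu_le hU c0 (leq0n k)).
Qed.

Lemma Sobolev_le_Lpmu k u U c : weak_derivatives k u U -> 0 <= c ->
  (forall j, (j <= k)%N -> (L (U j) <= c%:E)%E) -> (N k u <= (k.+1%:R * c)%:E)%E.
Proof.
move=> hU c0 h; apply/(Sobolev_leP hU); first exact: mulr_ge0.
apply: (@le_trans _ _ (\sum_(j < k.+1) (c `^ p)%:E)%E).
  by apply: lee_sum => j _; apply/Lpmu_pow_le => //; apply: h; rewrite -ltnS.
rewrite sumEFin lee_fin sumr_const card_ord -(mulr_natl (c `^ p)) powRM//.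
by rewrite ler_wpM2r ?powR_ge0// -[leLHS]powRr1// ler_powR// ler1n.
Qed.

(** Termwise estimates keep their constant, unlike in [Sobolev_le_Lpmu]; contractivity of
    the translations depends on this. *)
Lemma Sobolev_le_scale k u v U V r c : weak_derivatives k u U -> weak_derivatives k v V ->
  0 <= r -> 0 <= c ->
  (forall j d, (j <= k)%N -> 0 <= d -> (L (U j) <= d%:E)%E -> (L (V j) <= (r * d)%:E)%E) ->
  (N k u <= c%:E)%E -> (N k v <= (r * c)%:E)%E.
Proof.
move=> hU hV r0 c0 h uc; apply/(Sobolev_leP hV); first exact: mulr_ge0.
have uj j : (j <= k)%N -> (L (U j) < +oo)%E.
  by move=> jk; apply: le_lt_trans (Sobolev_Lpmu_le hU c0 jk uc) (ltry c).
move/(Sobolev_leP hU c0) : uc => uc.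
apply: (@le_trans _ _ ((r `^ p)%:E * \sum_(j < k.+1) L (U j) `^ p)%E); last first.
  by rewrite powRM// EFinM lee_wpmul2l// lee_fin powR_ge0.
rewrite ge0_sume_distrr; last by move=> j _; exact: poweR_ge0.
apply: lee_sum => j _; have jk : (j <= k)%N by rewrite -ltnS.
have [d d0 ud] := Lpmu_lty (uj j jk).
rewrite ud poweR_EFin -EFinM -powRM//; apply/Lpmu_pow_le; first exact: mulr_ge0.
by apply: h => //; rewrite ud.
Qed.

Lemma Sobolev_ae_eq k u v : ae_zero (u - v) -> N k u = N k v.
Proof.
suff h u' v' : ae_zero (u' - v') -> (N k v' <= N k u')%E.
  by move=> uv; apply/eqP; rewrite eq_le !h//; exact: ae_zero_sym.
move=> uv; have [uy|] := ltP (N k u') +oo%E; last by rewrite leye_eq => /eqP ->; exact: leey.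
have [U hU] := Sobolev_lty uy.
have hV := weak_derivatives_ae_eq uv hU; move: hV; set V := fun j : nat => _ => hV.
have [U0 _ _] := hU.
have eL (j : nat) : L (V j) = L (U j).
  case: j => [|j]; last exact: erefl.
  by rewrite U0; apply/esym/Lpmu_ae_eq/ae_zeroB.
have eq : (\sum_(j < k.+1) L (V j) `^ p = \sum_(j < k.+1) L (U j) `^ p)%E.
  by apply: eq_bigr => j _; rewrite eL.
suff -> : N k v' = N k u' by exact: lexx.
rewrite (Sobolev_normE hU) (Sobolev_normE hV).
exact: (congr1 (fun x => x `^ p^-1)%E eq).
Qed.

Lemma weak_derivatives_lin k (c : R[i]) u v U V : weak_derivatives k u U ->
  weak_derivatives k v V -> weak_derivatives k (c *: u + v) (fun j => c *: U j + V j).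
Proof.
move=> [U0 lu hU] [V0 lv hV]; split; first by rewrite U0 V0.
  exact: L1loc_lin.
by move=> j jk; apply: weak_derivative_lin; [exact: hU|exact: hV].
Qed.

Lemma weak_derivatives0 k : weak_derivatives k (0 : R -> E) (fun=> 0).
Proof. by split => // [|j _]; [exact: L1loc0|exact: weak_derivative0]. Qed.

Lemma weak_derivatives_shift k u U t : 0 <= t -> weak_derivatives k u U ->
  weak_derivatives k (left_translation t u) (fun j => left_translation t (U j)).
Proof.
move=> t0 [U0 lu hU]; split; first by rewrite U0.
  exact: L1loc_shift.
by move=> j jk; apply: weak_derivative_shift => //; exact: hU.
Qed.

Lemma Sobolev_qnorm k : qnorm ae_zero (N k).
Proof.
split.
- exact: Sobolev_norm_ge0.
- apply/eqP; rewrite eq_le Sobolev_norm_ge0 andbT.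
  have := @Sobolev_le_Lpmu k 0 _ 0 (weak_derivatives0 k) (lexx _).
  by rewrite mulr0; apply => j _; rewrite Lpmu0.
- exists (k.+1%:R * 4).
    by rewrite -[leLHS]mulr1; apply: ler_pM => //; rewrite ?ler1n//.
  move=> u v c c0 uc vc; have c0' := ltW c0.
  have [U hU] := Sobolev_lty (le_lt_trans uc (ltry c)).
  have [V hV] := Sobolev_lty (le_lt_trans vc (ltry c)).
  have := weak_derivatives_lin 1 hU hV; rewrite scale1r => hW.
  rewrite -mulrA; apply: (Sobolev_le_Lpmu hW); first by rewrite mulr_ge0.
  move=> j jk; rewrite scale1r; apply: Lpmu_leD => //.
    exact: (Sobolev_Lpmu_le hU).
  exact: (Sobolev_Lpmu_le hV).
- move=> a u c c0 uc; have [U hU] := Sobolev_lty (le_lt_trans uc (ltry c)).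
  have := weak_derivatives_lin a hU (weak_derivatives0 k); rewrite addr0 => hW.
  apply: (Sobolev_le_scale hU hW _ c0 _ uc); first exact: Re_norm_ge0.
  by move=> j d jk d0 ud; rewrite addr0; exact: Lpmu_leZ.
- move=> u n n0; rewrite (@Sobolev_ae_eq k (u + n) u)//.
  by rewrite addrAC subrr add0r.
Qed.

Lemma Sobolev_L1loc k u : (N k u < +oo)%E -> L1loc u.
Proof. by move=> /Sobolev_lty[U []]. Qed.

Lemma Sobolev_le_succ k u : (N k u <= N k.+1 u)%E.
Proof.
have [uy|] := ltP (N k.+1 u) +oo%E; last by rewrite leye_eq => /eqP ->; exact: leey.
have [c c0 uc] := fin_bound (Sobolev_norm_ge0 _ _) uy.
have [U hU] := Sobolev_lty uy; have [U0 lu hU'] := hU.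
have hU1 : weak_derivatives k u U by split => // j /ltnW/hU'.
rewrite uc; apply/(Sobolev_leP hU1 c0).
have /(Sobolev_leP hU c0) : (N k.+1 u <= c%:E)%E by rewrite uc.
by apply: le_trans; rewrite [leRHS]big_ord_recr/= leeDl// poweR_ge0.
Qed.

Lemma Sobolev_derivative_le k u v c : 0 <= c -> weak_derivative u v ->
  (N k.+1 u <= c%:E)%E -> (N k v <= c%:E)%E.
Proof.
move=> c0 uv uc; have [U hU] := Sobolev_lty (le_lt_trans uc (ltry c)).
have [U0 lu hU'] := hU; move/(Sobolev_leP hU c0) : uc => uc.
have v1 : ae_zero (U 1%N - v).
  by apply/ae_zeroB; apply: weak_derivative_unique uv; rewrite -U0; exact: hU'.
rewrite -(Sobolev_ae_eq k v1).
have hV : weak_derivatives k (U 1%N) (fun j => U j.+1).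
  by split=> [|//|j jk]; [exact: erefl|have [] := hU' 0%N isT|exact: hU'].
apply/(Sobolev_leP hV c0); apply: le_trans uc.
by rewrite [leRHS]big_ord_recl/= leeDr// poweR_ge0.
Qed.

Lemma Sobolev_succ_le k u v c : 0 <= c -> weak_derivative u v ->
  (L u <= c%:E)%E -> (N k v <= c%:E)%E -> (N k.+1 u <= (k.+2%:R * c)%:E)%E.
Proof.
move=> c0 uv uc vc; have [V hV] := Sobolev_lty (le_lt_trans vc (ltry c)).
have [V0 lv hV'] := hV.
have hU : weak_derivatives k.+1 u (fun j => if j is j'.+1 then V j' else u).
  split; [exact: erefl|by have [] := uv|].
  by move=> [|j] jk; [rewrite V0|exact: hV'].
apply: (Sobolev_le_Lpmu hU c0) => -[_|j jk]; first exact: uc.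
exact: (Sobolev_Lpmu_le hV c0 jk vc).
Qed.

End SobolevNorm.

(** * Translations and difference quotients at integer orders *)

Section SobolevMaps.
Context {R : realType} {E : completeNormedModType R[i]}.
Notation leb := (@lebesgue_measure R).
Context (p mu : R) (p1 : 1 <= p) (mu1 : mu <= 1).
Implicit Types (u v w z : R -> E) (k : nat).
Local Notation L := (Lpmu_norm (E := E) p mu).
Local Notation N := (Sobolev_norm (E := E) p mu).
Local Notation T := (left_translation (E := E)).
Local Notation nul := (ae_zero (R := R) (E := E)).

Let qN k : qnorm nul (N k). Proof. exact: Sobolev_qnorm. Qed.

Let nul0 : nul 0. Proof. exact: ae_zero0. Qed.
Let nul_lin (c : R[i]) u v : nul u -> nul v -> nul (c *: u + v). Proof. exact: ae_zero_lin. Qed.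

Lemma Lpmu_leB u v c : 0 <= c -> (L u <= c%:E)%E -> (L v <= c%:E)%E ->
  (L (u - v)%R <= (4 * c)%:E)%E.
Proof.
move=> c0 uc vc; have vc' : (L (- v)%R <= c%:E)%E.
  by have := Lpmu_leZ p1 (-1) c0 vc; rewrite [complex.Re _]cabsN1 mul1r scaleN1r.
exact: (Lpmu_leD p1 c0 uc vc').
Qed.

Lemma Sobolev_leB k : exists2 K : R, 1 <= K & forall u v c, 0 < c ->
  (N k u <= c%:E)%E -> (N k v <= c%:E)%E -> (N k (u - v)%R <= (K * c)%:E)%E.
Proof.
have [K K1 hK] := qn_add (qN k); exists K; first exact: K1.
move=> u v c c0 uc vc; apply: (hK _ _ _ c0 uc).
have := qn_scale (qN k) (-1) (ltW c0) vc.
by rewrite cabsN1 mul1r scaleN1r.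
Qed.

Lemma left_translation_lin t (c : R[i]) u v : T t (c *: u + v) = c *: T t u + T t v.
Proof. by []. Qed.

Lemma left_translation_bounded k t : 0 <= t -> bounded_map (N k) (N k) (T t) 1.
Proof.
move=> t0 u c c0 uc; have [U hU] := Sobolev_lty (le_lt_trans uc (ltry c)).
apply: (Sobolev_le_scale p1 hU (weak_derivatives_shift t0 hU) ler01 c0 _ uc) => j d _ d0 ud.
by rewrite mul1r; apply: le_trans ud; exact: Lpmu_left_translation.
Qed.

Lemma left_translation_small k u : (N k u < +oo)%E ->
  small 0^'+ (N k) (fun t => T t u - u).
Proof.
move=> uy e e0; have [U hU] := Sobolev_lty uy.
have [c c0 uc] := fin_bound (Sobolev_norm_ge0 p mu k u) uy.
have Uy j : (j <= k)%N -> (L (U j) < +oo)%E.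
  move=> jk; apply: le_lt_trans (ltry c).
  by apply: (Sobolev_Lpmu_le p1 hU c0 jk); rewrite uc.
have d0 : 0 < e / k.+1%:R by rewrite divr_gt0// ltr0n.
have sj j : (j <= k)%N -> \forall t \near 0^'+, (L (T t (U j) - U j)%R <= (e / k.+1%:R)%:E)%E.
  move=> jk; have := Lpmu_shift_continuous p1 mu1 (Uy j jk).
  by move/(cvge0P (fun t => Lpmu_norm_ge0 p mu _)); apply.
have all m : (m <= k)%N -> \forall t \near 0^'+, forall j, (j <= m)%N ->
    (L (T t (U j) - U j)%R <= (e / k.+1%:R)%:E)%E.
  elim: m => [_|m IH mk].
    by apply: filterS (sj 0%N (leq0n k)) => t h j; rewrite leqn0 => /eqP ->.
  apply: filterS2 (IH (ltnW mk)) (sj m.+1 mk) => t h1 h2 j.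
  by rewrite leq_eqVlt => /predU1P[->//|]; rewrite ltnS; exact: h1.
apply: filterS2 (nbhs_right_gt 0) (all k (leqnn k)) => t t0 h.
have hW := weak_derivatives_lin (-1) hU (weak_derivatives_shift (ltW t0) hU).
rewrite addrC -scaleN1r; have <- : k.+1%:R * (e / k.+1%:R) = e by rewrite mulrC divfK// gt_eqF.
apply: (Sobolev_le_Lpmu p1 hW (ltW d0)) => j jk.
by rewrite scaleN1r addrC; exact: h.
Qed.

Lemma Lpmu_average_bounded h v c : L1loc v -> 0 < h -> 0 <= c -> (L v <= c%:E)%E ->
  (L (average h v - v)%R <= (8 * c)%:E)%E.
Proof.
move=> lv h0 c0 vc; have -> : 8 * c = 2 * (4 * c) by ring.
apply: Lpmu_average => // [|t /andP[t0 _]]; first exact: mulr_ge0.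
apply: (Lpmu_leB c0 _ vc); apply: le_trans vc.
exact: (Lpmu_left_translation p1 mu1).
Qed.

Lemma Lpmu_average_small v : L1loc v -> (L v < +oo)%E -> forall e, 0 < e ->
  \forall h \near 0^'+, (L (average h v - v)%R <= e%:E)%E.
Proof.
move=> lv vy e e0; have e2 : 0 < e / 2 by rewrite divr_gt0.
have /(cvge0P (fun t => Lpmu_norm_ge0 p mu _)) := Lpmu_shift_continuous p1 mu1 vy.
move=> /(_ _ e2); rewrite near_withinE => /nbhs_ballP[d /= d0 hd].
near=> h; have h0 : 0 < h by near: h; exact: nbhs_right_gt.
have hd' : h < d by near: h; exact: nbhs_right_lt.
have <- : 2 * (e / 2) = e by rewrite mulrC divfK.
apply: Lpmu_average => //; first exact: ltW.
move=> t /andP[t0 th]; have [t0'|t0'] := ltP 0 t.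
  apply: hd => //=; rewrite /ball /= sub0r normrN gtr0_norm//.
  exact: le_lt_trans th hd'.
have -> : t = 0 by apply/eqP; rewrite eq_le t0 t0'.
have -> : T 0 v - v = 0.
  by apply/funext => x; change (v (x + 0) - v x = 0); rewrite addr0 subrr.
by rewrite Lpmu0// lee_fin ltW.
Unshelve. all: by end_near.
Qed.

(** A representative of the weak derivative, chosen by the axiom of choice: it is linear
    only up to almost everywhere equality. *)
Definition derivative u : R -> E := xget 0 [set v | weak_derivative u v].

Lemma derivativeP k u : (N k.+1 u < +oo)%E -> weak_derivative u (derivative u).
Proof.
move=> /Sobolev_lty[U [U0 _ hU]]; apply: (@xgetPex _ 0 [set v | weak_derivative u v]).
by exists (U 1%N); rewrite /= -U0; exact: hU.
Qed.

Lemma derivative_bounded k : bounded_map (N k.+1) (N k) derivative 1.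
Proof.
move=> u c c0 uc; rewrite mul1r; apply: (Sobolev_derivative_le p1 c0 _ uc).
exact: (derivativeP (le_lt_trans uc (ltry c))).
Qed.

Lemma Sobolev_sum_lty k u : (sum_norm (N k) (N k.+1) u < +oo)%E -> (N k u < +oo)%E.
Proof.
move=> /(sum_normP (qN k) (qN k.+1))[a [b [<- ay bY]]].
have := qn_lin_lty 1 (qN k) ay (le_lt_trans (Sobolev_le_succ _ p1 k b) bY).
by rewrite scale1r.
Qed.

Lemma derivative_linear k : linear_mod nul (N k.+1) derivative.
Proof.
move=> c u v uy vy; apply/ae_zeroB.
apply: (@weak_derivative_unique _ _ (c *: u + v)).
  exact: (derivativeP (qn_lin_lty c (qN k.+1) uy vy)).
by apply: weak_derivative_lin; [exact: derivativeP uy|exact: derivativeP vy].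
Qed.

Definition quotient_error (h : R) u : R -> E := (h^-1)%:C%C *: (T h u - u) - derivative u.

Lemma subr_linear (V : lmodType R[i]) (c : R[i]) (a b d x y z : V) : a = c *: b + d ->
  a - x - (c *: (b - y) + (d - z)) = - (x - (c *: y + z)).
Proof.
move=> ->; rewrite scalerBr addrACA -opprD.
move: (_ + d) (_ + z) => s t.
by rewrite !opprB addrC addrA subrK.
Qed.

Lemma quotient_error_linear k h : linear_mod nul (N k.+1) (quotient_error h).
Proof.
move=> c u v uy vy; have := ae_zeroN (derivative_linear c uy vy).
rewrite -(@subr_linear _ c ((h^-1)%:C%C *: (T h (c *: u + v) - (c *: u + v)))
  ((h^-1)%:C%C *: (T h u - u)) ((h^-1)%:C%C *: (T h v - v))); first exact.
rewrite left_translation_lin opprD addrACA -scalerBr scalerDr.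
by rewrite scalerA mulrC -scalerA.
Qed.

(** The chain of derivatives of the error: at each level the difference quotient is a
    moving average of the next derivative ([weak_derivative_average]). *)
Lemma quotient_errorE k h u U : weak_derivatives k.+1 u U -> 0 < h ->
  exists V, weak_derivatives k (quotient_error h u) V /\
    forall j, (j <= k)%N -> L (V j) = L (average h (U j.+1) - U j.+1)%R.
Proof.
move=> [U0 lu hU] h0.
have hD : weak_derivative u (derivative u).
  apply: (@xgetPex _ 0 [set v | weak_derivative u v]).
  by exists (U 1%N); rewrite /= -U0; exact: hU.
have e1 : nul (U 1%N - derivative u).
  by apply/ae_zeroB; apply: weak_derivative_unique hD; rewrite -U0; exact: hU.
pose W j : R -> E := (h^-1)%:C%C *: (T h (U j) - U j) - U j.+1.
have lT j : L1loc (U j) -> L1loc ((h^-1)%:C%C *: (T h (U j) - U j)).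
  by move=> lj; apply: L1locZ; apply: L1locB => //; exact: L1loc_shift (ltW h0) lj.
have hW : weak_derivatives k (W 0%N) W.
  split => [//||j jk].
    have [l0 l1 _] := hU 0%N isT.
    by apply: L1locB => //; exact: lT.
  apply: weak_derivativeB; last exact: hU.
  apply: weak_derivativeZ; apply: weak_derivativeB; last exact: (hU j (ltnW jk)).
  by apply: weak_derivative_shift; [exact: ltW|exact: (hU j (ltnW jk))].
have WQ : nul (W 0%N - quotient_error h u).
  rewrite /W U0 /quotient_error opprB addrC subrKA.
  exact: ae_zero_sym.
exists (fun j => if j is j'.+1 then W j'.+1 else quotient_error h u).
split; first exact: (weak_derivatives_ae_eq WQ hW).
have LW j : (j <= k)%N -> L (W j) = L (average h (U j.+1) - U j.+1)%R.
  move=> jk; apply: Lpmu_ae_eq; have := weak_derivative_average h0 (hU j jk).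
  apply: filterS => x hx xH; change ((h^-1)%:C%C *: (U j (x + h) - U j x) - U j.+1 x =
    average h (U j.+1) x - U j.+1 x).
  by congr (_ - _); exact: hx.
move=> [_|j jk]; last exact: LW.
rewrite -(LW 0%N (leq0n k)); apply: Lpmu_ae_eq; apply/ae_zeroB; exact: ae_zero_sym.
Qed.

Lemma quotient_error_bounded k h : 0 < h ->
  bounded_map (N k.+1) (N k) (quotient_error h) (k.+1%:R * 8).
Proof.
move=> h0 u c c0 uc; have [U hU] := Sobolev_lty (le_lt_trans uc (ltry c)).
have [V [hV LV]] := quotient_errorE hU h0.
rewrite -mulrA; apply: (Sobolev_le_Lpmu p1 hV); first exact: mulr_ge0.
move=> j jk; rewrite LV//; have [_ _ hU'] := hU.
apply: Lpmu_average_bounded => //; first by have [] := hU' j jk.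
have jk' : (j.+1 <= k.+1)%N by [].
exact: (Sobolev_Lpmu_le p1 hU c0 jk' uc).
Qed.

Lemma quotient_error_small k u : (N k.+1 u < +oo)%E ->
  small 0^'+ (N k) (quotient_error^~ u).
Proof.
move=> uy e e0; have [U hU] := Sobolev_lty uy; have [_ _ hU'] := hU.
have [c c0 uc] := fin_bound (Sobolev_norm_ge0 p mu _ u) uy.
have d0 : 0 < e / k.+1%:R by rewrite divr_gt0// ltr0n.
have sj j : (j <= k)%N ->
    \forall h \near 0^'+, (L (average h (U j.+1) - U j.+1)%R <= (e / k.+1%:R)%:E)%E.
  move=> jk; apply: Lpmu_average_small => //; first by have [] := hU' j jk.
  apply: le_lt_trans (ltry c); have jk' : (j.+1 <= k.+1)%N by [].
  by apply: (Sobolev_Lpmu_le p1 hU c0 jk'); rewrite uc.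
have all m : (m <= k)%N -> \forall h \near 0^'+, forall j, (j <= m)%N ->
    (L (average h (U j.+1) - U j.+1)%R <= (e / k.+1%:R)%:E)%E.
  elim: m => [_|m IH mk].
    by apply: filterS (sj 0%N (leq0n k)) => t h j; rewrite leqn0 => /eqP ->.
  apply: filterS2 (IH (ltnW mk)) (sj m.+1 mk) => t h1 h2 j.
  by rewrite leq_eqVlt => /predU1P[->//|]; rewrite ltnS; exact: h1.
apply: filterS2 (nbhs_right_gt 0) (all k (leqnn k)) => h h0 hj.
have [V [hV LV]] := quotient_errorE hU h0.
have <- : k.+1%:R * (e / k.+1%:R) = e by rewrite mulrC divfK// gt_eqF.
apply: (Sobolev_le_Lpmu p1 hV (ltW d0)) => j jk.
by rewrite LV//; exact: hj.
Qed.

End SobolevMaps.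

(** * Reconstruction of a function from its derivative *)

Section Increment.
Context {R : realType} {E : completeNormedModType R[i]}.
Notation leb := (@lebesgue_measure R).
Implicit Types (u v w z : R -> E) (k : nat).
Local Notation T := (left_translation (E := E)).
Local Notation nul := (ae_zero (R := R) (E := E)).

(** The integral over [[x, x + 1]], also the average of step [1] ([average1]). It
    gains one derivative and, unlike a primitive, it is bounded. *)
Definition increment u : R -> E := T 1 (primitive u) - primitive u.

Lemma average1 u : average 1 u = increment u.
Proof. by apply/funext => x; rewrite /average invr1 scale1r. Qed.

Lemma nul_shift (z : R -> E) t : 0 <= t -> weak_derivative z 0 -> nul (T t z - z).
Proof. by move=> t0 z0; apply/ae_zeroB; exact: weak_derivative0_shift. Qed.

(** Primitives are linear up to functions with zero derivative, which is all that
    matters for increments. *)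
Lemma weak_derivative_lin0 (c : R[i]) u v :
  L1loc u -> L1loc v ->
  weak_derivative (primitive (c *: u + v) - (c *: primitive u + primitive v)) 0.
Proof.
move=> lu lv; have := weak_derivativeB (weak_derivative_primitive (L1loc_lin c lu lv))
  (weak_derivative_lin c (weak_derivative_primitive lu) (weak_derivative_primitive lv)).
by rewrite subrr.
Qed.

Lemma subr_swap (V : zmodType) (a a' s s' : V) : (a' - a) - (s' - s) = (a' - s') - (a - s).
Proof. by rewrite !opprB addrACA [RHS]addrACA [- a - s']addrC. Qed.

Lemma regroup_shift (V : lmodType R[i]) (c : R[i]) (a a' b b' d d' : V) :
  (a' - (c *: b' + d')) - (a - (c *: b + d)) = (a' - a) - (c *: (b' - b) + (d' - d)).
Proof. by rewrite scalerBr [_ - _ + (_ - _)]addrACA -opprD [RHS]subr_swap. Qed.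

Lemma increment_lin (c : R[i]) u v : L1loc u -> L1loc v ->
  nul (increment (c *: u + v) - (c *: increment u + increment v)).
Proof.
move=> lu lv; have := nul_shift ler01 (weak_derivative_lin0 c lu lv).
by congr (nul _); exact: regroup_shift.
Qed.

Lemma increment_add w u v : w = u + v -> L1loc u -> L1loc v ->
  nul (increment w - (increment u + increment v)).
Proof. by move=> -> lu lv; have := increment_lin 1 lu lv; rewrite !scale1r. Qed.

(** All translates of [z] agree with [z] almost everywhere, and the average of step
    [1] is as close to [z] as they are ([Lpmu_average]). *)
Lemma increment_invariant z : weak_derivative z 0 -> nul (increment z - z).
Proof.
move=> z0; have [lz _ _] := z0; have mH := measurable_halfline (R := R).
have h : (Lpmu_norm 1 1 (average 1 z - z)%R <= 0%:E)%E.
  have -> : (0 : R) = 2 * 0 by rewrite mulr0.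
  apply: (@Lpmu_average _ _ 1 1 (lexx _) 1 z 0 lz ltr01 (lexx _)) => t /andP[t0 _].
  rewrite (@Lpmu_ae_eq _ _ 1 1 _ 0) ?Lpmu0//.
  exact: nul_shift.
have sm := Lpmu_lty_sm (le_lt_trans h (ltry _)).
rewrite -average1; apply: (norm_integral_eq0 mH sm); rewrite -Lpmu11//.
by apply/eqP; rewrite eq_le h Lpmu_norm_ge0.
Qed.

(** What has to be added to [increment u] to recover [u] from [v = u'], see
    [reconstruction]. *)
Definition correction v : R -> E := primitive v - increment (primitive v).

Lemma nul_add_congr (a b d e : R -> E) : nul (a - (b + e)) -> nul (b - d) -> nul (a - (d + e)).
Proof.
move=> h1 h2; apply: (ae_zero_trans h1).
by rewrite opprD addrACA subrr addr0.
Qed.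

Lemma regroup (V : zmodType) (a b d e : V) : - (a - (b - d + e)) = b - (a + (d - e)).
Proof.
by rewrite opprB opprD opprB -!addrA; congr (_ + _); rewrite addrCA [RHS]addrCA [- d - a]addrC.
Qed.

Lemma regroup_lin (V : lmodType R[i]) (c : R[i]) (a x b d y t : V) :
  - (x - (c *: y + t + (a - (c *: b + d)))) = a - x - (c *: (b - y) + (d - t)).
Proof.
rewrite scalerBr [_ - _ + (_ - _)]addrACA -opprD.
move: (_ + d) (_ + t) => s r.
by rewrite opprB opprB addrCA -addrA addrA addrAC addrA.
Qed.

Lemma correction_lin (c : R[i]) u v : L1loc u -> L1loc v ->
  nul (correction (c *: u + v) - (c *: correction u + correction v)).
Proof.
move=> lu lv; have z0 := weak_derivative_lin0 c lu lv.
have [lz _ _] := z0; have lPu := L1loc_primitive lu; have lPv := L1loc_primitive lv.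
have h1 := increment_add (esym (subrK _ _)) lz (L1loc_lin c lPu lPv).
have h2 := nul_add_congr h1 (increment_invariant z0).
rewrite [X in nul (_ - X)]addrC in h2; have h3 := nul_add_congr h2 (increment_lin c lPu lPv).
have := ae_zeroN h3; congr (nul _); rewrite /correction.
exact: regroup_lin.
Qed.

(** The function [u - primitive v] has zero derivative, hence equals its own increment.  In this
    identity the unbounded [primitive v] only occurs through [correction v]. *)
Lemma reconstruction u v : weak_derivative u v -> nul (u - (increment u + correction v)).
Proof.
move=> uv; have [lu lv _] := uv; have lP := L1loc_primitive lv.
have z0 : weak_derivative (u - primitive v) 0.
  by have := weak_derivativeB uv (weak_derivative_primitive lv); rewrite subrr.
have [lz _ _] := z0.
have h1 := increment_add (esym (subrK _ _)) lz lP.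
have h2 := nul_add_congr h1 (increment_invariant z0).
have := ae_zeroN h2; congr (nul _); rewrite /correction.
exact: regroup.
Qed.

Context (p mu : R) (p1 : 1 <= p) (mu1 : mu <= 1).
Local Notation L := (Lpmu_norm (E := E) p mu).
Local Notation N := (Sobolev_norm (E := E) p mu).

Lemma Lpmu_average_le h u c : L1loc u -> 0 < h -> 0 <= c -> (L u <= c%:E)%E ->
  (L (average h u) <= (32 * c)%:E)%E.
Proof.
move=> lu h0 c0 uc; rewrite -[average h u](subrK u).
have -> : 32 * c = 4 * (8 * c) by ring.
apply: (Lpmu_leD p1); first exact: mulr_ge0.
  exact: (Lpmu_average_bounded p1 mu1).
by apply: (le_trans uc); rewrite lee_fin; lra.
Qed.

Lemma Lpmu_increment_le u c : L1loc u -> 0 <= c -> (L u <= c%:E)%E ->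
  (L (increment u) <= (32 * c)%:E)%E.
Proof. by move=> lu; rewrite -average1; exact: Lpmu_average_le. Qed.

(** Up to sign this is the average of [primitive v] minus [primitive v], so
    [Lpmu_average] applies: the translates [T t (primitive v) - primitive v] are [t]
    times averages of [v]. *)
Lemma Lpmu_correction_le v c : L1loc v -> 0 <= c -> (L v <= c%:E)%E ->
  (L (correction v) <= (64 * c)%:E)%E.
Proof.
move=> lv c0 vc; rewrite /correction -average1.
have c32 : 0 <= 32 * c by rewrite mulr_ge0.
have h : (L (average 1 (primitive v) - primitive v)%R <= (2 * (32 * c))%:E)%E.
  apply: (Lpmu_average p1 (L1loc_primitive lv) ltr01 c32) => t /andP[t0 t1].
  have [tp|tn] := ltP 0 t; last first.
    have -> : t = 0 by apply/eqP; rewrite eq_le tn t0.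
    have -> : T 0 (primitive v) - primitive v = 0.
      by apply/funext => x; change (primitive v (x + 0) - primitive v x = 0); rewrite addr0 subrr.
    by rewrite Lpmu0// lee_fin.
  have -> : T t (primitive v) - primitive v = t%:C%C *: average t v.
    apply/funext => x; change (primitive v (x + t) - primitive v x =
      t%:C%C *: ((t^-1)%:C%C *: (primitive v (x + t) - primitive v x))).
    by rewrite scalerA -rmorphM/= divff ?gt_eqF// scale1r.
  have := Lpmu_leZ p1 t%:C%C c32 (Lpmu_average_le lv tp c0 vc).
  move/le_trans; apply; rewrite lee_fin [complex.Re _]cabs_real ger0_norm//.
  by rewrite ler_piMl.
have -> : 64 * c = 2 * (32 * c) by ring.
have c64 : 0 <= 2 * (32 * c) by rewrite mulr_ge0.
have := Lpmu_leZ p1 (-1) c64 h.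
by rewrite [complex.Re _]cabsN1 mul1r scaleN1r opprB.
Qed.

Lemma bounded_map_gt0 (F : lmodType R[i]) (N0 N1 : F -> \bar R) S C : 0 < C ->
  (forall (u : F) c, 0 < c -> (N0 u <= c%:E)%E -> (N1 (S u) <= (C * c)%:E)%E) -> bounded_map N0 N1 S C.
Proof.
move=> C0 h u c c0 uc; apply: lee_addgt0 => e e0.
have -> : C * c + e = C * (c + e / C) by rewrite mulrDr mulrCA divff ?gt_eqF// mulr1.
have eC : 0 < e / C by rewrite divr_gt0.
apply: h; first by rewrite ltr_wpDl.
by apply: (le_trans uc); rewrite lee_fin lerDl ltW.
Qed.

(** The derivative of [increment u] is [T 1 u - u], of the same order as [u]. *)
Lemma increment_bounded k : exists2 C : R, 0 < C & bounded_map (N k) (N k.+1) increment C.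
Proof.
have [K K1 hK] := @Sobolev_leB R E p mu p1 k.
have K0 : 0 < K by exact: lt_le_trans K1.
pose C := Num.max 32 K; have C0 : 0 < C by rewrite lt_max K0 orbT.
exists (k.+2%:R * C); first by rewrite mulr_gt0// ltr0n.
apply: bounded_map_gt0 => [|u c c0 uc]; first by rewrite mulr_gt0// ltr0n.
have lu := Sobolev_L1loc (le_lt_trans uc (ltry c)).
have uc' := Lpmu_le_Sobolev p1 (ltW c0) uc.
have tc : (N k (T 1 u) <= c%:E)%E.
  by have := left_translation_bounded p1 mu1 ler01 (ltW c0) uc; rewrite mul1r.
have C32 : 32 * c <= C * c by rewrite ler_pM2r// le_max lexx.
have CK : K * c <= C * c by rewrite ler_pM2r// le_max lexx orbT.
rewrite -mulrA; apply: (Sobolev_succ_le p1 _ (weak_derivative_increment lu)).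
- by rewrite mulr_ge0// ltW.
- by apply: (le_trans (Lpmu_increment_le lu (ltW c0) uc')); rewrite lee_fin.
- by apply: (le_trans (hK _ _ _ c0 tc uc)); rewrite lee_fin.
Qed.

(** The derivative of [correction v] is [v - increment v]. *)
Lemma correction_bounded k : exists2 C : R, 0 < C & bounded_map (N k) (N k.+1) correction C.
Proof.
have [K K1 hK] := @Sobolev_leB R E p mu p1 k.
have K0 : 0 < K by exact: lt_le_trans K1.
have [B B0 hB] := increment_bounded k.
pose C := Num.max 64 (K * Num.max 1 B).
have C0 : 0 < C by rewrite lt_max ltr0n.
exists (k.+2%:R * C); first by rewrite mulr_gt0// ltr0n.
apply: bounded_map_gt0 => [|v c c0 vc]; first by rewrite mulr_gt0// ltr0n.
have lv := Sobolev_L1loc (le_lt_trans vc (ltry c)).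
have vc' := Lpmu_le_Sobolev p1 (ltW c0) vc.
have B1 : 0 < Num.max 1 B * c by rewrite mulr_gt0// lt_max ltr01.
have ic : (N k (increment v) <= (Num.max 1 B * c)%:E)%E.
  apply: (le_trans (Sobolev_le_succ _ p1 _ _)); apply: (le_trans (hB _ _ (ltW c0) vc)).
  by rewrite lee_fin ler_pM2r// le_max lexx orbT.
have vB : (N k v <= (Num.max 1 B * c)%:E)%E.
  by apply: (le_trans vc); rewrite lee_fin ler_peMl ?(ltW c0)// le_max lexx.
have C64 : 64 * c <= C * c by rewrite ler_pM2r// le_max lexx.
have CK : K * (Num.max 1 B * c) <= C * c by rewrite mulrA ler_pM2r// le_max lexx orbT.
have d : weak_derivative (correction v) (v - increment v).
  apply: weak_derivativeB; first exact: weak_derivative_primitive.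
  exact: weak_derivative_increment (L1loc_primitive lv).
rewrite -mulrA; apply: (Sobolev_succ_le p1 _ d).
- by rewrite mulr_ge0// ltW.
- by apply: (le_trans (Lpmu_correction_le lv (ltW c0) vc')); rewrite lee_fin.
- by apply: (le_trans (hK _ _ _ B1 vB ic)); rewrite lee_fin.
Qed.

End Increment.

(** * The semigroup and its generator for an interpolation method *)

Section Generator.
Context {R : realType} {E : completeNormedModType R[i]}.
Context (p mu : R) (p1 : 1 <= p) (mu1 : mu <= 1) (k : nat).
Implicit Types (u v w : R -> E).
Local Notation L := (Lpmu_norm (E := E) p mu).
Local Notation N := (Sobolev_norm (E := E) p mu).
Local Notation T := (left_translation (E := E)).
Local Notation nul := (ae_zero (R := R) (E := E)).
Variable Phi : ((R -> E) -> \bar R) * ((R -> E) -> \bar R) -> (R -> E) -> \bar R.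
Hypothesis method : interpolation_method nul Phi.

Let qN j : qnorm nul (N j). Proof. exact: Sobolev_qnorm. Qed.
Let X := (N k, N k.+1).
Let Y := (N k.+1, N k.+2).
Let cX : couple nul X. Proof. by split; exact: qN. Qed.
Let cY : couple nul Y. Proof. by split; exact: qN. Qed.

Lemma weight_widen (phi : R -> R) (a b c d : R) : 0 < c -> c <= a -> b <= d ->
  weight phi a b -> weight phi c d.
Proof.
move=> c0 ca bd [cp _ z0]; split => // x xcd; apply: z0; apply: contra xcd.
by rewrite !in_itv/= => /andP[ax xb]; rewrite (le_trans ca ax) (le_trans xb bd).
Qed.

Lemma weightB (phi psi : R -> R) (a b : R) : weight phi a b -> weight psi a b ->
  weight (fun x => phi x - psi x) a b.
Proof.
move=> [cp a0 p0] [cq _ q0]; split => // [x|x xab]; last by rewrite p0// q0// subrr.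
by apply: cvgB; [exact: cp|exact: cq].
Qed.

Lemma weightZ (r : R) (phi : R -> R) (a b : R) : weight phi a b ->
  weight (fun x => r * phi x) a b.
Proof.
move=> [cp a0 p0]; split => // [x|x xab]; last by rewrite p0// mulr0.
by apply: cvgM; [exact: cvg_cst|exact: cp].
Qed.

Lemma opp_quotient (V : lmodType R[i]) (r : R[i]) (a b y z : V) :
  - (r *: (a - b) - y) = r *: (b - a) - z + (y + z).
Proof. by rewrite opprB -scalerN opprB [y + z]addrC addrA subrK addrC. Qed.

Lemma linear_mod_exact (M : (R -> E) -> \bar R) (S : (R -> E) -> R -> E) :
  (forall (c : R[i]) u v, S (c *: u + v) = c *: S u + S v) -> linear_mod nul M S.
Proof. by move=> h c u v _ _; rewrite h subrr; exact: ae_zero0. Qed.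

Lemma bounded_map_lty (M M' : (R -> E) -> \bar R) S C u : 0 < C -> (0 <= M u)%E ->
  bounded_map M M' S C -> (M u < +oo)%E -> (M' (S u) < +oo)%E.
Proof.
move=> C0 M0 h uy; have [c c0 uc] := fin_bound M0 uy.
by apply: le_lt_trans (h u c c0 _) (ltry _); rewrite uc.
Qed.

Lemma method_contraction t : 0 <= t -> bounded_map (Phi X) (Phi X) (T t) 1.
Proof.
move=> t0; apply: (im_map method cX cX ltr01).
- by apply: linear_mod_exact => c u v; exact: left_translation_lin.
- exact: left_translation_bounded.
- exact: left_translation_bounded.
Qed.

Lemma method_contraction_le t u : 0 <= t -> (Phi X u < +oo)%E -> (Phi X (T t u) <= Phi X u)%E.
Proof.
move=> t0 uy; have [c c0 uc] := fin_bound (im_ge0 method u cX) uy.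
by rewrite uc -[c]mul1r; apply: method_contraction => //; rewrite uc.
Qed.

Lemma method_strongly_continuous u : (Phi X u < +oo)%E ->
  small 0^'+ (Phi X) (fun t => T t u - u).
Proof.
have [K0 K01 hK0] := @Sobolev_leB R E p mu p1 k.
have [K1 K11 hK1] := @Sobolev_leB R E p mu p1 k.+1.
have C0 : 0 < Num.max K0 K1 by rewrite lt_max (lt_le_trans ltr01 K01).
apply: (im_strong method (S := fun t w => T t w - w) cX cX C0).
- move=> h _; apply: linear_mod_exact => c v w.
  by rewrite left_translation_lin scalerBr opprD addrACA.
- move=> h h0 _; apply: bounded_map_gt0 => // v c c0 vc.
  have tc := left_translation_bounded p1 mu1 (ltW h0) (ltW c0) vc; rewrite mul1r in tc.
  apply: (le_trans (hK0 _ _ _ c0 tc vc)).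
  by rewrite lee_fin ler_pM2r// le_max lexx.
- move=> h h0 _; apply: bounded_map_gt0 => // v c c0 vc.
  have tc := left_translation_bounded p1 mu1 (ltW h0) (ltW c0) vc; rewrite mul1r in tc.
  apply: (le_trans (hK1 _ _ _ c0 tc vc)).
  by rewrite lee_fin ler_pM2r// le_max lexx orbT.
- by move=> v vy; exact: left_translation_small.
- by move=> v vy; exact: left_translation_small.
Qed.

Lemma method_smallP (f : R -> R -> E) : small 0^'+ (Phi X) f <->
  Phi X (f h) @[h --> 0^'+] --> 0%E.
Proof. by split => [h|/cvge0P h]; [apply/cvge0P|apply: h] => // t; exact: (im_ge0 method _ cX). Qed.

Lemma method_semigroup : C0_contraction_semigroup (Phi X) T.
Proof.
split.
- split => [t c u v _ _ _|t u t0 uy]; last exact: method_contraction_le.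
  by rewrite left_translation_lin subrr (im_zero method cX).
- move=> u _; rewrite (_ : T 0 u - u = 0) ?(im_zero method cX)//.
  by apply/funext => x; change (u (x + 0) - u x = 0); rewrite addr0 subrr.
- move=> t r u _ _ _; rewrite (_ : T (t + r) u - T t (T r u) = 0) ?(im_zero method cX)//.
  by apply/funext => x; change (u (x + (t + r)) - u (x + t + r) = 0); rewrite addrA subrr.
- by move=> u uy; apply/method_smallP; exact: method_strongly_continuous.
Qed.

Lemma method_Sobolev u : (Phi X u < +oo)%E -> (N k u < +oo)%E.
Proof. by move=> /(im_sum method cX); exact: Sobolev_sum_lty. Qed.

Lemma sum_norm_Lpmu u c : 0 < c -> (sum_norm (N k) (N k.+1) u <= c%:E)%E ->
  (L u <= (8 * c)%:E)%E.
Proof.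
move=> c0 uc; have uc2 : (sum_norm (N k) (N k.+1) u < (2 * c)%:E)%E.
  by apply: (le_lt_trans uc); rewrite lte_fin; lra.
have c2 : 0 <= 2 * c by lra.
have [a [b [<- ac bc]]] := K_lt_parts (qN k) (qN k.+1) ltr01 uc2.
rewrite divr1 in bc; have -> : 8 * c = 4 * (2 * c) by ring.
apply: (Lpmu_leD p1 c2); first exact: (Lpmu_le_Sobolev p1 c2 ac).
exact: (Lpmu_le_Sobolev p1 c2 bc).
Qed.

(** At the endpoints the pairing is bounded because [L_(p,mu)] embeds locally into
    [L_1]. *)
Lemma method_pairing phi : test_function phi -> exists2 B : R, 0 < B &
  forall u c, 0 < c -> (Phi X u <= c%:E)%E -> rnorm (pairing phi u) <= B * c.
Proof.
move=> tp; have [a [b wp']] := test_function_weight tp.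
have [a0 [b0 [a00 ab0 z0]]] := tp.2; have wp : weight phi a0 b0.
  by split => //; have [] := wp'.
have [M M0 hM] := weight_bound wp.
have [C C0 hC] := Lpmu_L1 (E := E) p1 mu1 a00 ab0.
have MC0 : 0 < M * (C * 8) by rewrite mulr_gt0// mulr_gt0.
apply: (im_functional method cX MC0).
  move=> c u v /(@Sobolev_sum_lty R E p mu p1)/Sobolev_L1loc lu.
  move=> /(@Sobolev_sum_lty R E p mu p1)/Sobolev_L1loc lv.
  exact: pairing_lin wp lu lv.
move=> u c c0 uc; have lu : L1loc u.
  apply: Sobolev_L1loc; apply: (@Sobolev_sum_lty R E p mu p1).
  exact: le_lt_trans uc (ltry c).
have key d : 0 < d -> (sum_norm X.1 X.2 u <= d%:E)%E -> rnorm (pairing phi u) <= M * (C * 8) * d.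
  move=> d0 ud; have := hC u (8 * d) _ (sum_norm_Lpmu d0 ud).
  have d8 : 0 < 8 * d by rewrite mulr_gt0.
  move=> /(_ d8) h; have := rnorm_pairing wp lu hM.
  move/le_trans => /(_ (M * (C * (8 * d)))%:E); rewrite lee_fin !mulrA; apply.
  have -> : M * C * 8 * d = M * (C * (8 * d)) by rewrite !mulrA.
  by rewrite EFinM lee_pmul2l.
apply/ler_addgt0Pr => e e0; pose d := e / (M * (C * 8)).
have d0 : 0 < d by rewrite divr_gt0.
have -> : M * (C * 8) * c + e = M * (C * 8) * (c + d).
  have ed : M * (C * 8) * d = e by rewrite /d mulrC divfK// gt_eqF.
  by rewrite [RHS]mulrDr ed.
apply: key; first by rewrite ltr_wpDl.
by apply: (le_trans uc); rewrite lee_fin lerDl ltW.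
Qed.

(** Testing the difference quotient against [phi] turns it into minus the difference quotient
    of [phi], so that a strong limit of the former is a weak derivative. *)
Lemma method_weak_derivative u v : generator (Phi X) T u v -> weak_derivative u v.
Proof.
move=> [uy vy] /method_smallP uv; have lu := Sobolev_L1loc (method_Sobolev uy).
have lv := Sobolev_L1loc (method_Sobolev vy).
apply/weak_derivativeP; split => // phi tp.
have [B B0 hB] := method_pairing tp.
have tp' : test_function (derive1 phi) by exact: test_function_derive1.
have [M M0 hM] := test_function_quotient tp.
have [_ [a [b [a0 ab z0]]]] := tp.
have [_ [a' [b' [a0' ab' z0']]]] := tp'.
have wp : weight phi a b by have [? [? []]] := test_function_weight tp.
have wp' : weight (derive1 phi) a' b' by have [? [? []]] := test_function_weight tp'.
(* An interval that contains the supports of [phi], of its derivative and of its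
   translates by at most [1]. *)
pose c := Num.min a a'; pose d := Num.max b b' + 1.
pose D := norm_integral `[c, d] u.
have c0 : 0 < c by rewrite lt_min a0.
have cd : c < d.
  rewrite gt_min; apply/orP; left; rewrite (lt_trans ab)// /d.
  by rewrite ltr_pwDr// le_max lexx.
have [_ Dy] := lu c d c0 cd.
have [D' D'0 DD] := fin_bound (norm_integral_ge0 _ _) Dy.
have key h : 0 < h -> h <= 1 ->
    rnorm (pairing phi ((h^-1)%:C%C *: (T h u - u) - v) + (pairing (derive1 phi) u + pairing phi v))
    <= M * h * D'.
  move=> h0 h1; have h0' := ltW h0.
  pose psi x := h^-1 * (phi x - phi (x - h)).
  have cE : c <= a /\ c <= a' by rewrite !ge_min !lexx orbT.
  have dE : b + 1 <= d /\ b' <= d.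
    by rewrite /d lerD2r le_max lexx; split => //; rewrite ler_wpDr// le_max lexx orbT.
  have [ca ca'] := cE; have [bd bd'] := dE.
  have w1 : weight phi c d by apply: (weight_widen c0 ca _ wp); apply: le_trans bd; rewrite lerDl.
  have w2 : weight (fun x => phi (x - h)) c d.
    apply: (weight_widen c0 _ _ (weight_shift h0' wp)); first by rewrite ler_wpDr.
    by apply: le_trans bd; rewrite lerD2l.
  have w3 : weight (derive1 phi) c d by exact: weight_widen c0 ca' bd' wp'.
  have w4 := weightB w1 w2; have w5 : weight psi c d := weightZ h^-1 w4.
  have lT := L1loc_shift h0' lu; have lTu := L1locB lT lu.
  have := rnorm_pairing (weightB w5 w3) lu (fun x => hM h x h0).
  rewrite DD -EFinM lee_fin; congr (_ <= _).
  rewrite (pairing_weightB w5 w3 lu) (pairing_weightZ _ w4 lu) (pairing_weightB w1 w2 lu).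
  rewrite (pairing_shift h0' wp lu) (pairingB w1 (L1locZ _ lTu) lv).
  have -> : pairing phi ((h^-1)%:C%C *: (T h u - u)) = (h^-1)%:C%C *: (pairing phi (T h u) - pairing phi u).
    have := pairing_lin (h^-1)%:C%C w1 lTu (L1loc0 (R := R) (E := E)).
    by rewrite !addr0 => ->; rewrite (pairing0 w1) addr0 (pairingB w1 lT lu).
  rewrite -rnormN; congr rnorm; exact: opp_quotient.
apply/eqP; rewrite -subr_eq0 opprK; apply/eqP/rnorm0_eq0/eqP.
rewrite eq_le rnorm_ge0 andbT; apply/ler_addgt0Pr => e e0; rewrite add0r.
have e2 : 0 < e / 2 / B by rewrite !divr_gt0.
have D1 : 0 < D' + 1 by rewrite ltr_wpDl.
have r0 : 0 < Num.min 1 (e / 2 / (M * (D' + 1))).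
  by rewrite lt_min ltr01 !divr_gt0// mulr_gt0.
have [h h0 [hr huv]] := near_right0_ex (filterI (nbhs_right_lt r0) (uv _ e2)).
move: hr; rewrite lt_min => /andP[h1 he].
have := hB _ _ e2 huv; have -> : B * (e / 2 / B) = e / 2 by rewrite mulrC divfK// gt_eqF.
move=> h2; have := key h h0 (ltW h1).
move: (pairing phi (_ - v)) h2 => q h2 h3.
have -> : pairing (derive1 phi) u + pairing phi v =
    (q + (pairing (derive1 phi) u + pairing phi v)) - q by rewrite [q + _]addrC addrK.
apply: (le_trans (ler_rnormB _ _)); have -> : e = e / 2 + e / 2 by lra.
apply: lerD h2; apply: (le_trans h3).
have hM1 : h * (M * (D' + 1)) < e / 2 by rewrite -ltr_pdivlMr// mulr_gt0.
apply: le_trans (ltW hM1); rewrite mulrAC mulrC ler_pM2l// ler_pM2l//.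
by rewrite lerDl.
Qed.

(** By [reconstruction], as [increment] and [correction] gain one derivative at both
    endpoints, hence in between. *)
Lemma method_domain u v : weak_derivative u v -> (Phi X u < +oo)%E -> (Phi X v < +oo)%E ->
  (Phi Y u < +oo)%E.
Proof.
move=> uv uy vy.
have loc M M' w : (sum_norm M M' w < +oo)%E -> sum_norm M M' = sum_norm X.1 X.2 -> L1loc w.
  by move=> wy e; rewrite e in wy; exact: Sobolev_L1loc (Sobolev_sum_lty p1 wy).
have mI : exists2 C : R, 0 < C & bounded_map (Phi X) (Phi Y) increment C.
  have [C1 C10 h1] := increment_bounded (E := E) p1 mu1 k.
  have [C2 C20 h2] := increment_bounded (E := E) p1 mu1 k.+1.
  exists (Num.max C1 C2); first by rewrite lt_max C10.
  apply: (im_map method cY cX).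
  - by rewrite lt_max C10.
  - by move=> c a b /loc la /loc lb; apply: increment_lin; [exact: la|exact: lb].
  - move=> w c c0 wc; apply: (le_trans (h1 w c c0 wc)).
    by rewrite lee_fin ler_wpM2r// le_max lexx.
  - move=> w c c0 wc; apply: (le_trans (h2 w c c0 wc)).
    by rewrite lee_fin ler_wpM2r// le_max lexx orbT.
have mC : exists2 C : R, 0 < C & bounded_map (Phi X) (Phi Y) correction C.
  have [C1 C10 h1] := correction_bounded (E := E) p1 mu1 k.
  have [C2 C20 h2] := correction_bounded (E := E) p1 mu1 k.+1.
  exists (Num.max C1 C2); first by rewrite lt_max C10.
  apply: (im_map method cY cX).
  - by rewrite lt_max C10.
  - by move=> c a b /loc la /loc lb; apply: correction_lin; [exact: la|exact: lb].
  - move=> w c c0 wc; apply: (le_trans (h1 w c c0 wc)).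
    by rewrite lee_fin ler_wpM2r// le_max lexx.
  - move=> w c c0 wc; apply: (le_trans (h2 w c c0 wc)).
    by rewrite lee_fin ler_wpM2r// le_max lexx orbT.
have [CI CI0 hI] := mI; have [CC CC0 hC] := mC.
have iy := bounded_map_lty CI0 (im_ge0 method _ cX) hI uy.
have cy := bounded_map_lty CC0 (im_ge0 method _ cX) hC vy.
have := im_null method (increment u + correction v) cY (reconstruction uv).
rewrite addrC subrK => h; apply: (le_lt_trans h).
exact: (im_add method cY iy cy).
Qed.

Lemma Sobolev_embedding j : bounded_map (N j.+1) (N j) id 1.
Proof. by move=> u c _; rewrite mul1r; apply: le_trans; exact: Sobolev_le_succ. Qed.

Lemma method_generator u v :
  generator (Phi X) T u v <-> (Phi Y u < +oo)%E /\ weak_derivative u v.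
Proof.
split=> [guv|[uy uv]].
  have uv := method_weak_derivative guv; split => //.
  by have [uy vy _] := guv; exact: (method_domain uv).
have Y0 := im_ge0 method u cY.
have suY := im_sum method cY uy.
have uN : (N k.+1 u < +oo)%E by exact: Sobolev_sum_lty suY.
have dv : nul (v - derivative u).
  by apply/ae_zeroB; exact: weak_derivative_unique uv (derivativeP uN).
split.
- apply: (bounded_map_lty (S := id) ltr01 Y0 _ uy).
  by apply: (im_map method cX cY ltr01); [exact: linear_mod_exact|exact: Sobolev_embedding..].
- have -> : v = derivative u + (v - derivative u) by rewrite addrC subrK.
  apply: (le_lt_trans (im_null method _ cX dv)).
  apply: (bounded_map_lty (S := derivative) ltr01 Y0 _ uy).
  apply: (im_map method cX cY ltr01); [|exact: derivative_bounded..].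
  move=> c a b /(@Sobolev_sum_lty R E p mu p1) ay /(@Sobolev_sum_lty R E p mu p1) bY.
  exact: (derivative_linear p1 c ay bY).
apply/method_smallP => e e0.
have C0 : 0 < k.+2%:R * 8 :> R by rewrite mulr_gt0// ltr0n.
have hs : small 0^'+ (Phi X) ((@quotient_error R E)^~ u).
  apply: (im_strong method (S := @quotient_error R E) cX cY C0 _ _ _ _ _ uy).
  - move=> h _ c a b /(@Sobolev_sum_lty R E p mu p1) ay /(@Sobolev_sum_lty R E p mu p1) bY.
    exact: (quotient_error_linear p1 h c ay bY).
  - move=> h h0 _ w c c0 wc; apply: (le_trans (quotient_error_bounded p1 mu1 h0 c0 wc)).
    by rewrite lee_fin ler_wpM2r// ler_wpM2r// ler_nat.
  - by move=> h h0 _; exact: quotient_error_bounded.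
  - by move=> w; exact: quotient_error_small.
  - by move=> w; exact: quotient_error_small.
apply: filterS (hs e e0) => h; apply: le_trans.
have -> : (h^-1)%:C%C *: (T h u - u) - v = quotient_error h u + (derivative u - v).
  by rewrite addrA subrK.
by apply: (im_null method _ cX); exact: ae_zero_sym.
Qed.

End Generator.

(** * Arbitrary orders *)

Section FractionalOrder.
Context {R : realType} {E : completeNormedModType R[i]}.
Context (p mu s : R) (p1 : 1 <= p) (mu1 : mu <= 1) (s0 : 0 <= s).

Lemma truncn_add1 : Num.truncn (s + 1) = (Num.truncn s).+1.
Proof.
have /andP[h1 h2] := truncn_itv s0; apply/truncn_def.
by rewrite -[leLHS]natr1 -[ltRHS]natr1 lerD2r ltrD2r h1 h2.
Qed.

Lemma fractional_part : s != (Num.truncn s)%:R -> 0 < s - (Num.truncn s)%:R < 1.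
Proof.
move=> h; have /andP[ks sk] := truncn_itv s0.
by rewrite subr_gt0 lt_neqAle eq_sym h ks ltrBlDl natr1.
Qed.

(** The orders [s] and [s + 1] have the same fractional part, so they use the same
    method on consecutive couples. *)
Definition order_method (norm : R -> (R -> E) -> \bar R)
    (Phi : ((R -> E) -> \bar R) * ((R -> E) -> \bar R) -> (R -> E) -> \bar R) : Prop :=
  [/\ interpolation_method (ae_zero (R := R) (E := E)) Phi,
      norm s = Phi (Sobolev_norm p mu (Num.truncn s), Sobolev_norm p mu (Num.truncn s).+1) &
      norm (s + 1) =
        Phi (Sobolev_norm p mu (Num.truncn s).+1, Sobolev_norm p mu (Num.truncn s).+2)].

Lemma order_semigroup norm Phi : order_method norm Phi ->
  C0_contraction_semigroup (norm s) (left_translation (E := E)) /\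
  forall u v : R -> E, generator (norm s) (left_translation (E := E)) u v <->
    (norm (s + 1)%R u < +oo)%E /\ weak_derivative u v.
Proof.
move=> [m -> ->]; split; first exact: method_semigroup.
by move=> u v; exact: method_generator.
Qed.

Lemma W_method : exists Phi, order_method (W_norm p mu) Phi.
Proof.
have e1 : (s + 1 == (Num.truncn s).+1%:R) = (s == (Num.truncn s)%:R).
  by rewrite -natr1 (inj_eq (addIr 1)).
have [sk|sk] := boolP (s == (Num.truncn s)%:R).
  exists (fun X => X.1); split; first exact: endpoint_method.
    by rewrite /W_norm sk.
  by rewrite /W_norm truncn_add1 e1 sk.
exists (fun X => real_interpolation X.1 X.2 (s - (Num.truncn s)%:R) p); split.
- exact: real_method.
- by rewrite /W_norm (negPf sk).
- by rewrite /W_norm truncn_add1 e1 (negPf sk) -natr1 opprD addrACA subrr addr0.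
Qed.

Lemma H_method : exists Phi, order_method (H_norm p mu) Phi.
Proof.
have e1 : (s + 1 == (Num.truncn s).+1%:R) = (s == (Num.truncn s)%:R).
  by rewrite -natr1 (inj_eq (addIr 1)).
have [sk|sk] := boolP (s == (Num.truncn s)%:R).
  exists (fun X => X.1); split; first exact: endpoint_method.
    by rewrite /H_norm sk.
  by rewrite /H_norm truncn_add1 e1 sk.
exists (fun X => complex_interpolation X.1 X.2 (s - (Num.truncn s)%:R)); split.
- apply: complex_method; last exact: fractional_part sk.
    exact: ae_zero0.
  by move=> c a b; exact: ae_zero_lin.
- by rewrite /H_norm (negPf sk).
- by rewrite /H_norm truncn_add1 e1 (negPf sk) -natr1 opprD addrACA subrr addr0.
Qed.

End FractionalOrder.

Theorem lemma2p6 (R : realType) (E : completeNormedModType R[i]) (p mu s : R)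
    (hE : class_HT E) (hp : 1 < p) (hmu : p^-1 < mu) (hmu1 : mu <= 1)
    (hs : 0 <= s) :
  [/\ C0_contraction_semigroup (W_norm (E := E) p mu s) (left_translation (E := E)),
      C0_contraction_semigroup (H_norm (E := E) p mu s) (left_translation (E := E)),
      forall u v : R -> E,
        generator (W_norm p mu s) (left_translation (E := E)) u v <->
        (W_norm p mu (s + 1) u < +oo)%E /\ weak_derivative u v &
      forall u v : R -> E,
        generator (H_norm p mu s) (left_translation (E := E)) u v <->
        (H_norm p mu (s + 1) u < +oo)%E /\ weak_derivative u v].
Proof.
have p1 := ltW hp.
have [PW /(order_semigroup p1 hmu1)[cW gW]] := @W_method R E p mu s p1 hs.
have [PH /(order_semigroup p1 hmu1)[cH gH]] := @H_method R E p mu s hs.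
by split.
Qed.
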